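(* Let $\Gamma$ be a smoothly embedded circle in a complete Riemannian manifold with Riemannian distance $d$. a) If there exists a continuous map $\phi:\Gamma\to\Gamma$ such that $d(x,\phi(x))=\mathrm{diam}(\Gamma)$ for every $x\in\Gamma$, then $\mathcal{S}(\Gamma)=\mathrm{diam}(\Gamma)$. b) If $\mathcal{S}(\Gamma)=\mathrm{diam}(\Gamma)$, then for every $x\in\Gamma$ there exists $y\in\Gamma$ such that $d(x,y)=\mathrm{diam}(\Gamma)$. Assume, moreover, that $\Gamma$ is the boundary of a totally convex smoothly embedded disc. Then $\mathcal{S}(\Gamma)=\mathrm{diam}(\Gamma)$ if and only if there exists a continuous map $\phi:\Gamma\to\Gamma$ such that $d(x,\phi(x))=\mathrm{diam}(\Gamma)$ for every $x\in\Gamma$.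
   Context: $\mathrm{diam}(\Gamma)=\max_{x,y\in\Gamma}d(x,y)$ is the extrinsic diameter. A subset of a Riemannian manifold is totally convex if every geodesic with extremities in the subset lies entirely in the subset. Discs are two-dimensional. Width: a family $\{p_t,q_t\}\subset\Gamma$, $t\in[0,1]$, is a sweepout of $\Gamma$ if (i) $p_0=q_0$, $p_1=q_1$; (ii) $t\mapsto p_t$, $t\mapsto q_t$ are continuous; (iii) $p_t,q_t$ bound a closed arc $C_t\subset\Gamma$ with $t\mapsto C_t$ continuous (distance between arcs = length of symmetric difference), $C_0=\{p_0\}$, $C_1=\Gamma$. $\mathcal{S}(\Gamma)=\inf\max_{t\in[0,1]}d(p_t,q_t)$ over all sweepouts of $\Gamma$. *)

(* Defs.v *)
From HB Require Import structures.
From mathcomp Require Import all_boot all_order all_algebra.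
From mathcomp Require Import all_classical all_reals all_analysis.

Set Implicit Arguments.
Unset Strict Implicit.
Unset Printing Implicit Defensive.

Import Order.TTheory GRing.Theory Num.Theory.
Import numFieldNormedType.Exports.

Local Open Scope classical_set_scope.
Local Open Scope ring_scope.

(* Used only on open sets [U] of finite-dimensional spaces, where having
   continuous iterated directional derivatives up to order [k] is C^k. *)
Fixpoint Ck (R : realType) (V W : normedModType R) (U : set V) (k : nat)
    (f : V -> W) : Prop :=
  (forall x, U x -> f @ x --> f x) /\
  (if k is k'.+1 then
     forall v, (forall x, U x -> derivable f x v) /\
               Ck U k' (fun x => 'D_v f x)
   else True).

Definition smooth (R : realType) (V W : normedModType R) (U : set V)
    (f : V -> W) : Prop := forall k, Ck U k f.

Definition bilin (R : realType) (n : nat) (g : 'M[R]_n) (u v : 'rV[R]_n) : R :=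
  (u *m g *m v^T) 0 0.

(* No connectedness is required: the distance below is extended-real valued,
   and infinite between points of different components. *)
Record riemannianManifold (R : realType) (n : nat) := RiemannianManifold {
  carrier :> topologicalType ;
  manifold_hausdorff : hausdorff_space carrier ;
  manifold_second_countable : @second_countable carrier ;

  chart_index : Type ;
  dom : chart_index -> set carrier ;
  cod : chart_index -> set 'rV[R]_n ;
  chart : chart_index -> carrier -> 'rV[R]_n ;
  chart_inv : chart_index -> 'rV[R]_n -> carrier ;
  chart_at : carrier -> chart_index ;
  chart_atP : forall x, dom (chart_at x) x ;
  dom_open : forall i, open (dom i) ;
  cod_open : forall i, open (cod i) ;
  chart_cod : forall i x, dom i x -> cod i (chart i x) ;
  chart_inv_dom : forall i u, cod i u -> dom i (chart_inv i u) ;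
  chartK : forall i x, dom i x -> chart_inv i (chart i x) = x ;
  chart_invK : forall i u, cod i u -> chart i (chart_inv i u) = u ;
  chart_continuous : forall i x, dom i x -> chart i @ x --> chart i x ;
  chart_inv_continuous : forall i u, cod i u ->
    chart_inv i @ u --> chart_inv i u ;
  transition_smooth : forall i j,
    smooth (cod i `&` chart_inv i @^-1` dom j) (chart j \o chart_inv i) ;

  (* Gram matrix of the metric in the coordinates of each chart *)
  metric : chart_index -> 'rV[R]_n -> 'M[R]_n ;
  metric_smooth : forall i (a b : 'I_n),
    smooth (cod i) (fun u => metric i u a b) ;
  metric_sym : forall i u, cod i u -> (metric i u)^T = metric i u ;
  metric_pos : forall i u, cod i u ->
    forall v, v != 0 -> 0 < bilin (metric i u) v v ;
  metric_compat : forall i j x, dom i x -> dom j x -> forall v w,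
    bilin (metric i (chart i x)) v w =
    bilin (metric j (chart j x))
      ('D_v (chart j \o chart_inv i) (chart i x))
      ('D_w (chart j \o chart_inv i) (chart i x))
}.

Section Riemannian.
Variables (R : realType) (n : nat) (M : riemannianManifold R n).
Implicit Types (x y : M) (G : set M).

Definition smooth_map (V : normedModType R) (U : set V) (f : V -> M) : Prop :=
  (forall u, U u -> f @ u --> f u) /\
  (forall i, smooth (U `&` f @^-1` dom i) (chart i \o f)).

(* Smoothness on a possibly closed set [A], the values of [f] off [A] providing
   the smooth extension to a neighbourhood of [A]. *)
Definition smooth_on (V : normedModType R) (f : V -> M) (A : set V) : Prop :=
  exists U : set V, [/\ open U, A `<=` U & smooth_map U f].

Definition immersion_at (V : normedModType R) (f : V -> M) (u : V) : Prop :=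
  forall v : V, v != 0 -> 'D_v (chart (chart_at (f u)) \o f) u != 0.

Definition velocity (i : chart_index M) (c : R -> M) (t : R) : 'rV[R]_n :=
  'D_1 (chart i \o c) t.

Definition speed (c : R -> M) (t : R) : R :=
  let i := chart_at (c t) in
  let v := velocity i c t in
  Num.sqrt (bilin (metric i (chart i (c t))) v v).

Definition curve_length (c : R -> M) : \bar R :=
  \int[lebesgue_measure]_(t in `[0, 1]) (speed c t)%:E.

(* [pw_smooth_path x y L]: a piecewise smooth path of length [L] joins [x] to
   [y], given as a concatenation of smooth pieces parametrized by [0, 1]. *)
Inductive pw_smooth_path : M -> M -> \bar R -> Prop :=
| pw_nil x : pw_smooth_path x x 0%E
| pw_cons (c : R -> M) y L :
    smooth_on c `[0, 1] -> pw_smooth_path (c 1) y L ->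
    pw_smooth_path (c 0) y (curve_length c + L)%E.

Definition rdist x y : \bar R := ereal_inf [set L | pw_smooth_path x y L].

Definition complete_manifold : Prop :=
  forall u : nat -> M,
    (forall e : R, 0 < e -> exists N, forall p q, (N <= p)%N -> (N <= q)%N ->
      (rdist (u p) (u q) < e%:E)%E) ->
    exists x, (fun p => rdist (u p) x) @ \oo --> 0%E.

Definition christoffel (i : chart_index M) (u : 'rV[R]_n) (k a b : 'I_n) : R :=
  let dg (m p q : 'I_n) : R :=
    'D_(delta_mx 0 m) (fun w => metric i w p q) u in
  2^-1 * \sum_(l < n) invmx (metric i u) k l * (dg a b l + dg b a l - dg l a b).

(* As [t] ranges over [a, b], [velocity] and its derivative are two-sided; the
   equation is nevertheless only imposed on [a, b]. *)
Definition geodesic (a b : R) (c : R -> M) : Prop :=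
  smooth_on c `[a, b] /\
  forall (t : R) (i : chart_index M), a <= t <= b -> dom i (c t) ->
  forall k : 'I_n,
    ('D_1 (velocity i c) t) 0 k +
    \sum_(p < n) \sum_(q < n) christoffel i (chart i (c t)) k p q *
      velocity i c t 0 p * velocity i c t 0 q = 0.

Definition totally_convex (A : set M) : Prop :=
  forall (a b : R) (c : R -> M), a <= b -> geodesic a b c ->
    A (c a) -> A (c b) -> forall t, a <= t <= b -> A (c t).

(* Smooth embeddings of the circle R/Z with image [G], seen as 1-periodic
   maps; injective immersions are embeddings here by compactness. *)
Definition circle_param (c : R -> M) G : Prop :=
  [/\ smooth_map setT c,
      (forall t : R, c (t + 1) = c t),
      (forall s t : R, 0 <= s < 1 -> 0 <= t < 1 -> c s = c t -> s = t),
      (forall t, immersion_at c t) &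
      G = range c].

Definition embedded_circle G : Prop := exists c, circle_param c G.

Definition unit_disc : set 'rV[R]_2 :=
  [set u | u 0 0 ^+ 2 + u 0 1 ^+ 2 <= 1].
Definition unit_circle : set 'rV[R]_2 :=
  [set u | u 0 0 ^+ 2 + u 0 1 ^+ 2 = 1].

(* [D] is a smoothly embedded closed disc with boundary [G]. *)
Definition embedded_disc (D G : set M) : Prop :=
  exists f : 'rV[R]_2 -> M,
    [/\ smooth_on f unit_disc,
        (forall u v, unit_disc u -> unit_disc v -> f u = f v -> u = v),
        (forall u, unit_disc u -> immersion_at f u),
        D = f @` unit_disc & G = f @` unit_circle].

Definition diam G : \bar R :=
  ereal_sup [set r | exists x y, [/\ G x, G y & r = rdist x y]].

Definition arc_length (c : R -> M) (A : set M) : \bar R :=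
  \int[lebesgue_measure]_(t in `[0, 1] `&` [set t : R | A (c t)])
    (speed c t)%:E.

(* Closed arcs of the circle parametrized by [c], with endpoints [p] and [q];
   points ([a = b]) and the whole circle ([b = a + 1]) are allowed. *)
Definition closed_arc (c : R -> M) (p q : M) (A : set M) : Prop :=
  exists a b : R, [/\ a <= b <= a + 1,
    A = c @` `[a, b] &
    (p = c a /\ q = c b) \/ (p = c b /\ q = c a)].

Definition sweepout (c : R -> M) (p q : R -> M) (C : R -> set M) : Prop :=
  [/\ p 0 = q 0 /\ p 1 = q 1,
      {within `[0, 1], continuous p} /\ {within `[0, 1], continuous q},
      (forall t, 0 <= t <= 1 -> closed_arc c (p t) (q t) (C t)),
      (forall t, 0 <= t <= 1 ->
        (fun s => arc_length c (C s `+` C t)) @ within `[0, 1] (nbhs t)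
          --> 0%E) &
      C 0 = [set p 0] /\ C 1 = range c].

(* Arcs and their lengths do not depend on the parametrization [c]. *)
Definition width G : \bar R :=
  ereal_inf [set w | exists c p q C,
    [/\ circle_param c G, sweepout c p q C &
        w = ereal_sup [set rdist (p t) (q t) | t in `[0, 1]]]].

Definition has_antipodal_map G : Prop :=
  exists phi : M -> M,
    [/\ {within G, continuous phi},
        (forall x, G x -> G (phi x)) &
        forall x, G x -> rdist x (phi x) = diam G].

End Riemannian.

(* Main.v *)
(* If [phi] is antipodal, then along a sweepout [phi (p t)] lies outside the arc [C t] at [t = 0] and
   inside it at [t = 1], so it meets the endpoint [q t] in between: this gives (a). Conversely,
   rotating one endpoint around the circle while the other one stays at [x] is a sweepout of width
   at most [max_y d(x, y)]: this gives (b).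

   Now let [G] bound a totally convex disc and let every point of [G] have a partner, at distance
   [Dm = diam G]. Minimizing geodesics between boundary points stay in the disc, so those joining
   interlaced pairs cross. If [x] has two partners, each point [u] of the open arc between
   them is again a partner of [x]: otherwise [u] has a partner elsewhere, and crossing geodesics
   of length [Dm] could be recombined into minimizing ones that branch. The distance to [x] being
   constant along an arc, the first variation formula shows that the minimizing geodesics from [x]
   to the arc arrive orthogonally to [G] and are therefore unique; by the same formula they leave
   [x] orthogonally to [G], as [x] is at maximal distance from their endpoints. Hence they have the
   same initial velocity and coincide, a contradiction. So partners are unique and, by
   compactness, depend continuously on the point.

   No Riemannian geometry being assumed, geodesics are obtained from the boundary value problem in
   a chart by a contraction argument, and their minimality from a calibration. *)
Require Import Defs.
From mathcomp Require Import all_boot all_order all_algebra.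
From mathcomp Require Import all_classical all_reals all_analysis.
From mathcomp Require Import measurable_realfun.
From mathcomp Require Import zify ring lra.

Set Implicit Arguments.
Unset Strict Implicit.
Unset Printing Implicit Defensive.

Import Order.TTheory GRing.Theory Num.Theory.
Import numFieldNormedType.Exports.

Local Open Scope classical_set_scope.
Local Open Scope ring_scope.

(** * C^k maps *)

Section Ck_general.
Variables (R : realType) (V : normedModType R).

(** No exponential map is built. Nearby endpoints are joined by a coordinate geodesic, and Lipschitz
    dependence of its velocity on the endpoints is the only regularity in the data that is used. The
    calibration is a function of time and position; its growth along an arbitrary path, with time
    proportional to arc length, bounds the length from below. A negative quadratic term absorbs the
    second-order errors, and a free parameter in it forces the points realizing equality onto the
    geodesic. Minimizing curves between distant points start as purely metric objects, maximal
    isometrically ordered sets of intermediate points; local uniqueness then makes them smooth. The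
    distance is never differentiated: the first variation formula is an upper bound with quadratic
    error. Where the distance is constant along the boundary, comparing the endpoint with its
    neighbours yields orthogonality. Where it is only maximal, the bound must be applied from the
    neighbours towards the endpoint, and the minimizing curves must converge; this requires
    uniqueness, so the flat case has to come first. *)

Lemma Ck_sub (W : normedModType R) (U U' : set V) k (f : V -> W) :
  U' `<=` U -> Ck U k f -> Ck U' k f.
Proof.
move=> sU; elim: k f => [|k IH] f /= [cf df]; split=> //; try by move=> x /sU /cf.
by move=> v; have [d1 d2] := df v; split; [move=> x /sU /d1|apply: IH].
Qed.

Lemma Ck_ext (W : normedModType R) (U : set V) k (f g : V -> W) : open U ->
  (forall x, U x -> f x = g x) -> Ck U k f -> Ck U k g.
Proof.
move=> oU; elim: k f g => [|k IH] f g fg /= [cf df].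
  split=> // x Ux; rewrite -fg//; apply: cvg_trans (cf x Ux); apply: near_eq_cvg.
  by near do apply: fg; exact: open_nbhs_nbhs.
have nfg x : U x -> \near x, f x = g x.
  by move=> Ux; near do apply: fg; exact: open_nbhs_nbhs.
split=> [x Ux|v].
  by rewrite -fg//; apply: cvg_trans (cf x Ux); apply: near_eq_cvg; apply: nfg.
have [d1 d2] := df v; split.
  by move=> x Ux; apply: (near_eq_derivable _ (d1 x Ux)); apply: nfg.
by apply: IH d2 => x Ux; apply: near_eq_derive; apply: nfg.
Unshelve. all: by end_near. Qed.

(** Limits and derivatives in [Ck] are taken in the ambient space, so the condition is pointwise and
    the sets [B] need not be open. *)
Lemma Ck_local (W : normedModType R) (U : set V) k (f : V -> W) :
  (forall x, U x -> exists B, B x /\ Ck B k f) -> Ck U k f.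
Proof.
elim: k f => [|k IH] f loc.
  by split=> // x /loc[B [Bx [+ _]]]; apply.
split=> [x /loc[B [Bx [+ _]]]|v]; first by apply.
split=> [x /loc[B [Bx [_ /(_ v)[+ _]]]]|]; first by apply.
by apply: IH => x /loc[B [Bx [_ /(_ v)[_ ?]]]]; exists B.
Qed.

Lemma CkS (W : normedModType R) (U : set V) k (f : V -> W) :
  Ck U k.+1 f -> (forall x, U x -> f @ x --> f x) /\
  (forall v, (forall x, U x -> derivable f x v) /\ Ck U k (fun x => 'D_v f x)).
Proof. by []. Qed.

Lemma CkW (W : normedModType R) (U : set V) k (f : V -> W) :
  Ck U k.+1 f -> Ck U k f.
Proof.
elim: k f => [|k IH] f [cf df]; split=> // v.
by have [d1 d2] := df v; split=> //; apply: IH.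
Qed.

Lemma Ck_cst (W : normedModType R) (U : set V) k (a : W) : Ck U k (fun _ : V => a).
Proof.
elim: k a => [|k IH] a; split=> //; try by move=> x _; exact: cvg_cst.
move=> v; split=> [x _|]; first exact: derivable_cst.
suff -> : (fun x : V => 'D_v (fun=> a) x) = (fun _ => 0) by exact: IH.
by apply/funext => x; rewrite derive_cst.
Qed.

Lemma Ck_add (W : normedModType R) (U : set V) k (f g : V -> W) : open U ->
  Ck U k f -> Ck U k g -> Ck U k (fun x => f x + g x).
Proof.
move=> oU; elim: k f g => [|k IH] f g [cf df] [cg dg]; split=> //;
  try by move=> x Ux; apply: cvgD; [exact: cf|exact: cg].
move=> v; have [f1 f2] := df v; have [g1 g2] := dg v.
split=> [x Ux|]; first by apply: derivableD; [exact: f1|exact: g1].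
apply: (Ck_ext oU _ (IH _ _ f2 g2)) => x Ux.
by rewrite deriveD//; [exact: f1|exact: g1].
Qed.

Lemma Ck_mul (U : set V) k (f g : V -> R) : open U ->
  Ck U k f -> Ck U k g -> Ck U k (fun x => f x * g x).
Proof.
move=> oU; elim: k f g => [|k IH] f g cf cg.
  by split=> // x Ux; apply: cvgM; [case: cf => + _|case: cg => + _]; apply.
move: (CkW cf) (CkW cg) => cf' cg'; have [cf0 df] := CkS cf; have [cg0 dg] := CkS cg.
split=> [x Ux|v]; first by apply: cvgM; [exact: cf0|exact: cg0].
have [f1 f2] := df v; have [g1 g2] := dg v.
split=> [x Ux|]; first by apply: derivableM; [exact: f1|exact: g1].
apply: (Ck_ext oU _ (Ck_add oU (IH _ _ cf' g2) (IH _ _ cg' f2))) => x Ux.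
by rewrite deriveM//; [exact: f1|exact: g1].
Qed.

Lemma Ck_sum (U : set V) k (I : Type) (r : seq I) (P : pred I) (f : I -> V -> R) :
  open U -> (forall i, P i -> Ck U k (f i)) -> Ck U k (fun x => \sum_(i <- r | P i) f i x).
Proof.
move=> oU cf; elim: r => [|i r IH].
  by apply: (Ck_ext (f := fun=> 0) oU _ (Ck_cst U k _)) => x _; rewrite big_nil.
have [Pi|Pi] := boolP (P i).
  by apply: (Ck_ext oU _ (Ck_add oU (cf i Pi) IH)) => x _; rewrite big_cons Pi.
by apply: (Ck_ext oU _ IH) => x _; rewrite big_cons (negbTE Pi).
Qed.

Lemma Ck_prod (U : set V) k (I : Type) (r : seq I) (P : pred I) (f : I -> V -> R) :
  open U -> (forall i, P i -> Ck U k (f i)) -> Ck U k (fun x => \prod_(i <- r | P i) f i x).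
Proof.
move=> oU cf; elim: r => [|i r IH].
  by apply: (Ck_ext (f := fun=> (1 : R)) oU _ (Ck_cst U k (1 : R))) => x _; rewrite big_nil.
have [Pi|Pi] := boolP (P i).
  by apply: (Ck_ext oU _ (Ck_mul oU (cf i Pi) IH)) => x _; rewrite big_cons Pi.
by apply: (Ck_ext oU _ IH) => x _; rewrite big_cons (negbTE Pi).
Qed.

Lemma Ck_inv (U : set V) k (f : V -> R) : open U -> (forall x, U x -> f x != 0) ->
  Ck U k f -> Ck U k (fun x => (f x)^-1).
Proof.
move=> oU f0; elim: k => [|k IH] cf.
  by split=> // x Ux; apply: cvgV; [exact: f0|case: cf => + _; exact].
have cf' := IH (CkW cf); have [cf0 df] := CkS cf.
split=> [x Ux|v]; first by apply: cvgV; [exact: f0|exact: cf0].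
have [f1 f2] := df v.
split=> [x Ux|]; first by apply: derivableV; [exact: f0|exact: f1].
apply: (Ck_ext (f := fun x => -1 * ((f x)^-1 * (f x)^-1 * 'D_v f x)) oU _ (Ck_mul oU (Ck_cst U k (-1 : R)) (Ck_mul oU (Ck_mul oU cf' cf') f2))).
move=> x Ux; rewrite deriveV//; [|exact: f0|exact: f1].
by rewrite -exprVn expr2 mulN1r scaleNr.
Qed.

Lemma derive_coord m (f : V -> 'rV[R]_m) x v j : derivable f x v ->
  ('D_v f x) 0 j = 'D_v (fun y => f y 0 j) x.
Proof. by move=> df; rewrite derive_mx// mxE. Qed.

Lemma cvg_coord m (f : V -> 'rV[R]_m) (x : V) (l : 'rV[R]_m) :
  f @ x --> l <-> forall j, f y 0 j @[y --> x] --> l 0 j.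
Proof.
split=> [fl j|fl].
  exact: (cvg_comp f (fun M : 'rV[R]_m => M 0 j) fl (@coord_continuous _ _ _ 0 j l)).
apply/cvgrPdist_le => e e0; near=> y.
rewrite /Num.Def.normr/= mx_normrE (bigmax_le _ (ltW e0))//= => -[i j] _.
rewrite !mxE/= ord1.
move: j; near: y; apply: filter_forall => j.
exact: ((cvgrPdist_le _ _).1 (fl j)).
Unshelve. all: by end_near. Qed.

Lemma Ck_coord m (U : set V) k (f : V -> 'rV[R]_m) : open U ->
  Ck U k f <-> forall j, Ck U k (fun x => f x 0 j).
Proof.
move=> oU; elim: k f => [|k IH] f; split.
- by move=> [cf _] j; split=> // x Ux; move/cvg_coord: (cf x Ux); apply.
- by move=> cf; split=> // x Ux; apply/cvg_coord => j; case: (cf j) => + _; apply.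
- move=> [cf df] j; split=> [x Ux|v]; first by move/cvg_coord: (cf x Ux); apply.
  have [f1 f2] := df v; split=> [x Ux|].
    by move/derivable_mxP: (f1 x Ux); apply.
  apply: (Ck_ext oU _ ((IH _).1 f2 j)) => x Ux; rewrite derive_coord//; exact: f1.
- move=> cf; split=> [x Ux|v].
    by apply/cvg_coord => j; case: (cf j) => + _; apply.
  have d x : U x -> derivable f x v.
    move=> Ux; apply/derivable_mxP => i j; rewrite ord1.
    by case: (cf j) => _ /(_ v)[+ _]; apply.
  split=> //; apply/IH => j; case: (cf j) => _ /(_ v)[_ dj].
  by apply: (Ck_ext oU _ dj) => x Ux; rewrite derive_coord//; exact: d.
Qed.

End Ck_general.

(** * The chain rule from continuous partial derivatives *)

Section Chain.
Variables (R : realType).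

Lemma mvt_dir (V : normedModType R) (f : V -> R) (x v : V) (a : R) :
  (forall s : R, `|s| <= `|a| -> derivable f (x + s *: v) v) ->
  exists2 s : R, `|s| <= `|a| & f (x + a *: v) - f x = a * 'D_v f (x + s *: v).
Proof.
move=> df; pose g (s : R) := f (x + s *: v).
have dg s : `|s| <= `|a| -> is_derive s (1 : R) g ('D_v f (x + s *: v)).
  move=> sa; have E : (fun h : R => h^-1 *: ((g \o shift s) (h *: (1 : R)) - g s)) =
      (fun h => h^-1 *: ((f \o shift (x + s *: v)) (h *: v) - f (x + s *: v))).
    apply/funext => h; rewrite /g /=; congr (_ *: (f _ - _)).
    by rewrite [h%:A]mulr1 scalerDl addrCA.
  have := df s sa; split; first by rewrite /derivable E.
  by rewrite /derive E.
have [a0|a0] := leP 0 a.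
- have [||c] := @MVT_segment R g (fun s => 'D_v f (x + s *: v)) 0 a a0.
  + move=> s; rewrite in_itv/= => /andP[s0 sa]; apply: dg.
    by rewrite !ger0_norm// ltW.
  + apply: derivable_within_continuous => s; rewrite in_itv/= => /andP[s0 sa].
    by have [] := dg s; rewrite ?ger0_norm.
  rewrite in_itv/= => /andP[c0 ca] E; exists c; first by rewrite !ger0_norm.
  by move: E; rewrite /g scale0r addr0 subr0 mulrC.
- have [||c] := @MVT_segment R g (fun s => 'D_v f (x + s *: v)) a 0 (ltW a0).
  + move=> s; rewrite in_itv/= => /andP[sa s0]; apply: dg.
    by rewrite !ler0_norm ?lerN2 ?ltW.
  + apply: derivable_within_continuous => s; rewrite in_itv/= => /andP[sa s0].
    by have [] := dg s; rewrite // !ler0_norm ?lerN2// ltW.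
  rewrite in_itv/= => /andP[ca c0] E; exists c.
    by rewrite !ler0_norm ?lerN2// ltW.
  move: E; rewrite /g scale0r addr0 sub0r => E.
  by rewrite -[LHS]opprB E mulrN opprK mulrC.
Qed.

Lemma coord_norm_le m (h : 'rV[R]_m) j : `|h 0 j| <= `|h|.
Proof.
rewrite [leRHS]/Num.Def.normr/= mx_normrE.
exact: (le_bigmax _ (fun ij : 'I_1 * 'I_m => `|h ij.1 ij.2|) (0, j)).
Qed.

Lemma norm_rV_le m (h : 'rV[R]_m) (e : R) : 0 <= e ->
  (forall j, `|h 0 j| <= e) -> `|h| <= e.
Proof.
move=> e0 he; rewrite /Num.Def.normr/= mx_normrE (bigmax_le _ e0)//= => -[i j] _.
by rewrite ord1.
Qed.

(** The increment is split by changing one coordinate at a time. The mean value theorem on each step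
    produces a partial derivative at a point near [u], and continuity of the partial derivatives
    bounds the error. *)
Lemma C1_approx m (U : set 'rV[R]_m) (f : 'rV[R]_m -> R) (u : 'rV[R]_m) (e : R) :
  open U -> Ck U 1 f -> U u -> 0 < e ->
  \forall h \near (0 : 'rV[R]_m),
    `|f (u + h) - f u - \sum_j h 0 j * 'D_(delta_mx 0 j) f u| <= e * `|h|.
Proof.
move=> oU [cf df] Uu e0.
(* The error is shared among [m] steps; dividing by [m.+1] also covers dimension 0. *)
have e'0 : 0 < e / m.+1%:R by rewrite divr_gt0.
have [d d0 H] : exists2 d : R, 0 < d & forall y, `|y| < d ->
    U (u + y) /\ forall j, `|'D_(delta_mx 0 j) f (u + y) - 'D_(delta_mx 0 j) f u| <= e / m.+1%:R.
  have : \forall y \near u, U y /\ forall j, `|'D_(delta_mx 0 j) f y - 'D_(delta_mx 0 j) f u| <= e / m.+1%:R.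
    near=> y; split; first by near: y; exact: open_nbhs_nbhs.
    near: y; apply: filter_forall => j; have [_ [+ _]] := df (delta_mx 0 j).
    move=> /(_ u Uu) /cvgrPdist_le /(_ _ e'0).
    by apply: filterS => y; rewrite distrC.
  move=> /nbhs_ballP[d /= d0 dH]; exists d => // y yd; apply: dH.
  by rewrite -ball_normE/= opprD addNKr normrN.
near=> h.
have hd : `|h| < d by near: h; exact: (@nbhs0_lt _ 'rV[R]_m).
pose hk k : 'rV[R]_m := \row_j (if (j < k)%N then h 0 j else 0).
have hkn k : `|hk k| <= `|h|.
  apply: norm_rV_le => // j; rewrite mxE; case: ifP => _; last by rewrite normr0.
  exact: coord_norm_le.
have E0 : hk 0%N = 0 by apply/rowP => j; rewrite !mxE.
have Em : hk m = h by apply/rowP => j; rewrite !mxE ltn_ord.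
have step (k : 'I_m) : `|f (u + hk k.+1) - f (u + hk k) - h 0 k * 'D_(delta_mx 0 k) f u|
    <= e / m.+1%:R * `|h|.
  have hkS : hk k.+1 = hk k + h 0 k *: delta_mx 0 k.
    apply/rowP => j; rewrite !mxE eqxx /= ltnS leq_eqVlt.
    have [jk|jk] := eqVneq j k; first by rewrite jk eqxx ltnn mulr1 add0r.
    by rewrite (negbTE (_ : nat_of_ord j != k))//= mulr0 addr0.
  have inb s : `|s| <= `|h 0 k| -> `|hk k + s *: delta_mx 0 k| < d.
    move=> sh; apply: le_lt_trans hd; apply: norm_rV_le => // j; rewrite !mxE eqxx/=.
    have [->|jk] := eqVneq j k.
      by rewrite ltnn add0r mulr1 (le_trans sh)// coord_norm_le.
    rewrite mulr0 addr0; case: ifP; rewrite ?normr0// => _; exact: coord_norm_le.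
  have [|s sh Es] := @mvt_dir _ f (u + hk k) (delta_mx 0 k) (h 0 k).
    move=> s sh; rewrite -addrA; have [d1 _] := df (delta_mx 0 k).
    by apply: d1; apply H; apply: inb.
  rewrite hkS addrA Es -mulrBr normrM mulrC -addrA.
  apply: ler_pM => //; last exact: coord_norm_le.
  by have [_ ->] := H _ (inb _ sh).
have -> : f (u + h) - f u - \sum_j h 0 j * 'D_(delta_mx 0 j) f u =
    \sum_(k < m) (f (u + hk k.+1) - f (u + hk k) - h 0 k * 'D_(delta_mx 0 k) f u).
  rewrite sumrB; congr (_ - _).
  rewrite -(big_mkord xpredT (fun k => f (u + hk k.+1) - f (u + hk k))).
  by rewrite telescope_sumr// Em E0 addr0.
apply: le_trans (ler_norm_sum _ _ _) _.
apply: le_trans (ler_sum _ (fun k _ => step k)) _.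
rewrite sumr_const card_ord -mulrnAl -[_ *+ m]mulr_natr ler_wpM2r//.
by rewrite -mulrA ger_pMr// mulrC ler_pdivrMr// mul1r ler_nat.
Unshelve. all: by end_near. Qed.

(** Only the derivative of [g] in the direction [v] is assumed, so [g] has no differential to
    compose with. The difference quotient [q t] of [g] converges, and [C1_approx] is applied to the
    increment [t *: q t]. *)
Lemma chain_is_derive m (V : normedModType R) (U : set 'rV[R]_m) (f : 'rV[R]_m -> R)
  (g : V -> 'rV[R]_m) (x v : V) : open U -> Ck U 1 f -> U (g x) -> derivable g x v ->
  is_derive x v (fun y => f (g y))
    (\sum_j ('D_v g x) 0 j * 'D_(delta_mx 0 j) f (g x)).
Proof.
move=> oU cf Ugx dg.
pose q (t : R) := t^-1 *: ((g \o shift x) (t *: v) - g x).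
pose dg' := 'D_v g x.
have qc : q @ 0^' --> dg' by exact: dg.
have qj j : q t 0 j @[t --> 0^'] --> dg' 0 j.
  exact: (cvg_comp q (fun M : 'rV[R]_m => M 0 j) qc (@coord_continuous _ _ _ 0 j _)).
set S := \sum_j _.
have SC : (\sum_j q t 0 j * 'D_(delta_mx 0 j) f (g x)) @[t --> 0^'] --> S.
  rewrite /S; apply: cvg_big => [|j _]; first exact: add_continuous.
  by apply: cvgMr_tmp; exact: qj.
have ht : t *: q t @[t --> 0^'] --> (0 : 'rV[R]_m).
  rewrite -(scale0r dg'); apply: cvgZ qc; exact: cvg_within.
suff main : (t^-1 *: (((fun y => f (g y)) \o shift x) (t *: v) - f (g x))) @[t --> 0^'] --> S.
  split; first by apply/cvg_ex; exists S.
  exact/cvg_lim.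
apply/cvgrPdist_le => e e0.
(* For small [t] the quotient [q t] has norm at most [|dg'| + 1], so this tolerance contributes an
   error [e / 2]. *)
have e1 : 0 < e / 2 / (`|dg'| + 1) by rewrite !divr_gt0// ltr_pwDr.
have ap := C1_approx oU cf Ugx e1.
have e2 : 0 < e / 2 by rewrite divr_gt0.
near=> t.
have t0 : t != 0 by near: t; exact: nbhs_dnbhs_neq.
have qE : (g \o shift x) (t *: v) = g x + t *: q t.
  by rewrite /q scalerA divff// scale1r addrC subrK.
have -> : ((fun y => f (g y)) \o shift x) (t *: v) = f (g x + t *: q t).
  by rewrite -qE.
have H1 : `|f (g x + t *: q t) - f (g x) - \sum_j (t *: q t) 0 j * 'D_(delta_mx 0 j) f (g x)|
    <= e / 2 / (`|dg'| + 1) * `|t *: q t|.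
  by near: t; exact: (ht _ ap).
have H2 : `|S - \sum_j q t 0 j * 'D_(delta_mx 0 j) f (g x)| <= e / 2.
  by near: t; move/cvgrPdist_le: SC; apply.
have H3 : `|q t| <= `|dg'| + 1.
  have : `|dg' - q t| <= 1 by near: t; move/cvgrPdist_le: qc; apply.
  move=> h; rewrite -[q t](subrKC dg'); apply: le_trans (ler_normD _ _) _.
  by rewrite lerD2l distrC.
rewrite -(subrKA (\sum_j q t 0 j * 'D_(delta_mx 0 j) f (g x))).
apply: le_trans (ler_normD _ _) _; rewrite [leRHS](splitr e) lerD// distrC.
have -> : t^-1 *: (f (g x + t *: q t) - f (g x)) - \sum_j q t 0 j * 'D_(delta_mx 0 j) f (g x) =
   t^-1 * (f (g x + t *: q t) - f (g x) - \sum_j (t *: q t) 0 j * 'D_(delta_mx 0 j) f (g x)).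
  rewrite mulrBr; congr (_ - _); rewrite mulr_sumr; apply: eq_bigr => j _.
  by rewrite [(t *: q t) 0 j]mxE -mulrA mulKf.
rewrite normrM normfV ler_pdivrMl ?normr_gt0//.
apply: le_trans H1 _; rewrite normrZ mulrCA ler_wpM2l//.
by rewrite -[leRHS]mulr1 -[X in X <= _]mulrA ler_wpM2l ?(ltW e2)// ler_pdivrMl ?mulr1// ltr_pwDr.
Unshelve. all: by end_near. Qed.

Lemma Ck_comp m (V : normedModType R) (U : set 'rV[R]_m) (O : set V) k
  (f : 'rV[R]_m -> R) (g : V -> 'rV[R]_m) : open U -> open O ->
  (forall x, O x -> U (g x)) -> Ck U k f -> Ck O k g -> Ck O k (fun x => f (g x)).
Proof.
move=> oU oO OU; elim: k f => [|k IH] f cf cg.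
  split=> // x Ox; case: cg => /(_ x Ox) cg _; apply: cvg_comp cg _.
  by case: cf => + _; apply; exact: OU.
have cg' := CkW cg.
have [cf0 df] := CkS cf; have [cg0 dg] := CkS cg.
split=> [x Ox|v].
  by apply: cvg_comp (cg0 x Ox) _; apply: cf0; exact: OU.
have [g1 g2] := dg v.
have cf1 : Ck U 1 f.
  split=> // w; have [d1 d2] := df w; split=> //; split=> //.
  by case: (k) d2 => [|k'] /= [].
have D x : O x -> is_derive x v (fun y => f (g y)) (\sum_j ('D_v g x) 0 j * 'D_(delta_mx 0 j) f (g x)).
  by move=> Ox; apply: (chain_is_derive oU cf1 (OU _ Ox)); exact: g1.
split=> [x /D[]//|].
apply: (Ck_ext oO (f := fun x => \sum_j ('D_v g x) 0 j * 'D_(delta_mx 0 j) f (g x))).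
  by move=> x /D[_ ->].
apply: Ck_sum => // j _; apply: Ck_mul => //.
  by move/(Ck_coord _ _ oO): g2; apply.
by apply: (IH ('D_(delta_mx 0 j) f)) cg'; have [_] := df (delta_mx 0 j).
Qed.

Lemma Ck_compv m p (V : normedModType R) (U : set 'rV[R]_m) (O : set V) k
  (f : 'rV[R]_m -> 'rV[R]_p) (g : V -> 'rV[R]_m) : open U -> open O ->
  (forall x, O x -> U (g x)) -> Ck U k f -> Ck O k g -> Ck O k (fun x => f (g x)).
Proof.
move=> oU oO OU /(Ck_coord _ _ oU) cf cg; apply/Ck_coord => // j.
exact: (Ck_comp oU oO OU (cf j) cg).
Qed.

(** Linearity in the direction is not part of [Ck]; it is the chain rule for [g = id]. *)
Lemma derive_lin m (U : set 'rV[R]_m) (f : 'rV[R]_m -> R) (u h : 'rV[R]_m) :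
  open U -> Ck U 1 f -> U u ->
  'D_h f u = \sum_j h 0 j * 'D_(delta_mx 0 j) f u.
Proof.
move=> oU cf Uu.
have [_] := @chain_is_derive m _ U f id u h oU cf Uu (@derivable_id _ _ _ _).
by move=> ->; rewrite derive_id.
Qed.

End Chain.

(** * Calculus on an interval *)

Section RealLemmas.
Variables (R : realType).

Lemma is_derive_within (f df : R -> R) (a b : R) :
  (forall t : R, a <= t <= b -> is_derive t (1 : R) f (df t)) -> {within `[a, b], continuous f}.
Proof.
move=> d; apply: derivable_within_continuous => t; rewrite in_itv/= => /d[+ _]; exact.
Qed.

(** Integrating from [- B] makes 0 an interior point, so the primitive has a two-sided derivative
    there. *)
Lemma antideriv (f : R -> R) (B : R) : continuous f ->
  exists F : R -> R, F 0 = 0 /\ forall t : R, - B < t < B -> is_derive t (1 : R) F (f t).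
Proof.
move=> cf.
pose F0 x := (\int[lebesgue_measure]_(t in `[- B, x]) (f t))%R.
exists (fun x => F0 x - F0 0); split; first by rewrite subrr.
move=> t /andP[tB Bt].
have fi : lebesgue_measure.-integrable `[- B, B] (EFin \o f).
  apply: continuous_compact_integrable; first exact: segment_compact.
  exact: continuous_subspaceT.
have [d1 d2] := continuous_FTC1_closed Bt fi tB (cf t).
have dF : is_derive t (1 : R) F0 (f t) by split; [exact: d1|rewrite -derive1E; exact: d2].
by rewrite -[f t]subr0; apply: is_deriveB.
Qed.

Lemma FTC_is_derive (F f : R -> R) :
  {within `[0, 1], continuous f} ->
  (forall t : R, 0 <= t <= 1 -> is_derive t (1 : R) F (f t)) ->
  (\int[lebesgue_measure]_(t in `[0%R, 1%R]) (f t)%:E = (F 1 - F 0)%R%:E)%E.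
Proof.
move=> cf dF; rewrite EFinB; apply: continuous_FTC2 => //.
- have dc (x : R) : 0 <= x <= 1 -> F y @[y --> x] --> F x.
    move=> /dF[+ _] => /derivable1_diffP; exact: differentiable_continuous.
  split.
  + by move=> x; rewrite in_itv/= => /andP[x0 x1]; have [] := dF x _ => //; rewrite !ltW.
  + by apply: cvg_at_right_filter; apply: dc; rewrite lexx ler01.
  + by apply: cvg_at_left_filter; apply: dc; rewrite lexx ler01.
- move=> x; rewrite in_itv/= => /andP[x0 x1]; rewrite derive1E.
  by have [] := dF x _ => //; rewrite !ltW.
Qed.

Lemma is_derive_mono (f g f' g' : R -> R) (a b : R) : a <= b ->
  (forall t : R, a <= t <= b -> is_derive t (1 : R) f (f' t)) ->
  (forall t : R, a <= t <= b -> is_derive t (1 : R) g (g' t)) ->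
  (forall t : R, a <= t <= b -> f' t <= g' t) -> f b - f a <= g b - g a.
Proof.
move=> ab df dg fg.
have dh t : a <= t <= b -> is_derive t (1 : R) (fun t => g t - f t) (g' t - f' t).
  by move=> tab; apply: is_deriveB; [exact: dg|exact: df].
have [||c] := @MVT_segment R (fun t => g t - f t) (fun t => g' t - f' t) a b ab.
- by move=> x; rewrite in_itv/= => /andP[ax xb]; apply: dh; rewrite !ltW.
- exact: is_derive_within dh.
rewrite in_itv/= => cab E; have : 0 <= (g' c - f' c) * (b - a).
  by rewrite mulr_ge0 ?subr_ge0// fg.
rewrite -E; lra.
Qed.

Lemma is_derive_lip (f f' g g' : R -> R) (a b : R) : a <= b ->
  (forall t : R, a <= t <= b -> is_derive t (1 : R) f (f' t)) ->
  (forall t : R, a <= t <= b -> is_derive t (1 : R) g (g' t)) ->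
  (forall t : R, a <= t <= b -> `|f' t| <= g' t) -> `|f b - f a| <= g b - g a.
Proof.
move=> ab df dg fg; rewrite ler_norml; apply/andP; split; last first.
  by apply: (is_derive_mono ab df dg) => t /fg; apply: le_trans; exact: ler_norm.
have df' t : a <= t <= b -> is_derive t (1 : R) (fun t => - f t) (- f' t).
  by move=> tab; apply: is_deriveN; exact: df.
have := is_derive_mono ab df' dg; rewrite lerNl opprB => /(_ _).
rewrite opprK addrC; apply => t /fg; apply: le_trans.
by rewrite -normrN ler_norm.
Qed.

Lemma is_derive_comp_affine (W : normedModType R) (f : R -> W) (a b t : R) (l : W) :
  is_derive (a + b * t) (1 : R) f l -> is_derive t (1 : R) (fun t => f (a + b * t)) (b *: l).
Proof.
move=> [df <-]; have df' := (derivable1_diffP _ _).1 df.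
have E : (fun t => f (a + b * t)) = f \o (fun t => a + b * t) by [].
have dg : is_derive t (1 : R) (fun t => a + b * t) b.
  have := is_deriveD (is_derive_cst a t 1) (is_deriveZ b (is_derive_id t 1)).
  by rewrite add0r => -[d1 d2]; split=> //; rewrite d2 [b%:A]mulr1.
have dg' : differentiable (fun t => a + b * t : R) t by apply/derivable1_diffP; case: dg.
split.
  by apply/derivable1_diffP; rewrite E; apply: differentiable_comp.
rewrite E deriveE; last by apply: differentiable_comp.
rewrite diff_comp//=.
have -> : 'd (fun t : R => a + b * t : R) t 1 = b by rewrite -deriveE//; case: dg.
by rewrite -[X in 'd f _ X]mulr1 linearZ/= -deriveE.
Qed.

(** Connectedness of [[a, b]], in a form suited to properties that spread to the right and pass to
    limits from the left: the supremum of the points up to which [P] holds throughout can only be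
    [b]. *)
Lemma real_induction (P : R -> Prop) (a b : R) : a <= b -> P a ->
  (forall t : R, a <= t < b -> (forall s : R, a <= s <= t -> P s) ->
     exists2 e, 0 < e & forall s : R, t < s < t + e -> s <= b -> P s) ->
  (forall t : R, a < t <= b -> (forall s : R, a <= s < t -> P s) -> P t) ->
  forall t : R, a <= t <= b -> P t.
Proof.
move=> ab Pa Pright Pleft.
pose S := [set t | a <= t <= b /\ forall s : R, a <= s <= t -> P s].
have Sa : S a by split=> [|s /andP[as_ sa]]; rewrite ?lexx//; have -> : s = a by apply/le_anti/andP.
have Sub : has_sup S by split; [exists a|exists b => x [/andP[]]].
pose T := sup S.
have aT : a <= T by apply: ub_le_sup => //; case: Sub.
have Tb : T <= b by apply: ge_sup; [exists a|move=> x [/andP[]]].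
have PT s : a <= s < T -> P s.
  move=> /andP[as_ sT]; have Ts : 0 < T - s by rewrite subr_gt0.
  have [x [xab Px] sx] := sup_adherent Ts Sub; move: sx; rewrite -/T.
  by rewrite subKr => sx; apply: Px; rewrite as_ ltW.
have PTT : forall s : R, a <= s <= T -> P s.
  move=> s /andP[as_]; rewrite le_eqVlt => /orP[/eqP->|sT]; last by apply: PT; rewrite as_.
  have [<-//|aT'] := eqVneq a T.
  by apply: Pleft => //; rewrite lt_neqAle aT' aT.
suff Tb' : T = b by move=> t tab; apply: PTT; rewrite Tb'.
apply/eqP; rewrite eq_le Tb/= leNgt; apply/negP => Tb'.
have [|e e0 He] := Pright T _ PTT; first by rewrite aT.
pose T' := Num.min b (T + e / 2).
have TT' : T < T' by rewrite lt_min Tb' ltrDl divr_gt0.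
have : T' <= T; last by rewrite leNgt TT'.
apply: ub_le_sup; first by case: Sub.
split; first by rewrite (le_trans aT (ltW TT'))//= ge_min lexx.
move=> s /andP[as_ sT']; have [sT|Ts] := leP s T; first by apply: PTT; rewrite as_.
move: sT'; rewrite le_min => /andP[sb se]; apply: He => //; rewrite Ts/=.
by apply: le_lt_trans se _; rewrite ltrD2l ltr_pdivrMr// ltr_pMr// ltr1n.
Qed.

Lemma derive_scaleR (W : normedModType R) (f : R -> W) (x v : R) :
  derivable f x 1 -> derivable f x v /\ 'D_v f x = v *: 'D_1 f x.
Proof.
move=> /derivable1_diffP df; split; first exact: diff_derivable.
by rewrite !deriveE// -[X in 'd f x X]mulr1 linearZ.
Qed.

Lemma Ck_scale (V W : normedModType R) (U : set V) k (a : R) (f : V -> W) : open U ->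
  Ck U k f -> Ck U k (fun x => a *: f x).
Proof.
move=> oU; elim: k f => [|k IH] f cf.
  by split=> // x Ux; apply: cvgZl_tmp; case: cf => + _; apply.
have [c0 df] := CkS cf; split=> [x Ux|v]; first by apply: cvgZl_tmp; exact: c0.
have [d1 d2] := df v; split=> [x /d1 d|]; first exact: derivableZ.
by apply: (Ck_ext oU _ (IH _ d2)) => x /d1 d; rewrite deriveZ.
Qed.

Lemma CkR_intro (W : normedModType R) (U : set R) k (f : R -> W) : open U ->
  (forall x, U x -> derivable f x (1 : R)) -> Ck U k (fun x => 'D_1 f x) -> Ck U k.+1 f.
Proof.
move=> oU df cf; split=> [x /df/derivable1_diffP|v]; first exact: differentiable_continuous.
split=> [x /df/derive_scaleR-/(_ v)[]//|].
have := Ck_scale v oU cf.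
by apply: (Ck_ext oU) => x /df/derive_scaleR-/(_ v)[_ ->].
Qed.

Lemma open_affine (U : set R) (a b : R) : open U -> open [set t : R | U (a + b * t)].
Proof.
move=> oU; apply: (@open_comp _ _ (fun t : R => a + b * t)) => // t _.
by apply: cvgD; [exact: cvg_cst|apply: cvgMl_tmp].
Qed.

Lemma Ck_affine (W : normedModType R) (U : set R) k (f : R -> W) (a b : R) : open U ->
  Ck U k f -> Ck [set t : R | U (a + b * t)] k (fun t => f (a + b * t)).
Proof.
move=> oU; have oU' := @open_affine U a b oU.
have ca t : a + b * s @[s --> t] --> a + b * t.
  by apply: cvgD; [exact: cvg_cst|apply: cvgMl_tmp].
elim: k f => [|k IH] f cf.
  by split=> // t Ut; apply: cvg_comp (ca t) _; case: cf => + _; exact.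
have [c0 df] := CkS cf; have [d1 d2] := df 1.
have D t : U (a + b * t) -> is_derive t (1 : R) (fun t => f (a + b * t)) (b *: 'D_1 f (a + b * t)).
  by move=> Ut; apply: is_derive_comp_affine; split=> //; exact: d1.
apply: CkR_intro => [//|t /D[]//|].
by apply: (Ck_ext oU' _ (Ck_scale b oU' (IH _ d2))) => t /D[_ ->].
Qed.

Lemma open_preimage_within (T T' : topologicalType) (A : set T) (f : T -> T') (B : set T') :
  open A -> (forall x, A x -> f @ x --> f x) -> open B -> open (A `&` f @^-1` B).
Proof.
move=> oA cf oB; rewrite openE => x [Ax Bx]; apply: filterI.
  exact: open_nbhs_nbhs.
by apply: cf => //; exact: open_nbhs_nbhs.
Qed.

Lemma chain_derive_vec m p (V : normedModType R) (U : set 'rV[R]_m) (f : 'rV[R]_m -> 'rV[R]_p)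
  (g : V -> 'rV[R]_m) (x v : V) : open U -> Ck U 1 f -> U (g x) -> derivable g x v ->
  is_derive x v (fun y => f (g y)) ('D_('D_v g x) f (g x)).
Proof.
move=> oU cf Ugx dg.
have cfj j : Ck U 1 (fun x => f x 0 j) by move/Ck_coord: cf; exact.
have dj j := chain_is_derive oU (cfj j) Ugx dg.
have d : derivable (fun y => f (g y)) x v.
  by apply/derivable_mxP => i j; rewrite ord1; have [] := dj j.
split; first exact: d.
apply/rowP => j; rewrite derive_coord//; have [_ ->] := dj j.
have df : derivable f (g x) ('D_v g x).
  by have [_ /(_ ('D_v g x))[+ _]] := CkS cf; apply.
rewrite [RHS](derive_coord _ df).
by rewrite (derive_lin _ oU (cfj j) Ugx).
Qed.

End RealLemmas.

(** * Velocity, speed and length in charts *)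

Section Manifold.
Variables (R : realType) (n : nat) (M : riemannianManifold R n).

Lemma bilinE (g : 'M[R]_n) (u v : 'rV[R]_n) :
  bilin g u v = \sum_a \sum_b g a b * u 0 a * v 0 b.
Proof.
rewrite /bilin mxE exchange_big/=; apply: eq_bigr => b _.
rewrite !mxE mulr_suml; apply: eq_bigr => a _; rewrite mulrAC.
by rewrite mulrC mulrA.
Qed.

Lemma bilin_sym (g : 'M[R]_n) (u v : 'rV[R]_n) : g^T = g -> bilin g u v = bilin g v u.
Proof.
move=> gT; rewrite !bilinE exchange_big/=; apply: eq_bigr => b _; apply: eq_bigr => a _.
by rewrite -{1}gT mxE mulrAC.
Qed.

Lemma bilinDl (g : 'M[R]_n) (u u' v : 'rV[R]_n) : bilin g (u + u') v = bilin g u v + bilin g u' v.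
Proof. by rewrite /bilin !mulmxDl mxE. Qed.

Lemma bilinDr (g : 'M[R]_n) (u v v' : 'rV[R]_n) : bilin g u (v + v') = bilin g u v + bilin g u v'.
Proof. by rewrite /bilin linearD/= mulmxDr mxE. Qed.

Lemma bilinZl (g : 'M[R]_n) a (u v : 'rV[R]_n) : bilin g (a *: u) v = a * bilin g u v.
Proof. by rewrite /bilin -!scalemxAl mxE. Qed.

Lemma bilinZr (g : 'M[R]_n) a (u v : 'rV[R]_n) : bilin g u (a *: v) = a * bilin g u v.
Proof. by rewrite /bilin linearZ/= -scalemxAr mxE. Qed.

Lemma cvg_bilin (T : Type) (F : set_system T) {FF : Filter F} (g : T -> 'M[R]_n)
    (u v : T -> 'rV[R]_n) (g0 : 'M[R]_n) (u0 v0 : 'rV[R]_n) :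
  (forall a b, g t a b @[t --> F] --> g0 a b) ->
  (forall a, u t 0 a @[t --> F] --> u0 0 a) ->
  (forall a, v t 0 a @[t --> F] --> v0 0 a) ->
  bilin (g t) (u t) (v t) @[t --> F] --> bilin g0 u0 v0.
Proof.
move=> cg cu cv; rewrite bilinE; under eq_cvg do rewrite bilinE.
apply: cvg_big => [|a _]; first exact: add_continuous.
apply: cvg_big => [|b _]; first exact: add_continuous.
by apply: cvgM; [apply: cvgM|].
Qed.

Lemma open_transition (i j : chart_index M) : open (cod i `&` chart_inv i @^-1` dom j).
Proof.
apply: open_preimage_within; [exact: cod_open| |exact: dom_open].
by move=> u; exact: chart_inv_continuous.
Qed.

Section SmoothMap.
Variables (V : normedModType R) (U : set V) (c : V -> M).
Hypotheses (oU : open U) (sc : smooth_map U c).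

Lemma smooth_map_open i : open (U `&` c @^-1` dom i).
Proof. by case: sc => cc _; apply: open_preimage_within => //; exact: dom_open. Qed.

Lemma smooth_map_Ck i k : Ck (U `&` c @^-1` dom i) k (chart i \o c).
Proof. by case: sc => _ /(_ i); exact. Qed.

Lemma smooth_map_derivable i t v : U t -> dom i (c t) -> derivable (chart i \o c) t v.
Proof.
move=> Ut it; have [_ /(_ v)[+ _]] := CkS (smooth_map_Ck i 1); apply; exact: conj.
Qed.

Lemma smooth_map_transition i j t v : U t -> dom i (c t) -> dom j (c t) ->
  'D_v (chart j \o c) t = 'D_('D_v (chart i \o c) t) (chart j \o chart_inv i) (chart i (c t)).
Proof.
move=> Ut it jt.
have -> : 'D_v (chart j \o c) t = 'D_v (fun s => (chart j \o chart_inv i) ((chart i \o c) s)) t.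
  apply: near_eq_derive; have := open_nbhs_nbhs (conj (smooth_map_open i) (conj Ut it)).
  by apply: filterS => s [_ si]; rewrite /= chartK.
have := @chain_derive_vec R n n V _ (chart j \o chart_inv i) (chart i \o c) t v
  (@open_transition i j) (@transition_smooth _ _ M i j 1).
case=> //; first by split; [exact: chart_cod|rewrite /= chartK].
exact: smooth_map_derivable.
Qed.

End SmoothMap.

(** [speed] is computed in the chart that [chart_at] selects at each time, which may jump along the
    curve. [metric_compat] allows a fixed chart instead, and this is what makes continuity arguments
    possible. *)
Lemma speed_chart (U : set R) (c : R -> M) t i : open U -> smooth_map U c -> U t -> dom i (c t) ->
  speed c t = Num.sqrt (bilin (metric i (chart i (c t))) (velocity i c t) (velocity i c t)).
Proof.
move=> oU sc Ut it; rewrite /speed; apply: (congr1 Num.sqrt).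
have jt := chart_atP (c t).
have <- : 'D_('D_1 (chart i \o c) t) (chart (chart_at (c t)) \o chart_inv i) (chart i (c t)) =
    velocity (chart_at (c t)) c t by exact/esym/(smooth_map_transition oU sc).
by rewrite -metric_compat.
Qed.

Lemma speed_ge0 (c : R -> M) t : 0 <= speed c t.
Proof. exact: sqrtr_ge0. Qed.

Lemma bilin_metric_ge0 i u v : cod i u -> 0 <= bilin (@metric _ _ M i u) v v.
Proof.
move=> iu; have [->|v0] := eqVneq v 0; last by rewrite ltW// metric_pos.
by rewrite /bilin !mul0mx mxE.
Qed.

Lemma speed_sqr (U : set R) (c : R -> M) t i : open U -> smooth_map U c -> U t -> dom i (c t) ->
  speed c t ^+ 2 = bilin (metric i (chart i (c t))) (velocity i c t) (velocity i c t).
Proof.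
move=> oU sc Ut it; rewrite (speed_chart oU sc Ut it) sqr_sqrtr//.
by apply: bilin_metric_ge0; exact: chart_cod.
Qed.

Lemma metric_cvg i u a b : cod i u -> @metric _ _ M i v a b @[v --> u] --> metric i u a b.
Proof. by move=> iu; have [+ _] := @metric_smooth _ _ M i a b 0%N; exact. Qed.

Lemma speed_continuous (U : set R) (c : R -> M) t : open U -> smooth_map U c -> U t ->
  speed c s @[s --> t] --> speed c t.
Proof.
move=> oU sc Ut; pose i := chart_at (c t); have it : dom i (c t) := chart_atP _.
have near_i : \forall s \near t, U s /\ dom i (c s).
  by apply: open_nbhs_nbhs; split=> //; exact: smooth_map_open.
rewrite (speed_chart oU sc Ut it).
have cont : (chart i \o c) s @[s --> t] --> chart i (c t).
  by have [+ _] := smooth_map_Ck sc i 0; apply.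
have dcont : velocity i c s @[s --> t] --> velocity i c t.
  by have [_ /(_ 1)[_ [+ _]]] := CkS (smooth_map_Ck sc i 1); apply.
apply: (@cvg_trans _ (Num.sqrt (bilin (metric i (chart i (c s))) (velocity i c s) (velocity i c s)) @[s --> t])).
  apply: near_eq_cvg; move: near_i; apply: filterS => s [Us si].
  exact/esym/(speed_chart oU sc Us si).
have B : bilin (metric i (chart i (c s))) (velocity i c s) (velocity i c s) @[s --> t] -->
    bilin (metric i (chart i (c t))) (velocity i c t) (velocity i c t); last first.
  exact: (cvg_comp _ _ B (@sqrt_continuous R _)).
apply: cvg_bilin.
- move=> a b; apply: (cvg_comp _ (fun u => metric i u a b) cont).
  by apply: metric_cvg; exact: chart_cod.
- by move=> a; move/cvg_coord: dcont; exact.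
- by move=> a; move/cvg_coord: dcont; exact.
Qed.

(** Replaces the integral by a primitive of the speed: length estimates then become comparisons of
    derivatives. *)
Lemma length_primitive (c : R -> M) : smooth_on c `[0, 1] ->
  exists L : R -> R, [/\ L 0 = 0,
    forall t : R, 0 <= t <= 1 -> is_derive t (1 : R) L (speed c t) &
    curve_length c = (L 1)%:E].
Proof.
move=> [U [oU sU sc]].
(* The speed is continuous only on a neighbourhood of [[0, 1]], whereas [antideriv] wants a
   continuous function on the line; clamping the time provides one. *)
pose cl (t : R) := Num.max 0 (Num.min 1 t).
have cl01 t : 0 <= cl t <= 1.
  by rewrite /cl le_max lexx/= ge_max ler01/= ge_min lexx.
have clE t : 0 <= t <= 1 -> cl t = t.
  by move=> /andP[t0 t1]; rewrite /cl min_r// max_r.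
have ccl : continuous cl.
  move=> t; apply: continuous_max; first exact: cvg_cst.
  by apply: continuous_min; [exact: cvg_cst|exact: cvg_id].
have Ucl t : U (cl t) by apply: sU; rewrite /= in_itv/=.
have cs : continuous (fun t => speed c (cl t)).
  by move=> t; exact: (cvg_comp cl (speed c) (ccl t) (speed_continuous oU sc (Ucl t))).
have [L [L0 dL]] := antideriv 2 cs.
have dL' (t : R) : 0 <= t <= 1 -> is_derive t (1 : R) L (speed c (cl t)).
  by move=> /andP[t0 t1]; apply: dL; apply/andP; split; lra.
exists L; split; [exact: L0|by move=> t t01; have := dL' t t01; rewrite clE|].
rewrite /curve_length.
have := FTC_is_derive (continuous_subspaceT cs) dL'; rewrite L0 subr0 => <-.
by apply: eq_integral => t; rewrite inE/= in_itv/= => t01; rewrite clE.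
Qed.

Lemma curve_length_primitive (c : R -> M) (L : R -> R) : smooth_on c `[0, 1] ->
  (forall t : R, 0 <= t <= 1 -> is_derive t (1 : R) L (speed c t)) ->
  curve_length c = (L 1 - L 0)%:E.
Proof.
move=> /length_primitive[L' [L'0 dL' ->]] dL; congr (_%:E).
have -> : L' 1 = L' 1 - L' 0 by rewrite L'0 subr0.
apply/le_anti/andP; split.
  by apply: (is_derive_mono ler01 dL' dL).
by apply: (is_derive_mono ler01 dL dL').
Qed.

Lemma smooth_map_affine (W : set R) (c : R -> M) (a b : R) : open W -> smooth_map W c ->
  smooth_map [set t : R | W (a + b * t)] (fun t => c (a + b * t)).
Proof.
move=> oW [cc sc]; split=> [t Wt|i k].
  apply: (cvg_comp (fun s => a + b * s) c _ (cc _ Wt)).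
  by apply: cvgD; [exact: cvg_cst|apply: cvgMl_tmp].
have oWi : open (W `&` c @^-1` dom i) by exact: smooth_map_open.
exact: (Ck_affine a b oWi (sc i k)).
Qed.

Lemma speed_affine (W : set R) (c : R -> M) (a b t : R) : open W -> smooth_map W c -> W (a + b * t) ->
  speed (fun t => c (a + b * t)) t = `|b| * speed c (a + b * t).
Proof.
move=> oW sc Wt; rewrite /speed; set i := chart_at _.
have di := smooth_map_derivable sc (v := 1) Wt (chart_atP _ : dom i _).
have [_ E] := is_derive_comp_affine (DeriveDef di erefl).
rewrite /velocity.
have -> : 'D_1 (chart i \o (fun t0 => c (a + b * t0))) t = b *: 'D_1 (chart i \o c) (a + b * t) by [].
by rewrite bilinZl bilinZr mulrA -expr2 sqrtrM ?sqr_ge0// sqrtr_sqr.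
Qed.

Lemma smooth_on_affine (c : R -> M) (W : set R) (a b : R) : open W -> smooth_map W c ->
  (forall t : R, 0 <= t <= 1 -> W (a + b * t)) -> smooth_on (fun t => c (a + b * t)) `[0, 1].
Proof.
move=> oW sc H; exists [set t : R | W (a + b * t)]; split.
- exact: open_affine.
- by move=> t /=; rewrite in_itv/=; exact: H.
- exact: smooth_map_affine.
Qed.

End Manifold.

(** * Length and distance *)

Section Paths.
Variables (R : realType) (n : nat) (M : riemannianManifold R n).
Implicit Types x y z : M.

(** Every piecewise smooth path has finite length ([pathl_fin]), so real lengths lose nothing. *)
Definition pathl x y (l : R) := pw_smooth_path x y l%:E.

Lemma is_derive_ge0 (F f : R -> R) (a b : R) : a <= b ->
  (forall t : R, a <= t <= b -> is_derive t (1 : R) F (f t)) ->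
  (forall t : R, a <= t <= b -> 0 <= f t) -> F a <= F b.
Proof.
move=> ab dF f0; rewrite -subr_ge0.
have dc (t : R) : a <= t <= b -> is_derive t (1 : R) (cst (0 : R)) ((cst 0 : R -> R) t).
  by move=> _; exact: is_derive_cst.
by have := is_derive_mono ab dc dF f0; rewrite subrr.
Qed.

Lemma primitive_ge0 (c : R -> M) (L : R -> R) :
  (forall t : R, 0 <= t <= 1 -> is_derive t (1 : R) L (speed c t)) -> L 0 <= L 1.
Proof.
move=> dL; apply: (is_derive_ge0 ler01 dL) => t _; exact: speed_ge0.
Qed.

Lemma pathl_fin x y L : pw_smooth_path x y L -> exists2 l, 0 <= l & L = l%:E.
Proof.
elim=> [z|c z L' sc _ [l l0 ->]]; first by exists 0.
have [F [F0 dF ->]] := length_primitive sc; exists (F 1 + l) => //.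
by rewrite addr_ge0// -F0; exact: primitive_ge0 dF.
Qed.

Lemma pathl_ge0 x y l : pathl x y l -> 0 <= l.
Proof. by move=> /pathl_fin[l' l'0 [->]]. Qed.

(** Induction on the pieces with lengths expressed by primitives, so that no integral or extended
    real appears in later arguments. *)
Lemma pathl_ind (P : M -> M -> R -> Prop) :
  (forall x, P x x 0) ->
  (forall (c : R -> M) (L : R -> R) y l, smooth_on c `[0, 1] -> L 0 = 0 ->
    (forall t : R, 0 <= t <= 1 -> is_derive t (1 : R) L (speed c t)) ->
    pathl (c 1) y l -> P (c 1) y l -> P (c 0) y (L 1 + l)) ->
  forall x y l, pathl x y l -> P x y l.
Proof.
move=> P0 Pc x y l; rewrite /pathl; move El : (l%:E) => e pe.
elim: pe l El => [z l [->]//|c z L' sc pc IH l].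
have [l' l'0 L'E] := pathl_fin pc; have [F [F0 dF ->]] := length_primitive sc.
rewrite L'E => -[->]; apply: Pc => //; first by rewrite /pathl -L'E.
exact: IH.
Qed.

Lemma pathl_cons (c : R -> M) (L : R -> R) y l : smooth_on c `[0, 1] ->
  (forall t : R, 0 <= t <= 1 -> is_derive t (1 : R) L (speed c t)) ->
  pathl (c 1) y l -> pathl (c 0) y (L 1 - L 0 + l).
Proof.
move=> sc dL pl; rewrite /pathl EFinD -(curve_length_primitive sc dL).
exact: pw_cons.
Qed.

Lemma pathl_piece (c : R -> M) (L : R -> R) : smooth_on c `[0, 1] ->
  (forall t : R, 0 <= t <= 1 -> is_derive t (1 : R) L (speed c t)) ->
  pathl (c 0) (c 1) (L 1 - L 0).
Proof.
move=> sc dL; rewrite -[_ - _]addr0; apply: pathl_cons => //; exact: pw_nil.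
Qed.

Lemma pathl_cat x y z l l' : pathl x y l -> pathl y z l' -> pathl x z (l + l').
Proof.
move=> pl; elim/pathl_ind: pl z l' => [{}x z l' |c L {}y {}l sc L0 dL _ IH z l' pz].
  by rewrite add0r.
by rewrite -addrA (_ : L 1 = L 1 - L 0); [exact: pathl_cons (IH _ _ pz)|rewrite L0 subr0].
Qed.

(* For [b < 0] the piece of [c] is run backwards. *)
Lemma pathl_sub (c : R -> M) (L : R -> R) (a b : R) : smooth_on c `[0, 1] ->
  (forall t : R, 0 <= t <= 1 -> is_derive t (1 : R) L (speed c t)) ->
  0 <= a <= 1 -> 0 <= a + b <= 1 -> pathl (c a) (c (a + b)) `|L (a + b) - L a|.
Proof.
move=> [U [oU sU sc]] dL a01 ab01.
have in01 t : 0 <= t <= 1 -> 0 <= a + b * t <= 1.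
  move=> /andP[t0 t1]; have [b0|b0] := leP 0 b; apply/andP; split; nra.
have Uab t : 0 <= t <= 1 -> U (a + b * t).
  by move=> /in01 H; apply: sU; rewrite /= in_itv.
have d1 (t : R) : 0 <= t <= 1 -> is_derive t (1 : R) (fun t => L (a + b * t)) (b * speed c (a + b * t)).
  by move=> t01; apply: is_derive_comp_affine; apply: dL; exact: in01.
have so : smooth_on (fun t : R => c (a + b * t)) `[0, 1] := smooth_on_affine oU sc Uab.
have [b0|b0] := leP 0 b.
  have := @pathl_piece _ (fun t => L (a + b * t)) so.
  rewrite !mulr0 !mulr1 !addr0 => H; rewrite ger0_norm.
    apply H; move=> t t01; apply: (is_derive_eq (d1 t t01)).
    by rewrite -{1}(ger0_norm b0); exact/esym/(speed_affine oU sc (Uab t t01)).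
  have := is_derive_ge0 ler01 d1; rewrite mulr0 mulr1 addr0 subr_ge0; apply=> t _.
  by rewrite mulr_ge0// speed_ge0.
have d2 (t : R) : 0 <= t <= 1 -> is_derive t (1 : R) (fun t => - L (a + b * t)) (- (b * speed c (a + b * t))).
  by move=> t01; apply: is_deriveN; exact: d1.
have := @pathl_piece _ (fun t => - L (a + b * t)) so.
rewrite !mulr0 !mulr1 !addr0 => H; rewrite ler0_norm.
  rewrite opprD; apply H; move=> t t01; apply: (is_derive_eq (d2 t t01)).
  by rewrite -mulNr -(ltr0_norm b0); exact/esym/(speed_affine oU sc (Uab t t01)).
have := is_derive_ge0 ler01 d2; rewrite mulr0 mulr1 addr0 lerN2 subr_le0; apply=> t _.
by rewrite -mulNr mulr_ge0 ?speed_ge0// oppr_ge0 ltW.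
Qed.

Lemma pathl_rev x y l : pathl x y l -> pathl y x l.
Proof.
elim/pathl_ind => [z|c L {}y {}l sc L0 dL _ IH]; first exact: pw_nil.
rewrite addrC; apply: pathl_cat IH _.
have := @pathl_sub c L 1 (-1) sc dL; rewrite subrr lexx ler01 L0 sub0r normrN ger0_norm.
  by apply; rewrite ?lexx ?ler01.
by have := primitive_ge0 dL; rewrite L0.
Qed.

(** The first piece ending above the level [r] is cut by the intermediate value theorem. The strict
    inequality at [x] excludes the empty path. *)
Lemma pathl_cross (psi : M -> R) (r : R) x y l : continuous psi -> pathl x y l ->
  psi x < r <= psi y ->
  exists z l1 l2, [/\ psi z = r, pathl x z l1, pathl z y l2 & l1 + l2 = l].
Proof.
move=> cpsi pl; elim/pathl_ind: pl => [z|c L {}y {}l sc L0 dL pl IH] /andP[xr ry].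
  by have := lt_le_trans xr ry; rewrite ltxx.
have p1 : pathl (c 0) (c 1) (L 1) by rewrite (_ : L 1 = L 1 - L 0); [exact: pathl_piece|rewrite L0 subr0].
have [c1r|rc1] := ltP (psi (c 1)) r.
  have [z [l1 [l2 [zr p2 p3 <-]]]] := IH (introT andP (conj c1r ry)).
  by exists z, (L 1 + l1), l2; split=> //; [exact: pathl_cat p2|rewrite addrA].
have [t0 t01 Et] : exists2 t0, t0 \in `[(0:R), 1] & (psi \o c) t0 = r.
  apply: IVT => //; last first.
    by rewrite ge_min le_max /= (ltW xr)/= rc1 orbT.
  case: sc => U [oU sU [cc _]].
  apply: continuous_in_subspaceT => t; rewrite inE => /sU Ut.
  exact: (cvg_comp c psi (cc t Ut) (cpsi _)).
move: t01; rewrite in_itv/= => t01.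
exists (c t0), (L t0), (L 1 - L t0 + l); split=> //; last by rewrite addrA addrCA subrr addr0.
- have := @pathl_sub c L 0 t0 sc dL; rewrite add0r lexx ler01 L0 subr0 => /(_ isT t01).
  rewrite ger0_norm// -L0; apply: (@is_derive_ge0 L (speed c)); first by case/andP: t01.
  + by move=> t /andP[t0' t1]; apply: dL; rewrite t0'/= (le_trans t1)//; case/andP: t01.
  + by move=> t _; exact: speed_ge0.
- apply: pathl_cat pl.
  have := @pathl_sub c L t0 (1 - t0) sc dL t01; rewrite subrKC ler01 lexx => /(_ isT).
  rewrite ger0_norm// subr_ge0; apply: (@is_derive_ge0 L (speed c)); first by case/andP: t01.
  + by move=> t /andP[t0' t1]; apply: dL; rewrite t1 andbT (le_trans _ t0')//; case/andP: t01.
  + by move=> t _; exact: speed_ge0.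
Qed.

Definition conn x y := exists l, pathl x y l.
(** [fine] sends an infinite distance to 0, which is why statements about [dist] come with [conn]
    hypotheses. *)
Definition dist x y : R := fine (rdist x y).

Lemma conn_refl x : conn x x. Proof. by exists 0; exact: pw_nil. Qed.

Lemma conn_sym x y : conn x y -> conn y x.
Proof. by move=> [l /pathl_rev]; exists l. Qed.

Lemma conn_trans y x z : conn x y -> conn y z -> conn x z.
Proof. by move=> [l p] [l' p']; exists (l + l'); exact: pathl_cat p'. Qed.

Lemma rdist_ge0 x y : (0 <= rdist x y)%E.
Proof.
by apply: le_ereal_inf_tmp => L /pathl_fin[l l0 ->]; rewrite lee_fin.
Qed.

Lemma rdistE x y : conn x y -> rdist x y = (dist x y)%:E.
Proof.
move=> [l pl]; rewrite /dist fineK// ge0_fin_numE; last exact: rdist_ge0.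
by apply: le_lt_trans (ltry l); exact: ereal_inf_lbound.
Qed.

Lemma rdist_lt_conn x y (e : \bar R) : (rdist x y < e)%E -> conn x y.
Proof.
by move=> /ereal_inf_lt[L + _] => pL; have [l _ E] := pathl_fin pL; exists l; rewrite /pathl -E.
Qed.

Lemma rdist_lt x y (e : R) : (rdist x y < e%:E)%E -> conn x y /\ dist x y < e.
Proof. by move=> xy; have c := rdist_lt_conn xy; split=> //; rewrite -lte_fin -rdistE. Qed.

Lemma dist_ge0 x y : 0 <= dist x y.
Proof. by rewrite fine_ge0// rdist_ge0. Qed.

Lemma dist_le_path x y l : pathl x y l -> dist x y <= l.
Proof.
by move=> pl; rewrite -lee_fin -rdistE; [exact: ereal_inf_lbound|exists l].
Qed.

Lemma dist_adherent x y (e : R) : conn x y -> 0 < e ->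
  exists2 l, pathl x y l & l < dist x y + e.
Proof.
move=> xy e0; have : (rdist x y < (dist x y + e)%:E)%E by rewrite rdistE// lte_fin ltrDl.
move=> /ereal_inf_lt[L pL Le]; have [l _ E] := pathl_fin pL.
by exists l; [rewrite /pathl -E|rewrite -lte_fin -E].
Qed.

Lemma dist_refl x : dist x x = 0.
Proof. by apply/le_anti; rewrite dist_ge0 andbT; apply: dist_le_path; exact: pw_nil. Qed.

Lemma rdist_sym x y : rdist x y = rdist y x.
Proof.
rewrite /rdist; congr ereal_inf; apply/seteqP; split=> L pL;
  have [l _ E] := pathl_fin pL; move: pL; rewrite /= E; exact: pathl_rev.
Qed.

Lemma dist_sym x y : dist x y = dist y x.
Proof. by rewrite /dist rdist_sym. Qed.

Lemma dist_tri y x z : conn x y -> conn y z -> dist x z <= dist x y + dist y z.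
Proof.
move=> xy yz; apply/ler_addgt0Pr => e e0.
have e20 : 0 < e / 2 by rewrite divr_gt0.
have [l pl le] := dist_adherent xy e20; have [l' pl' le'] := dist_adherent yz e20.
apply: le_trans (dist_le_path (pathl_cat pl pl')) _; lra.
Qed.

End Paths.

(** * Local Lipschitz and Taylor estimates *)

Section LocalBounds.
Variables (R : realType).

(** Estimates on the metric and on the Christoffel symbols are obtained entry by entry; this yields
    a common radius and a common constant. *)
Lemma fin_unif (I : finType) (P : I -> R -> R -> Prop) :
  (forall i r r' k k', P i r k -> 0 < r' <= r -> k <= k' -> P i r' k') ->
  (forall i, exists r k, [/\ 0 < r, 0 <= k & P i r k]) ->
  exists r k, [/\ 0 < r, 0 <= k & forall i, P i r k].
Proof.
move=> mono ex.
suff [r [k [r0 k0 H]]] : exists r k, [/\ 0 < r, 0 <= k & forall i, i \in enum I -> P i r k].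
  by exists r, k; split=> // i; apply: H; rewrite mem_enum.
elim: (enum I) => [|i s [r [k [r0 k0 H]]]]; first by exists 1, 0; split.
have [r' [k' [r'0 k'0 Pi]]] := ex i.
exists (Num.min r r'), (k + k'); split; first by rewrite lt_min r0.
  by rewrite addr_ge0.
move=> j; rewrite inE => /predU1P[->|js].
  by apply: (mono _ _ _ _ _ Pi); rewrite ?lt_min ?r0 ?r'0 ?ge_min ?lexx ?orbT ?lerDr.
by apply: (mono _ _ _ _ _ (H _ js)); rewrite ?lt_min ?r0 ?r'0 ?ge_min ?lexx ?lerDl.
Qed.

Lemma nbhs_norm_ex (W : normedModType R) (x : W) (P : set W) : nbhs x P ->
  exists2 r : R, 0 < r & forall y, `|y - x| < r -> P y.
Proof.
move=> /nbhs_ballP[r /= r0 H]; exists r => // y yr; apply: H.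
by rewrite -ball_normE/= distrC.
Qed.

Lemma ex_nbhs_norm (W : normedModType R) (x : W) (P : set W) (r : R) : 0 < r ->
  (forall y, `|y - x| < r -> P y) -> nbhs x P.
Proof.
move=> r0 H; apply/nbhs_ballP; exists r => //= y; rewrite -ball_normE/= distrC; exact: H.
Qed.

Lemma is_derive_line m (u w : 'rV[R]_m) (s : R) :
  is_derive s (1 : R) (fun s : R => u + s *: w) w.
Proof.
suff H : (fun h : R => h^-1 *: (((fun s : R => u + s *: w) \o shift s) (h *: (1 : R)) - (u + s *: w))) @ 0^' --> w.
  by split; [apply/cvg_ex; exists w|exact/cvg_lim].
apply: (@cvg_trans _ ((fun _ : R => w) @ 0^')); last exact: cvg_cst.
apply: near_eq_cvg; near=> h; have h0 : h != 0 by near: h; exact: nbhs_dnbhs_neq.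
by rewrite /= [h%:A]mulr1 scalerDl opprD addrACA subrr add0r addrK scalerA mulVf// scale1r.
Unshelve. all: by end_near. Qed.

Lemma is_derive_mulc (c s : R) : is_derive s (1 : R) (fun t : R => c * t) c.
Proof. by have := is_deriveZ c (is_derive_id s (1 : R)); rewrite [c%:A]mulr1. Qed.

Lemma is_derive_along m (U : set 'rV[R]_m) (f : 'rV[R]_m -> R) (u w : 'rV[R]_m) (s : R) :
  open U -> Ck U 1 f -> U (u + s *: w) ->
  is_derive s (1 : R) (fun s : R => f (u + s *: w))
    (\sum_j w 0 j * 'D_(delta_mx 0 j) f (u + s *: w)).
Proof.
move=> oU cf Us; have dl := is_derive_line u w s.
have := chain_is_derive (g := fun s : R => u + s *: w) oU cf Us (@ex_derive _ _ _ _ _ _ _ dl).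
by rewrite derive_val.
Qed.

Lemma segment_in_ball m (u0 u v : 'rV[R]_m) (r s : R) : `|u - u0| < r -> `|v - u0| < r ->
  0 <= s <= 1 -> `|u + s *: (v - u) - u0| < r.
Proof.
move=> ur vr /andP[s0 s1].
have -> : u + s *: (v - u) - u0 = (1 - s) *: (u - u0) + s *: (v - u0).
  by apply/rowP => j; rewrite !mxE; ring.
apply: le_lt_trans (ler_normD _ _) _; rewrite !normrZ (ger0_norm s0) ger0_norm ?subr_ge0//.
have [->|s'] := eqVneq s 0; first by rewrite subr0 mul1r mul0r addr0.
have : 0 < s by rewrite lt_neqAle eq_sym s'.
have := normr_ge0 (u - u0); have := normr_ge0 (v - u0); nra.
Qed.

Lemma loc_bound m (U : set 'rV[R]_m) (f : 'rV[R]_m -> R) (u0 : 'rV[R]_m) : open U -> Ck U 1 f -> U u0 ->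
  exists r k, [/\ 0 < r, 0 <= k & forall u, `|u - u0| < r -> [/\ U u, `|f u| <= k &
    forall v, `|v - u0| < r -> `|f v - f u| <= k * `|v - u|]].
Proof.
move=> oU cf Uu0; have [cf0 df] := CkS cf.
have [k1 k10 H1] : exists2 k1, 0 <= k1 & \forall u \near u0, `|f u| <= k1.
  exists (`|f u0| + 1); first by rewrite addr_ge0.
  have /cvgrPdist_le/(_ 1 ltr01) := cf0 u0 Uu0; apply: filterS => u H.
  rewrite -[f u](subrKC (f u0)); apply: le_trans (ler_normD _ _) _.
  by rewrite lerD2l distrC.
have [k2 k20 H2] : exists2 k2, 0 <= k2 & \forall u \near u0, forall j, `|'D_(delta_mx 0 j) f u| <= k2.
  exists (\sum_j (`|'D_(delta_mx 0 j) f u0| + 1)).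
    by apply: sumr_ge0 => j _; rewrite addr_ge0.
  suff HH j : \forall u \near u0, `|'D_(delta_mx 0 j) f u| <= \sum_j (`|'D_(delta_mx 0 j) f u0| + 1).
    by near=> u; near: u; apply: filter_forall => j; exact: HH.
  have [_ [dc _]] := df (delta_mx 0 j).
  have /cvgrPdist_le/(_ 1 ltr01) := dc u0 Uu0; apply: filterS => u H.
  apply: (@le_trans _ _ (`|'D_(delta_mx 0 j) f u0| + 1)).
    rewrite -['D_(delta_mx 0 j) f u](subrKC ('D_(delta_mx 0 j) f u0)).
    by apply: le_trans (ler_normD _ _) _; rewrite lerD2l distrC.
  by rewrite (bigD1 j)//= lerDl sumr_ge0// => l _; rewrite addr_ge0.
have H3 : \forall u \near u0, U u by exact: open_nbhs_nbhs.
have [r r0 H] := nbhs_norm_ex (filterI H3 (filterI H1 H2)).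
have {}H u : `|u - u0| < r -> [/\ U u, `|f u| <= k1 & forall j, `|'D_(delta_mx 0 j) f u| <= k2].
  by move=> /H[? [? ?]].
exists r, (k1 + m%:R * k2); split=> //; first by rewrite addr_ge0// mulr_ge0.
move=> u ur; have [Uu fu _] := H u ur; split=> //.
  by rewrite (le_trans fu)// lerDl mulr_ge0.
move=> v vr.
pose g s := f (u + s *: (v - u)).
have dg (s : R) : 0 <= s <= 1 -> is_derive s (1 : R) g (\sum_j (v - u) 0 j * 'D_(delta_mx 0 j) f (u + s *: (v - u))).
  move=> s01; have sr := segment_in_ball ur vr s01; have [Us _ _] := H _ sr.
  exact: is_derive_along oU cf Us.
have := is_derive_lip ler01 dg (fun s _ => is_derive_mulc (m%:R * k2 * `|v - u|) s).
rewrite /g scale1r scale0r addr0 subrKC mulr1 mulr0 subr0 => Hl.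
apply: (le_trans (Hl _)); last by rewrite ler_wpM2r// lerDr.
move=> s s01; have [_ _ Ds] := H _ (segment_in_ball ur vr s01).
apply: le_trans (ler_norm_sum _ _ _) _.
apply: (@le_trans _ _ (\sum_(j < m) (k2 * `|v - u|))).
  apply: ler_sum => j _; rewrite normrM mulrC; apply: ler_pM => //.
  exact: coord_norm_le.
by rewrite sumr_const card_ord -[X in X <= _]mulr_natl mulrA.
Unshelve. all: by end_near. Qed.

(** The mean value theorem along the segment, with the Lipschitz bound of [loc_bound] for the
    partial derivatives. *)
Lemma loc_taylor m (U : set 'rV[R]_m) (f : 'rV[R]_m -> R) (u0 : 'rV[R]_m) : open U -> Ck U 2 f -> U u0 ->
  exists r k, [/\ 0 < r, 0 <= k & forall u v, `|u - u0| < r -> `|v - u0| < r ->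
    `|f v - f u - 'D_(v - u) f u| <= k * `|v - u| ^+ 2].
Proof.
move=> oU cf2 Uu0; have cf := CkW cf2; have [_ df] := CkS cf2.
have [r [k [r0 k0 H]]] : exists r k, [/\ 0 < r, 0 <= k & forall j u, `|u - u0| < r -> [/\ U u, `|'D_(delta_mx 0 j) f u| <= k &
    forall v, `|v - u0| < r -> `|'D_(delta_mx 0 j) f v - 'D_(delta_mx 0 j) f u| <= k * `|v - u|]].
  apply: fin_unif => [j r r' k k' H /andP[r'0 r'r] kk' u ur|j]; last first.
    have [_ dj] := df (delta_mx 0 j); exact: (loc_bound oU dj Uu0).
  have [Uu Du Dv] := H u (lt_le_trans ur r'r); split=> //; first exact: le_trans kk'.
  move=> v vr; apply: le_trans (Dv v (lt_le_trans vr r'r)) _.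
  by rewrite ler_wpM2r.
have [r1 [k1 [r10 k10 H1]]] := loc_bound oU cf Uu0.
exists (Num.min r r1), (m%:R * k); split; rewrite ?lt_min ?r0// ?mulr_ge0// => u v.
rewrite !lt_min => /andP[ur ur1] /andP[vr vr1].
pose g s := f (u + s *: (v - u)).
have seg (s : R) : 0 <= s <= 1 -> U (u + s *: (v - u)).
  by move=> s01; have [] := H1 _ (segment_in_ball ur1 vr1 s01).
have dg (s : R) : 0 <= s <= 1 -> is_derive s (1 : R) g (\sum_j (v - u) 0 j * 'D_(delta_mx 0 j) f (u + s *: (v - u))).
  move=> s01.
  exact: is_derive_along oU cf (seg s s01).
have [||s] := @MVT_segment R g (fun s => \sum_j (v - u) 0 j * 'D_(delta_mx 0 j) f (u + s *: (v - u))) 0 1 ler01.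
- by move=> s; rewrite in_itv/= => /andP[s0 s1]; apply: dg; rewrite !ltW.
- exact: is_derive_within dg.
rewrite in_itv/= /g scale1r scale0r addr0 subrKC subr0 mulr1 => s01 ->.
have Uu : U u by have [] := H1 _ ur1.
rewrite (derive_lin _ oU cf Uu) -sumrB.
apply: le_trans (ler_norm_sum _ _ _) _.
apply: (@le_trans _ _ (\sum_(j < m) (k * `|v - u| ^+ 2))); last first.
  by rewrite sumr_const card_ord -[X in X <= _]mulr_natl mulrA.
apply: ler_sum => j _; rewrite -mulrBr normrM expr2 mulrA mulrC; apply: ler_pM => //.
  have [_ _ Dj] := H j u ur; have sr := segment_in_ball ur vr s01.
  apply: le_trans (Dj _ sr) _; rewrite addrAC subrr add0r normrZ.
  rewrite ler_wpM2l// -[leRHS]mul1r ler_wpM2r//.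
  by case/andP: s01 => s0 s1; rewrite ger0_norm.
exact: coord_norm_le.
Qed.

Lemma bilin_le n (g : 'M[R]_n) (v w : 'rV[R]_n) (k : R) : (forall a b, `|g a b| <= k) ->
  `|bilin g v w| <= (n * n)%:R * k * `|v| * `|w|.
Proof.
move=> gk; rewrite bilinE; apply: le_trans (ler_norm_sum _ _ _) _.
apply: (@le_trans _ _ (\sum_(a < n) \sum_(b < n) k * `|v| * `|w|)).
  apply: ler_sum => a _; apply: le_trans (ler_norm_sum _ _ _) _; apply: ler_sum => b _.
  rewrite !normrM; apply: ler_pM; rewrite ?mulr_ge0//; last exact: coord_norm_le.
  by apply: ler_pM => //; exact: coord_norm_le.
by rewrite !sumr_const !card_ord -mulrnA -[X in X <= _]mulr_natl -!mulrA.
Qed.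

End LocalBounds.

(** * The geodesic equation in coordinates *)

Section ChartLocal.
Variables (R : realType).

Lemma is_derive_bigsum (V : normedModType R) (m : nat) (h : 'I_m -> V -> R) (x v : V) (dh : 'I_m -> R) :
  (forall j, is_derive x v (h j) (dh j)) ->
  is_derive x v (fun y => \sum_j h j y) (\sum_j dh j).
Proof.
move=> d; have := is_derive_sum d.
by rewrite (_ : \sum_(j < m) h j = fun y => \sum_j h j y)//; apply/funext => y; rewrite fct_sumE.
Qed.

Lemma is_derive_coordP (V : normedModType R) m (f : V -> 'rV[R]_m) (x v : V) (l : 'rV[R]_m) :
  is_derive x v f l <-> forall j, is_derive x v (fun y => f y 0 j) (l 0 j).
Proof.
split=> [[df <-] j|H].
  by rewrite derive_coord//; apply: derivableP; move/derivable_mxP: df; exact.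
have df : derivable f x v by apply/derivable_mxP => a j; rewrite ord1; have [] := H j.
by split=> //; apply/rowP => j; rewrite derive_coord//; have [_ ->] := H j.
Qed.

Lemma is_deriveM' (V : normedModType R) (f g : V -> R) (x v : V) (df dg : R) :
  is_derive x v f df -> is_derive x v g dg ->
  is_derive x v (fun y => f y * g y) (df * g x + f x * dg).
Proof.
move=> hf hg; have := is_deriveM hf hg; rewrite addrC.
by rewrite [df * g x]mulrC.
Qed.

Lemma Ck_det m (V : normedModType R) (U : set V) k (A : V -> 'M[R]_m) : open U ->
  (forall a b, Ck U k (fun u => A u a b)) -> Ck U k (fun u => \det (A u)).
Proof.
move=> oU cA; apply: Ck_sum => // s _; apply: Ck_mul => //; first exact: Ck_cst.
by apply: Ck_prod => // j _; exact: cA.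
Qed.

Lemma posdef_unit m (A : 'M[R]_m) : (forall v, v != 0 -> 0 < bilin A v v) -> A \in unitmx.
Proof.
move=> pA; rewrite -row_free_unit -kermx_eq0; apply/negPn/negP => /rowV0Pn[v /sub_kermxP vA /pA].
by rewrite /bilin vA mul0mx mxE ltxx.
Qed.

Lemma bilinBm m (A B : 'M[R]_m) u v : bilin (A - B) u v = bilin A u v - bilin B u v.
Proof. by rewrite /bilin mulmxBr mulmxBl !mxE. Qed.

Lemma bilinBl m (A : 'M[R]_m) u u' v : bilin A (u - u') v = bilin A u v - bilin A u' v.
Proof. by rewrite /bilin !mulmxBl !mxE. Qed.

Lemma bilinBr m (A : 'M[R]_m) u v v' : bilin A u (v - v') = bilin A u v - bilin A u v'.
Proof. by rewrite /bilin linearB/= mulmxBr !mxE. Qed.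

Variables (n : nat) (M : riemannianManifold R n) (i : chart_index M).

Lemma metric_unit u : cod i u -> metric i u \in unitmx.
Proof. by move=> iu; apply: posdef_unit; exact: metric_pos. Qed.

(** Cramer's formula: the entries are cofactors divided by a determinant that positivity of the
    metric keeps away from 0. *)
Lemma invmx_metric_Ck k a b : Ck (cod i) k (fun u => invmx (metric i u) a b).
Proof.
have oC := @cod_open _ _ M i.
have cg a' b' : Ck (cod i) k (fun u => metric i u a' b') by exact: metric_smooth.
apply: (Ck_ext (f := fun u => (\det (metric i u))^-1 * ((-1) ^+ (b + a) * \det (row' b (col' a (metric i u)))))) => //.
  by move=> u iu; rewrite /invmx metric_unit// !mxE.
apply: Ck_mul => //; first apply: Ck_inv => //.
- by move=> u iu; rewrite -unitfE; exact: metric_unit.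
- exact: Ck_det.
apply: Ck_mul => //; first exact: Ck_cst.
apply: Ck_det => // a' b'.
by apply: (Ck_ext oC _ (cg (lift b a') (lift a b'))) => u _; rewrite !mxE.
Qed.

Lemma christoffel_Ck k a p q : Ck (cod i) k (fun u => christoffel i u a p q).
Proof.
have oC := @cod_open _ _ M i.
have dg m b c : Ck (cod i) k (fun u => 'D_(delta_mx 0 m) (fun w => metric i w b c) u).
  by have [_ /(_ (delta_mx 0 m))[]] := CkS (@metric_smooth _ _ M i b c k.+1).
rewrite /christoffel; apply: Ck_mul => //; first exact: Ck_cst.
apply: Ck_sum => // l _; apply: Ck_mul => //; first exact: invmx_metric_Ck.
apply: Ck_add => //; first exact: Ck_add.
apply: (Ck_ext (f := fun u => -1 * 'D_(delta_mx 0 l) (fun w => metric i w p q) u)) => //.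
  by move=> u _; rewrite mulN1r.
by apply: Ck_mul => //; exact: Ck_cst.
Qed.

Definition dmet u h : 'M[R]_n := \matrix_(a, b) 'D_h (fun w => metric i w a b) u.

(** The geodesic equation solved for the second derivative reads [c'' = acc c c']. *)
Definition acc u v : 'rV[R]_n :=
  \row_k (- bilin (\matrix_(p, q) christoffel i u k p q) v v).

Lemma dmetE u h a b : cod i u ->
  dmet u h a b = \sum_l h 0 l * 'D_(delta_mx 0 l) (fun w => metric i w a b) u.
Proof.
move=> iu; rewrite mxE.
exact: (derive_lin h (@cod_open _ _ M i) (@metric_smooth _ _ M i a b 1) iu).
Qed.

(** The Euler-Lagrange form of the geodesic equation: lowering the index cancels the inverse matrix
    in the Christoffel symbols. Conservation of energy and the calibration rely on the equation in
    this form. *)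
Lemma acc_momentum u v w : cod i u ->
  bilin (metric i u) (acc u v) w = 2^-1 * bilin (dmet u w) v v - bilin (dmet u v) v w.
Proof.
move=> iu.
pose d m p q := 'D_(delta_mx 0 m) (fun w => metric i w p q) u.
pose S m := \sum_p \sum_q (d p q m + d q p m - d m p q) * v 0 p * v 0 q.
have accE k : acc u v 0 k = - (2^-1 * \sum_l invmx (metric i u) k l * S l).
  rewrite mxE bilinE; congr (- _).
  transitivity (\sum_p \sum_q \sum_l 2^-1 * (invmx (metric i u) k l * ((d p q l + d q p l - d l p q) * v 0 p * v 0 q))).
    apply: eq_bigr => p _; apply: eq_bigr => q _; rewrite mxE /christoffel -/(d _ _ _).
    rewrite -!mulrA mulr_suml mulr_sumr; apply: eq_bigr => l _.
    by rewrite /d -!mulrA.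
  under eq_bigr do rewrite exchange_big/=.
  rewrite exchange_big/= mulr_sumr; apply: eq_bigr => l _.
  rewrite /S !mulr_sumr; apply: eq_bigr => p _.
  by rewrite !mulr_sumr; apply: eq_bigr => q _.
have -> : bilin (metric i u) (acc u v) w = - (2^-1 * \sum_m S m * w 0 m).
  have -> : acc u v = - 2^-1 *: ((\row_l S l) *m invmx (metric i u)).
    apply/rowP => k; rewrite accE !mxE mulNr; congr (- (_ * _)); apply: eq_bigr => l _.
    rewrite mxE mulrC; congr (_ * _).
    have gT := Defs.metric_sym iu.
    have -> : invmx (metric i u) k l = (invmx (metric i u))^T l k by rewrite mxE.
    by rewrite trmx_inv gT.
  rewrite /bilin -!scalemxAl mulmxKV ?metric_unit// !mxE mulNr; congr (- (_ * _)).
  by apply: eq_bigr => m _; rewrite !mxE.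
have -> : bilin (dmet u w) v v = \sum_m (\sum_p \sum_q d m p q * v 0 p * v 0 q) * w 0 m.
  rewrite bilinE.
  transitivity (\sum_p \sum_q \sum_m d m p q * v 0 p * v 0 q * w 0 m).
    apply: eq_bigr => p _; apply: eq_bigr => q _; rewrite dmetE// !mulr_suml.
    by apply: eq_bigr => m _; rewrite -/(d _ _ _) -!mulrA mulrC -!mulrA.
  under eq_bigr do rewrite exchange_big/=.
  rewrite exchange_big/=; apply: eq_bigr => m _; rewrite mulr_suml; apply: eq_bigr => p _.
  by rewrite mulr_suml.
have -> : bilin (dmet u v) v w = \sum_m (\sum_p \sum_q d p q m * v 0 p * v 0 q) * w 0 m.
  rewrite bilinE exchange_big/=; apply: eq_bigr => m _.
  rewrite exchange_big/= mulr_suml; apply: eq_bigr => q _; rewrite dmetE// !mulr_suml.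
  by apply: eq_bigr => p _; rewrite -/(d _ _ _) [v 0 p * _]mulrC.
(* Exchanging [p] and [q] identifies the first two terms of the Christoffel symbol once they are
   contracted with [v] twice. *)
have SE m : S m = 2 * (\sum_p \sum_q d p q m * v 0 p * v 0 q) - \sum_p \sum_q d m p q * v 0 p * v 0 q.
  rewrite mulr2n mulrDl mul1r [X in _ = _ + X - _]exchange_big/= -big_split/= -sumrB; apply: eq_bigr => p _.
  rewrite -big_split/= -sumrB; apply: eq_bigr => q _; ring.
under eq_bigr do rewrite SE mulrBl -mulrA.
rewrite sumrB -mulr_sumr mulrBr mulKf ?pnatr_eq0//; ring.
Qed.

Lemma bilin_curve (c p q : R -> 'rV[R]_n) (t : R) c' p' q' : cod i (c t) ->
  is_derive t (1 : R) c c' -> is_derive t (1 : R) p p' -> is_derive t (1 : R) q q' ->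
  is_derive t (1 : R) (fun s => bilin (metric i (c s)) (p s) (q s))
   (bilin (dmet (c t) c') (p t) (q t) + bilin (metric i (c t)) p' (q t) + bilin (metric i (c t)) (p t) q').
Proof.
move=> ic dc /is_derive_coordP dp /is_derive_coordP dq.
have -> : (fun s => bilin (metric i (c s)) (p s) (q s)) =
    (fun s => \sum_a \sum_b metric i (c s) a b * p s 0 a * q s 0 b).
  by apply/funext => s; rewrite bilinE.
rewrite !bilinE -!big_split/=; apply: is_derive_bigsum => a.
rewrite -!big_split/=; apply: is_derive_bigsum => b.
have oC := @cod_open _ _ M i.
have dg : is_derive t (1 : R) (fun s => metric i (c s) a b) (dmet (c t) c' a b).
  have := chain_is_derive (g := c) oC (@metric_smooth _ _ M i a b 1) ic (@ex_derive _ _ _ _ _ _ _ dc).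
  by rewrite derive_val dmetE.
have := is_deriveM' (is_deriveM' dg (dp a)) (dq b).
by rewrite mulrDl.
Qed.

End ChartLocal.

(** * Uniform estimates on a coordinate ball *)

Section Good.
Variables (R : realType) (n : nat) (M : riemannianManifold R n) (i : chart_index M).

(** [la] is an ellipticity constant, and the single constant [k] serves all upper bounds. The bounds
    on [acc] are quadratic in the velocity, so restricting to slow curves makes the geodesic
    equation a small perturbation of [c'' = 0]. *)
Record good (u0 : 'rV[R]_n) (r la k : R) : Prop := Good {
  good_r : 0 < r;
  good_la : 0 < la;
  good_k : 0 <= k;
  good_cod : forall u, `|u - u0| < r -> cod i u;
  good_lower : forall u v, `|u - u0| < r -> la * `|v| ^+ 2 <= bilin (metric i u) v v;
  good_upper : forall u v w, `|u - u0| < r -> `|bilin (metric i u) v w| <= k * `|v| * `|w|;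
  good_lip : forall u u' v w, `|u - u0| < r -> `|u' - u0| < r ->
    `|bilin (metric i u') v w - bilin (metric i u) v w| <= k * `|u' - u| * `|v| * `|w|;
  good_taylor : forall u u' v, `|u - u0| < r -> `|u' - u0| < r ->
    `|bilin (metric i u') v v - bilin (metric i u) v v - bilin (dmet i u (u' - u)) v v|
      <= k * `|u' - u| ^+ 2 * `|v| ^+ 2;
  good_acc : forall u v, `|u - u0| < r -> `|acc i u v| <= k * `|v| ^+ 2;
  good_acc_lip : forall u u' v v', `|u - u0| < r -> `|u' - u0| < r ->
    `|acc i u' v' - acc i u v| <= k * (`|u' - u| * `|v| ^+ 2 + `|v' - v| * (`|v| + `|v'|)) }.

Lemma bilin_cont (A : 'M[R]_n) (v : 'rV[R]_n) : bilin A w w @[w --> v] --> bilin A v v.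
Proof.
apply: (@cvg_bilin R n _ (nbhs v) _ (fun=> A) id id); first by move=> a b; exact: cvg_cst.
- by move=> a; exact: coord_continuous.
- by move=> a; exact: coord_continuous.
Qed.

(** The minimum on the unit sphere, extended by homogeneity. *)
Lemma posdef_lower (A : 'M[R]_n) : (forall v, v != 0 -> 0 < bilin A v v) ->
  exists2 la : R, 0 < la & forall v, la * `|v| ^+ 2 <= bilin A v v.
Proof.
move=> pA; pose S := [set v : 'rV[R]_n | `|v| = 1].
(* The sphere is empty in dimension 0, where only [v = 0] remains. *)
have [S0|S0] := pselect (S !=set0); last first.
  exists 1 => // v; have [->|v0] := eqVneq v 0.
    by rewrite normr0 expr0n/= mulr0 /bilin !mul0mx mxE.
  exfalso; apply: S0; exists (`|v|^-1 *: v).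
  by rewrite /S/= normrZ normfV normr_id mulVf// normr_eq0.
have cS : compact S.
  apply: bounded_closed_compact.
    exists 1; split; first exact: num_real.
    by move=> x x1 v /= ->; exact: ltW.
  have -> : S = (fun v : 'rV[R]_n => `|v|) @^-1` [set 1] by [].
  apply: closed_comp => [v _|]; [exact: norm_continuous|exact: closed_eq].
have cb : {within S, continuous (fun v => bilin A v v)}.
  apply: continuous_subspaceT => v; exact: bilin_cont.
have [c cS1 Hc] := EVT_min_rV S0 cS cb.
move: cS1; rewrite inE => c1.
exists (bilin A c c).
  by apply: pA; rewrite -normr_gt0 c1.
move=> v; have [->|v0] := eqVneq v 0.
  by rewrite normr0 expr0n/= mulr0 /bilin !mul0mx mxE.
have := Hc (`|v|^-1 *: v); rewrite inE /S/= normrZ normfV normr_id mulVf ?normr_eq0// => /(_ erefl).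
rewrite bilinZl bilinZr mulrA -expr2 exprVn ler_pdivlMl ?exprn_gt0 ?normr_gt0//.
by rewrite mulrC.
Qed.

Lemma good_ex u0 : cod i u0 -> exists r la k, good u0 r la k.
Proof.
move=> iu0; have oC := @cod_open _ _ M i.
have [r1 [k1 [r10 k10 H1]]] : exists r k, [/\ 0 < r, 0 <= k & forall ab : 'I_n * 'I_n,
    forall u, `|u - u0| < r -> [/\ cod i u, `|metric i u ab.1 ab.2| <= k &
    forall v, `|v - u0| < r -> `|metric i v ab.1 ab.2 - metric i u ab.1 ab.2| <= k * `|v - u|]].
  apply: fin_unif => [ab r r' k k' H /andP[r'0 r'r] kk' u ur|[a b]]; last first.
    exact: (loc_bound oC (@metric_smooth _ _ M i a b 1) iu0).
  have [Uu Du Dv] := H u (lt_le_trans ur r'r); split=> //; first exact: le_trans kk'.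
  by move=> v vr; apply: le_trans (Dv v (lt_le_trans vr r'r)) _; rewrite ler_wpM2r.
have [r2 [k2 [r20 k20 H2]]] : exists r k, [/\ 0 < r, 0 <= k & forall ab : 'I_n * 'I_n,
    forall u v, `|u - u0| < r -> `|v - u0| < r ->
    `|metric i v ab.1 ab.2 - metric i u ab.1 ab.2 - 'D_(v - u) (fun w => metric i w ab.1 ab.2) u| <= k * `|v - u| ^+ 2].
  apply: fin_unif => [ab r r' k k' H /andP[r'0 r'r] kk' u v ur vr|[a b]]; last first.
    exact: (loc_taylor oC (@metric_smooth _ _ M i a b 2) iu0).
  apply: le_trans (H u v (lt_le_trans ur r'r) (lt_le_trans vr r'r)) _.
  by rewrite ler_wpM2r ?exprn_ge0.
have [r3 [k3 [r30 k30 H3]]] : exists r k, [/\ 0 < r, 0 <= k & forall abc : 'I_n * 'I_n * 'I_n,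
    forall u, `|u - u0| < r -> [/\ cod i u, `|christoffel i u abc.2 abc.1.1 abc.1.2| <= k &
    forall v, `|v - u0| < r -> `|christoffel i v abc.2 abc.1.1 abc.1.2 - christoffel i u abc.2 abc.1.1 abc.1.2| <= k * `|v - u|]].
  apply: fin_unif => [ab r r' k k' H /andP[r'0 r'r] kk' u ur|[[a b] c]]; last first.
    exact: (loc_bound oC (@christoffel_Ck _ _ M i 1 c a b) iu0).
  have [Uu Du Dv] := H u (lt_le_trans ur r'r); split=> //; first exact: le_trans kk'.
  by move=> v vr; apply: le_trans (Dv v (lt_le_trans vr r'r)) _; rewrite ler_wpM2r.
have [la la0 Hla] := posdef_lower (fun v => @metric_pos _ _ M i u0 iu0 v).
pose N : R := (n * n)%:R; have N0 : 0 <= N by rewrite /N.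
pose k := N * (k1 + k2 + k3).
have k0 : 0 <= k by rewrite /k mulr_ge0// !addr_ge0.
have Nk1 : N * k1 <= k by rewrite /k ler_wpM2l//; lra.
have Nk2 : N * k2 <= k by rewrite /k ler_wpM2l//; lra.
have Nk3 : N * k3 <= k by rewrite /k ler_wpM2l//; lra.
(* The last bound keeps the variation of the metric below [la / 2], which leaves half of the
   ellipticity constant found at [u0]. *)
pose r := Num.min (Num.min r1 r2) (Num.min r3 (la / (2 * (k + 1)))).
have rP u : `|u - u0| < r -> [/\ `|u - u0| < r1, `|u - u0| < r2, `|u - u0| < r3 & `|u - u0| < la / (2 * (k + 1))].
  by rewrite /r !lt_min => /andP[/andP[-> ->] /andP[-> ->]].
have k21 : 0 < 2 * (k + 1) by rewrite mulr_gt0// ltr_wpDl.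
have dl0 : 0 < la / (2 * (k + 1)) by rewrite divr_gt0.
have lip u u' v w : `|u - u0| < r1 -> `|u' - u0| < r1 ->
    `|bilin (metric i u') v w - bilin (metric i u) v w| <= k * `|u' - u| * `|v| * `|w|.
  move=> ur u'r; rewrite -bilinBm.
  apply: (le_trans (@bilin_le _ _ _ _ _ (k1 * `|u' - u|) _)).
    by move=> a b; rewrite !mxE; have [_ _ ->] := H1 (a, b) u ur.
  by rewrite mulrA; do 3 apply: ler_wpM2r => //.
exists r, (la / 2), k; split=> //.
- by rewrite /r !lt_min r10 r20 r30.
- by rewrite divr_gt0.
(* The estimates are indexed by pairs of coordinates, of which there are none in dimension 0; there
   [u = u0]. *)
- move=> u /rP[ur _ _ _]; have [a _|n0] := pickP (fun _ : 'I_n => true).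
    by have [] := H1 (a, a) u ur.
  by have -> : u = u0 by apply/rowP => a; have := n0 a.
- move=> u v /rP[ur _ _ url].
  have r11 : `|u0 - u0| < r1 by rewrite subrr normr0.
  have := lip _ _ v v r11 ur; have := Hla v => h1 h2.
  have h3 : k * `|u - u0| * `|v| * `|v| <= la / 2 * `|v| ^+ 2.
    rewrite -mulrA -expr2 ler_wpM2r ?exprn_ge0//.
    have := normr_ge0 (u - u0); move: url; rewrite ltr_pdivlMr// => url u0'.
    by rewrite ler_pdivlMr//; nra.
  have := le_trans (ler_norm (- _)) (le_trans (_ : `|- (bilin (metric i u) v v - bilin (metric i u0) v v)| <= _) h3).
  rewrite normrN => /(_ h2); lra.
- move=> u v w /rP[ur _ _ _].
  apply: (le_trans (@bilin_le _ _ _ _ _ k1 _)).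
    by move=> a b; have [_ -> _] := H1 (a, b) u ur.
  by do 2 apply: ler_wpM2r => //.
- by move=> u u' v w /rP[ur _ _ _] /rP[u'r _ _ _]; exact: lip.
- move=> u u' v /rP[_ ur _ _] /rP[_ u'r _ _]; rewrite -!bilinBm.
  apply: (le_trans (@bilin_le _ _ _ _ _ (k2 * `|u' - u| ^+ 2) _)).
    by move=> a b; rewrite !mxE; exact: (H2 (a, b)).
  rewrite mulrA [`|v| ^+ 2]expr2 !mulrA; do 2 apply: ler_wpM2r => //.
  by do 2 apply: ler_wpM2r => //.
- move=> u v /rP[_ _ ur _]; apply: norm_rV_le; first by rewrite mulr_ge0 ?exprn_ge0.
  move=> a; rewrite mxE normrN.
  apply: (le_trans (@bilin_le _ _ _ _ _ k3 _)).
    by move=> b c; rewrite mxE; have [_ -> _] := H3 ((b, c), a) u ur.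
  by rewrite -mulrA -expr2 ler_wpM2r ?exprn_ge0.
- move=> u u' v v' /rP[_ _ ur _] /rP[_ _ u'r _].
  apply: norm_rV_le; first by rewrite mulr_ge0// addr_ge0 ?mulr_ge0 ?exprn_ge0// addr_ge0.
  move=> a; rewrite !mxE.
  set C' := \matrix_(p, q) christoffel i u' a p q; set C := \matrix_(p, q) christoffel i u a p q.
  have -> : - bilin C' v' v' - - bilin C v v =
     - (bilin (C' - C) v v + (bilin C' (v' - v) v + bilin C' v' (v' - v))).
    have id (x y z w : R) : - x - - y = - (z - y + (w - z + (x - w))) by ring.
    by rewrite bilinBm bilinBl bilinBr; exact: id.
  rewrite normrN mulrDr; apply: le_trans (ler_normD _ _) _; apply: lerD.
    apply: (le_trans (@bilin_le _ _ _ _ _ (k3 * `|u' - u|) _)).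
      by move=> b c; rewrite !mxE; have [_ _ ->] := H3 ((b, c), a) u ur.
    rewrite mulrA expr2 !mulrA; do 2 apply: ler_wpM2r => //.
    by apply: ler_wpM2r.
  have C'k b c : `|C' b c| <= k3 by rewrite mxE; have [_ ->] := H3 ((b, c), a) u' u'r.
  apply: le_trans (ler_normD _ _) _.
  rewrite mulrDr mulrDr; apply: lerD.
    apply: (le_trans (@bilin_le _ _ _ _ _ k3 C'k)).
    by rewrite mulrA; do 2 apply: ler_wpM2r => //.
  apply: (le_trans (@bilin_le _ _ _ _ _ k3 C'k)).
  by rewrite mulrA mulrAC; do 2 apply: ler_wpM2r => //.
Qed.

End Good.

(** * Geodesics in a chart *)

Section Picard.
Variables (R : realType) (n : nat).

Lemma expr2_small (C e : R) : 0 < e -> exists m : nat, C / 2 ^+ m < e.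
Proof.
move=> e0; have [m Hm] : exists m : nat, C / e < m%:R.
  by exists (Num.bound `|C / e|); apply: le_lt_trans (ler_norm _) _; exact: archi_boundP.
exists m; rewrite ltr_pdivrMr ?exprn_gt0//.
have : (m%:R : R) <= 2 ^+ m.
  by rewrite -natrX ler_nat; apply: ltnW; exact: ltn_expl.
move: Hm; rewrite ltr_pdivrMr// => Hm H; apply: lt_le_trans Hm _; by rewrite mulrC ler_wpM2l// ltW.
Qed.

(** Banach iteration started at 0. The contraction bounds are uniform in time, hence the limit is
    again continuous and bounded by [al]. *)
Lemma picard (al : R) (X : set (R -> 'rV[R]_n)) (Phi : (R -> 'rV[R]_n) -> R -> 'rV[R]_n) :
  X = [set a | continuous a /\ forall t, `|a t| <= al] -> 0 <= al ->
  (forall a, X a -> X (Phi a)) ->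
  (forall a b s, X a -> X b -> 0 <= s -> (forall t, `|a t - b t| <= s) ->
    forall t, `|Phi a t - Phi b t| <= s / 2) ->
  exists2 a, X a & forall t, Phi a t = a t.
Proof.
move=> XE al0 PX Pc.
pose u m := iter m Phi (fun=> 0).
have Xu m : X (u m).
  elim: m => [|m /PX//]; rewrite XE; split=> [t|t] /=; first exact: cvg_cst.
  by rewrite /u/= normr0.
have ub m t : `|u m t| <= al by have := Xu m; rewrite XE => -[].
have cauchy_u m p t : `|u (p + m)%N t - u m t| <= 2 * al / 2 ^+ m.
  elim: m t => [|m IH] t.
    by rewrite expr0 divr1 /u/= subr0 addn0 (le_trans (ub _ _))// ler_peMl// ler1n.
  rewrite addnS; have := Pc _ _ _ (Xu (p + m)%N) (Xu m) _ IH t.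
  rewrite exprS invfM [2^-1 * _]mulrC mulrA; apply.
  by rewrite divr_ge0 ?mulr_ge0// exprn_ge0.
have cauchy_u' m j t : (m <= j)%N -> `|u j t - u m t| <= 2 * al / 2 ^+ m.
  by move=> mj; rewrite -(subnK mj).
have cv t : cvg (u m t @[m --> \oo]).
  apply: cauchy_cvg; apply: cauchy_exP => e e0.
  have [m Hm] := expr2_small (2 * al) e0; exists (u m t).
  exists m => // j /= mj; rewrite -ball_normE/= distrC.
  exact: le_lt_trans (cauchy_u' _ _ _ mj) Hm.
pose a t := lim (u m t @[m --> \oo]).
have au t (e : R) : 0 < e -> exists N, forall j, (N <= j)%N -> `|a t - u j t| <= e.
  move=> e0; have /cvgrPdist_le/(_ _ e0)[N _ HN] := cv t.
  by exists N => j /HN.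
have aum m t : `|a t - u m t| <= 2 * al / 2 ^+ m.
  apply/ler_addgt0Pr => e e0; have [N HN] := au t e e0.
  rewrite -(subrKA (u (maxn N m) t)); apply: le_trans (ler_normD _ _) _.
  rewrite addrC lerD//; first by apply: cauchy_u'; rewrite leq_maxr.
  by apply: HN; rewrite leq_maxl.
have Xa : X a.
  rewrite XE; split=> [t|t].
    apply/cvgrPdist_le => e e0; have e3 : 0 < e / 3 by rewrite divr_gt0.
    have [m Hm] := expr2_small (2 * al) e3.
    have cu : continuous (u m) by have := Xu m; rewrite XE => -[].
    have /cvgrPdist_le/(_ _ e3) := cu t; apply: filterS => s Hs.
    have -> : a t - a s = (a t - u m t) + (u m t - u m s) - (a s - u m s).
      by rewrite opprB addrA subrKA subrK.
    have h1 := aum m t; have h2 := aum m s.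
    apply: le_trans (ler_normB _ _) _.
    have h3 := ler_normD (a t - u m t) (u m t - u m s).
    lra.
  apply/ler_addgt0Pr => e e0; have [N HN] := au t e e0.
  rewrite -[a t](subrK (u N t)); apply: le_trans (ler_normD _ _) _.
  by rewrite addrC lerD//; exact: HN.
exists a => // t; apply/eqP; rewrite -subr_eq0 -normr_le0.
apply/ler_addgt0Pr => e e0; rewrite add0r.
have [m Hm] := expr2_small (2 * al) e0.
rewrite -(subrKA (u m.+1 t)); apply: le_trans (ler_normD _ _) _.
have h1 := Pc _ _ _ Xa (Xu m) _ (aum m) t.
have h2 := aum m.+1 t.
rewrite distrC in h2.
have q : 2 * al / 2 ^+ m.+1 = 2 * al / 2 ^+ m / 2 by rewrite exprS invfM [2^-1 * _]mulrC mulrA.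
rewrite q in h2.
have q0 : 0 <= 2 * al / 2 ^+ m by rewrite divr_ge0 ?mulr_ge0// exprn_ge0.
have {}h1 := h1 q0; rewrite -/(u m.+1) in h1.
apply: le_trans (lerD h1 h2) _; lra.
Qed.

Lemma clamp_cont (b c : R) : continuous (fun t : R => Num.max b (Num.min c t)).
Proof.
move=> t; apply: continuous_max; first exact: cvg_cst.
by apply: continuous_min; [exact: cvg_cst|exact: cvg_id].
Qed.

Lemma clamp_in (b c t : R) : b <= c -> b <= Num.max b (Num.min c t) <= c.
Proof. by move=> bc; rewrite le_max lexx/= ge_max bc/= ge_min lexx. Qed.

Lemma clamp_id (b c t : R) : b <= t <= c -> Num.max b (Num.min c t) = t.
Proof. by move=> /andP[bt tc]; rewrite min_r// max_r. Qed.

Lemma is_derive_cvg (W : normedModType R) (f : R -> W) (t : R) (l : W) :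
  is_derive t (1 : R) f l -> f s @[s --> t] --> f t.
Proof. by move=> [/derivable1_diffP/differentiable_continuous]. Qed.

Lemma lin_bvp_scalar (a : R -> R) (p q : R) : continuous a ->
  exists y y1 : R -> R, [/\ y 0 = p, y 1 = q &
    forall t : R, -1 <= t <= 2 -> is_derive t (1 : R) y (y1 t) /\ is_derive t (1 : R) y1 (a t)].
Proof.
move=> ca; have [F [F0 dF]] := antideriv 4 ca.
(* The first primitive is controlled only on [(-4, 4)]; it is clamped to be integrated a second
   time, and [[-1, 2]] lies where the clamp is the identity. *)
pose cl (t : R) := Num.max (-3) (Num.min 3 t).
have clP t : -3 <= cl t <= 3 by apply: clamp_in; lra.
have cF : continuous (fun t => F (cl t)).
  move=> t; have cFt : F x @[x --> cl t] --> F (cl t).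
    apply: (@is_derive_cvg _ F (cl t) (a (cl t))); apply: dF; have /andP[c1 c2] := clP t.
    by apply/andP; split; lra.
  exact: (cvg_comp cl F (@clamp_cont (-3) 3 t) cFt).
have [G [G0 dG]] := antideriv 4 cF.
exists (fun t => p + (q - p - G 1) * t + G t), (fun t => q - p - G 1 + F t); split.
- by rewrite mulr0 G0 !addr0.
- by rewrite mulr1 addrA subrK addrCA subrr addr0.
- move=> t t12; split; last first.
    have := is_deriveD (is_derive_cst (q - p - G 1) t (1 : R)) (dF t _).
    by rewrite add0r; apply; lra.
  have := is_deriveD (is_deriveD (is_derive_cst p t (1 : R)) (is_derive_mulc (q - p - G 1) t)) (dG t _).
  rewrite add0r (_ : cl t = t); first by apply; lra.
  by apply: clamp_id; lra.
Qed.

Lemma lin_bvp (a : R -> 'rV[R]_n) (p q : 'rV[R]_n) : continuous a ->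
  exists y y1 : R -> 'rV[R]_n, [/\ y 0 = p, y 1 = q &
    forall t : R, -1 <= t <= 2 -> is_derive t (1 : R) y (y1 t) /\ is_derive t (1 : R) y1 (a t)].
Proof.
move=> ca; have caj j : continuous (fun t => a t 0 j).
  by move=> t; move/cvg_coord: (ca t); exact.
have /choice[Y HY] : forall j, exists yy : (R -> R) * (R -> R), [/\ yy.1 0 = p 0 j, yy.1 1 = q 0 j &
    forall t : R, -1 <= t <= 2 -> is_derive t (1 : R) yy.1 (yy.2 t) /\ is_derive t (1 : R) yy.2 (a t 0 j)].
  by move=> j; have [y [y1 H]] := lin_bvp_scalar (p 0 j) (q 0 j) (caj j); exists (y, y1).
exists (fun t => \row_j (Y j).1 t), (fun t => \row_j (Y j).2 t); split.
- by apply/rowP => j; rewrite mxE; have [] := HY j.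
- by apply/rowP => j; rewrite mxE; have [] := HY j.
- move=> t t12; split; apply/is_derive_coordP => j; have [_ _ /(_ t t12)[d1 d2]] := HY j.
    rewrite mxE (_ : (fun y => _) = (Y j).1)//; by apply/funext => s; rewrite mxE.
  by rewrite (_ : (fun y => _) = (Y j).2)//; apply/funext => s; rewrite mxE.
Qed.

(** At some [xi] in [[0, 1]] the derivative is exactly [y 1 - y 0]. Every time in [[-1, 2]] is
    within 2 of [xi] and within 2 of 0, which explains the two factors 2. *)
Lemma bvp_bound_scalar (y y1 b : R -> R) (s : R) :
  (forall t : R, -1 <= t <= 2 -> [/\ is_derive t (1 : R) y (y1 t), is_derive t (1 : R) y1 (b t) & `|b t| <= s]) ->
  forall t : R, -1 <= t <= 2 -> `|y1 t| <= `|y 1 - y 0| + 2 * s /\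
    `|y t - y 0| <= 2 * (`|y 1 - y 0| + 2 * s).
Proof.
move=> H.
have s0 : 0 <= s by have [|_ _] := H 0; [lra|exact: le_trans].
have [||xi] := @MVT_segment R y y1 0 1 ler01.
- by move=> x; rewrite in_itv/= => /andP[x0 x1]; have [] := H x; first lra.
- by apply: (@is_derive_within _ y y1) => t /andP[t0 t1]; have [] := H t; first lra.
rewrite in_itv/= subr0 mulr1 => /andP[xi0 xi1] Exi.
have lip a c : -1 <= a -> a <= c -> c <= 2 -> `|y1 c - y1 a| <= s * (c - a).
  move=> a1 ac c2; rewrite mulrBr.
  apply: (is_derive_lip (f' := b) (g := fun t => s * t) (g' := fun=> s) ac).
  - by move=> t /andP[t0 t1]; have [] := H t; first lra.
  - by move=> t _; exact: is_derive_mulc.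
  - by move=> t /andP[t0 t1]; have [] := H t; first lra.
have B t : -1 <= t <= 2 -> `|y1 t| <= `|y 1 - y 0| + 2 * s.
  move=> /andP[t1 t2]; rewrite Exi -[y1 t](subrKC (y1 xi)); apply: le_trans (ler_normD _ _) _.
  rewrite lerD2l; have [txi|xit] := leP t xi.
    have : -1 <= xi by lra. move=> xi1'.
    rewrite distrC; apply: (le_trans (lip t xi t1 txi _)); first lra.
    by rewrite mulrC ler_wpM2r//; lra.
  apply: (le_trans (lip xi t _ (ltW xit) t2)); first lra.
  by rewrite mulrC ler_wpM2r//; lra.
move=> t t12; split; first exact: B.
set C := `|y 1 - y 0| + 2 * s; have C0 : 0 <= C by rewrite /C addr_ge0// mulr_ge0.
have lip2 a c : -1 <= a -> a <= c -> c <= 2 -> `|y c - y a| <= C * (c - a).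
  move=> a1 ac c2; rewrite mulrBr.
  apply: (is_derive_lip (f' := y1) (g := fun t => C * t) (g' := fun=> C) ac).
  - by move=> x /andP[t0 t1]; have [] := H x; first lra.
  - by move=> x _; exact: is_derive_mulc.
  - by move=> x /andP[t0 t1]; apply: B; lra.
have [t0|t0] := leP t 0.
  rewrite distrC; apply: (le_trans (lip2 t 0 _ t0 _)); [lra|lra|].
  by rewrite mulrC ler_wpM2r//; lra.
apply: (le_trans (lip2 0 t _ (ltW t0) _)); [lra|lra|].
by rewrite mulrC ler_wpM2r//; lra.
Qed.

Lemma bvp_bound (y y1 b : R -> 'rV[R]_n) (s : R) :
  (forall t : R, -1 <= t <= 2 -> [/\ is_derive t (1 : R) y (y1 t), is_derive t (1 : R) y1 (b t) & `|b t| <= s]) ->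
  forall t : R, -1 <= t <= 2 -> `|y1 t| <= `|y 1 - y 0| + 2 * s /\
    `|y t - y 0| <= 2 * (`|y 1 - y 0| + 2 * s).
Proof.
move=> H t t12.
have s0 : 0 <= s by have [|_ _] := H 0; [lra|exact: le_trans].
have Hj j : `|y1 t 0 j| <= `|y 1 - y 0| + 2 * s /\ `|(y t - y 0) 0 j| <= 2 * (`|y 1 - y 0| + 2 * s).
  have := @bvp_bound_scalar (fun t => y t 0 j) (fun t => y1 t 0 j) (fun t => b t 0 j) s _ t t12.
  have h : `|y 1 0 j - y 0 0 j| <= `|y 1 - y 0|.
    by have := coord_norm_le (y 1 - y 0) j; rewrite !mxE.
  rewrite !mxE; case.
    move=> x x12; have [/is_derive_coordP d1 /is_derive_coordP d2 bs] := H x x12; split => //.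
    exact: le_trans (coord_norm_le _ _) bs.
  move=> h1 h2; split; [apply: le_trans h1 _|apply: le_trans h2 _]; lra.
split; apply: norm_rV_le; rewrite ?mulr_ge0 ?addr_ge0 ?mulr_ge0// => j; by have [] := Hj j.
Qed.

End Picard.

(** * The boundary value problem for geodesics *)

Section GeoSol.
Variables (R : realType) (n : nat) (M : riemannianManifold R n) (i : chart_index M).

Definition ode_on (I : set R) (c c1 : R -> 'rV[R]_n) : Prop := forall t, I t ->
  is_derive t (1 : R) c (c1 t) /\ is_derive t (1 : R) c1 (acc i (c t) (c1 t)).

(** The bounds by [V] keep the curve in a ball where [good] applies, and they single out the slow
    solution, the one that depends on its endpoints in a Lipschitz way. *)
Definition geo_sol (V : R) (p q : 'rV[R]_n) (c c1 : R -> 'rV[R]_n) : Prop :=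
  [/\ c 0 = p, c 1 = q, ode_on [set t | -1 <= t <= 2] c c1 &
      forall t : R, -1 <= t <= 2 -> `|c t - p| <= 2 * V /\ `|c1 t| <= V].

Lemma acc_cvg (T : Type) (F : set_system T) {FF : Filter F} (u v : T -> 'rV[R]_n) (u0 v0 : 'rV[R]_n) :
  cod i u0 -> u @ F --> u0 -> v @ F --> v0 -> acc i (u t) (v t) @[t --> F] --> acc i u0 v0.
Proof.
move=> iu cu cv.
have cj (w : T -> 'rV[R]_n) (w0 : 'rV[R]_n) j : w @ F --> w0 -> w t 0 j @[t --> F] --> w0 0 j.
  by move=> cw; exact: (cvg_comp w (fun M : 'rV[R]_n => M 0 j) cw (@coord_continuous _ _ _ 0 j w0)).
have cc j : acc i (u t) (v t) 0 j @[t --> F] --> acc i u0 v0 0 j.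
  rewrite mxE; under eq_cvg do rewrite mxE.
  apply: cvgN; apply: cvg_bilin; [move=> a b|by move=> a; exact: cj|by move=> a; exact: cj].
  rewrite mxE; under eq_cvg do rewrite mxE.
  have [+ _] := @christoffel_Ck _ _ M i 0 j a b => /(_ u0 iu) h.
  exact: (cvg_comp u _ cu h).
apply/cvgrPdist_le => e e0; near=> t.
apply: norm_rV_le; first exact: ltW.
move=> j; rewrite [X in `|X|]mxE [X in _ + X]mxE; move: j; near: t; apply: filter_forall => j.
exact: ((cvgrPdist_le _ _).1 (cc j)).
Unshelve. all: by end_near. Qed.

(** Bootstrap: if [c] and [c1] are of class [k], so are their derivatives [c1] and [acc c c1]. *)
Lemma geo_sol_Ck (c c1 : R -> 'rV[R]_n) (O : set R) k : open O ->
  (forall t, O t -> cod i (c t)) -> ode_on O c c1 -> Ck O k c /\ Ck O k c1.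
Proof.
move=> oO Oc ode.
elim: k => [|k [IH IH1]].
  by split; split=> // t /ode[d d1]; exact: is_derive_cvg.
have ca : Ck O k (fun t => acc i (c t) (c1 t)).
  apply/Ck_coord => // j.
  apply: (Ck_ext (f := fun t => -1 * \sum_a \sum_b christoffel i (c t) j a b * c1 t 0 a * c1 t 0 b)) => //.
    move=> t _; rewrite mxE bilinE mulN1r; congr (- _); apply: eq_bigr => a _; apply: eq_bigr => b _.
    by rewrite mxE.
  apply: Ck_mul => //; first exact: Ck_cst.
  apply: Ck_sum => // a _; apply: Ck_sum => // b _.
  have c1j l : Ck O k (fun t => c1 t 0 l) by move/Ck_coord: IH1; exact.
  apply: Ck_mul => //; apply: Ck_mul => //.
  exact: (Ck_comp (@cod_open _ _ M i) oO Oc (@christoffel_Ck _ _ M i k j a b) IH).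
split; apply: CkR_intro => //.
- by move=> t /ode[[]].
- by apply: (Ck_ext oO _ IH1) => t /ode[[_ ->]].
- by move=> t /ode[_ []].
- by apply: (Ck_ext oO _ ca) => t /ode[_ [_ ->]].
Qed.

Variables (u0 : 'rV[R]_n) (r la k : R).
Hypothesis G : good i u0 r la k.
Variable V : R.
Hypotheses (V0 : 0 < V) (V1 : V <= 1) (kV : k * V <= 1 / 16).

Let k0 : 0 <= k := good_k G.

Lemma acc_diff (u u' v v' : 'rV[R]_n) (a b : R) : `|u - u0| < r -> `|u' - u0| < r ->
  `|v| <= V -> `|v'| <= V -> `|u' - u| <= a -> `|v' - v| <= b ->
  `|acc i u' v' - acc i u v| <= (a + 2 * b) / 16.
Proof.
move=> ur u'r vV v'V ha hb; apply: le_trans (good_acc_lip G v v' ur u'r) _.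
have a0 : 0 <= a by exact: le_trans ha.
have b0 : 0 <= b by exact: le_trans hb.
have kVp : 0 <= k * V by rewrite mulr_ge0// ltW.
apply: (@le_trans _ _ (k * (a * V + b * (2 * V)))).
  rewrite ler_wpM2l// lerD// ler_pM//; rewrite ?exprn_ge0 ?addr_ge0//; last by lra.
  apply: (@le_trans _ _ (V * V)); first by rewrite expr2 ler_pM.
  by rewrite ler_piMr// ltW.
have -> : k * (a * V + b * (2 * V)) = k * V * (a + 2 * b) by ring.
have ab : 0 <= a + 2 * b by lra.
by apply: (le_trans (ler_wpM2r ab kV)); lra.
Qed.

(** The fixed point is sought among accelerations: [Phi a] is the acceleration demanded by the
    geodesic equation along the solution of [y'' = a] with ends [p] and [q]. If [a] is bounded by
    [V / 4], that solution has speed at most [V / 2 + 2 * (V / 4) = V]. *)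
Lemma geo_ex p q : `|p - u0| + 2 * V < r -> `|q - p| <= V / 2 ->
  exists c c1, geo_sol V p q c c1.
Proof.
move=> pr qp; have V0' := V0.
have /choice[Y HY] : forall a : R -> 'rV[R]_n, exists yy : (R -> 'rV[R]_n) * (R -> 'rV[R]_n),
    continuous a -> [/\ yy.1 0 = p, yy.1 1 = q &
    forall t : R, -1 <= t <= 2 -> is_derive t (1 : R) yy.1 (yy.2 t) /\ is_derive t (1 : R) yy.2 (a t)].
  move=> a; have [ca|nc] := pselect (continuous a); last by exists (fun=> 0, fun=> 0).
  by have [y [y1 H]] := lin_bvp p q ca; exists (y, y1).
pose cl (t : R) := Num.max (-1) (Num.min 2 t).
have clP t : -1 <= cl t <= 2 by apply: clamp_in; lra.
pose Phi a t := acc i ((Y a).1 (cl t)) ((Y a).2 (cl t)).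
pose X := [set a : R -> 'rV[R]_n | continuous a /\ forall t, `|a t| <= V / 4].
have bd a : X a -> forall t, -1 <= t <= 2 -> `|(Y a).2 t| <= V /\ `|(Y a).1 t - p| <= 2 * V.
  move=> [ca aV] t t12; have [y0 y1 dy] := HY a ca.
  have := @bvp_bound R n (Y a).1 (Y a).2 a (V / 4) _ t t12; rewrite y0 y1; case.
    by move=> s s12; have [d1 d2] := dy s s12; split.
  by move=> h1 h2; split; lra.
have inr a : X a -> forall t, -1 <= t <= 2 -> `|(Y a).1 t - u0| < r.
  move=> Xa t t12; have [_ h] := bd a Xa t t12.
  rewrite -(subrKA p); apply: le_lt_trans (ler_normD _ _) _; lra.
have [| |a b s Xa Xb s0 ab t|a Xa Ha] := @picard R n (V / 4) X Phi erefl.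
- by rewrite divr_ge0// ltW.
- move=> a Xa; have [ca aV] := Xa; split=> [t|t].
    have [_ _ dy] := HY a ca; have [d1 d2] := dy _ (clP t).
    apply: acc_cvg; first by apply: (good_cod G); exact: inr.
      exact: (cvg_comp cl (Y a).1 (@clamp_cont _ (-1) 2 t) (is_derive_cvg d1)).
    exact: (cvg_comp cl (Y a).2 (@clamp_cont _ (-1) 2 t) (is_derive_cvg d2)).
  have [h1 h2] := bd a Xa _ (clP t).
  apply: le_trans (good_acc G _ (inr a Xa _ (clP t))) _.
  apply: (@le_trans _ _ (k * (V * V))); first by rewrite ler_wpM2l// expr2 ler_pM.
  by rewrite mulrA; apply: (le_trans (ler_wpM2r (ltW V0) kV)); lra.
(* Both solutions have the same ends, so they differ by at most [4 s] in position and [2 s] in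
   velocity; [acc_diff] turns this into [(4 s + 4 s) / 16 = s / 2]. *)
- have [ca aV] := Xa; have [cb bV] := Xb.
  have [h1 h2] := bd a Xa _ (clP t); have [h3 h4] := bd b Xb _ (clP t).
  have [y0 y1 dy] := HY a ca; have [z0 z1 dz] := HY b cb.
  have := @bvp_bound R n (fun t => (Y a).1 t - (Y b).1 t) (fun t => (Y a).2 t - (Y b).2 t) (fun t => a t - b t) s _ _ (clP t).
  rewrite y0 y1 z0 z1 !subrr subr0 normr0 add0r; case.
    move=> x x12; have [d1 d2] := dy x x12; have [d3 d4] := dz x x12; split=> //; exact: is_deriveB.
  move=> e2 e1.
  apply: le_trans (acc_diff (inr b Xb _ (clP t)) (inr a Xa _ (clP t)) h3 h1 e1 e2) _; lra.
have [ca aV] := Xa; have [y0 y1 dy] := HY a ca.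
exists (Y a).1, (Y a).2; split=> //.
  move=> t t12; have [d1 d2] := dy t t12; split=> //.
  have := Ha t; rewrite /Phi (_ : cl t = t); last by rewrite /cl clamp_id.
  by move=> ->.
by move=> t t12; have [] := bd a Xa t t12.
Qed.

Lemma geo_in p q c c1 : `|p - u0| + 2 * V < r -> geo_sol V p q c c1 ->
  forall t : R, -1 <= t <= 2 -> `|c t - u0| < r.
Proof.
move=> pr [_ _ _ B] t t12; have [h _] := B t t12.
rewrite -(subrKA p); apply: le_lt_trans (ler_normD _ _) _; lra.
Qed.

(** If the accelerations differ by at most [s], then [bvp_bound] and [acc_diff] improve this to
    [5 d / 16 + s / 2]. Starting from the a priori bound and iterating leaves [d], whence [d + 2 d]
    for the velocities. *)
Lemma geo_dep p q c c1 p' q' c' c1' : `|p - u0| + 2 * V < r -> `|p' - u0| + 2 * V < r ->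
  geo_sol V p q c c1 -> geo_sol V p' q' c' c1' ->
  forall t : R, -1 <= t <= 2 -> `|c1 t - c1' t| <= 3 * (`|p - p'| + `|q - q'|).
Proof.
move=> pr pr' S S'; have V0' := V0; have inr := geo_in pr S; have inr' := geo_in pr' S'.
case: S => c0 c1E ode B; case: S' => c0' c1E' ode' B'.
set d := `|p - p'| + `|q - q'|.
have d0 : 0 <= d by rewrite addr_ge0.
pose A t := acc i (c t) (c1 t) - acc i (c' t) (c1' t).
have pq : `|(c 1 - c' 1) - (c 0 - c' 0)| <= d.
  by rewrite c0 c1E c0' c1E'; have := ler_normB (q - q') (p - p'); rewrite /d; lra.
have bnd s : 0 <= s -> (forall t : R, -1 <= t <= 2 -> `|A t| <= s) -> forall t : R, -1 <= t <= 2 ->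
    `|c1 t - c1' t| <= d + 2 * s /\ `|c t - c' t| <= d + 2 * (d + 2 * s).
  move=> s0 As t t12.
  have := @bvp_bound R n (fun t => c t - c' t) (fun t => c1 t - c1' t) A s _ t t12; case.
    by move=> x x12; have [d1 d2] := ode x x12; have [d3 d4] := ode' x x12; split; [exact: is_deriveB|exact: is_deriveB|exact: As].
  move=> h1 h2; split; first by apply: le_trans h1 _; lra.
  rewrite -[c t - c' t](subrKC (c 0 - c' 0)); apply: le_trans (ler_normD _ _) _.
  have h3 : `|c 0 - c' 0| <= d by rewrite c0 c0' /d lerDl.
  by apply: (le_trans (lerD h3 h2)); lra.
have Am m : forall t : R, -1 <= t <= 2 -> `|A t| <= d + V / 2 ^+ m.
  elim: m => [|m IH] t t12.
    rewrite expr0 divr1 /A; apply: le_trans (ler_normB _ _) _.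
    have h u v : `|u - u0| < r -> `|v| <= V -> `|acc i u v| <= V / 16.
      move=> ur vV; apply: le_trans (good_acc G _ ur) _.
      apply: (@le_trans _ _ (k * (V * V))); first by rewrite ler_wpM2l// expr2 ler_pM.
      by rewrite mulrA; apply: (le_trans (ler_wpM2r (ltW V0) kV)); lra.
    have [_ b1] := B t t12; have [_ b2] := B' t t12.
    by apply: (le_trans (lerD (h _ _ (inr t t12) b1) (h _ _ (inr' t t12) b2))); lra.
  have s0 : 0 <= d + V / 2 ^+ m by rewrite addr_ge0// divr_ge0 ?exprn_ge0// ltW.
  have [e1 e2] := bnd _ s0 IH t t12.
  have [_ b1] := B t t12; have [_ b2] := B' t t12.
  rewrite /A; apply: le_trans (acc_diff (inr' t t12) (inr t t12) b2 b1 e2 e1) _.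
  rewrite exprS invfM mulrCA [2^-1 * _]mulrC.
  have : 0 <= V / 2 ^+ m by rewrite divr_ge0 ?exprn_ge0// ltW.
  by move: (V / 2 ^+ m) => w; lra.
have Ad t : -1 <= t <= 2 -> `|A t| <= d.
  move=> t12; apply/ler_addgt0Pr => e e0; have [m Hm] := expr2_small V e0.
  by apply: le_trans (Am m t t12) _; rewrite lerD2l ltW.
by move=> t t12; have [h _] := bnd d d0 Ad t t12; apply: le_trans h _; lra.
Qed.

Lemma geo_energy p q c c1 : `|p - u0| + 2 * V < r -> geo_sol V p q c c1 ->
  forall t : R, -1 <= t <= 2 ->
  bilin (metric i (c t)) (c1 t) (c1 t) = bilin (metric i (c 0)) (c1 0) (c1 0).
Proof.
move=> pr S; have inr := geo_in pr S; case: S => c0 c1E ode B.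
pose e t := bilin (metric i (c t)) (c1 t) (c1 t).
have de (t : R) : -1 <= t <= 2 -> is_derive t (1 : R) e 0.
  move=> t12; have [d1 d2] := ode t t12; have ic := good_cod G (inr t t12).
  have := bilin_curve ic d1 d2 d2.
  rewrite [X in _ + X](bilin_sym _ _ (Defs.metric_sym ic)) acc_momentum//.
  by rewrite (_ : _ + _ + _ = 0)//; field.
have cst a b : -1 <= a -> a <= b -> b <= 2 -> e b = e a.
  move=> a1 ab b2; apply/eqP; rewrite -subr_eq0 -normr_le0.
  have := @is_derive_lip R e (fun=> 0) (fun=> 0) (fun=> 0) a b ab.
  rewrite subrr; apply.
  - by move=> t /andP[ta tb]; apply: de; lra.
  - by move=> t _; rewrite normr0.
move=> t /andP[t1 t2]; have [t0|t0] := leP t 0.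
  by apply/esym/cst => //; lra.
by apply: cst => //; lra.
Qed.

End GeoSol.

(** * Riemannian distance against coordinates *)

Section Charts.
Variables (R : realType) (n : nat) (M : riemannianManifold R n).

Lemma Ck_id (V : normedModType R) (U : set V) k : Ck U k (fun x : V => x).
Proof.
case: k => [|k]; (split; first by move=> x _; exact: cvg_id); first by [].
move=> v; split=> [x _|]; first exact: derivable_id.
rewrite (_ : (fun x : V => 'D_v (fun x => x) x) = fun=> v); first exact: Ck_cst.
by apply/funext => x; rewrite derive_id.
Qed.

Lemma norm_sub_cont (W : normedModType R) (w : W) : continuous (fun v : W => `|v - w|).
Proof. by move=> v; apply: cvg_norm; apply: cvgB; [exact: cvg_id|exact: cvg_cst]. Qed.

Lemma Ck_line m (O : set R) k (u w : 'rV[R]_m) : open O -> Ck O k (fun t : R => u + t *: w).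
Proof.
move=> oO; apply/Ck_coord => // j.
apply: (Ck_ext (f := fun t : R => u 0 j + t * w 0 j)) => //; first by move=> t _; rewrite !mxE.
apply: Ck_add => //; first exact: Ck_cst.
by apply: Ck_mul => //; [exact: Ck_id|exact: Ck_cst].
Qed.

Lemma smooth_map_chart (V : normedModType R) (O : set V) (i : chart_index M) (s : V -> 'rV[R]_n) :
  open O -> (forall k, Ck O k s) -> (forall t, O t -> cod i (s t)) ->
  smooth_map O (fun t => chart_inv i (s t)).
Proof.
move=> oO cs iO.
have cc t : O t -> (fun t => chart_inv i (s t)) @ t --> chart_inv i (s t).
  move=> Ot; have [c0 _] := cs 0%N.
  exact: (cvg_comp s (chart_inv i) (c0 t Ot) (chart_inv_continuous (iO t Ot))).
split=> // j k.
have oO' : open (O `&` (fun t => chart_inv i (s t)) @^-1` dom j).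
  by apply: open_preimage_within => //; exact: dom_open.
apply: (Ck_compv (@open_transition _ _ M i j) oO' (f := chart j \o chart_inv i) (g := s)).
- by move=> t [Ot jt]; split=> //; exact: iO.
- exact: transition_smooth.
- by apply: Ck_sub (cs k) => t [].
Qed.

Lemma speed_chart_curve (O : set R) (i : chart_index M) (s : R -> 'rV[R]_n) (t : R) l :
  open O -> (forall k, Ck O k s) -> (forall t, O t -> cod i (s t)) -> O t ->
  is_derive t (1 : R) s l ->
  speed (fun t => chart_inv i (s t)) t ^+ 2 = bilin (metric i (s t)) l l.
Proof.
move=> oO cs iO Ot [ds <-].
have sc := smooth_map_chart oO cs iO.
rewrite (speed_sqr oO sc Ot (chart_inv_dom (iO t Ot))) chart_invK; last exact: iO.
have -> // : velocity i (fun t => chart_inv i (s t)) t = 'D_1 s t.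
apply: near_eq_derive; have := open_nbhs_nbhs (conj oO Ot).
by apply: filterS => x Ox; rewrite /= chart_invK//; exact: iO.
Qed.

Lemma left_limit_ge0 (h : R -> R) (a t : R) : a < t -> h s @[s --> t] --> h t ->
  (forall s, a <= s < t -> 0 <= h s) -> 0 <= h t.
Proof.
move=> at_ ct H; rewrite leNgt; apply/negP => lt.
have ct' : h s @[s --> t^'-] --> h t by exact: cvg_at_left_filter.
near t^'- => s.
have : h s < 0 by near: s; exact: (cvgr_lt _ ct').
rewrite ltNge => /negP; apply; apply: H; apply/andP; split; near: s; last exact: nbhs_left_lt.
exact: nbhs_left_ge.
Unshelve. all: by end_near. Qed.

Section GoodChart.
Variables (i : chart_index M) (u0 : 'rV[R]_n) (r la k : R).
Hypothesis G : good i u0 r la k.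

Let C : R := (Num.sqrt la)^-1.

Lemma good_C_gt0 : 0 < C.
Proof. by rewrite invr_gt0 sqrtr_gt0; exact: (good_la G). Qed.

Lemma good_norm_le u v s : `|u - u0| < r -> 0 <= s -> s ^+ 2 = bilin (metric i u) v v -> `|v| <= C * s.
Proof.
move=> ur s0 sE; rewrite ler_pdivlMl ?sqrtr_gt0 ?(good_la G)//.
rewrite -(ler_pXn2r (n := 2)) ?nnegrE ?mulr_ge0 ?sqrtr_ge0//.
by rewrite exprMn sqr_sqrtr ?(ltW (good_la G))// sE; exact: (good_lower G v ur).
Qed.

Lemma good_le_norm u v s : `|u - u0| < r -> 0 <= s -> s ^+ 2 = bilin (metric i u) v v -> s <= Num.sqrt k * `|v|.
Proof.
move=> ur s0 sE; rewrite -(ler_pXn2r (n := 2)) ?nnegrE ?mulr_ge0 ?sqrtr_ge0//.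
rewrite exprMn sqr_sqrtr ?(good_k G)// sE expr2 mulrA.
by apply: le_trans (ler_norm _) _; exact: (good_upper G).
Qed.

Lemma good_ball_open m (s : R -> 'rV[R]_m) (w : 'rV[R]_m) (e : R) :
  continuous s -> open [set t : R | `|s t - w| < e].
Proof.
move=> cs; apply: (@open_comp _ _ (fun t => `|s t - w|) [set x : R | x < e]); last exact: open_lt.
move=> t _; apply: (cvg_comp (fun t => s t - w) _ _ (@norm_continuous _ _ _)).
by apply: cvgB; [exact: cs|exact: cvg_cst].
Qed.

Lemma chart_segment u v : `|u - u0| < r -> `|v - u0| < r ->
  exists2 l, pathl (chart_inv i u) (chart_inv i v) l & l <= Num.sqrt k * `|v - u|.
Proof.
move=> ur vr.
pose s (t : R) : 'rV[R]_n := u + t *: (v - u).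
pose O := [set t : R | `|s t - u0| < r].
have cs : continuous s by move=> t; apply: (is_derive_cvg (is_derive_line u (v - u) t)).
have oO : open O by exact: good_ball_open.
have cO : forall m, Ck O m s by move=> m; exact: Ck_line.
have iO t : O t -> cod i (s t) by exact: (good_cod G).
have O01 t : 0 <= t <= 1 -> O t by exact: segment_in_ball.
have sc := smooth_map_chart oO cO iO.
have so : smooth_on (fun t => chart_inv i (s t)) `[0, 1].
  by exists O; split=> // t; rewrite /= in_itv/=; exact: O01.
have [L [L0 dL _]] := length_primitive so.
exists (L 1 - L 0).
  by have := pathl_piece so dL; rewrite /s scale0r addr0 scale1r subrKC.
have := is_derive_mono ler01 dL (fun t _ => is_derive_mulc (Num.sqrt k * `|v - u|) t).
rewrite mulr1 mulr0 subr0; apply => t t01.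
have := speed_chart_curve oO cO iO (O01 t t01) (is_derive_line u (v - u) t).
exact: (good_le_norm (O01 t t01) (speed_ge0 _ _)).
Qed.

Lemma good_ball_closed (e : R) : e < r ->
  closed (chart_inv i @` [set u | `|u - u0| <= e]).
Proof.
move=> er; apply: (compact_closed (@manifold_hausdorff _ _ M)).
apply: continuous_compact.
  apply: continuous_in_subspaceT => u; rewrite inE/= => ue.
  by apply: chart_inv_continuous; apply: (good_cod G); exact: le_lt_trans ue er.
apply: bounded_closed_compact.
  exists (e + `|u0|); split; first exact: num_real.
  move=> x x1 v /= ve; apply: ltW; apply: le_lt_trans x1.
  by rewrite -[v](subrK u0); apply: le_trans (ler_normD _ _) _; rewrite lerD2r.
apply: (@closed_comp _ _ (fun v : 'rV[R]_n => `|v - u0|) [set x : R | x <= e]); last exact: closed_le.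
by move=> v _; exact: (@norm_sub_cont 'rV[R]_n u0 v).
Qed.

(** A curve must be shown not to leave the chart before its coordinates can be estimated; both are
    propagated together by [real_induction]. The coordinate displacement is at most [C] times the
    length travelled. *)
Lemma good_piece (c : R -> M) (L : R -> R) : smooth_on c `[0, 1] -> L 0 = 0 ->
  (forall t : R, 0 <= t <= 1 -> is_derive t (1 : R) L (speed c t)) ->
  dom i (c 0) -> `|chart i (c 0) - u0| + C * L 1 < r ->
  forall t : R, 0 <= t <= 1 -> dom i (c t) /\ `|chart i (c t) - chart i (c 0)| <= C * L t.
Proof.
move=> [U [oU sU sc]] L0 dL d0 H.
have sU' t : 0 <= t <= 1 -> U t by move=> t01; apply: sU; rewrite /= in_itv.
have Lm a b : 0 <= a -> a <= b -> b <= 1 -> L a <= L b.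
  move=> a0 ab b1; apply: (is_derive_ge0 ab (f := speed c)) => [t /andP[ta tb]|t _].
    by apply: dL; rewrite (le_trans a0 ta) (le_trans tb b1).
  exact: speed_ge0.
have C0 := good_C_gt0.
have inr t : 0 <= t <= 1 -> `|chart i (c t) - chart i (c 0)| <= C * L t -> `|chart i (c t) - u0| < r.
  move=> /andP[t0 t1] h; rewrite -(subrKA (chart i (c 0))).
  apply: le_lt_trans (ler_normD _ _) _; apply: le_lt_trans H; rewrite addrC lerD2l.
  by apply: le_trans h _; rewrite ler_wpM2l ?(ltW C0)// Lm.
apply: (@real_induction R _ 0 1 ler01).
- by split=> //; rewrite subrr normr0 L0 mulr0.
- move=> t /andP[t0 t1] /(_ t); rewrite t0 lexx => /(_ isT)[dt ht].
  have t01 : 0 <= t <= 1 by rewrite t0 ltW.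
  have Ut := sU' t t01.
  have ct : (chart i \o c) s @[s --> t] --> chart i (c t).
    by have [+ _] := smooth_map_Ck sc i 0; apply.
  have n1 : \forall s \near t, U s /\ dom i (c s).
    by apply: open_nbhs_nbhs; split=> //; exact: (smooth_map_open oU sc).
  have n2 : \forall s \near t, `|chart i (c s) - u0| < r.
    apply: (ct [set v | `|v - u0| < r]); apply: open_nbhs_nbhs; split; last exact: inr.
    apply: (@open_comp _ _ (fun v : 'rV[R]_n => `|v - u0|) [set x : R | x < r]); last exact: open_lt.
    move=> v _; exact: (@norm_sub_cont 'rV[R]_n u0 v).
  have [e e0 He] : exists2 e : R, 0 < e & forall s : R, `|s - t| < e ->
    (U s /\ dom i (c s)) /\ `|chart i (c s) - u0| < r := nbhs_norm_ex (filterI n1 n2).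
  exists e => // s /andP[ts ste] s1.
  have near_s x : t <= x <= s -> [/\ U x, dom i (c x) & `|chart i (c x) - u0| < r].
    move=> /andP[tx xs]; have [|[? ?] ?] := He x; last by split.
    by rewrite ger0_norm ?subr_ge0//; lra.
  split; first by have [|] := near_s s; rewrite ?lexx ?(ltW ts).
  rewrite -(subrKA (chart i (c t))); apply: le_trans (ler_normD _ _) _.
  suff h : `|chart i (c s) - chart i (c t)| <= C * L s - C * L t.
    by apply: le_trans (lerD h ht) _; rewrite subrK.
  apply: norm_rV_le => [|j].
    by rewrite -mulrBr mulr_ge0 ?(ltW C0)// subr_ge0 Lm// ltW.
  rewrite !mxE.
  apply: (@is_derive_lip R (fun x => chart i (c x) 0 j) (fun x => velocity i c x 0 j)
    (fun x => C * L x) (fun x => C * speed c x) t s (ltW ts)).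
  + move=> x /near_s[Ux dx _].
    have := derivableP (smooth_map_derivable sc (v := 1) Ux dx) => /is_derive_coordP; exact.
  + move=> x /andP[tx xs].
    have := is_deriveZ C (dL x _); rewrite [_ *: speed c x]/(_ * _); apply.
    by rewrite (le_trans t0 tx) (le_trans xs s1).
  + move=> x /near_s[Ux dx xr]; apply: le_trans (coord_norm_le _ _) _.
    exact: (good_norm_le xr (speed_ge0 _ _) (speed_sqr oU sc Ux dx)).
- move=> t /andP[t0 t1] Ht.
  have t01 : 0 <= t <= 1 by rewrite t1 ltW.
  have Ut := sU' t t01.
  (* At a limit time the coordinates are not yet available. The image of a closed coordinate ball is
     compact, hence closed in the Hausdorff space [M], and it contains the curve just before [t]. *)
  have dt : dom i (c t).
    suff : (chart_inv i @` [set u | `|u - u0| <= `|chart i (c 0) - u0| + C * L 1]) (c t).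
      move=> [u /= ue <-]; apply: chart_inv_dom; apply: (good_cod G); exact: le_lt_trans ue H.
    have cc : c s @[s --> t^'-] --> c t.
      apply: cvg_within_filter; case: sc => + _; exact.
    apply: (@closed_cvg _ _ (t^'-) _ c _ (good_ball_closed H) _ _ cc).
    near=> s.
    have s0t : 0 <= s < t.
      by apply/andP; split; near: s; [exact: nbhs_left_ge|exact: nbhs_left_lt].
    have [ds hs] := Ht s s0t.
    exists (chart i (c s)); last by rewrite chartK.
    rewrite /= -(subrKA (chart i (c 0))); apply: le_trans (ler_normD _ _) _.
    rewrite addrC lerD2l; apply: le_trans hs _; rewrite ler_wpM2l ?(ltW C0)//.
    by case/andP: s0t => s0 st; apply: Lm => //; lra.
  split=> //; rewrite -subr_ge0.
  apply: (@left_limit_ge0 (fun t => C * L t - `|chart i (c t) - chart i (c 0)|) 0 t t0).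
    apply: cvgB; first by apply: cvgMl_tmp; apply: is_derive_cvg; exact: dL.
    apply: cvg_norm; apply: cvgB; last exact: cvg_cst.
    by have [+ _] := smooth_map_Ck sc i 0; apply.
  by move=> s s0t; rewrite subr_ge0; have [] := Ht s s0t.
Unshelve. all: by end_near. Qed.

Lemma good_stay x y l : pathl x y l -> dom i x -> `|chart i x - u0| + C * l < r ->
  dom i y /\ `|chart i y - chart i x| <= C * l.
Proof.
have C0 := good_C_gt0.
elim/pathl_ind => [z dz _|c L {}y {}l sc L0 dL pl IH d0 H].
  by rewrite subrr normr0 mulr0.
have l0 := pathl_ge0 pl.
have H1 : `|chart i (c 0) - u0| + C * L 1 < r.
  by apply: le_lt_trans H; rewrite lerD2l ler_wpM2l ?(ltW C0)// lerDl.
have [|d1 h1] := @good_piece c L sc L0 dL d0 H1 1; first by rewrite lexx ler01.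
have h2 : `|chart i (c 1) - u0| <= `|chart i (c 0) - u0| + C * L 1.
  by rewrite -(subrKA (chart i (c 0))); apply: le_trans (ler_normD _ _) _; rewrite addrC lerD2l.
have [|dy h3] := IH d1.
  by apply: le_lt_trans H; rewrite mulrDr addrA lerD2r.
split=> //; rewrite -(subrKA (chart i (c 1))); apply: le_trans (ler_normD _ _) _.
by rewrite mulrDr addrC lerD.
Qed.

End GoodChart.

Lemma near_dist (x : M) (e : R) : 0 < e -> \forall y \near x, conn x y /\ dist x y < e.
Proof.
move=> e0; pose i := chart_at x; have ix : dom i x := chart_atP x.
have [r [la [k G]]] := good_ex (chart_cod ix).
pose d := Num.min r (e / (Num.sqrt k + 1)).
have k1 : 0 < Num.sqrt k + 1 by rewrite ltr_wpDl ?sqrtr_ge0.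
have d0 : 0 < d by rewrite lt_min (good_r G) divr_gt0.
have n1 : \forall y \near x, dom i y.
  by apply: open_nbhs_nbhs; split=> //; exact: dom_open.
have n2 : \forall y \near x, `|chart i y - chart i x| < d.
  have ci : chart i y @[y --> x] --> chart i x := chart_continuous ix.
  apply: (ci [set v | `|v - chart i x| < d]).
  exact: (ex_nbhs_norm d0).
apply: filterS (filterI n1 n2) => y [iy]; rewrite /d lt_min => /andP[yr ye].
have xr : `|chart i x - chart i x| < r by rewrite subrr normr0 (good_r G).
have [l] := chart_segment G xr yr; rewrite !chartK// => pl lk.
split; first by exists l.
apply: le_lt_trans (dist_le_path pl) _; apply: le_lt_trans lk _.
move: ye; rewrite ltr_pdivlMr// mulrDr mulr1 mulrC => ye.
by apply: le_lt_trans ye; rewrite lerDl.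
Qed.

(** A short path cannot leave a small coordinate ball. Together with [near_dist], this identifies
    the topology of the manifold with that of the distance. *)
Lemma dist_near (x : M) (N : set M) : nbhs x N ->
  exists2 e : R, 0 < e & forall y, conn x y -> dist x y < e -> N y.
Proof.
move=> xN; pose i := chart_at x; have ix : dom i x := chart_atP x.
have [r [la [k G]]] := good_ex (chart_cod ix).
have C0 := good_C_gt0 G; set C := (Num.sqrt la)^-1 in C0.
have [d d0 Hd] : exists2 d : R, 0 < d & forall u, `|u - chart i x| < d -> N (chart_inv i u).
  apply: nbhs_norm_ex; apply: (chart_inv_continuous (chart_cod ix)).
  by rewrite chartK.
exists (Num.min r d / C); first by rewrite divr_gt0// lt_min (good_r G).
move=> y xy; rewrite ltr_pdivlMr// => h.
have e0 : 0 < Num.min r d / C - dist x y by rewrite subr_gt0 ltr_pdivlMr.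
have [l pl] := dist_adherent xy e0; rewrite subrKC ltr_pdivlMr// mulrC lt_min => /andP[lr ld].
have [|iy hy] := good_stay G pl ix; first by rewrite subrr normr0 add0r.
by rewrite -(chartK iy); apply: Hd; exact: le_lt_trans hy ld.
Qed.

End Charts.

(** * Calibration of a coordinate geodesic *)

Section Calibration.
Variables (R : realType) (n : nat) (M : riemannianManifold R n) (i : chart_index M).

Definition dot (u v : 'rV[R]_n) : R := bilin 1%:M u v.

Lemma dotE u v : dot u v = \sum_j u 0 j * v 0 j.
Proof. by rewrite /dot /bilin mulmx1 mxE; apply: eq_bigr => j _; rewrite mxE. Qed.

Lemma dot_norm_ge u : `|u| ^+ 2 <= dot u u.
Proof.
have d0 : 0 <= dot u u by rewrite dotE sumr_ge0// => j _; rewrite -expr2 sqr_ge0.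
rewrite -[leRHS]sqr_sqrtr// ler_pXn2r ?nnegrE ?sqrtr_ge0//.
apply: norm_rV_le; first exact: sqrtr_ge0.
move=> j; rewrite -sqrtr_sqr ler_sqrt// dotE (bigD1 j)//= -expr2 lerDl.
by apply: sumr_ge0 => l _; rewrite -expr2 sqr_ge0.
Qed.

Let N : R := (n * n)%:R + 1.

Lemma dot_le u v : `|dot u v| <= N * `|u| * `|v|.
Proof.
apply: le_trans (@bilin_le R n 1%:M u v 1 _) _.
  by move=> a b; rewrite mxE; case: eqP => _; rewrite ?normr1 ?normr0.
by do 2 apply: ler_wpM2r => //; rewrite mulr1 /N lerDl.
Qed.

Lemma is_derive_compR (c : R -> 'rV[R]_n) (tau : R -> R) (t T : R) (v : 'rV[R]_n) :
  is_derive t (1 : R) tau T -> is_derive (tau t) (1 : R) c v ->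
  is_derive t (1 : R) (fun s => c (tau s)) (T *: v).
Proof.
move=> dt /is_derive_coordP dc; apply/is_derive_coordP => j.
by have := is_derive1_comp (dc j) dt; rewrite mxE mulrC.
Qed.

(** By [acc_momentum] the derivative of the metric along the curve cancels, and half of its
    derivative in the direction [eta] is left. *)
Lemma momentum_derive (c c1 : R -> 'rV[R]_n) (tau : R -> R) (t T : R) (eta : R -> 'rV[R]_n) eta' :
  cod i (c (tau t)) -> is_derive t (1 : R) tau T ->
  is_derive (tau t) (1 : R) c (c1 (tau t)) -> is_derive (tau t) (1 : R) c1 (acc i (c (tau t)) (c1 (tau t))) ->
  is_derive t (1 : R) eta eta' ->
  is_derive t (1 : R) (fun s => bilin (metric i (c (tau s))) (c1 (tau s)) (eta s))
    (T / 2 * bilin (dmet i (c (tau t)) (eta t)) (c1 (tau t)) (c1 (tau t)) +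
     bilin (metric i (c (tau t))) (c1 (tau t)) eta').
Proof.
move=> ic dt dc dc1 de.
have d1 := is_derive_compR dt dc; have d2 := is_derive_compR dt dc1.
have := bilin_curve (c := fun s => c (tau s)) ic d1 d2 de.
suff -> : bilin (dmet i (c (tau t)) (T *: c1 (tau t))) (c1 (tau t)) (eta t) =
   T * bilin (dmet i (c (tau t)) (c1 (tau t))) (c1 (tau t)) (eta t).
  rewrite bilinZl acc_momentum//.
  by rewrite (_ : T * _ + T * _ = T / 2 * bilin (dmet i (c (tau t)) (eta t)) (c1 (tau t)) (c1 (tau t)))//; ring.
rewrite !bilinE mulr_sumr; apply: eq_bigr => a _; rewrite mulr_sumr; apply: eq_bigr => b _.
rewrite !dmetE// !mulrA; do 2 congr (_ * _); rewrite mulr_sumr; apply: eq_bigr => l _.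
by rewrite mxE mulrA.
Qed.

Variables (u0 : 'rV[R]_n) (r la k : R).
Hypothesis G : good i u0 r la k.
(** Chosen so that [la = 4 A N^2], which lets the square in [|w|] dominate the cross terms in
    [calib_ineq]. *)
Let A : R := la / (4 * N ^+ 2).
Let C : R := (Num.sqrt la)^-1.

(** The bound [1 / 16] makes the boundary value problem a contraction, the next two make
    [calib_ineq] work, and the last one leaves room in the ball. *)
Record smallV (V : R) : Prop := SmallV {
  smallV_gt0 : 0 < V; smallV_le1 : V <= 1; smallV_k : k * V <= 1 / 16;
  smallV_A1 : k * V <= A * N / 4; smallV_A2 : k * V ^+ 2 <= A / 2; smallV_r : 4 * V < r }.

Lemma N_ge1 : 1 <= N. Proof. by rewrite /N lerDr. Qed.
Lemma A_gt0 : 0 < A.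
Proof. by rewrite /A divr_gt0 ?(good_la G)// mulr_gt0// exprn_gt0// (lt_le_trans _ N_ge1). Qed.

Lemma smallV_ex : exists V, smallV V.
Proof.
have A0 := A_gt0; have N1 := N_ge1; have r0 := good_r G; have k0 := good_k G.
have AN0 : 0 < A * N by rewrite mulr_gt0// (lt_le_trans _ N1).
pose V := Num.min (Num.min 1 (r / 8)) (Num.min (1 / 16 / (k + 1)) (Num.min (A * N / 4 / (k + 1)) (A / 2 / (k + 1)))).
have k10 : 0 < k + 1 by lra.
have V0 : 0 < V.
  by rewrite /V !lt_min ltr01 (divr_gt0 r0 (ltr0Sn R 7)) (divr_gt0 (divr_gt0 (@ltr01 R) (ltr0Sn R 15)) k10)
    (divr_gt0 (divr_gt0 AN0 (ltr0Sn R 3)) k10) (divr_gt0 (divr_gt0 A0 (ltr0Sn R 1)) k10).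
have h x : V <= x / (k + 1) -> k * V <= x.
  rewrite ler_pdivlMr// => h; apply: le_trans h; rewrite mulrDr mulr1 mulrC; lra.
have [V1 Vr V2 V3 V4] : [/\ V <= 1, V <= r / 8, V <= 1 / 16 / (k + 1), V <= A * N / 4 / (k + 1) & V <= A / 2 / (k + 1)].
  have : V <= V by [].
  by rewrite {2}/V !le_min => /andP[/andP[-> ->] /and3P[-> -> ->]].
exists V; split=> //; try exact: h; last by lra.
by rewrite expr2 mulrA; apply: le_trans (h _ V4); rewrite ler_piMr ?mulr_ge0// ltW.
Qed.

(** Here [u] is a point of the geodesic with velocity [v], [x] a moving point with velocity
    [T v + w], and [T] the rate at which time is run. The second summand in the bracket is the
    derivative of [calib]. Comparing the metric at [x] with that at [u] leaves a quadratic form in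
    [|w|] and [T |x - u|]. *)
Lemma calib_ineq (V T b : R) (u x v w : 'rV[R]_n) : smallV V ->
  `|u - u0| < r -> `|x - u0| < r -> `|v| <= V -> 0 <= T -> `|b| <= 1 ->
  T * (T * bilin (metric i u) v v + (T * bilin (dmet i u (x - u)) v v + 2 * bilin (metric i u) v w
    - A * T * dot (x - u) (x - u) - 2 * A * b * dot (x - u) w)) <=
  bilin (metric i x) (T *: v + w) (T *: v + w).
Proof.
move=> [V0 V1 _ kV1 kV2 _] ur xr vV T0 b1.
have A0 := A_gt0; have N1 := N_ge1; have k0 := good_k G.
set eta := x - u.
have ix := good_cod G xr.
have laE : la = 4 * A * N ^+ 2.
  by rewrite /A; field; rewrite gt_eqF//; lra.
have -> : bilin (metric i x) (T *: v + w) (T *: v + w) =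
    T ^+ 2 * bilin (metric i x) v v + 2 * T * bilin (metric i x) v w + bilin (metric i x) w w.
  rewrite bilinDl !bilinDr !bilinZl !bilinZr [bilin _ w v](bilin_sym _ _ (Defs.metric_sym ix)); ring.
have h1 := good_lower G w xr.
have h2 : `|bilin (metric i x) v w - bilin (metric i u) v w| <= k * V * `|eta| * `|w|.
  apply: le_trans (good_lip G v w ur xr) _; rewrite -/eta.
  rewrite ler_wpM2r// -!mulrA ler_wpM2l// mulrC ler_wpM2r//.
have h3 : `|bilin (metric i x) v v - bilin (metric i u) v v - bilin (dmet i u eta) v v| <= k * V ^+ 2 * `|eta| ^+ 2.
  apply: le_trans (good_taylor G v ur xr) _; rewrite -/eta mulrAC.
  by rewrite ler_wpM2r ?exprn_ge0// ler_wpM2l// ler_pXn2r ?nnegrE// ltW.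
have h4 := dot_norm_ge eta.
have h5 := dot_le eta w.
move: h1 h2 h3 h4 h5 (normr_ge0 w) (normr_ge0 eta).
move: (bilin (metric i x) w w) (bilin (metric i x) v w) (bilin (metric i u) v w)
  (bilin (metric i x) v v) (bilin (metric i u) v v) (bilin (dmet i u eta) v v)
  (dot eta eta) (dot eta w) (`|w|) (`|eta|) => gww gxvw guvw gxvv guvv dd ee ew X Y.
rewrite !ler_norml => h1 /andP[h2 _] /andP[h3 _] h4 /andP[h5 h5'] X0 Y0.
have h6 : - (N * Y * X) <= b * ew.
  have : `|b * ew| <= N * Y * X.
    rewrite normrM; apply: le_trans (ler_wpM2r (normr_ge0 _) b1) _; rewrite mul1r.
    by rewrite ler_norml h5.
  by rewrite ler_norml => /andP[].
have Z0 : 0 <= T * Y by rewrite mulr_ge0.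
have e1 : T * - (k * V * Y * X) <= T * (gxvw - guvw) by rewrite ler_wpM2l.
have e2 : T ^+ 2 * - (k * V ^+ 2 * Y ^+ 2) <= T ^+ 2 * (gxvv - guvv - dd) by rewrite ler_wpM2l ?sqr_ge0.
have e3 : A * T ^+ 2 * Y ^+ 2 <= A * T ^+ 2 * ee by rewrite ler_wpM2l// mulr_ge0 ?sqr_ge0// ltW.
have e4 : 2 * A * T * - (N * Y * X) <= 2 * A * T * (b * ew) by apply: ler_wpM2l h6; exact: (mulr_ge0 (mulr_ge0 (ler0n _ 2) (ltW A0)) T0).
have e5 : k * V * (T * Y * X) <= A * N / 4 * (T * Y * X) by rewrite ler_wpM2r// mulr_ge0.
have e6 : k * V ^+ 2 * (T * Y) ^+ 2 <= A / 2 * (T * Y) ^+ 2 by rewrite ler_wpM2r ?sqr_ge0.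
(* The remaining form is [4 N^2 X^2 - (5 / 2) N X (T Y) + (1 / 2) (T Y)^2] up to the factor [A]; its
   square is completed. *)
have e7 : 0 <= A * ((2 * N * X - 5 / 8 * (T * Y)) ^+ 2 + 7 / 64 * (T * Y) ^+ 2).
  apply: (mulr_ge0 (ltW A0)); apply: addr_ge0; first exact: sqr_ge0.
  by apply: mulr_ge0; [rewrite divr_ge0|exact: sqr_ge0].
rewrite laE in h1.
rewrite -subr_ge0.
have -> : T ^+ 2 * gxvv + 2 * T * gxvw + gww -
  T * (T * guvv + (T * dd + 2 * guvw - A * T * ee - 2 * A * b * ew)) =
  (gww - 4 * A * N ^+ 2 * X ^+ 2) + 2 * (T * (gxvw - guvw) - T * - (k * V * Y * X)) +
  (T ^+ 2 * (gxvv - guvv - dd) - T ^+ 2 * - (k * V ^+ 2 * Y ^+ 2)) +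
  (A * T ^+ 2 * ee - A * T ^+ 2 * Y ^+ 2) + (2 * A * T * (b * ew) - 2 * A * T * - (N * Y * X)) +
  2 * (A * N / 4 * (T * Y * X) - k * V * (T * Y * X)) +
  (A / 2 * (T * Y) ^+ 2 - k * V ^+ 2 * (T * Y) ^+ 2) +
  A * ((2 * N * X - 5 / 8 * (T * Y)) ^+ 2 + 7 / 64 * (T * Y) ^+ 2).
  by field.
lra.
Qed.

Variable V : R.
Hypothesis sV : smallV V.
Variables (p q : 'rV[R]_n) (c c1 : R -> 'rV[R]_n).
Hypotheses (pr : `|p - u0| + 2 * V < r) (S : geo_sol i V p q c c1).

Let E := bilin (metric i (c 0)) (c1 0) (c1 0).

(** It vanishes on the geodesic. The first term pairs the momentum with the displacement; the time
    derivative of the second supplies the negative square that compensates the second-order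
    variation of the metric. The parameter [a] is left free for the equality case. *)
Definition calib (a t : R) (x : 'rV[R]_n) : R :=
  2 * bilin (metric i (c t)) (c1 t) (x - c t) - A * (t - a) * dot (x - c t) (x - c t).

Lemma calib_derive (a t T : R) (tau : R -> R) (s : R -> 'rV[R]_n) (s' : 'rV[R]_n) :
  -1 <= tau t <= 2 -> is_derive t (1 : R) tau T -> is_derive t (1 : R) s s' ->
  is_derive t (1 : R) (fun y => calib a (tau y) (s y))
  (let u := c (tau t) in let v := c1 (tau t) in let w := s' - T *: v in let eta := s t - u in
   T * bilin (dmet i u eta) v v + 2 * bilin (metric i u) v w - A * T * dot eta eta
   - 2 * A * (tau t - a) * dot eta w).
Proof.
move=> t12 dt ds; have := S => -[_ _ ode _]; have [dc dc1] := ode _ t12.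
have ic := good_cod G (geo_in pr S t12).
have deta := is_deriveB ds (is_derive_compR dt dc).
have dm := momentum_derive ic dt dc dc1 deta.
have d2 := is_deriveZ 2 dm.
have dd : is_derive t (1 : R) (fun y => dot (s y - c (tau y)) (s y - c (tau y)))
   (2 * dot (s t - c (tau t)) (s' - T *: c1 (tau t))).
  have := deta => /is_derive_coordP dj.
  rewrite (_ : (fun y => _) = fun y => \sum_j (s y - c (tau y)) 0 j * (s y - c (tau y)) 0 j); last first.
    by apply/funext => y; rewrite dotE.
  rewrite dotE mulr_sumr; apply: is_derive_bigsum => j.
  have := is_deriveM' (dj j) (dj j).
  by rewrite (_ : _ + _ = 2 * ((s t - c (tau t)) 0 j * (s' - T *: c1 (tau t)) 0 j))//; ring.
have da : is_derive t (1 : R) (fun y => A * (tau y - a)) (A * T).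
  have := is_deriveZ A (is_deriveB dt (is_derive_cst a t (1 : R))).
  by rewrite subr0.
have := is_deriveB d2 (is_deriveM' da dd).
rewrite [_ *: (_ + _)]/(_ * (_ + _)) /=.
move=> H; rewrite (_ : _ - _ - _ = 2 * (T / 2 * bilin (dmet i (c (tau t)) (s t - c (tau t))) (c1 (tau t)) (c1 (tau t)) +
        bilin (metric i (c (tau t))) (c1 (tau t)) (s' - T *: c1 (tau t))) -
   (A * T * dot (s t - c (tau t)) (s t - c (tau t)) +
    A * (tau t - a) * (2 * dot (s t - c (tau t)) (s' - T *: c1 (tau t)))))//.
by field.
Qed.

(** Time is run at [ka] times the arc length, so the rate in [calib_ineq] is [ka * speed]. Dividing
    by the speed and integrating along the piece gives the bound. *)
Lemma calib_piece (cc : R -> M) (L : R -> R) (a ka t0 : R) : smooth_on cc `[0, 1] -> L 0 = 0 ->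
  (forall t : R, 0 <= t <= 1 -> is_derive t (1 : R) L (speed cc t)) ->
  dom i (cc 0) -> `|chart i (cc 0) - u0| + C * L 1 < r ->
  1 / 4 <= a <= 1 -> 0 < ka -> 0 <= t0 -> t0 + ka * L 1 <= 5 / 4 ->
  E * ka * L 1 + calib a (t0 + ka * L 1) (chart i (cc 1)) - calib a t0 (chart i (cc 0)) <= L 1 / ka.
Proof.
move=> sc L0 dL d0 H a1 ka0 t00 t1.
have P := good_piece G sc L0 dL d0 H.
have [U [oU sU scc]] := sc.
have sU' t : 0 <= t <= 1 -> U t by move=> t01; apply: sU; rewrite /= in_itv.
have Lm t t' : 0 <= t -> t <= t' -> t' <= 1 -> L t <= L t'.
  move=> a0 ab b1; apply: (is_derive_ge0 ab (f := speed cc)) => [s /andP[sa sb]|s _].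
    by apply: dL; rewrite (le_trans a0 sa) (le_trans sb b1).
  exact: speed_ge0.
have C0 := good_C_gt0 G.
pose tau t := t0 + ka * L t.
pose s t := chart i (cc t).
have tauP t : 0 <= t <= 1 -> 0 <= tau t <= 5 / 4.
  move=> /andP[t0' t1']; have h1 := Lm 0 t (lexx 0) t0' t1'; have h2 := Lm t 1 t0' t1' (lexx 1).
  rewrite L0 in h1; apply/andP; split; first by rewrite /tau addr_ge0// mulr_ge0// ltW.
  by apply: le_trans t1; rewrite lerD2l ler_wpM2l// ltW.
have tauP' t : 0 <= t <= 1 -> -1 <= tau t <= 2 by move=> /tauP; lra.
have xr t : 0 <= t <= 1 -> `|s t - u0| < r.
  move=> t01; have [_ h] := P t t01; rewrite -(subrKA (s 0)).
  apply: le_lt_trans (ler_normD _ _) _; apply: le_lt_trans H; rewrite addrC lerD2l.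
  apply: le_trans h _; rewrite ler_wpM2l ?(ltW C0)//.
  by case/andP: t01 => t0' t1'; exact: Lm.
have ds (t : R) : 0 <= t <= 1 -> is_derive t (1 : R) s (velocity i cc t).
  move=> t01; have [dt _] := P t t01; apply: derivableP.
  exact: (smooth_map_derivable scc (v := 1) (sU' t t01) dt).
have dtau (t : R) : 0 <= t <= 1 -> is_derive t (1 : R) tau (ka * speed cc t).
  move=> t01; have := is_deriveD (is_derive_cst t0 t (1 : R)) (is_deriveZ ka (dL t t01)).
  by rewrite add0r.
have dW (t : R) (t01 : 0 <= t <= 1) := calib_derive a (tauP' t t01) (dtau t t01) (ds t t01).
pose D t := let u := c (tau t) in let v := c1 (tau t) in let w := velocity i cc t - (ka * speed cc t) *: v in
  let eta := s t - u in
   (ka * speed cc t) * bilin (dmet i u eta) v v + 2 * bilin (metric i u) v w - A * (ka * speed cc t) * dot eta eta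
   - 2 * A * (tau t - a) * dot eta w.
have dh (t : R) : 0 <= t <= 1 -> is_derive t (1 : R)
   (fun t => (ka^-1 - E * ka) * L t - calib a (tau t) (s t)) ((ka^-1 - E * ka) * speed cc t - D t).
  move=> t01; exact: (is_deriveB (is_deriveZ (ka^-1 - E * ka) (dL t t01)) (dW t t01)).
have := is_derive_ge0 ler01 dh; rewrite L0 mulr0 sub0r.
have -> : tau 0 = t0 by rewrite /tau L0 mulr0 addr0.
move=> F; have {}F : - calib a t0 (s 0) <= (ka^-1 - E * ka) * L 1 - calib a (tau 1) (s 1).
  apply: F => t t01; rewrite subr_ge0.
  have [dt _] := P t t01.
  have sq := speed_sqr oU scc (sU' t t01) dt.
  have s0 := speed_ge0 cc t.
  have EE := geo_energy G pr S (tauP' t t01).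
  have [_ _ _ /(_ _ (tauP' t t01))[_ vV]] := S.
  have T0 : 0 <= ka * speed cc t by rewrite mulr_ge0// ltW.
  (* Time stays in [[0, 5 / 4]] and [a] in [[1 / 4, 1]]; these ranges are chosen to make the
     difference at most 1. *)
  have b1 : `|tau t - a| <= 1 by rewrite ler_norml; have := tauP t t01; lra.
  have := calib_ineq (velocity i cc t - (ka * speed cc t) *: c1 (tau t)) sV (geo_in pr S (tauP' t t01)) (xr t t01) vV T0 b1.
  rewrite subrKC -/(s t) -sq EE -/E -/(D t).
  (* Where the speed vanishes it cannot be divided out, but there the velocity and [D t] vanish
     too. *)
  have [s_eq0|s_neq0] := eqVneq (speed cc t) 0.
    have v0 : velocity i cc t = 0.
      have := good_norm_le G (xr t t01) s0 sq; rewrite s_eq0 mulr0 normr_le0 => /eqP; exact.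
    move=> _; rewrite /D s_eq0 v0 !mulr0 scale0r subrr /dot.
    by rewrite /bilin linear0 !mulmx0 !mxE !mulr0 !mul0r !subr0 addr0.
  have s_gt0 : 0 < speed cc t by rewrite lt_neqAle eq_sym s_neq0.
  move=> H1.
  have : ka * (ka * speed cc t * E + D t) <= speed cc t.
    rewrite -(ler_pM2r s_gt0) -expr2; apply: le_trans H1.
    by rewrite le_eqVlt; apply/orP; left; apply/eqP; ring.
  rewrite -ler_pdivlMl// mulrBl => h; lra.
by move: F; rewrite /tau /s mulrBl; lra.
Qed.

Lemma calib_pathl (x y : M) (l a ka t0 : R) : pathl x y l -> dom i x ->
  `|chart i x - u0| + C * l < r ->
  1 / 4 <= a <= 1 -> 0 < ka -> 0 <= t0 -> t0 + ka * l <= 5 / 4 ->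
  E * ka * l + calib a (t0 + ka * l) (chart i y) - calib a t0 (chart i x) <= l / ka.
Proof.
move=> pl + + a1 ka0; have C0 := good_C_gt0 G.
elim/pathl_ind: pl t0 => [z t0 _ _ _ _|cc L {}y {}l sc L0 dL pl IH t0 d0 H t00 t1].
  by rewrite !mulr0 addr0 add0r subrr mul0r.
have l0 := pathl_ge0 pl.
have L10 : 0 <= L 1 by rewrite -L0; exact: primitive_ge0 dL.
have H1 : `|chart i (cc 0) - u0| + C * L 1 < r.
  by apply: le_lt_trans H; rewrite lerD2l ler_wpM2l ?(ltW C0)// lerDl.
have t1' : t0 + ka * L 1 <= 5 / 4.
  by apply: le_trans t1; rewrite lerD2l ler_wpM2l ?(ltW ka0)// lerDl.
have F1 := calib_piece sc L0 dL d0 H1 a1 ka0 t00 t1'.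
have [|d1 h1] := good_piece G sc L0 dL d0 H1 (t := 1); first by rewrite lexx ler01.
have h2 : `|chart i (cc 1) - u0| <= `|chart i (cc 0) - u0| + C * L 1.
  by rewrite -(subrKA (chart i (cc 0))); apply: le_trans (ler_normD _ _) _; rewrite addrC lerD2l.
have := IH (t0 + ka * L 1) d1; rewrite -addrA -mulrDr => F2.
have {}F2 := F2 (le_lt_trans (lerD h2 (lexx _)) _).
have {F2} : E * ka * l + calib a (t0 + ka * (L 1 + l)) (chart i y) - calib a (t0 + ka * L 1) (chart i (cc 1)) <= l / ka.
  apply: F2 => //; first by rewrite -addrA -mulrDr.
  by rewrite addr_ge0// mulr_ge0// ltW.
rewrite mulrDr [(L 1 + l) / ka]mulrDl; lra.
Qed.

Lemma calib_cvg (a t : R) (x : 'rV[R]_n) : -1 <= t <= 2 -> calib a s x @[s --> t] --> calib a t x.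
Proof.
move=> t12.
have dt : is_derive t (1 : R) (fun y : R => y) 1 by exact: is_derive_id.
exact: (is_derive_cvg (calib_derive a (tau := fun y => y) t12 dt (is_derive_cst x t (1 : R)))).
Qed.

Lemma good_stay_dist (x y : M) : conn x y -> dom i x -> `|chart i x - u0| + C * dist x y < r ->
  dom i y /\ `|chart i y - chart i x| <= C * dist x y.
Proof.
move=> xy dx H; have C0 := good_C_gt0 G.
have e0 : 0 < (r - `|chart i x - u0|) / C - dist x y by rewrite subr_gt0 ltr_pdivlMr//; lra.
have st l : pathl x y l -> l < (r - `|chart i x - u0|) / C -> dom i y /\ `|chart i y - chart i x| <= C * l.
  by move=> pl; rewrite ltr_pdivlMr// => h; apply: (good_stay G pl dx); rewrite /C in h *; lra.
have [l pl] := dist_adherent xy e0; rewrite subrKC => ll.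
split; first by have [] := st l pl ll.
apply/ler_addgt0Pr => e ep.
have e'0 : 0 < Num.min (e / C) ((r - `|chart i x - u0|) / C - dist x y) by rewrite lt_min e0 divr_gt0.
have [l' pl' ll'] := dist_adherent xy e'0.
have [|_ h] := st l' pl'; first by apply: lt_le_trans ll' _; rewrite -lerBrDl ge_min lexx orbT.
apply: le_trans h _; apply: (@le_trans _ _ (C * (dist x y + e / C))).
  by rewrite ler_wpM2l ?(ltW C0)//; apply: le_trans (ltW ll') _; rewrite lerD2l ge_min lexx.
by rewrite mulrDr mulrCA mulfV ?mulr1// gt_eqF.
Qed.

(** Paths nearly realizing the distance are slightly longer than it, so they overrun time 1; this is
    why the path version reaches [5 / 4]. Continuity of [calib] in time then gives the bound for the
    distance itself. *)
Lemma calib_dist (x y : M) (a ka t0 : R) : conn x y -> dom i x ->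
  `|chart i x - u0| + C * dist x y < r ->
  1 / 4 <= a <= 1 -> 0 < ka -> 0 <= t0 -> t0 + ka * dist x y <= 1 ->
  E * ka * dist x y + calib a (t0 + ka * dist x y) (chart i y) - calib a t0 (chart i x) <= dist x y / ka.
Proof.
move=> xy dx H a1 ka0 t00 t1; have C0 := good_C_gt0 G.
rewrite leNgt; apply/negP => lt.
pose F l := E * ka * l + calib a (t0 + ka * l) (chart i y) - calib a t0 (chart i x) - l / ka.
have d0 := dist_ge0 x y.
have cF : F l @[l --> dist x y] --> F (dist x y).
  apply: cvgB; last by apply: cvgMr_tmp; exact: cvg_id.
  apply: cvgB; last exact: cvg_cst.
  apply: cvgD; first by apply: cvgMl_tmp; exact: cvg_id.
  have aff : t0 + ka * l @[l --> dist x y] --> t0 + ka * dist x y.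
    by apply: cvgD; [exact: cvg_cst|apply: cvgMl_tmp].
  apply: (cvg_comp _ (fun s => calib a s (chart i y)) aff); apply: calib_cvg.
  by have := mulr_ge0 (ltW ka0) d0; lra.
have : 0 < F (dist x y) by rewrite /F subr_gt0.
move=> Fpos; have [e ep He] := nbhs_norm_ex (cvgr_gt _ cF _ Fpos).
pose e1 := Num.min e (Num.min ((r - `|chart i x - u0|) / C - dist x y) (ka^-1 / 4)).
have e10 : 0 < e1.
  rewrite /e1 !lt_min ep /= subr_gt0 ltr_pdivlMr// divr_gt0 ?invr_gt0// andbT; lra.
have [l pl ll] := dist_adherent xy e10.
have dl := dist_le_path pl.
have : 0 < F l.
  apply: He; rewrite ger0_norm ?subr_ge0// ltrBlDl; apply: lt_le_trans ll _.
  by rewrite lerD2l /e1 ge_min lexx.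
rewrite ltNge => /negP; apply; rewrite /F subr_le0; apply: calib_pathl => //.
  have : l < (r - `|chart i x - u0|) / C.
    by apply: lt_le_trans ll _; rewrite -lerBrDl /e1 !ge_min lexx !orbT.
  by rewrite ltr_pdivlMr// mulrC; lra.
have : ka * l <= ka * dist x y + 1 / 4.
  apply: (@le_trans _ _ (ka * (dist x y + ka^-1 / 4))).
    rewrite ler_wpM2l ?(ltW ka0)//; apply: le_trans (ltW ll) _.
    by rewrite lerD2l /e1 !ge_min lexx !orbT.
  by rewrite mulrDr mulrA mulfV ?gt_eqF.
lra.
Qed.

End Calibration.

(** * Local minimality, uniqueness and first variation *)

Section LocalGeodesic.
Variables (R : realType) (n : nat) (M : riemannianManifold R n) (i : chart_index M).

Lemma bilin0r (g : 'M[R]_n) u : bilin g u 0 = 0.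
Proof. by rewrite /bilin linear0 mulmx0 mxE. Qed.

Definition I12 : set R := [set t | -1 < t < 2].

Lemma I12_open : open I12.
Proof.
rewrite (_ : I12 = [set` `](-1 : R), (2 : R)[%R]); first exact: interval_open.
by apply/seteqP; split=> t /=; rewrite in_itv.
Qed.

Lemma geo_smooth (c c1 : R -> 'rV[R]_n) V p q : geo_sol i V p q c c1 ->
  (forall t : R, -1 <= t <= 2 -> cod i (c t)) -> forall m, Ck I12 m c /\ Ck I12 m c1.
Proof.
move=> [_ _ ode _] ic m; apply: geo_sol_Ck; first exact: I12_open.
  by move=> t /andP[t1 t2]; apply: ic; lra.
by move=> t /andP[t1 t2]; apply: ode => /=; lra.
Qed.

Section InGood.
Variables (u0 : 'rV[R]_n) (r la k : R).
Hypothesis G : good i u0 r la k.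
Variable V : R.
Hypothesis sV : smallV n r la k V.
Let C : R := (Num.sqrt la)^-1.
Variables (p q : M) (c c1 : R -> 'rV[R]_n).
Hypotheses (dp : dom i p) (dq : dom i q).
Hypothesis S : geo_sol i V (chart i p) (chart i q) c c1.
Hypothesis pr : `|chart i p - u0| + 2 * V < r.
Let D := dist p q.
Hypotheses (pq : conn p q) (pD : `|chart i p - u0| + C * D < r) (D0 : 0 < D).

Lemma geo_cod t : -1 <= t <= 2 -> cod i (c t).
Proof. by move=> t12; apply: (good_cod G); exact: (geo_in pr S). Qed.

(** The squared speed [E] is constant. At [p] and [q] the calibration vanishes, so [calib_dist] with
    [ka = 1 / D] reads [E <= D^2]; conversely [c] is a path of length [sqrt E] from [p] to [q]. *)
Lemma geo_lengthE t : -1 <= t <= 2 -> bilin (metric i (c t)) (c1 t) (c1 t) = D ^+ 2.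
Proof.
move=> t12; rewrite (geo_energy G pr S t12).
set E := bilin _ _ _.
have E0 : 0 <= E by apply: bilin_metric_ge0; apply: geo_cod; lra.
have [c0 cE1 ode _] := S.
apply/le_anti/andP; split.
  have D0' := D0.
  have a1 : 1 / 4 <= (1 / 2 : R) <= 1 by lra.
  have kD : 0 < D^-1 by rewrite invr_gt0.
  have := calib_dist G sV pr S pq dp pD a1 kD (lexx 0).
  rewrite add0r mulVf ?gt_eqF// lexx => /(_ isT).
  rewrite -/E -mulrA mulVf ?gt_eqF// mulr1 /calib -c0 -cE1 !subrr /dot !bilin0r.
  by rewrite !mulr0 !subr0 addr0 invrK -expr2.
have smo := geo_smooth S geo_cod.
have oI : open I12 := I12_open.
have iI t' : I12 t' -> cod i (c t').
  by move=> /andP[t1 t2]; apply: geo_cod; lra.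
have sc := smooth_map_chart oI (fun m => (smo m).1) iI.
have so : smooth_on (fun t => chart_inv i (c t)) `[0, 1].
  exists I12; split=> // s; rewrite /I12/= in_itv/= => /andP[s0 s1]; apply/andP; split; lra.
have pl : pathl (chart_inv i (c 0)) (chart_inv i (c 1)) (Num.sqrt E * 1 - Num.sqrt E * 0).
  apply: (pathl_piece (L := fun t => Num.sqrt E * t) so) => s s01.
  have s12 : -1 <= s <= 2 by lra.
  have Is : I12 s by rewrite /I12/=; apply/andP; split; lra.
  have [dc _] := ode s s12.
  have := speed_chart_curve oI (fun m => (smo m).1) iI Is dc.
  rewrite (geo_energy G pr S s12) -/E => sE.
  have -> : speed (fun t => chart_inv i (c t)) s = Num.sqrt E.
    by rewrite -sE sqrtr_sqr ger0_norm// speed_ge0.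
  exact: is_derive_mulc.
move: pl; rewrite c0 cE1 !chartK// mulr1 mulr0 subr0 => /dist_le_path h.
rewrite -[E]sqr_sqrtr//; rewrite ler_pXn2r ?nnegrE ?sqrtr_ge0//; exact: ltW.
Qed.

(** Applying [calib_dist] from [p] to [z] and from [z] to [q] shows that [calib a t z] is both
    nonpositive and nonnegative, for every admissible [a]. *)
Lemma geo_unique (z : M) (t : R) : 0 <= t <= 1 -> conn p z -> conn z q ->
  dist p z = t * D -> dist z q = (1 - t) * D -> z = chart_inv i (c t).
Proof.
move=> /andP[t0 t1] pz zq pzE zqE.
have D0' := D0; have [c0 cE1 ode _] := S.
have C0 : 0 < C := good_C_gt0 G.
have pz' : `|chart i p - u0| + C * dist p z < r.
  apply: le_lt_trans pD; rewrite lerD2l ler_wpM2l ?(ltW C0)// pzE.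
  by rewrite ler_piMl// ltW.
have [dz hz] := good_stay_dist G pz dp pz'.
have zq' : `|chart i z - u0| + C * dist z q < r.
  apply: le_lt_trans pD; rewrite -(subrKA (chart i p)) zqE.
  have := ler_normD (chart i z - chart i p) (chart i p - u0).
  rewrite pzE -/C in hz; have : C * (t * D) + C * ((1 - t) * D) = C * D by ring.
  lra.
have EE := geo_lengthE (t := 0) _; have {}EE := EE (_ : -1 <= 0 <= 2).
have {}EE : bilin (metric i (c 0)) (c1 0) (c1 0) = D ^+ 2 by apply: EE; lra.
have kD : 0 < D^-1 by rewrite invr_gt0.
have W0 a : 1 / 4 <= a <= 1 -> calib i la c c1 a t (chart i z) = 0.
  move=> a1.
  have tD : D^-1 * (t * D) = t by rewrite mulrCA mulVf ?mulr1// gt_eqF.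
  have := calib_dist G sV pr S pz dp pz' a1 kD (lexx 0).
  rewrite add0r pzE tD t1 EE invrK => /(_ isT) h1.
  have := calib_dist G sV pr S zq dz zq' a1 kD t0.
  have tD' : D^-1 * ((1 - t) * D) = 1 - t by rewrite mulrCA mulVf ?mulr1// gt_eqF.
  rewrite zqE tD' subrKC lexx EE invrK => /(_ isT) h2.
  have q0 : calib i la c c1 a 1 (chart i q) = 0.
    by rewrite /calib -cE1 !subrr /dot !bilin0r !mulr0 subr0.
  have p0 : calib i la c c1 a 0 (chart i p) = 0.
    by rewrite /calib -c0 !subrr /dot !bilin0r !mulr0 subr0.
  rewrite p0 subr0 in h1; rewrite q0 addr0 in h2.
  have e1 : D ^+ 2 * D^-1 * (t * D) = t * D * D by field; rewrite gt_eqF.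
  have e2 : D ^+ 2 * D^-1 * ((1 - t) * D) = (1 - t) * D * D by field; rewrite gt_eqF.
  rewrite e1 in h1; rewrite e2 in h2.
  lra.
(* Subtracting the identities for two values of [a] isolates the quadratic term, which must
   vanish. *)
have w1 := W0 (1 / 2); have {}w1 := w1 (_ : 1 / 4 <= 1 / 2 <= 1).
have w2 := W0 (1 / 3); have {}w2 := w2 (_ : 1 / 4 <= 1 / 3 <= 1).
have {}w1 : calib i la c c1 (1 / 2) t (chart i z) = 0 by apply: w1; lra.
have {}w2 : calib i la c c1 (1 / 3) t (chart i z) = 0 by apply: w2; lra.
have A0 := A_gt0 G.
have ee0 : dot (chart i z - c t) (chart i z - c t) = 0.
  apply/eqP; rewrite -[X in X == _]mulr1; apply/eqP.
  have : (la / (4 * ((n * n)%:R + 1) ^+ 2)) * dot (chart i z - c t) (chart i z - c t) = 0.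
    move: w1 w2; rewrite /calib; move: (la / _) (dot _ _) => x y; lra.
  by move=> /eqP; rewrite mulf_eq0 (gt_eqF A0)/= => /eqP ->; rewrite mul0r.
have : `|chart i z - c t| ^+ 2 <= 0 by rewrite -ee0; exact: dot_norm_ge.
rewrite exprn_even_le0//= normr_eq0 subr_eq0 => /eqP <-; by rewrite chartK.
Qed.

(** The curve [c t + t xi] joins [p] to [q']. Its squared speed is [D^2 + 2 m'] up to [4 k |xi|^2],
    where the geodesic equation makes [m'] the derivative of the momentum paired with [t xi];
    integration leaves only the boundary term. *)
Lemma geo_variation (q' : M) (xi : 'rV[R]_n) : dom i q' -> xi = chart i q' - chart i q ->
  `|chart i p - u0| + 2 * V + `|xi| < r ->
  dist p q' <= D + (2 * bilin (metric i (c 1)) (c1 1) xi + 4 * k * `|xi| ^+ 2) / (2 * D).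
Proof.
move=> dq' xiE rr; have D0' := D0; have k0 := good_k G.
have [c0 cE1 ode B] := S.
have V1 := smallV_le1 sV; have V0 := smallV_gt0 sV.
have smo := geo_smooth S geo_cod.
pose s (t : R) := c t + t *: xi.
have oI : open I12 := I12_open.
have I12le t : I12 t -> -1 <= t <= 2 by rewrite /I12/=; lra.
have csI m : Ck I12 m s.
  apply: Ck_add => //; first exact: (smo m).1.
  apply: (Ck_ext (f := fun t : R => 0 + t *: xi)) => //; first by move=> t _; rewrite add0r.
  exact: Ck_line.
pose O := I12 `&` s @^-1` [set x | `|x - u0| < r].
have oO : open O.
  apply: open_preimage_within => //.
    by move=> t It; have [+ _] := csI 0%N; exact.
  by apply: (@open_comp _ _ (fun v : 'rV[R]_n => `|v - u0|) [set x : R | x < r]) => [v _|];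
    [exact: (@norm_sub_cont _ _ u0 v)|exact: open_lt].
have iO t : O t -> cod i (s t) by move=> [_ h]; exact: (good_cod G).
have cO m : Ck O m s by apply: Ck_sub (csI m) => t [].
have O01 t : 0 <= t <= 1 -> O t.
  move=> t01; have t12 : -1 <= t <= 2 by lra.
  split; first by rewrite /I12/=; apply/andP; split; lra.
  rewrite /= /s; have [b1 _] := B t t12.
  have -> : c t + t *: xi - u0 = (c t - chart i p) + (chart i p - u0) + t *: xi.
    by rewrite subrKA addrAC.
  apply: le_lt_trans (ler_normD _ _) _.
  have := ler_normD (c t - chart i p) (chart i p - u0).
  have : `|t *: xi| <= `|xi|.
    by rewrite normrZ ler_piMl// ger0_norm; lra.
  by lra.
have sc := smooth_map_chart oO cO iO.
have so : smooth_on (fun t => chart_inv i (s t)) `[0, 1].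
  by exists O; split=> // t /=; rewrite in_itv/=; exact: O01.
have [L [L0 dL _]] := length_primitive so.
have pl := pathl_piece so dL.
have s0E : chart_inv i (s 0) = p by rewrite /s scale0r addr0 c0 chartK.
have s1E : chart_inv i (s 1) = q' by rewrite /s scale1r cE1 xiE subrKC chartK.
rewrite s0E s1E in pl; apply: le_trans (dist_le_path pl) _.
pose m t := bilin (metric i (c t)) (c1 t) (t *: xi).
pose m' t := bilin (dmet i (c t) (t *: xi)) (c1 t) (c1 t) / 2 + bilin (metric i (c t)) (c1 t) xi.
have dm (t : R) : 0 <= t <= 1 -> is_derive t (1 : R) m (m' t).
  move=> t01; have t12 : -1 <= t <= 2 by lra.
  have [dc dc1] := ode t t12.
  have dx : is_derive t (1 : R) (fun t : R => t *: xi) xi.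
    have := is_derive_line 0 xi t.
    by rewrite (_ : (fun s : R => 0 + s *: xi) = fun t : R => t *: xi)//; apply/funext => y; rewrite add0r.
  have := momentum_derive (tau := fun y : R => y) (geo_cod t12) (is_derive_id t 1) dc dc1 dx.
  by rewrite [1 / 2 * _]mulrC mul1r /m' mulrC.
pose F (t : R) := (D + 2 * k * `|xi| ^+ 2 / D) * t + D^-1 * m t.
have dF (t : R) : 0 <= t <= 1 -> is_derive t (1 : R) F ((D + 2 * k * `|xi| ^+ 2 / D) + D^-1 * m' t).
  by move=> t01; apply: is_deriveD; [exact: is_derive_mulc|exact: (is_deriveZ D^-1 (dm t t01))].
have := is_derive_mono ler01 dL dF.
have m0 : m 0 = 0 by rewrite /m scale0r bilin0r.
have m1 : m 1 = bilin (metric i (c 1)) (c1 1) xi by rewrite /m scale1r.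
rewrite /F m0 m1 !mulr0 addr0 subr0 mulr1 => h.
apply: le_trans (h _) _; last first.
  by rewrite le_eqVlt; apply/orP; left; apply/eqP; field; rewrite gt_eqF.
move=> t t01; have t12 : -1 <= t <= 2 by lra.
have [dc dc1] := ode t t12.
have ds : is_derive t (1 : R) s (c1 t + xi).
  have := is_deriveD dc (is_derive_line 0 xi t).
  by rewrite (_ : c + (fun s : R => 0 + s *: xi) = s)//; apply/funext => y; rewrite /s -[LHS]/(c y + (0 + y *: xi)) add0r.
have sp := speed_chart_curve oO cO iO (O01 t t01) ds.
have sp0 := speed_ge0 (fun t => chart_inv i (s t)) t.
move: sp sp0; set w := speed _ t => sp sp0.
have [_ /= sr] := O01 t t01.
have cr := geo_in pr S t12.
have [_ vV] := B t t12.
have ics := good_cod G sr.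
have eE := geo_lengthE t12.
have sE : s t - c t = t *: xi by rewrite /s addrAC subrr add0r.
have tx : `|t *: xi| <= `|xi| by rewrite normrZ ler_piMl// ger0_norm; lra.
have vle1 : `|c1 t| <= 1 by exact: le_trans vV V1.
have e1 : `|bilin (metric i (s t)) (c1 t) xi - bilin (metric i (c t)) (c1 t) xi| <= k * `|xi| ^+ 2.
  apply: le_trans (good_lip G _ _ cr sr) _; rewrite sE expr2 mulrA ler_wpM2r//.
  by rewrite -mulrA ler_wpM2l// -[leRHS]mulr1 ler_pM.
have e2 : `|bilin (metric i (s t)) (c1 t) (c1 t) - bilin (metric i (c t)) (c1 t) (c1 t) -
   bilin (dmet i (c t) (t *: xi)) (c1 t) (c1 t)| <= k * `|xi| ^+ 2.
  rewrite -sE; apply: le_trans (good_taylor G _ cr sr) _; rewrite sE -mulrA ler_wpM2l//.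
  rewrite -[leRHS]mulr1 ler_pM ?exprn_ge0// ?ler_pXn2r ?nnegrE//.
  by rewrite exprn_ile1.
have e3 : bilin (metric i (s t)) xi xi <= k * `|xi| ^+ 2.
  by apply: le_trans (ler_norm _) _; rewrite expr2 mulrA; exact: (good_upper G).
have spE : w ^+ 2 = bilin (metric i (s t)) (c1 t) (c1 t) + 2 * bilin (metric i (s t)) (c1 t) xi + bilin (metric i (s t)) xi xi.
  by rewrite sp bilinDl !bilinDr [bilin _ xi (c1 t)](bilin_sym _ _ (Defs.metric_sym ics)); ring.
move: e1 e2; rewrite !ler_norml => /andP[_ e1] /andP[_ e2].
rewrite eE in e2.
have bound : w ^+ 2 <= D ^+ 2 + 2 * m' t + 4 * k * `|xi| ^+ 2.
  rewrite spE /m'; move: e1 e2 e3.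
  have -> : 4 * k * `|xi| ^+ 2 = 4 * (k * `|xi| ^+ 2) by ring.
  move: (bilin (metric i (s t)) (c1 t) xi) (bilin (metric i (c t)) (c1 t) xi)
    (bilin (metric i (s t)) (c1 t) (c1 t)) (bilin (dmet i (c t) (t *: xi)) (c1 t) (c1 t))
    (bilin (metric i (s t)) xi xi) (k * `|xi| ^+ 2) (D ^+ 2) => a1 a2 a3 a4 a5 a6 a7 h1 h2 h3.
  lra.
(* The inequality [2 D w <= D^2 + w^2] bounds the speed by its square, avoiding the expansion of a
   square root. *)
have sq : 0 <= (w - D) ^+ 2 by exact: sqr_ge0.
rewrite -(ler_pM2l D0').
have -> : D * (D + 2 * k * `|xi| ^+ 2 / D + D^-1 * m' t) = D ^+ 2 + 2 * k * `|xi| ^+ 2 + m' t.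
  by field; rewrite gt_eqF.
have -> : D * w = (D ^+ 2 + w ^+ 2 - (w - D) ^+ 2) / 2 by field.
lra.
Qed.

End InGood.

Lemma vec_lip m (f f' : R -> 'rV[R]_m) (a b e : R) : a <= b -> 0 <= e ->
  (forall t : R, a <= t <= b -> is_derive t (1 : R) f (f' t) /\ `|f' t| <= e) ->
  `|f b - f a| <= e * (b - a).
Proof.
move=> ab e0 H; apply: norm_rV_le; first by rewrite mulr_ge0// subr_ge0.
move=> j; rewrite !mxE -/(GRing.scale _ _).
have := @is_derive_lip R (fun t => f t 0 j) (fun t => f' t 0 j) (fun t => e * t) (fun=> e) a b ab.
rewrite -mulrBr; apply.
- by move=> t tab; have [/is_derive_coordP d _] := H t tab.
- by move=> t _; exact: is_derive_mulc.
- by move=> t tab; have [_ h] := H t tab; exact: le_trans (coord_norm_le _ _) h.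
Qed.

Lemma vec_lip_abs m (f f' : R -> 'rV[R]_m) (a b s t e : R) : 0 <= e -> a <= s <= b -> a <= t <= b ->
  (forall t : R, a <= t <= b -> is_derive t (1 : R) f (f' t) /\ `|f' t| <= e) ->
  `|f t - f s| <= e * `|t - s|.
Proof.
move=> e0 sab tab H; have [st|ts] := leP s t.
  rewrite ger0_norm ?subr_ge0//; apply: vec_lip => // u ust; apply: H; lra.
have -> : `|t - s| = s - t by rewrite distrC ger0_norm// subr_ge0 ltW.
rewrite distrC; apply: (@vec_lip m f f') => //; first exact: ltW.
by move=> u ust; apply: H; lra.
Qed.

(** Integrating from [t0] twice, a bound [x] on the differences of positions and velocities improves
    to [3 x / 16], hence at least to [x / 2]; iteration leaves 0. *)
Lemma geo_ivp (u0 : 'rV[R]_n) (r la k V : R) (p q p' q' : 'rV[R]_n) (c c1 c' c1' : R -> 'rV[R]_n) (t0 : R) :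
  good i u0 r la k -> smallV n r la k V ->
  `|p - u0| + 2 * V < r -> `|p' - u0| + 2 * V < r ->
  geo_sol i V p q c c1 -> geo_sol i V p' q' c' c1' -> 0 <= t0 <= 1 ->
  c t0 = c' t0 -> c1 t0 = c1' t0 -> forall t : R, 0 <= t <= 1 -> c t = c' t.
Proof.
move=> G sV pr pr' S S' t01 e0 e1.
have V0 := smallV_gt0 sV; have V1 := smallV_le1 sV; have kV := smallV_k sV.
have inr := geo_in pr S; have inr' := geo_in pr' S'.
case: S => _ _ ode B; case: S' => _ _ ode' B'.
have E12 (t : R) : 0 <= t <= 1 -> -1 <= t <= 2 by move=> ?; lra.
have V2 m : 0 <= 2 * V / 2 ^+ m by rewrite divr_ge0 ?exprn_ge0// mulr_ge0// ltW.
have tt (t : R) : 0 <= t <= 1 -> `|t - t0| <= 1 by move=> ?; rewrite ler_norml; lra.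
have dd (t : R) : 0 <= t <= 1 -> is_derive t (1 : R) (fun t => c t - c' t) (c1 t - c1' t) /\
    is_derive t (1 : R) (fun t => c1 t - c1' t) (acc i (c t) (c1 t) - acc i (c' t) (c1' t)).
  move=> /E12 t12; have [d1 d2] := ode t t12; have [d3 d4] := ode' t t12.
  by split; exact: is_deriveB.
have from_t0 (f f' : R -> 'rV[R]_n) (e : R) : 0 <= e -> f t0 = 0 ->
    (forall t : R, 0 <= t <= 1 -> is_derive t (1 : R) f (f' t) /\ `|f' t| <= e) ->
    forall t : R, 0 <= t <= 1 -> `|f t| <= e.
  move=> e0' f0 H t t1; have := vec_lip_abs e0' t01 t1 H; rewrite f0 subr0 => h.
  by apply: le_trans h _; rewrite ler_piMr// tt.
have f0 : c t0 - c' t0 = 0 by rewrite e0 subrr.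
have f10 : c1 t0 - c1' t0 = 0 by rewrite e1 subrr.
have main m : forall t : R, 0 <= t <= 1 ->
    `|c t - c' t| <= 2 * V / 2 ^+ m /\ `|c1 t - c1' t| <= 2 * V / 2 ^+ m.
  elim: m => [|m IH].
    have b1 (t : R) : 0 <= t <= 1 -> `|c1 t - c1' t| <= 2 * V / 2 ^+ 0.
      move=> /E12 t12; have [_ h] := B t t12; have [_ h'] := B' t t12.
      by rewrite expr0 divr1; apply: le_trans (ler_normB _ _) _; lra.
    move=> t t1; split; last exact: b1.
    apply: (@from_t0 (fun t => c t - c' t) (fun t => c1 t - c1' t)) => // u u1.
    by split; [have [] := dd u u1|exact: b1].
  have b1 (t : R) : 0 <= t <= 1 -> `|c1 t - c1' t| <= 2 * V / 2 ^+ m.+1.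
    move=> t1; apply: (@from_t0 (fun t => c1 t - c1' t) (fun t => acc i (c t) (c1 t) - acc i (c' t) (c1' t))) => // u u1.
    split; first by have [] := dd u u1.
    have [i1 i2] := IH u u1; have u12 := E12 u u1; have [_ h] := B u u12; have [_ h'] := B' u u12.
    apply: le_trans (acc_diff G V0 V1 kV (inr' u u12) (inr u u12) h' h i1 i2) _.
    have -> : 2 * V / 2 ^+ m.+1 = 2 * V / 2 ^+ m / 2 by rewrite exprS [2 * 2 ^+ m]mulrC invfM mulrA.
    by have := V2 m; move: (2 * V / 2 ^+ m) => w; lra.
  move=> t t1; split; last exact: b1.
  apply: (@from_t0 (fun t => c t - c' t) (fun t => c1 t - c1' t)) => // u u1.
  by split; [have [] := dd u u1|exact: b1].
move=> t t1; apply/eqP; rewrite -subr_eq0 -normr_le0; apply/ler_addgt0Pr => e e0'.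
have [m Hm] := expr2_small (2 * V) e0'.
by rewrite add0r; have [h _] := main m t t1; apply: le_trans h _; exact: ltW.
Qed.

(* Near a point, [p] and [q] are joined by a coordinate geodesic [c] on [0, 1], of constant speed
   [dist p q]; it is defined on [-1, 2] so that it can be continued past both endpoints. *)
Record geo_ball (u0 : 'rV[R]_n) (de K V : R) : Prop := GeoBall {
  geo_ball_gt0 : 0 < de;
  geo_ball_K : 0 <= K;
  geo_ball_cod : forall u, `|u - u0| < de -> cod i u;
  geo_ball_ex : forall p q : M, dom i p -> dom i q -> `|chart i p - u0| < de -> `|chart i q - u0| < de ->
    conn p q /\ exists c c1, [/\ geo_sol i V (chart i p) (chart i q) c c1,
     (forall t : R, -1 <= t <= 2 -> cod i (c t)) & 0 < dist p q ->
     [/\ forall t : R, -1 <= t <= 2 -> bilin (metric i (c t)) (c1 t) (c1 t) = dist p q ^+ 2,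
      forall (z : M) (t : R), 0 <= t <= 1 -> conn p z -> conn z q ->
        dist p z = t * dist p q -> dist z q = (1 - t) * dist p q -> z = chart_inv i (c t) &
      forall (q' : M) xi, dom i q' -> `|chart i q' - u0| < de -> xi = chart i q' - chart i q ->
        dist p q' <= dist p q +
          (2 * bilin (metric i (c 1)) (c1 1) xi + K * `|xi| ^+ 2) / (2 * dist p q)]];
  geo_ball_dep : forall p q c c1 p' q' c' c1', `|p - u0| < de -> `|p' - u0| < de ->
    geo_sol i V p q c c1 -> geo_sol i V p' q' c' c1' ->
    `|c1 1 - c1' 1| <= 3 * (`|p - p'| + `|q - q'|);
  geo_ball_ivp : forall p q c c1 p' q' c' c1' (t0 : R), `|p - u0| < de -> `|p' - u0| < de ->
    geo_sol i V p q c c1 -> geo_sol i V p' q' c' c1' -> 0 <= t0 <= 1 ->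
    c t0 = c' t0 -> c1 t0 = c1' t0 -> forall t : R, 0 <= t <= 1 -> c t = c' t }.

Lemma geo_ball_exists (u0 : 'rV[R]_n) : cod i u0 -> exists de K V : R, geo_ball u0 de K V.
Proof.
move=> iu0; have [r [la [k G]]] := good_ex iu0.
have [V sV] := smallV_ex G.
pose C : R := (Num.sqrt la)^-1.
have C0 : 0 < C := good_C_gt0 G.
have r0 := good_r G.
have V0 := smallV_gt0 sV; have V1 := smallV_le1 sV; have kV := smallV_k sV; have Vr := smallV_r sV.
have sk0 : 0 <= Num.sqrt k := sqrtr_ge0 _.
have q0 : 0 < 1 + 2 * C * Num.sqrt k.
  by rewrite ltr_pwDl// !mulr_ge0// ltW.
(* With [V / 4] two points of the ball are at most [V / 2] apart, as [geo_ex] requires; [r / 8]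
   leaves room for the solutions and the variation; the last term keeps the distance of the two
   points, multiplied by [C], inside the good ball. *)
pose de := Num.min (Num.min (V / 4) (r / 8)) (r / (2 * (1 + 2 * C * Num.sqrt k))).
have de0 : 0 < de by rewrite /de !lt_min !divr_gt0// mulr_gt0.
have [d1 d2 d3] : [/\ de <= V / 4, de <= r / 8 & de <= r / (2 * (1 + 2 * C * Num.sqrt k))].
  have : de <= de by []. by rewrite {2}/de !le_min => /andP[/andP[-> ->] ->].
have d4 : de + C * (Num.sqrt k * (2 * de)) < r.
  move: d3; rewrite ler_pdivlMr ?mulr_gt0// => h.
  have -> : de + C * (Num.sqrt k * (2 * de)) = de * (1 + 2 * C * Num.sqrt k) by ring.
  lra.
exists de, (4 * k), V; split=> //.
- by rewrite mulr_ge0// (good_k G).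
- by move=> u ud; apply: (good_cod G); lra.
- move=> p q dp dq pd qd.
  have pr : `|chart i p - u0| < r by lra.
  have qr : `|chart i q - u0| < r by lra.
  have qp : `|chart i q - chart i p| < 2 * de.
    rewrite -(subrKA u0); have := ler_normD (chart i q - u0) (u0 - chart i p).
    by rewrite [`|u0 - _|]distrC; lra.
  have [l] := chart_segment G pr qr; rewrite !chartK// => pl lk.
  have pq : conn p q by exists l.
  split=> //.
  have pr2 : `|chart i p - u0| + 2 * V < r by lra.
  have qpV : `|chart i q - chart i p| <= V / 2 by lra.
  have [c [c1 S]] := geo_ex G V0 V1 kV pr2 qpV.
  exists c, c1; split=> //; first by move=> t t12; exact: (geo_cod G S pr2).
  move=> D0.
  have Dle : dist p q <= Num.sqrt k * (2 * de).
    apply: le_trans (dist_le_path pl) _; apply: le_trans lk _.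
    by rewrite ler_wpM2l// ltW.
  have pD : `|chart i p - u0| + C * dist p q < r.
    apply: le_lt_trans d4; apply: lerD; first exact: ltW.
    by rewrite ler_wpM2l// ltW.
  split.
  + by move=> t t12; exact: (geo_lengthE G sV dp dq S pr2 pq pD D0 t12).
  + by move=> z t; exact: (geo_unique G sV dp dq S pr2 pq pD D0).
  + move=> q' xi dq' q'd xiE; apply: (geo_variation G sV dp dq S pr2 pq pD D0 dq' xiE); rewrite xiE.
    have := ler_normD (chart i q' - u0) (u0 - chart i q).
    by rewrite subrKA [`|u0 - _|]distrC; lra.
- move=> p q c c1 p' q' c' c1' pd p'd S S'.
  apply: (geo_dep G V0 V1 kV _ _ S S'); lra.
- move=> p q c c1 p' q' c' c1' t0 pd p'd S S'.
  apply: (geo_ivp G sV _ _ S S'); lra.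
Qed.

End LocalGeodesic.

(** * Minimizing curves *)

Section MetricGeodesic.
Variables (R : realType) (n : nat) (M : riemannianManifold R n).
Implicit Types x y z w : M.

Lemma dist_junk x y : ~ conn x y -> dist x y = 0.
Proof.
move=> nc; rewrite /dist /rdist (_ : [set L | _] = set0) ?ereal_inf0//.
apply/seteqP; split=> // L /= p; apply: nc.
by have [l _ lE] := pathl_fin p; exists l; rewrite /pathl -lE.
Qed.

Lemma dist_gt0_conn x y : 0 < dist x y -> conn x y.
Proof. by move=> d0; apply: contrapT => /dist_junk d; rewrite d ltxx in d0. Qed.

Lemma dist_lip x y z : conn x y -> conn y z -> `|dist x y - dist x z| <= dist y z.
Proof.
move=> xy yz; have xz := conn_trans xy yz.
have h1 := dist_tri xy yz; have h2 := dist_tri xz (conn_sym yz).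
by rewrite [dist z y]dist_sym in h2; rewrite ler_norml; lra.
Qed.

(** Off the component of [z] the value is 0 by default, and components are open by [near_dist], so
    continuity holds everywhere. *)
Lemma dist_cont z : continuous (dist z : M -> R).
Proof.
move=> x; apply/cvgrPdist_lt => e e0; near=> y.
have [xy d] : conn x y /\ dist x y < e by near: y; exact: near_dist.
have [zx|zx] := pselect (conn z x); first by apply: le_lt_trans d; exact: dist_lip.
rewrite !dist_junk// ?subrr ?normr0// => zy; apply: zx.
exact: conn_trans zy (conn_sym xy).
Unshelve. all: by end_near. Qed.

Lemma dist0_eq x y : conn x y -> dist x y = 0 -> x = y.
Proof.
move=> xy d0; apply: (@manifold_hausdorff _ _ M) => A B nA nB.
have [e e0 H] := dist_near nA; exists y; split; last exact: nbhs_singleton nB.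
by apply: H => //; rewrite d0.
Qed.

Lemma compact_ball m (u0 : 'rV[R]_m) (e : R) : compact [set u : 'rV[R]_m | `|u - u0| <= e].
Proof.
apply: bounded_closed_compact.
  exists (e + `|u0|); split=> [|N eN u /= ue]; first exact: num_real.
  rewrite -[u](subrK u0); apply: le_trans (ler_normD _ _) _.
  by apply: le_trans (ltW eN); rewrite lerD2r.
apply: (@closed_comp _ _ (fun u : 'rV[R]_m => `|u - u0|) [set t | t <= e]).
  by move=> u _; exact: norm_sub_cont.
exact: closed_le.
Qed.

Lemma chart_ball_compact i (u0 : 'rV[R]_n) (r e : R) : (forall u, `|u - u0| < r -> cod i u) -> e < r ->
  compact (@chart_inv _ _ M i @` [set u : 'rV[R]_n | `|u - u0| <= e]).
Proof.
move=> H er; apply: continuous_compact; last exact: compact_ball.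
apply: continuous_in_subspaceT => u; rewrite inE /= => ue.
apply: (@chart_inv_continuous _ _ M); apply: H; exact: le_lt_trans er.
Qed.

(** Every path from [x] to [y] crosses the sphere of small radius [rho] around [x], which is compact
    because it lies in a closed coordinate ball. A point of the sphere nearest to [y] does not
    lengthen the way. *)
Lemma one_step x y : conn x y -> 0 < dist x y ->
  exists z, [/\ 0 < dist x z < dist x y, conn z y & dist x z + dist z y = dist x y].
Proof.
move=> xy D0; set i := @chart_at _ _ M x.
have dx : dom i x by exact: chart_atP.
have [r [la [k G]]] := good_ex (chart_cod dx).
have r0 := good_r G.
pose C : R := (Num.sqrt la)^-1; have C0 : 0 < C := good_C_gt0 G.
pose rho := Num.min (dist x y / 2) (r / (2 * C)).
have rho0 : 0 < rho by rewrite lt_min (divr_gt0 D0)// divr_gt0// mulr_gt0.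
have rD : rho < dist x y.
  by apply: (@le_lt_trans _ _ (dist x y / 2)); [rewrite ge_min lexx|lra].
have rC : C * rho <= r / 2.
  have : rho <= r / (2 * C) by rewrite ge_min lexx orbT.
  rewrite ler_pdivlMr ?mulr_gt0// mulrCA mulrC => h; lra.
pose K := chart_inv i @` [set u : 'rV[R]_n | `|u - chart i x| <= r / 2].
have cK : compact K by apply: (chart_ball_compact (good_cod G)); lra.
have inK w : conn x w -> dist x w = rho -> K w.
  move=> xw dw; have h : `|chart i x - chart i x| + C * dist x w < r by rewrite subrr normr0 dw; lra.
  have [dw' cw] := good_stay_dist G xw dx h.
  exists (chart i w); last exact: chartK.
  by apply: le_trans cw _; rewrite dw.
pose S := K `&` [set w | dist x w = rho].
have cS : compact S.
  apply: compact_closedI => //.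
  by apply: (@closed_comp _ _ (dist x) [set t | t = rho]) => [w _|]; [exact: dist_cont|exact: closed_eq].
have cross l : pathl x y l -> exists w l2, [/\ S w, pathl w y l2 & rho + l2 <= l].
  move=> pl; have h : dist x x < rho <= dist x y by rewrite dist_refl rho0 ltW.
  have [w [l1 [l2 [ww p1 p2 <-]]]] := pathl_cross (@dist_cont x) pl h.
  exists w, l2; split=> //; first by split=> //; apply: inK => //; exists l1.
  by rewrite lerD2r -ww; exact: dist_le_path p1.
have [l0 pl0] := xy; have [w0 [_ [Sw0 _ _]]] := cross _ pl0.
have [w] := @compact_EVT_min M R (dist y) S (ex_intro _ w0 Sw0) cS (continuous_subspaceT (@dist_cont y)).
rewrite inE => Sw wmin; have dw : dist x w = rho by case: Sw.
have xw : conn x w by apply: dist_gt0_conn; rewrite dw.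
have wy := conn_trans (conn_sym xw) xy.
exists w; rewrite dw rho0 rD; split=> //; apply/eqP; rewrite eq_le; apply/andP; split; last first.
  by rewrite -dw; exact: dist_tri.
apply/ler_addgt0Pr => e e0; have [l pl lD] := dist_adherent xy e0.
have [v [l2 [Sv p2 h]]] := cross _ pl.
have := wmin v; rewrite inE => /(_ Sv); rewrite ![dist y _]dist_sym => h2.
have := dist_le_path p2; lra.
Qed.

Definition mgeo (L : R) (g : R -> M) : Prop := forall s t : R, 0 <= s <= L -> 0 <= t <= L ->
  conn (g s) (g t) /\ dist (g s) (g t) = `|s - t|.

(** Zorn's lemma gives a maximal set [S] of points between [x] and [y] on which the distance is the
    difference of the distances to [x]. Maximality, completeness and [one_step] show that these
    differences fill the whole interval, so [S] is the image of a minimizing curve. *)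
Lemma mgeo_ex x y : complete_manifold M -> conn x y ->
  exists g, [/\ mgeo (dist x y) g, g 0 = x & g (dist x y) = y].
Proof.
move=> cM xy; set D := dist x y.
pose B := [set z | conn x z /\ dist x z + dist z y = D].
pose F := [set S | S `<=` B /\ forall z w, S z -> S w -> dist z w = `|dist x z - dist x w|].
have [S [[SB Sd] maxS]] : exists S, F S /\ forall T, S `<` T -> ~ F T.
  apply: Zorn_bigcup => FF FFF tot; split=> [z [X FX Xz]|z w [X FX Xz] [Y FY Yw]].
    by have [h _] := FFF X FX; exact: h.
  have [XY|YX] := tot X Y FX FY.
    by have [_ h] := FFF Y FY; apply: h => //; exact: XY.
  by have [_ h] := FFF X FX; apply: h => //; exact: YX.
have add z : B z -> (forall w, S w -> dist z w = `|dist x z - dist x w|) -> S z.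
  move=> Bz dz; apply: contrapT => nz; apply: (maxS (S `|` [set z])).
    split; first by move=> w; left.
    by move=> h; apply: nz; apply: h; right.
  split=> [w [/SB//|->]//|w v [Sw|->] [Sv|->]]; first exact: Sd.
  - by rewrite dist_sym distrC; exact: dz.
  - exact: dz.
  - by rewrite dist_refl subrr normr0.
have Sc z w : S z -> S w -> conn z w.
  by move=> /SB[xz _] /SB[xw _]; exact: conn_trans (conn_sym xz) xw.
have Sx : S x.
  apply: add; first by split; [exact: conn_refl|rewrite dist_refl add0r].
  by move=> w Sw; rewrite dist_refl sub0r normrN ger0_norm// dist_ge0.
have Sy : S y.
  apply: add; first by split=> //; rewrite dist_refl addr0.
  move=> w /SB[_ h]; rewrite dist_sym ger0_norm -/D; first by rewrite -h addrAC subrr add0r.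
  by rewrite subr_ge0 -h lerDl dist_ge0.
(* Points of [S] whose distances to [x] converge form a Cauchy sequence; its limit can be added to
   [S], so it belongs to it. *)
have clos t : (forall e : R, 0 < e -> exists2 z, S z & `|dist x z - t| < e) -> exists2 z, S z & dist x z = t.
  move=> H.
  have H' (m : nat) : exists z, S z /\ `|dist x z - t| < m.+1%:R^-1.
    by have [|z Sz h] := H m.+1%:R^-1; [rewrite invr_gt0|exists z].
  have [u Hu] := choice H'.
  have small (e : R) : 0 < e -> exists N, forall p, (N <= p)%N -> `|dist x (u p) - t| < e.
    move=> e0; have [N _ HN] := near_infty_natSinv_lt (PosNum e0).
    by exists N => p Np; have [_ h] := Hu p; apply: lt_trans h _; exact: (HN p Np).
  have [z cz] : exists z, (fun p => rdist (u p) z) @ \oo --> 0%E.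
    apply: cM => e e0; have [|N HN] := small (e / 2); first lra.
    exists N => p q Np Nq; have [Sp _] := Hu p; have [Sq _] := Hu q.
    rewrite (rdistE (Sc _ _ Sp Sq)) lte_fin (Sd _ _ Sp Sq).
    have := HN p Np; have := HN q Nq; rewrite !ltr_norml; lra.
  have cz' (e : R) : 0 < e -> exists p, [/\ S (u p), conn (u p) z, dist (u p) z < e & `|dist x (u p) - t| < e].
    move=> e0; have [N HN] := small e e0.
    have [N' _ HN'] : \forall p \near \oo, (rdist (u p) z < e%:E)%E.
      by apply: (cz [set z | (z < e%:E)%E]); apply: open_ereal_lt'; rewrite lte_fin.
    exists (maxn N N'); have [Sp _] := Hu (maxn N N').
    have [] := rdist_lt (HN' _ (leq_maxr N N')); split=> //.
    exact/HN/leq_maxl.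
  have [p0 [Sp0 p0z _ _]] := cz' 1 ltr01.
  have xz : conn x z := conn_trans (Sc _ _ Sx Sp0) p0z.
  have dw w : S w -> dist z w = `|t - dist x w|.
    move=> Sw; apply/eqP; rewrite -subr_eq0 -normr_le0; apply/ler_addgt0Pr => e e0.
    have [|p [Sp pz h1 h2]] := cz' (e / 2); first lra.
    have := dist_lip (conn_sym (Sc _ _ Sp Sw)) pz; rewrite (dist_sym w) (dist_sym w) => h3.
    rewrite (Sd _ _ Sp Sw) in h3.
    have := ler_dist_dist (dist x (u p) - dist x w) (t - dist x w).
    rewrite opprB addrA subrK => h4.
    by move: h1 h2 h3 h4; rewrite !ler_norml; lra.
  have zt : dist x z = t.
    have t0 : 0 <= t.
      apply/ler_addgt0Pr => e e0; have [p [_ _ _]] := cz' e e0.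
      by rewrite ltr_norml; have := dist_ge0 x (u p); lra.
    by rewrite dist_sym dw// dist_refl subr0 ger0_norm.
  exists z => //; apply: add => [|w Sw]; last by rewrite zt dw.
  split=> //; rewrite zt dw//.
  have tD : t <= D.
    apply/ler_addgt0Pr => e e0; have [p [Sp _ _]] := cz' e e0; have [_ h] := SB _ Sp.
    by rewrite ltr_norml; have := dist_ge0 (u p) y; lra.
  by rewrite distrC ger0_norm -/D ?subr_ge0//; lra.
(* A missing value lies in a gap whose two ends are attained by the previous step; [one_step]
   between the corresponding points yields a point inside the gap that could be added to [S]. *)
have full t : 0 <= t <= D -> exists z, S z /\ dist x z = t.
  move=> /andP[t0 tD].
  pose A := [set s | exists2 z, S z & dist x z = s] `&` [set s | s <= t].
  pose A' := [set s | exists2 z, S z & dist x z = s] `&` [set s | t <= s].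
  have hA : has_sup A.
    by split; [exists 0; split=> //; exists x => //; exact: dist_refl|exists t => s []].
  have hA' : has_inf A'.
    by split; [exists D; split=> //; exists y|exists t => s []].
  have at_ : sup A <= t by apply: sup_le_ub; [case: hA|move=> s []].
  have bt : t <= inf A' by apply: lb_le_inf; [case: hA'|move=> s []].
  have [z Sz za] : exists2 z, S z & dist x z = sup A.
    apply: clos => e e0; have [s [[z Sz <-] st] h] := sup_adherent e0 hA.
    exists z => //; have := sup_upper_bound hA (conj (ex_intro2 _ _ z Sz erefl) st).
    by rewrite ltr_norml; lra.
  have [w Sw wb] : exists2 z, S z & dist x z = inf A'.
    apply: clos => e e0; have [s [[z' Sz' <-] st] h] := inf_adherent e0 hA'.
    exists z' => //; have := ge_inf hA'.2 (conj (ex_intro2 _ _ z' Sz' erefl) st).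
    by rewrite ltr_norml; lra.
  have [ab|ab] := ltP (sup A) (inf A'); last by exists z; split=> //; lra.
  exfalso.
  have zw := Sd _ _ Sz Sw; rewrite za wb distrC gtr0_norm ?subr_gt0// in zw.
  have [|v [vb vw vE]] := one_step (Sc _ _ Sz Sw); first by rewrite zw subr_gt0.
  have zv : conn z v by apply: dist_gt0_conn; lra.
  have [xz hz] := SB _ Sz; have [xw hw] := SB _ Sw.
  have wy : conn w y := Sc _ _ Sw Sy.
  have xv := conn_trans xz zv; have vy := conn_trans vw wy.
  have t1 := dist_tri xz zv; have t2 := dist_tri vw wy; have t3 := dist_tri xv vy; rewrite -/D in t3.
  have fv : dist x v = sup A + dist z v by lra.
  have Sv : S v.
    apply: add => [|s Ss]; first by split=> //; lra.
    have sz := Sc _ _ Ss Sz; have sv := conn_trans sz zv.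
    have lo : `|dist x v - dist x s| <= dist v s by apply: dist_lip => //; exact: conn_sym.
    apply/eqP; rewrite eq_le lo andbT.
    have [st|ts] := leP (dist x s) t.
      have := sup_upper_bound hA (conj (ex_intro2 _ _ s Ss erefl) st) => sA.
      have := dist_tri sz zv; rewrite (Sd _ _ Ss Sz) za fv (dist_sym s v) distrC => h.
      move: h; rewrite !ger0_norm; lra.
    have := ge_inf hA'.2 (conj (ex_intro2 _ _ s Ss erefl) (ltW ts)) => sA.
    have := dist_tri vw (Sc _ _ Sw Ss); rewrite (Sd _ _ Sw Ss) wb fv => h.
    move: h; rewrite distrC [`|_ + _ - _|]distrC !ger0_norm; lra.
  have [vt|tv] := leP (dist x v) t.
    have := sup_upper_bound hA (conj (ex_intro2 _ _ v Sv erefl) vt); lra.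
  have := ge_inf hA'.2 (conj (ex_intro2 _ _ v Sv erefl) (ltW tv)); lra.
have full' (t : R) : exists z : M, 0 <= t <= D -> S z /\ dist x z = t.
  have [tD|tD] := pselect (0 <= t <= D); last by exists x.
  by have [z] := full t tD; exists z.
have [g Hg] := choice full'.
have D0 : 0 <= D by exact: dist_ge0.
exists g; split=> [s t sD tD||].
- have [Ss hs] := Hg s sD; have [St ht] := Hg t tD; split; first exact: Sc.
  by rewrite Sd// hs ht.
- have [|S0 h] := Hg 0; first by rewrite lexx.
  by apply/esym/dist0_eq => //; exact: Sc.
- have [|S0 h] := Hg D; first by rewrite lexx andbT.
  apply: dist0_eq; first exact: Sc.
  by have [_] := SB _ S0; rewrite h; lra.
Qed.

Lemma mgeo_cat (L L' : R) (g g' : R -> M) : 0 <= L -> 0 <= L' -> mgeo L g -> mgeo L' g' ->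
  g L = g' 0 -> dist (g 0) (g' L') = L + L' ->
  mgeo (L + L') (fun t => if t <= L then g t else g' (t - L)).
Proof.
move=> L0 L'0 mg mg' e de.
have cross (s t : R) : 0 <= s <= L -> L < t <= L + L' -> conn (g s) (g' (t - L)) /\ dist (g s) (g' (t - L)) = t - s.
  move=> s1 t1; have L1 : 0 <= L <= L by rewrite L0 lexx.
  have L2 : 0 <= (0 : R) <= L' by rewrite lexx L'0.
  have L3 : 0 <= L' <= L' by rewrite lexx L'0.
  have L4 : 0 <= (0 : R) <= L by rewrite lexx L0.
  have t2 : 0 <= t - L <= L' by lra.
  have [c1 d1] := mg _ _ s1 L1; have [c2 d2] := mg' _ _ L2 t2; rewrite -e in c2 d2.
  have [c3 d3] := mg _ _ L4 s1; have [c4 d4] := mg' _ _ t2 L3.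
  have c := conn_trans c1 c2; split=> //.
  have h1 := dist_tri c1 c2; have h2 := dist_tri c3 (conn_trans c c4); have h3 := dist_tri c c4.
  rewrite d1 d2 in h1; rewrite de d3 in h2; rewrite d4 in h3; move: h1 h2 h3.
  by rewrite !sub0r !normrN [`|s - L|]distrC [`|t - L - L'|]distrC !ger0_norm; lra.
move=> s t sL tL; case: ifPn => h; case: ifPn => h'.
- by apply: mg; lra.
- rewrite -ltNge in h'; have [||c d] := cross s t; try lra.
  by split=> //; rewrite d distrC ger0_norm; lra.
- rewrite -ltNge in h; have [||c d] := cross t s; try lra.
  by split; [exact: conn_sym|rewrite dist_sym d ger0_norm; lra].
- rewrite -ltNge in h; rewrite -ltNge in h'.
  by have [||c d] := mg' (s - L) (t - L); try lra; split=> //; rewrite d opprB addrA subrK.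
Qed.

End MetricGeodesic.

(** * Smoothness and non-branching of minimizing curves *)

Section Geodesics.
Variables (R : realType) (n : nat) (M : riemannianManifold R n).
Implicit Types (x y : M) (g : R -> M) (L : R).

Lemma smooth_map_local (V : normedModType R) (U : set V) (f : V -> M) :
  (forall u, U u -> exists O h, [/\ open O, O u, smooth_map O h & forall v, O v -> f v = h v]) ->
  smooth_map U f.
Proof.
move=> H; split=> [u Uu|i k].
  have [B [h [oB Bu [ch _] e]]] := H u Uu; rewrite (e u Bu).
  apply: cvg_trans (ch u Bu); apply: near_eq_cvg.
  by apply: filterS (open_nbhs_nbhs (conj oB Bu)) => v Bv; rewrite e.
apply: Ck_local => u [Uu iu]; have [B [h [oB Bu [ch sh] e]]] := H u Uu.
have oB' : open (B `&` h @^-1` dom i) by apply: open_preimage_within => //; exact: dom_open.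
exists (B `&` h @^-1` dom i); split; first by split=> //=; rewrite -e.
by apply: Ck_ext (sh i k) => // v [Ov _] /=; rewrite e.
Qed.

Lemma mgeo_near L g (t0 : R) (N : set M) : mgeo L g -> 0 <= t0 <= L -> nbhs (g t0) N ->
  exists2 e : R, 0 < e & forall s : R, 0 <= s <= L -> `|s - t0| < e -> N (g s).
Proof.
move=> mg t0L /dist_near[e e0 H]; exists e => // s sL st; have [c d] := mg t0 s t0L sL.
by apply: H => //; rewrite d distrC.
Qed.

Lemma chart_near i x (de : R) : dom i x -> 0 < de ->
  nbhs x [set y | dom i y /\ `|@chart _ _ M i y - chart i x| < de].
Proof.
move=> ix de0; near=> y; split; near: y.
  by apply: open_nbhs_nbhs; split; [exact: dom_open|].
have /cvgrPdist_lt/(_ de de0) := chart_continuous ix.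
by apply: filterS => y /=; rewrite distrC.
Unshelve. all: by end_near. Qed.

Lemma mgeo_rev L g : mgeo L g -> mgeo L (fun s => g (L - s)).
Proof.
move=> mg s t sL tL; have [||c d] := mg (L - s) (L - t); try lra.
by split=> //; rewrite d opprB addrC addrA subrK distrC.
Qed.

(** Each point of the piece divides the distance of its ends in the right ratio, so [geo_unique]
    places it on the coordinate geodesic. *)
Lemma mgeo_sol L g (a b : R) i u0 (de K V : R) : geo_ball i u0 de K V -> mgeo L g ->
  0 <= a -> a < b -> b <= L -> dom i (g a) -> dom i (g b) ->
  `|chart i (g a) - u0| < de -> `|chart i (g b) - u0| < de ->
  exists c c1, [/\ geo_sol i V (chart i (g a)) (chart i (g b)) c c1,
    forall t : R, -1 <= t <= 2 -> cod i (c t),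
    forall t : R, -1 <= t <= 2 -> bilin (metric i (c t)) (c1 t) (c1 t) = (b - a) ^+ 2,
    forall t : R, 0 <= t <= 1 -> g (a + t * (b - a)) = chart_inv i (c t) &
    forall (q' : M) xi, dom i q' -> `|chart i q' - u0| < de -> xi = chart i q' - chart i (g b) ->
        dist (g a) q' <= (b - a) +
          (2 * bilin (metric i (c 1)) (c1 1) xi + K * `|xi| ^+ 2) / (2 * (b - a))].
Proof.
move=> B mg a0 ab bL da db na nb.
have [||cab dab] := mg a b; try lra.
rewrite distrC gtr0_norm ?subr_gt0// in dab.
have [_ [c [c1 [S ic H]]]] := geo_ball_ex B da db na nb.
have [|H1 H2 H3] := H; first by rewrite dab subr_gt0.
rewrite dab in H1 H2 H3; exists c, c1; split=> // t t01.
have tp : 0 <= t * (b - a) by rewrite mulr_ge0//; lra.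
have tp' : t * (b - a) <= b - a by rewrite ler_piMl//; lra.
have A1 : 0 <= a <= L by lra.
have A2 : 0 <= a + t * (b - a) <= L by lra.
have A3 : 0 <= b <= L by lra.
have [ca ea] := mg _ _ A1 A2; have [cb eb] := mg _ _ A2 A3.
apply: H2 => //.
  by rewrite ea opprD addrA subrr sub0r normrN ger0_norm.
by rewrite eb distrC ger0_norm; lra.
Qed.

Lemma mgeo_chart L g (t0 : R) i u0 (de K V : R) : geo_ball i u0 de K V -> mgeo L g ->
  0 <= t0 <= L -> dom i (g t0) -> u0 = chart i (g t0) ->
  exists2 e : R, 0 < e & forall s : R, 0 <= s <= L -> `|s - t0| < e ->
    dom i (g s) /\ `|chart i (g s) - u0| < de.
Proof.
move=> B mg t0L it0 ->.
exact: mgeo_near mg t0L (chart_near it0 (geo_ball_gt0 B)).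
Qed.

(* Non-branching: agreement on an initial interval forces the same Cauchy data at an interior point. *)
Lemma mgeo_unique L g g' (s0 : R) : 0 < s0 -> s0 <= L -> mgeo L g -> mgeo L g' ->
  (forall t : R, 0 <= t <= s0 -> g t = g' t) -> forall t : R, 0 <= t <= L -> g t = g' t.
Proof.
move=> s00 s0L mg mg' H0.
suff H : forall t : R, s0 <= t <= L -> g t = g' t.
  by move=> t tL; have [ts|st] := leP t s0; [apply: H0; lra|apply: H; lra].
apply: real_induction => //; first by apply: H0; rewrite lexx andbT ltW.
  move=> t tL Ht; have Ht' (s : R) : 0 <= s <= t -> g s = g' s.
    by move=> st; have [ts|st'] := leP s s0; [apply: H0; lra|apply: Ht; lra].
  have e0 : g t = g' t by apply: Ht'; lra.
  set i := @chart_at _ _ M (g t); have dt : dom i (g t) by exact: chart_atP.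
  have [de [K [V B]]] := geo_ball_exists (chart_cod dt).
  have tL' : 0 <= t <= L by lra.
  have [e1 e10 E1] := mgeo_chart B mg tL' dt erefl.
  have dt' : dom i (g' t) by rewrite -e0.
  have [|e2 e20 E2] := mgeo_chart B mg' tL' dt'; first by rewrite -e0.
  pose h := Num.min (Num.min e1 e2 / 2) (Num.min s0 (L - t)).
  have h0 : 0 < h by rewrite !lt_min divr_gt0 ?lt_min ?e10 ?e20//= s00; lra.
  have [h1 h2 h3 h4] : [/\ h < e1, h < e2, h <= s0 & h <= L - t].
    have : h <= h by [].
    rewrite {2}/h !le_min => /andP[]; have : Num.min e1 e2 <= e1 /\ Num.min e1 e2 <= e2.
      by rewrite !ge_min !lexx orbT.
    by move: h0 => /[swap]-[? ?] ? ? /andP[? ?]; clear E1 E2 Ht Ht' mg mg' B; split=> //; lra.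
  have in1 : 0 <= t - h <= L by clear - tL h0 h3 s00; lra.
  have in2 : 0 <= t + h <= L by clear - tL h0 h4 s00; lra.
  have N1 : `|(t - h) - t| < Num.min e1 e2 /\ `|(t + h) - t| < Num.min e1 e2.
    by rewrite addrAC subrr sub0r normrN [t + h]addrC addrK gtr0_norm// !lt_min h1 h2.
  move: N1; rewrite !lt_min => -[/andP[n1 n2] /andP[n3 n4]].
  have [d1 m1] := E1 _ in1 n1; have [d2 m2] := E1 _ in2 n3.
  have [d1' m1'] := E2 _ in1 n2; have [d2' m2'] := E2 _ in2 n4.
  have ab : t - h < t + h by clear - h0; lra.
  have [[/andP[a0 _] /andP[_ bL]]] := (in1, in2).
  have [c [c1 [S ic _ gE _]]] := mgeo_sol B mg a0 ab bL d1 d2 m1 m2.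
  have [c' [c1' [S' ic' _ gE' _]]] := mgeo_sol B mg' a0 ab bL d1' d2' m1' m2'.
  have cc' (u : R) : 0 <= u <= 1 / 2 -> c u = c' u.
    move=> u2; have u12 : -1 <= u <= 2 by clear - u2; lra.
    have u01 : 0 <= u <= 1 by clear - u2; lra.
    rewrite -(chart_invK (ic u u12)) -(chart_invK (ic' u u12)) -(gE u u01) -(gE' u u01).
    congr chart; apply: Ht'.
    clear - h0 a0 u2; have -> : u * (t + h - (t - h)) = 2 * (u * h) by ring.
    have : 0 <= u * h <= 1 / 2 * h by case/andP: u2 => ? ?; rewrite mulr_ge0 ?ler_wpM2r// ltW.
    lra.
  have q12 : [set t | -1 <= t <= 2] (1 / 4 : R) by rewrite /=; lra.
  have c1E : c1 (1 / 4) = c1' (1 / 4).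
    have [_ _ ode _] := S; have [_ _ ode' _] := S'.
    have [D1 _] := ode _ q12; have [D2 _] := ode' _ q12.
    rewrite -(@derive_val _ _ _ _ _ _ _ D1) -(@derive_val _ _ _ _ _ _ _ D2).
    apply: near_eq_derive.
    apply: (@ex_nbhs_norm R R (1 / 4) _ (1 / 4)); first by lra.
    by move=> u; rewrite ltr_norml => u4; apply: cc'; clear - u4; lra.
  have q01 : 0 <= (1 / 4 : R) <= 1 by lra.
  have all := geo_ball_ivp B m1 m1' S S' q01 (cc' _ _) c1E.
  exists h => // s sth sL.
  have w : s = (t - h) + ((s - (t - h)) / (2 * h)) * (t + h - (t - h)) by clear - h0; field; lra.
  have s01 : 0 <= (s - (t - h)) / (2 * h) <= 1.
    by clear - h0 sth; rewrite ler_pdivrMr ?ler_pdivlMr ?mulr_gt0//; lra.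
  by rewrite w gE// gE'// all//; clear - s01; lra.
move=> t tL H; have tL' : 0 <= t <= L by lra.
have s0L' : 0 <= s0 <= L by lra.
have [xx _] := mg t s0 tL' s0L'; have [yy _] := mg' t s0 tL' s0L'.
have es0 : g s0 = g' s0 by apply: H0; lra.
have cc : conn (g t) (g' t) by apply: conn_trans xx _; rewrite es0; exact: conn_sym.
apply: dist0_eq => //; apply/eqP; rewrite eq_le dist_ge0 andbT; apply/ler_addgt0Pr => e e0.
pose s := Num.max s0 (t - e / 2).
have [s1 s2] : s0 <= s < t /\ t - s <= e / 2.
  by rewrite /s; clear - tL e0; have [|] := leP s0 (t - e / 2); lra.
have [||p1 p2] := mg t s; try lra.
have [||p1' p2'] := mg' s t; try lra.
have es : g s = g' s by apply: H.
rewrite -es in p1' p2'.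
have := dist_tri p1 p1'; rewrite p2 p2' [`|s - t|]distrC gtr0_norm; lra.
Qed.

Lemma geo_affine_ode i V p q (c c1 : R -> 'rV[R]_n) (a b : R) (O : set R) (f : R -> M) (t : R) :
  geo_sol i V p q c c1 -> (forall t : R, -1 <= t <= 2 -> cod i (c t)) ->
  open O -> (forall s, O s -> -1 < a + b * s < 2 /\ f s = chart_inv i (c (a + b * s))) -> O t ->
  'D_1 (velocity i f) t = acc i (chart i (f t)) (velocity i f t).
Proof.
move=> S ic oO H Ot; have [_ _ ode _] := S.
have H12 s : O s -> -1 <= a + b * s <= 2 by move=> /H[h _]; lra.
have vE s : O s -> velocity i f s = b *: c1 (a + b * s).
  move=> Os; have [d1 _] := ode _ (H12 s Os).
  have d := is_derive_comp_affine d1.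
  rewrite -(@derive_val _ _ _ _ _ _ _ d) /velocity; apply: near_eq_derive.
  have := open_nbhs_nbhs (conj oO Os); apply: filterS => u Ou /=.
  by have [_ ->] := H u Ou; rewrite chart_invK//; apply: ic; exact: H12.
rewrite vE//; have [_ d2] := ode _ (H12 t Ot).
have d := is_deriveZ b (is_derive_comp_affine d2).
have [_ fE] := H t Ot; rewrite fE chart_invK; last by apply: ic; exact: H12.
rewrite (_ : 'D_1 (velocity i f) t = b *: (b *: acc i (c (a + b * t)) (c1 (a + b * t)))).
  apply/rowP => k; rewrite !mxE bilinZl bilinZr; ring.
rewrite -(@derive_val _ _ _ _ _ _ _ d); apply: near_eq_derive.
by have := open_nbhs_nbhs (conj oO Ot); apply: filterS => u Ou /=; rewrite vE.
Qed.

Lemma eq_at_limit (W : normedModType R) (f g : R -> W) (t : R) : f s @[s --> t] --> f t -> g s @[s --> t] --> g t ->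
  (forall e : R, 0 < e -> exists2 s, `|s - t| < e & f s = g s) -> f t = g t.
Proof.
move=> cf cg H; apply/eqP; rewrite -subr_eq0 -normr_le0; apply/ler_addgt0Pr => e e0; rewrite add0r.
have e2 : 0 < e / 2 by lra.
have /cvgrPdist_lt/(_ _ e2) nf := cf; have /cvgrPdist_lt/(_ _ e2) ng := cg.
have [r r0 Hr] := nbhs_norm_ex (filterI nf ng).
have [s sr fg] := H r r0; have [/= h1 h2] := Hr s sr.
rewrite -(subrKA (f s)) {2}fg; apply: le_trans (ler_normD _ _) _.
by rewrite [`|g s - _|]distrC; lra.
Qed.

Lemma acc_geodesic i (f : R -> M) (t : R) :
  'D_1 (velocity i f) t = acc i (chart i (f t)) (velocity i f t) ->
  forall k : 'I_n, ('D_1 (velocity i f) t) 0 k +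
    \sum_(p < n) \sum_(q < n) christoffel i (chart i (f t)) k p q *
      velocity i f t 0 p * velocity i f t 0 q = 0.
Proof.
move=> -> k; rewrite mxE bilinE addrC; apply/eqP; rewrite subr_eq0; apply/eqP.
by apply: eq_bigr => a _; apply: eq_bigr => b _; rewrite mxE.
Qed.

(** The right-hand side makes sense for negative [s] as well and continues [g] beyond its starting
    point; the other end is reached through [mgeo_rev]. The form [0 + h^-1 * s] matches the affine
    reparametrizations used elsewhere. *)
Lemma mgeo_extension L g : 0 < L -> mgeo L g -> exists i V p q (c c1 : R -> 'rV[R]_n) (h : R),
  [/\ geo_sol i V p q c c1, (forall t : R, -1 <= t <= 2 -> cod i (c t)), 0 < h <= L &
     forall s : R, 0 <= s <= h -> g s = chart_inv i (c (0 + h^-1 * s))].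
Proof.
move=> L0 mg; set i := @chart_at _ _ M (g 0); have d0 : dom i (g 0) by exact: chart_atP.
have [de [K [V B]]] := geo_ball_exists (chart_cod d0).
have L00 : 0 <= (0 : R) <= L by rewrite lexx ltW.
have [e e0 E] := mgeo_chart B mg L00 d0 erefl.
pose h := Num.min (e / 2) L.
have h0 : 0 < h by rewrite lt_min L0 andbT; lra.
have [h1 h2] : h <= e / 2 /\ h <= L by rewrite !ge_min !lexx orbT.
have [||_ n0] := E 0; rewrite ?subrr ?normr0//.
have [||dh nh] := E h; rewrite ?subr0 ?gtr0_norm//; try lra.
have [c [c1 [S ic _ gE _]]] := mgeo_sol B mg (lexx 0) h0 h2 d0 dh n0 nh.
exists i, V, (chart i (g 0)), (chart i (g h)), c, c1, h; split=> //; first by rewrite h0.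
move=> s sh; rewrite -gE ?add0r ?subr0; first by congr g; field; rewrite gt_eqF.
by rewrite mulrC; apply/andP; split; rewrite ?ler_pdivrMr ?ler_pdivlMr//; lra.
Qed.

Lemma mgeo_local L g i (t0 : R) : mgeo L g -> 0 < t0 < L -> dom i (g t0) ->
  exists V p q (c c1 : R -> 'rV[R]_n) (a b h : R),
  [/\ geo_sol i V p q c c1, (forall t : R, -1 <= t <= 2 -> cod i (c t)), 0 < h, h <= t0 /\ h <= L - t0 &
     forall s : R, `|s - t0| < h -> -1 < a + b * s < 2 /\ g s = chart_inv i (c (a + b * s))].
Proof.
move=> mg tL it; have [de [K [V B]]] := geo_ball_exists (chart_cod it).
have tL' : 0 <= t0 <= L by lra.
have [e e0 E] := mgeo_chart B mg tL' it erefl.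
pose h := Num.min (e / 2) (Num.min t0 (L - t0)).
have h0 : 0 < h by rewrite !lt_min; lra.
have [h1 h2 h3] : [/\ h <= e / 2, h <= t0 & h <= L - t0] by rewrite !ge_min !lexx !orbT.
have [||d1 n1] := E (t0 - h); first lra.
  by rewrite addrAC subrr sub0r normrN gtr0_norm//; lra.
have [||d2 n2] := E (t0 + h); first lra.
  by rewrite [t0 + h]addrC addrK gtr0_norm//; lra.
have a0 : 0 <= t0 - h by lra.
have ab : t0 - h < t0 + h by lra.
have bL : t0 + h <= L by lra.
have [c [c1 [S ic _ gE _]]] := mgeo_sol B mg a0 ab bL d1 d2 n1 n2.
exists V, (chart i (g (t0 - h))), (chart i (g (t0 + h))), c, c1, (- (t0 - h) / (2 * h)), (2 * h)^-1, h.
split=> // s; rewrite ltr_norml => st.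
have sE : - (t0 - h) / (2 * h) + (2 * h)^-1 * s = (s - (t0 - h)) / (2 * h).
  by field; rewrite gt_eqF.
have s01 : 0 <= (s - (t0 - h)) / (2 * h) <= 1.
  by apply/andP; split; rewrite ?ler_pdivrMr ?ler_pdivlMr ?mulr_gt0//; lra.
rewrite sE; split; first by lra.
by rewrite -gE//; congr g; field; rewrite gt_eqF.
Qed.

(** [geodesic] involves two-sided derivatives at both ends, so [g] is continued by coordinate
    geodesics on either side before its smoothness is examined. *)
Lemma mgeo_geodesic L g : 0 < L -> mgeo L g ->
  exists c, geodesic 0 L c /\ forall t : R, 0 <= t <= L -> c t = g t.
Proof.
move=> L0 mg.
have [i0 [V0 [p0 [q0 [c0 [c01 [h0 [S0 ic0 /andP[h00 h0L] E0]]]]]]]] := mgeo_extension L0 mg.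
have [i1 [V1 [p1 [q1 [c1 [c11 [h1 [S1 ic1 /andP[h10 h1L] E1]]]]]]]] := mgeo_extension L0 (mgeo_rev mg).
pose f (t : R) := if t < 0 then chart_inv i0 (c0 (0 + h0^-1 * t)) else
  if t <= L then g t else chart_inv i1 (c1 (0 + h1^-1 * (L - t))).
have fg (t : R) : 0 <= t <= L -> f t = g t by rewrite /f => /andP[t0 ->]; rewrite ltNge t0.
have sm (i : chart_index M) V p q (c cc : R -> 'rV[R]_n) (a b : R) (O : set R) : geo_sol i V p q c cc ->
    (forall t : R, -1 <= t <= 2 -> cod i (c t)) -> open O -> (forall s, O s -> -1 < a + b * s < 2) ->
    smooth_map O (fun s => chart_inv i (c (a + b * s))).
  move=> S ic oO H; apply: smooth_map_chart => // [k|s /H h]; last by apply: ic; lra.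
  have [ck _] := geo_smooth S ic k.
  have sub : O `<=` [set t | @I12 R (a + b * t)] by move=> s /H.
  exact: Ck_sub sub (Ck_affine a b (@I12_open R) ck).
have oI (t e : R) : open [set s : R | `|s - t| < e].
  apply: (@open_comp _ _ (fun s : R => `|s - t|) [set x : R | x < e]); last exact: open_lt.
  by move=> s _; exact: norm_sub_cont.
(* The times around which [f] agrees with some smooth curve: open by construction, and smoothness of
   [f] on it is local. *)
pose U := [set t : R | exists O h, [/\ open O, O t, smooth_map O h & forall s, O s -> f s = h s]].
have oU : open U.
  rewrite openE => t [B [h [oB Bt sh e]]]; apply: filterS (open_nbhs_nbhs (conj oB Bt)) => s Bs.
  by exists B, h.
have f0 (s : R) : `|s - 0| < h0 -> -1 < 0 + h0^-1 * s < 2 /\ f s = chart_inv i0 (c0 (0 + h0^-1 * s)).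
  rewrite subr0 ltr_norml => sh; have s1 : -1 < h0^-1 * s < 1.
    by rewrite mulrC; apply/andP; split; rewrite ?ltr_pdivrMr ?ltr_pdivlMr//; lra.
  split; first by lra.
  have [s0|s0] := ltP s 0; first by rewrite /f s0.
  by rewrite fg ?E0//; lra.
have f1 (s : R) : `|s - L| < h1 -> -1 < h1^-1 * L + (- h1^-1) * s < 2 /\
    f s = chart_inv i1 (c1 (h1^-1 * L + (- h1^-1) * s)).
  rewrite ltr_norml => sh; have -> : h1^-1 * L + (- h1^-1) * s = h1^-1 * (L - s) by ring.
  have s1 : -1 < h1^-1 * (L - s) < 1.
    by rewrite mulrC; apply/andP; split; rewrite ?ltr_pdivrMr ?ltr_pdivlMr//; lra.
  split; first by lra.
  have [sL|sL] := leP s L; last by rewrite /f ltNge (ltW (lt_trans L0 sL))/= leNgt sL/= add0r.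
  have := E1 (L - s); rewrite subKr add0r => <-; last by lra.
  by rewrite fg//; lra.
have inU (t : R) : 0 <= t <= L -> U t.
  move=> tL; have [->|t0] := eqVneq t 0.
    exists [set s : R | `|s - 0| < h0], (fun s => chart_inv i0 (c0 (0 + h0^-1 * s))); split=> //.
    - by rewrite /= subrr normr0.
    - by apply: (sm _ _ _ _ _ _ _ _ _ S0) => // s /f0[].
    - by move=> s /f0[].
  have [->|tL1] := eqVneq t L.
    exists [set s : R | `|s - L| < h1], (fun s => chart_inv i1 (c1 (h1^-1 * L + (- h1^-1) * s))); split=> //.
    - by rewrite /= subrr normr0.
    - by apply: (sm _ _ _ _ _ _ _ _ _ S1) => // s /f1[].
    - by move=> s /f1[].
  have tL2 : 0 < t < L by rewrite !lt_neqAle eq_sym t0 tL1.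
  have [V [p [q [c [cc [a [b [h [S ic hh [ht hL] E]]]]]]]]] := mgeo_local mg tL2 (chart_atP (g t)).
  exists [set s : R | `|s - t| < h], (fun s => chart_inv (chart_at (g t)) (c (a + b * s))); split=> //.
  - by rewrite /= subrr normr0.
  - by apply: (sm _ _ _ _ _ _ _ _ _ S) => // s /E[].
  - by move=> s /= sh; have [_ <-] := E s sh; apply: fg; move: sh; rewrite ltr_norml; lra.
have smU : smooth_map U f by apply: smooth_map_local => t [B [h H]]; exists B, h.
have int (t : R) j : 0 < t < L -> dom j (f t) -> 'D_1 (velocity j f) t = acc j (chart j (f t)) (velocity j f t).
  move=> tL jt; rewrite fg in jt; last by lra.
  have [V [p [q [c [cc [a [b [h [S ic hh [ht hL] E]]]]]]]]] := mgeo_local mg tL jt.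
  apply: (geo_affine_ode (a := a) (b := b) S ic (oI t h)); last by rewrite /= subrr normr0.
  move=> s /= sh; have [ab <-] := E s sh; split=> //.
  by apply: fg; move: sh; rewrite ltr_norml; lra.
exists f; split=> //; split; first by exists U; split=> // t; rewrite /= in_itv/=; exact: inU.
move=> t j tL jt; apply: acc_geodesic.
have oW := smooth_map_open oU smU j; have Wt : (U `&` f @^-1` dom j) t by split=> //; exact: inU.
have C2 := smooth_map_Ck smU j 2; have [_ /(_ (1 : R))[_ CV]] := CkS C2.
have [cv /(_ (1 : R))[_ [ca _]]] := CkS CV.
have [cj _] := C2.
(* The equation is known at interior times; moving [t] slightly towards the middle of the interval
   and passing to the limit covers the two ends. *)
apply: (@eq_at_limit _ (fun t => 'D_1 (velocity j f) t) (fun t => acc j (chart j (f t)) (velocity j f t))).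
- exact: ca.
- by apply: acc_cvg; [exact: chart_cod|exact: cj|exact: cv].
move=> e e0; have [r r0 Hr] := nbhs_norm_ex (open_nbhs_nbhs (conj oW Wt)).
pose d := Num.min (Num.min e r / 2) (L / 4).
have [d0 d1 d2 d3] : [/\ 0 < d, d < e, d < r & d <= L / 4].
  have m0 : 0 < Num.min e r by rewrite lt_min e0.
  have : Num.min e r <= e /\ Num.min e r <= r by rewrite !ge_min !lexx orbT.
  have : d <= Num.min e r / 2 by rewrite ge_min lexx.
  have : d <= L / 4 by rewrite ge_min lexx orbT.
  have : 0 < d by rewrite lt_min; lra.
  by move=> ? ? ? [? ?]; split=> //; lra.
have [tl|tr] := leP t (L / 2).
  exists (t + d); first by rewrite addrAC subrr add0r gtr0_norm.
  have [_ jd] : (U `&` f @^-1` dom j) (t + d) by apply: Hr; rewrite addrAC subrr add0r gtr0_norm.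
  by apply: int => //; lra.
exists (t - d); first by rewrite addrAC subrr add0r normrN gtr0_norm.
have [_ jd] : (U `&` f @^-1` dom j) (t - d) by apply: Hr; rewrite addrAC subrr add0r normrN gtr0_norm.
by apply: int => //; lra.
Qed.

End Geodesics.

(** * Crossing curves in the disc *)

Section Crossing.
Variable R : realType.

Lemma uniform_cont (f : R -> R) (e : R) : continuous f -> 0 < e ->
  exists2 d : R, 0 < d & forall s t : R, 0 <= s <= 1 -> `|s - t| < d -> `|f s - f t| < e.
Proof.
move=> cf e0; have e2 : 0 < e / 2 by lra.
have /compact_near_coveringP cov := @segment_compact R 0 1.
have := cov R (0^'+) (fun d s => forall t : R, `|s - t| < d -> `|f s - f t| < e) _ _.
case.
  move=> x _; have /cvgrPdist_lt/(_ _ e2) nf := cf x.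
  have [r r0 Hr] := nbhs_norm_ex nf.
  near=> y d => t /= td.
  have yx : `|y - x| < r / 2.
    by near: y; apply: (@ex_nbhs_norm R R x _ (r / 2)); [lra|].
  have dr : d < r / 2.
    by near: d; apply: nbhs_right_lt; lra.
  have h1 := Hr y; have h2 := Hr t.
  have tx : `|t - x| < r by move: td yx; rewrite !ltr_norml; lra.
  have yr : `|y - x| < r by lra.
  by move: (h1 yr) (h2 tx); rewrite /= !ltr_norml; lra.
move=> d /= d0 Hd; exists (d / 2); first by rewrite divr_gt0.
move=> s t s01 st; apply: (Hd (d / 2)) => //=.
- by rewrite sub0r normrN gtr0_norm ?divr_gt0// ltr_pdivrMr// ltr_pMr// ltr1n.
- by rewrite divr_gt0.
Unshelve. all: by end_near. Qed.

Lemma xor_telescope (f : nat -> bool) (c : bool) N :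
  \big[addb/false]_(i < N) ((f i (+) f i.+1) && c) = (f 0%N (+) f N) && c.
Proof.
elim: N => [|N IH]; first by rewrite big_ord0 addbb.
by rewrite big_ord_recr /= IH {IH}; case: (f 0%N); case: (f N); case: (f N.+1); case: c.
Qed.

(** Stokes' formula modulo 2: the interior edges are counted twice when the cells are added up. *)
Lemma xor_grid (h v : nat -> nat -> bool) N :
  (forall i j, (i < N)%N -> (j < N)%N -> h i j (+) v i.+1 j (+) h i j.+1 (+) v i j = false) ->
  (\big[addb/false]_(i < N) h i 0%N) (+) (\big[addb/false]_(j < N) v N j) (+)
  (\big[addb/false]_(i < N) h i N) (+) (\big[addb/false]_(j < N) v 0%N j) = false.
Proof.
move=> H.
have row j : (j < N)%N -> forall k, (k <= N)%N ->
    (\big[addb/false]_(i < k) h i j) (+) (\big[addb/false]_(i < k) h i j.+1) = v k j (+) v 0%N j.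
  move=> jN; elim=> [|k IH] kN; first by rewrite !big_ord0 !addbb.
  rewrite !big_ord_recr /=; have := IH (ltnW kN); have := H k j kN jN.
  move: (\big[addb/false]_(i < k) h i j) (\big[addb/false]_(i < k) h i j.+1) => a b.
  by case: a; case: b; case: (h k j); case: (h k j.+1); case: (v k j); case: (v k.+1 j); case: (v 0%N j).
have all : forall l, (l <= N)%N ->
    (\big[addb/false]_(i < N) h i 0%N) (+) (\big[addb/false]_(i < N) h i l) =
    (\big[addb/false]_(j < l) v N j) (+) (\big[addb/false]_(j < l) v 0%N j).
  elim=> [|l IH] lN; first by rewrite !big_ord0 !addbb.
  rewrite !big_ord_recr /=; have := IH (ltnW lN); have := row l lN N (leqnn N).
  move: (\big[addb/false]_(i < N) h i 0%N) (\big[addb/false]_(i < N) h i l) => a b.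
  move: (\big[addb/false]_(i < N) h i l.+1) (\big[addb/false]_(j < l) v N j) (\big[addb/false]_(j < l) v 0%N j) => c d f.
  by case: a; case: b; case: c; case: d; case: f; case: (v N l); case: (v 0%N l).
have := all N (leqnn N).
by do 4 (case: (\big[addb/false]_(_ < N) _)).
Qed.

(* For nearby [v] and [w] away from the origin, whether the segment between them crosses the
   half-line [v.1 = 0, v.2 > 0]. *)
Definition crosses (v w : R * R) : bool := ((0 < v.1) (+) (0 < w.1)) && (0 < v.2).

Definition near_pt (d : R) (v w : R * R) : Prop := `|v.1 - w.1| < d /\ `|v.2 - w.2| < d.

(** Inside an open half-plane only one half of the axis [v.1 = 0] is visible, the positive one
    exactly when [k2] is positive. Being close to each other and far from the origin, two vectors
    separated by the axis have second coordinates of the same strict sign. *)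
Lemma crosses_half_plane (d k1 k2 : R) (v w : R * R) : near_pt d v w ->
  4 * d <= `|v.1| + `|v.2| -> 0 < k1 * v.1 + k2 * v.2 -> 0 < k1 * w.1 + k2 * w.2 ->
  crosses v w = ((0 < v.1) (+) (0 < w.1)) && (0 < k2).
Proof.
case: v w => v1 v2 [w1 w2]; rewrite /near_pt /crosses /= !ltr_norml => -[n1 n2] far kv kw.
have [v0|v0] := ltP 0 v1; have [w0|w0] := ltP 0 w1 => //=.
- have [p2|p2] := ltP 0 v2; apply/esym.
    have hw : 0 < w2 by move: far; rewrite gtr0_norm// gtr0_norm//; lra.
    rewrite ltNge; apply/negP => k0; have : 0 < k1 by rewrite ltNge; apply/negP => k10; nra.
    nra.
  have hv : v2 < - (2 * d) by move: far; rewrite gtr0_norm// ler0_norm//; lra.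
  apply/negbTE; rewrite -leNgt leNgt; apply/negP => k0.
  have hw : w2 < 0 by lra.
  have : 0 < k1 by rewrite ltNge; apply/negP => k10; nra.
  nra.
- have [p2|p2] := ltP 0 v2; apply/esym.
    have hw : 0 < w2 by move: far; rewrite ler0_norm// gtr0_norm//; lra.
    rewrite ltNge; apply/negP => k0; have : 0 < k1 by rewrite ltNge; apply/negP => k10; nra.
    nra.
  have hv : v2 < - (2 * d) by move: far; rewrite ler0_norm// ler0_norm//; lra.
  apply/negbTE; rewrite -leNgt leNgt; apply/negP => k0.
  have hw : w2 < 0 by lra.
  have : 0 < k1 by rewrite ltNge; apply/negP => k10; nra.
  nra.
Qed.

(** The four vectors are close together and far from the origin. Either their first coordinates
    agree in sign, or their second coordinates are all nonpositive, and nothing crosses; or the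
    second coordinates are all positive, and the sign changes cancel around the cell. *)
Lemma crosses_cell (d : R) (v1 v2 v3 v4 : R * R) :
  near_pt d v1 v2 -> near_pt d v1 v3 -> near_pt d v1 v4 -> near_pt d v4 v3 -> near_pt d v2 v3 ->
  4 * d <= `|v1.1| + `|v1.2| ->
  crosses v1 v2 (+) crosses v2 v3 (+) crosses v4 v3 (+) crosses v1 v4 = false.
Proof.
case: v1 v2 v3 v4 => a1 b1 [a2 b2] [a3 b3] [a4 b4]; rewrite /near_pt /crosses /= !ltr_norml.
move=> [h12 g12] [h13 g13] [h14 g14] [h43 g43] [h23 g23] far.
have key : [\/ [/\ (0 < a1) = (0 < a2), (0 < a1) = (0 < a3) & (0 < a1) = (0 < a4)],
   [/\ 0 < b1, 0 < b2, 0 < b3 & 0 < b4] | [/\ b1 <= 0, b2 <= 0, b3 <= 0 & b4 <= 0]].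
  have [ab|ab] := leP (2 * d) `|b1|.
    have [b0|b0] := ltP 0 b1; first by constructor 2; move: ab; rewrite gtr0_norm//; split; lra.
    by constructor 3; move: ab; rewrite ler0_norm//; split; lra.
  constructor 1; have [a0|a0] := ltP 0 a1; split; apply/esym.
  - by move: far; rewrite gtr0_norm//; lra.
  - by move: far; rewrite gtr0_norm//; lra.
  - by move: far; rewrite gtr0_norm//; lra.
  - by apply/negbTE; rewrite -leNgt; move: far; rewrite ler0_norm//; lra.
  - by apply/negbTE; rewrite -leNgt; move: far; rewrite ler0_norm//; lra.
  - by apply/negbTE; rewrite -leNgt; move: far; rewrite ler0_norm//; lra.
case: key => [[<- <- <-]|[-> -> _ ->]|[]]; first by rewrite addbb.
  by case: (0 < a1); case: (0 < a2); case: (0 < a3); case: (0 < a4).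
by rewrite !leNgt => /negbTE-> /negbTE-> _ /negbTE->; rewrite !andbF.
Qed.

Lemma uniform_step (f : R -> R) (e : R) : continuous f -> 0 < e ->
  exists N0 : nat, forall N : nat, (N0 <= N)%N -> forall s t : R, 0 <= s <= 1 -> `|s - t| <= N.+1%:R^-1 ->
    `|f s - f t| < e.
Proof.
move=> cf e0; have [d d0 H] := uniform_cont cf e0.
have [N0 _ HN] := near_infty_natSinv_lt (PosNum d0).
exists N0 => N NN s t s01 st; apply: H => //; apply: le_lt_trans st _; exact: HN.
Qed.

(* Crossings of the vector [a s - b t] with a half-line, counted modulo 2 along the boundary of the
   square: there are none around a small cell of a grid, whereas the sign conditions on the sides
   of the square make their total number odd. *)
Lemma no_avoiding (a1 a2 b1 b2 : R -> R) (k1 k2 : bool -> R) (l1 l2 : bool -> R) :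
  continuous a1 -> continuous a2 -> continuous b1 -> continuous b2 ->
  (forall s t : R, 0 <= s <= 1 -> 0 <= t <= 1 -> ~ (a1 s = b1 t /\ a2 s = b2 t)) ->
  (forall (b : bool) (s : R), 0 <= s <= 1 -> 0 < k1 b * (a1 s - b1 b%:R) + k2 b * (a2 s - b2 b%:R)) ->
  (forall (b : bool) (t : R), 0 <= t <= 1 -> 0 < l1 b * (a1 b%:R - b1 t) + l2 b * (a2 b%:R - b2 t)) ->
  (forall b : bool, (0 < a1 0 - b1 b%:R) = (0 < a1 1 - b1 b%:R)) ->
  (0 < a1 0 - b1 0) = ~~ (0 < a1 0 - b1 1) -> 0 < l2 false -> l2 true <= 0 -> False.
Proof.
move=> ca1 ca2 cb1 cb2 nz hk hl same opp l0 l1'.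
pose F (s t : R) : R * R := (a1 s - b1 t, a2 s - b2 t).
have [m m0 mF] : exists2 m : R, 0 < m & forall s t : R, 0 <= s <= 1 -> 0 <= t <= 1 -> m <= `|(F s t).1| + `|(F s t).2|.
  pose K : set (R * R) := `[0, 1] `*` `[0, 1].
  have cK : compact K by apply: compact_setX; exact: segment_compact.
  have K0 : K !=set0 by exists (0, 0); split; rewrite /= in_itv/= lexx ler01.
  have cF : continuous (fun z : R * R => `|a1 z.1 - b1 z.2| + `|a2 z.1 - b2 z.2|).
    move=> z.
    have c1 (g : R -> R) : continuous g -> (fun z : R * R => g z.1) @ z --> g z.1.
      by move=> cg; apply: (@cvg_comp _ _ _ (fun z : R * R => z.1) g); [exact: cvg_fst|exact: cg].
    have c2 (g : R -> R) : continuous g -> (fun z : R * R => g z.2) @ z --> g z.2.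
      by move=> cg; apply: (@cvg_comp _ _ _ (fun z : R * R => z.2) g); [exact: cvg_snd|exact: cg].
    apply: cvgD; apply: cvg_norm; apply: cvgB; [exact: c1|exact: c2|exact: c1|exact: c2].
  have [z] := compact_EVT_min K0 cK (continuous_subspaceT cF).
  rewrite inE => -[/= z1 z2] zm; exists (`|a1 z.1 - b1 z.2| + `|a2 z.1 - b2 z.2|).
    rewrite lt_neqAle addr_ge0// andbT eq_sym paddr_eq0// !normr_eq0 !subr_eq0.
    apply/negP => /andP[/eqP e1 /eqP e2]; apply: (nz z.1 z.2) => //.
  by move=> s t s01 t01; apply: (zm (s, t)); rewrite inE; split; rewrite /= in_itv.
(* The grid is taken so fine that [F] moves by less than [d] in each coordinate between neighbours,
   while [m = 4 d] bounds its size from below, as the lemmas on [crosses] require. *)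
pose d := m / 4; have d2 : 0 < d / 2 by rewrite !divr_gt0.
have [N1 H1] := uniform_step ca1 d2; have [N2 H2] := uniform_step ca2 d2.
have [N3 H3] := uniform_step cb1 d2; have [N4 H4] := uniform_step cb2 d2.
pose N' := maxn (maxn N1 N2) (maxn N3 N4); pose N := N'.+1.
pose x (i : nat) : R := i%:R / N%:R.
have N0 : 0 < N%:R :> R by rewrite ltr0n.
have x01 i : (i <= N)%N -> 0 <= x i <= 1.
  by move=> iN; rewrite divr_ge0//= ler_pdivrMr// mul1r ler_nat.
have xS i : `|x i - x i.+1| <= N%:R^-1.
  by rewrite /x -mulrBl -natr1 opprD addrA subrr sub0r normrM normrN normr1 mul1r ger0_norm// invr_ge0.
have xx i : `|x i - x i| <= N%:R^-1 by rewrite subrr normr0 invr_ge0.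
have x0 : x 0%N = 0 by rewrite /x mul0r.
have x1 : x N = 1 by rewrite /x divff// gt_eqF.
have nF i j i' j' : (i <= N)%N -> (j <= N)%N -> `|x i - x i'| <= N%:R^-1 -> `|x j - x j'| <= N%:R^-1 ->
    near_pt d (F (x i) (x j)) (F (x i') (x j')).
  move=> iN jN hi hj; have iI := x01 i iN; have jI := x01 j jN.
  have q1 : (N1 <= N')%N by rewrite !leq_max leqnn.
  have q2 : (N2 <= N')%N by rewrite !leq_max leqnn orbT.
  have q3 : (N3 <= N')%N by rewrite !leq_max leqnn !orbT.
  have q4 : (N4 <= N')%N by rewrite !leq_max leqnn !orbT.
  have := H1 N' q1 _ _ iI hi; have := H2 N' q2 _ _ iI hi.
  have := H3 N' q3 _ _ jI hj; have := H4 N' q4 _ _ jI hj.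
  rewrite /near_pt /F /=.
  move: (a1 (x i)) (a1 (x i')) (a2 (x i)) (a2 (x i')) (b1 (x j)) (b1 (x j')) (b2 (x j)) (b2 (x j')).
  by clear => u1 u2 u3 u4 u5 u6 u7 u8; rewrite !ltr_norml; split; lra.
have far i j : (i <= N)%N -> (j <= N)%N -> 4 * d <= `|(F (x i) (x j)).1| + `|(F (x i) (x j)).2|.
  by move=> iN jN; rewrite /d mulrC divfK ?pnatr_eq0//; apply: mF; exact: x01.
pose h i j := crosses (F (x i) (x j)) (F (x i.+1) (x j)).
pose v i j := crosses (F (x i) (x j)) (F (x i) (x j.+1)).
have side_h (b : bool) j : (j <= N)%N -> x j = b%:R -> \big[addb/false]_(i < N) h i j = false.
  move=> jN xj; rewrite (eq_bigr (fun i : 'I_N =>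
    ((0 < (F (x i) (x j)).1) (+) (0 < (F (x i.+1) (x j)).1)) && (0 < k2 b))); last first.
    move=> i _; apply: (@crosses_half_plane d (k1 b)).
    - by apply: nF => //; rewrite ltnW.
    - by apply: far => //; rewrite ltnW.
    - by rewrite /F xj /=; apply: hk; apply: x01; rewrite ltnW.
    - by rewrite /F xj /=; apply: hk; exact: x01.
  rewrite (xor_telescope (fun i => 0 < (F (x i) (x j)).1)) /F /= x0 x1 xj same.
  by rewrite addbb.
have side_v (b : bool) i : (i <= N)%N -> x i = b%:R -> \big[addb/false]_(j < N) v i j =
    ((0 < a1 b%:R - b1 0) (+) (0 < a1 b%:R - b1 1)) && (0 < l2 b).
  move=> iN xi; rewrite (eq_bigr (fun j : 'I_N =>
    ((0 < (F (x i) (x j)).1) (+) (0 < (F (x i) (x j.+1)).1)) && (0 < l2 b))); last first.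
    move=> j _; apply: (@crosses_half_plane d (l1 b)).
    - by apply: nF => //; rewrite ltnW.
    - by apply: far => //; rewrite ltnW.
    - by rewrite /F xi /=; apply: hl; apply: x01; rewrite ltnW.
    - by rewrite /F xi /=; apply: hl; exact: x01.
  by rewrite (xor_telescope (fun j => 0 < (F (x i) (x j)).1)) /F /= x0 x1 xi.
have cell i j : (i < N)%N -> (j < N)%N -> h i j (+) v i.+1 j (+) h i j.+1 (+) v i j = false.
  move=> iN jN; have iN' := ltnW iN; have jN' := ltnW jN.
  by apply: (@crosses_cell d); (try by apply: nF); exact: far.
have := xor_grid cell; rewrite (side_h false)// (side_h true)// (side_v true)// (side_v false)//.
by rewrite [0 < l2 true]ltNge l1' andbF l0 /= opp; case: (0 < _).
Qed.

Definition clamp01 (t : R) : R := Num.max 0 (Num.min 1 t).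

Lemma clamp01_in t : 0 <= clamp01 t <= 1.
Proof. exact: clamp_in ler01. Qed.

Lemma clamp01_id t : 0 <= t <= 1 -> clamp01 t = t.
Proof. exact: clamp_id. Qed.

Lemma clamp01_comp (T : topologicalType) (f : R -> T) :
  {within `[0, 1], continuous f} -> continuous (fun t => f (clamp01 t)).
Proof.
move=> /subspace_continuousP cf t P nP.
have m0 : `[0, 1]%classic (clamp01 t) by rewrite /= in_itv/= clamp01_in.
have := @clamp_cont R 0 1 t; move/(_ _ (cf _ m0 P nP)).
move=> h; change (\forall s \near t, P (f (clamp01 s))).
have h' : \forall s \near t, `[0, 1]%classic (clamp01 s) -> P (f (clamp01 s)) := h.
by apply: filterS h' => s; rewrite /= in_itv/=; apply; exact: clamp01_in.
Qed.

Definition ip (u v : 'rV[R]_2) : R := u 0 0 * v 0 0 + u 0 1 * v 0 1.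
Definition cr (u v : 'rV[R]_2) : R := u 0 0 * v 0 1 - u 0 1 * v 0 0.

Lemma rV2P (u v : 'rV[R]_2) : u 0 0 = v 0 0 -> u 0 1 = v 0 1 -> u = v.
Proof.
move=> h0 h1; apply/rowP => -[[|[|//]] k].
  by rewrite (_ : Ordinal k = 0)//; exact: val_inj.
by rewrite (_ : Ordinal k = 1)//; exact: val_inj.
Qed.

Lemma ip_gt0 u : u != 0 -> 0 < ip u u.
Proof.
move=> u0; rewrite lt_neqAle /ip -!expr2 addr_ge0 ?sqr_ge0// andbT eq_sym paddr_eq0 ?sqr_ge0//.
by apply: contra u0; rewrite !sqrf_eq0 => /andP[/eqP h /eqP h']; apply/eqP/rV2P; rewrite ?h ?h' mxE.
Qed.

Lemma ip_lt1 x u : ip x x = 1 -> ip u u <= 1 -> u != x -> ip x u < 1.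
Proof.
move=> x1 u1 ux; have : 0 < ip (u - x) (u - x) by apply: ip_gt0; rewrite subr_eq0.
have -> : ip (u - x) (u - x) = ip u u - 2 * ip x u + ip x x by rewrite /ip !mxE; ring.
lra.
Qed.

Lemma unit_discE u : unit_disc u <-> ip u u <= 1.
Proof. by rewrite /unit_disc /ip /= !expr2. Qed.

Lemma unit_circleE u : unit_circle u <-> ip u u = 1.
Proof. by rewrite /unit_circle /ip /= !expr2. Qed.

(* Stereographic projection of the unit circle from [x]; the value at [x] itself is the junk [0]. *)
Definition stereo (x u : 'rV[R]_2) : R := cr x u / (1 - ip x u).

Lemma stereoE x u : ip x x = 1 -> ip u u = 1 -> u != x -> cr x u = (1 - ip x u) * stereo x u.
Proof.
move=> x1 u1 ux; rewrite /stereo mulrC divfK// subr_eq0 eq_sym; apply: negbT.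
by apply: lt_eqF; apply: ip_lt1; rewrite ?u1.
Qed.

Lemma coord_cont2 (T : topologicalType) (f : T -> 'rV[R]_2) (j : 'I_2) : continuous f -> continuous (fun t => f t 0 j).
Proof. by move=> cf t; apply: (@cvg_comp _ _ _ f (fun v : 'rV[R]_2 => v 0 j) _ _ _ (cf t)); exact: coord_continuous. Qed.

(** Points are read in the rotated and scaled frame with coordinates [cr e] and [ip e], where
    [e = x - m]. There [x] and [m] have the same first coordinate, while [p] and [q] lie on opposite
    sides of their chord, which are the sign conditions of [no_avoiding]. *)
Lemma crossing (x m p q : 'rV[R]_2) (A B : R -> 'rV[R]_2) :
  ip x x = 1 -> ip m m = 1 -> ip p p = 1 -> ip q q = 1 -> m != x -> p != x -> q != x ->
  stereo x p < stereo x m < stereo x q ->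
  {within `[0, 1], continuous A} -> {within `[0, 1], continuous B} ->
  (forall t : R, 0 <= t <= 1 -> unit_disc (A t) /\ unit_disc (B t)) ->
  A 0 = x -> A 1 = m -> B 0 = p -> B 1 = q ->
  exists s t : R, [/\ 0 <= s <= 1, 0 <= t <= 1 & A s = B t].
Proof.
move=> x1 m1 p1 q1 mx px qx /andP[pm mq] /clamp01_comp cA /clamp01_comp cB inD A0 A1 B0 B1.
apply: contrapT => no; pose e := x - m.
have E0 : 0 < ip e e by apply: ip_gt0; rewrite subr_eq0 eq_sym.
have cip (f : R -> 'rV[R]_2) w : continuous f -> continuous (fun t => ip w (f t)).
  by move=> cf t; apply: cvgD; apply: cvgM; (try exact: cvg_cst); exact: coord_cont2.
have ccr (f : R -> 'rV[R]_2) w : continuous f -> continuous (fun t => cr w (f t)).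
  by move=> cf t; apply: cvgB; apply: cvgM; (try exact: cvg_cst); exact: coord_cont2.
have c0 : clamp01 0 = 0 by apply: clamp01_id; rewrite lexx ler01.
have c1 : clamp01 1 = 1 by apply: clamp01_id; rewrite lexx ler01.
have nAB (s t : R) : A (clamp01 s) != B (clamp01 t).
  by apply/eqP => h; apply: no; exists (clamp01 s), (clamp01 t); split=> //; exact: clamp01_in.
have dA (s : R) : ip (A (clamp01 s)) (A (clamp01 s)) <= 1.
  by apply/unit_discE; have [] := inD _ (clamp01_in s).
have dB (s : R) : ip (B (clamp01 s)) (B (clamp01 s)) <= 1.
  by apply/unit_discE; have [] := inD _ (clamp01_in s).
pose pq (b : bool) := if b then q else p; pose xm (b : bool) := if b then m else x.
have pq1 b : ip (pq b) (pq b) = 1 by case: b.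
have xm1 b : ip (xm b) (xm b) = 1 by case: b.
have pqE (b : bool) : B (clamp01 b%:R) = pq b by case: b; rewrite /= ?c0 ?c1.
have xmE (b : bool) : A (clamp01 b%:R) = xm b by case: b; rewrite /= ?c0 ?c1.
have crE u : cr e x - cr e u = (1 - ip x m) * (1 - ip x u) * (stereo x m - stereo x u) ->
   u != x -> ip u u = 1 -> 0 < (1 - ip x m) * (1 - ip x u).
  by move=> _ ux u1; rewrite mulr_gt0// subr_gt0 ip_lt1// ?m1 ?u1.
(* The side of the chord from [x] to [m] on which [u] lies is decided by comparing stereographic
   coordinates, as the other factors are positive. *)
have crE' u : u != x -> ip u u = 1 -> cr e x - cr e u = (1 - ip x m) * (1 - ip x u) * (stereo x m - stereo x u).
  move=> ux u1.
  have -> : (1 - ip x m) * (1 - ip x u) * (stereo x m - stereo x u) =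
    ((1 - ip x m) * stereo x m) * (1 - ip x u) - (1 - ip x m) * ((1 - ip x u) * stereo x u) by ring.
  rewrite -!stereoE//.
  have -> : cr x m * (1 - ip x u) - (1 - ip x m) * cr x u = cr x m - cr x u + ip x x * cr m u.
    by rewrite /cr /ip; ring.
  by rewrite x1 mul1r /e /cr !mxE; ring.
apply: (@no_avoiding (fun s => cr e (A (clamp01 s))) (fun s => ip e (A (clamp01 s)))
  (fun s => cr e (B (clamp01 s))) (fun s => ip e (B (clamp01 s)))
  (fun b => - cr e (pq b)) (fun b => - ip e (pq b)) (fun b => cr e (xm b)) (fun b => ip e (xm b))).
- exact: ccr. - exact: cip. - exact: ccr. - exact: cip.
(* Both coordinates in the frame of [e] vanish only for the zero vector, by Lagrange's identity. *)
- move=> s t s1 t1 [h1 h2]; have /negP := nAB s t; apply; rewrite -subr_eq0.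
  apply/negPn/negP => /ip_gt0; set w := A _ - B _ => w0.
  have z1 : cr e w = 0 
    by transitivity (cr e (A (clamp01 s)) - cr e (B (clamp01 t))); [rewrite /cr /w !mxE; ring|rewrite h1 subrr].
  have z2 : ip e w = 0 
    by transitivity (ip e (A (clamp01 s)) - ip e (B (clamp01 t))); [rewrite /ip /w !mxE; ring|rewrite h2 subrr].
  have : ip e e * ip w w = cr e w ^+ 2 + ip e w ^+ 2 by rewrite /ip /cr; ring.
  by rewrite z1 z2 expr0n addr0 => h; have := mulr_gt0 E0 w0; rewrite h ltxx.
(* With one curve at an endpoint on the circle, the difference stays in a half-plane bounded by a
   parallel to the tangent there: the disc is strictly convex and the curves are assumed not to
   meet. *)
- move=> b s _; rewrite !pqE; set a := A _.
  have -> : - cr e (pq b) * (cr e a - cr e (pq b)) + - ip e (pq b) * (ip e a - ip e (pq b)) =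
    ip e e * (ip (pq b) (pq b) - ip (pq b) a) by rewrite /ip /cr; ring.
  rewrite mulr_gt0// pq1 subr_gt0; apply: ip_lt1 => //; first exact: dA.
  by rewrite -pqE; exact: nAB.
- move=> b t _; rewrite !xmE; set a := B _.
  have -> : cr e (xm b) * (cr e (xm b) - cr e a) + ip e (xm b) * (ip e (xm b) - ip e a) =
    ip e e * (ip (xm b) (xm b) - ip (xm b) a) by rewrite /ip /cr; ring.
  rewrite mulr_gt0// xm1 subr_gt0; apply: ip_lt1 => //; first exact: dB.
  by rewrite -xmE eq_sym; exact: nAB.
- move=> b; rewrite c0 c1 A0 A1; congr (0 < _ - _).
  by rewrite /cr /e !mxE; ring.
- rewrite c0 c1 A0 B0 B1 !crE'//.
  have s0 u : u != x -> ip u u = 1 -> 0 < (1 - ip x m) * (1 - ip x u).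
    by move=> ux u1; apply: crE => //; exact: crE'.
  by rewrite pmulr_rgt0 ?s0// pmulr_rgt0 ?s0// !subr_gt0 pm -leNgt ltW.
- rewrite /= /e; have -> : ip (x - m) x = ip x x - ip x m by rewrite /ip !mxE; ring.
  by rewrite x1 subr_gt0 ip_lt1// m1.
- rewrite /= /e; have -> : ip (x - m) m = ip x m - ip m m by rewrite /ip !mxE; ring.
  by rewrite m1 subr_le0 ltW// ip_lt1// m1.
Qed.

End Crossing.

(** * Sweepouts *)

Section Circle.
Variables (R : realType) (n : nat) (M : riemannianManifold R n).
Variables (c : R -> M) (G : set M).
Hypothesis cG : circle_param c G.

Lemma param_cont : continuous c.
Proof. by case: cG => -[cc _] _ _ _ _ t; exact: cc. Qed.

Lemma param_nat (t : R) (k : nat) : c (t + k%:R) = c t.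
Proof.
case: cG => _ per _ _ _; elim: k => [|k IH]; first by rewrite addr0.
by rewrite -natr1 addrA per IH.
Qed.

Lemma param_int (t : R) (k : int) : c (t + k%:~R) = c t.
Proof.
case: k => k; first exact: param_nat.
by rewrite -(param_nat _ k.+1) NegzE rmorphN/= addrAC addrK.
Qed.

Lemma int_frac (t : R) : exists k : int, 0 <= t + k%:~R < 1.
Proof.
exists (- Num.floor t); rewrite rmorphN/= subr_ge0; have := floor_itv t.
by rewrite intrD => /andP[h1 h2]; rewrite h1/=; lra.
Qed.

Lemma param_inj (s t : R) : c s = c t -> exists k : int, s = t + k%:~R.
Proof.
case: cG => _ _ inj _ _ st; have [k sk] := int_frac s; have [l tl] := int_frac t.
have := inj _ _ sk tl; rewrite !param_int => /(_ st) e.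
by exists (l - k); rewrite intrB; lra.
Qed.

Lemma param_lift (v0 : R) x : G x -> exists2 v : R, x = c v & v0 <= v < v0 + 1.
Proof.
case: cG => _ _ _ _ -> [s _ <-]; have [k sk] := int_frac (s - v0).
by exists (s + k%:~R); [rewrite param_int|lra].
Qed.

Lemma param_in (t : R) : G (c t).
Proof. by case: cG => _ _ _ _ ->; exists t. Qed.

Lemma param_smooth_on : smooth_on c `[0, 1].
Proof. by case: cG => sm _ _ _ _; exists setT; split=> //; exact: openT. Qed.

Lemma param_compact (a b : R) : compact (c @` `[a, b]).
Proof.
apply: continuous_compact; last exact: segment_compact.
by apply: continuous_subspaceT; exact: param_cont.
Qed.

Lemma param_imageE : G = c @` `[0, 1].
Proof.
apply/seteqP; split=> [x /(param_lift 0)[v -> v01]|x [t _ <-]]; last exact: param_in.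
by exists v => //=; rewrite in_itv/=; lra.
Qed.

Lemma circle_compact : compact G.
Proof. by rewrite param_imageE; exact: param_compact. Qed.

Lemma circle_conn : exists K : R, forall x y, G x -> G y -> conn x y /\ dist x y <= K.
Proof.
have [L [L0 dL _]] := length_primitive param_smooth_on.
have Lm (a b : R) : 0 <= a -> a <= b -> b <= 1 -> L a <= L b.
  move=> a0 ab b1; apply: (is_derive_ge0 (f := speed c) ab) => t tab; last exact: speed_ge0.
  by apply: dL; lra.
exists (L 1) => x y /(param_lift 0)[s -> s01] /(param_lift 0)[t -> t01].
have s1 : 0 <= s <= 1 by lra.
have t1 : 0 <= s + (t - s) <= 1 by lra.
have := pathl_sub param_smooth_on dL s1 t1; rewrite addrC subrK => p.
split; first by exists `|L t - L s|.
apply: le_trans (dist_le_path p) _.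
have := Lm 0 s; have := Lm s 1; have := Lm 0 t; have := Lm t 1; rewrite L0.
by rewrite ler_norml; lra.
Qed.

Lemma diamE : exists D : R, [/\ diam G = D%:E, 0 < D &
  forall x y, G x -> G y -> conn x y /\ dist x y <= D].
Proof.
have [K HK] := circle_conn.
have ub x y : G x -> G y -> (rdist x y <= diam G)%E.
  by move=> Gx Gy; apply: ereal_sup_ubound; exists x, y.
have le_K : (diam G <= K%:E)%E.
  apply: ge_ereal_sup => _ [x [y [Gx Gy ->]]]; have [xy d] := HK x y Gx Gy.
  by rewrite (rdistE xy) lee_fin.
have G0 := param_in 0; have G2 := param_in (1 / 2).
have [xy _] := HK _ _ G0 G2; have := ub _ _ G0 G2; rewrite (rdistE xy).
have d0 : 0 < dist (c 0) (c (1 / 2)).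
  rewrite lt_neqAle dist_ge0 andbT eq_sym; apply/eqP => /(dist0_eq xy).
  case: cG => _ _ inj _ _ /inj h; have : (0 : R) = 1 / 2 by apply: h; lra.
  by lra.
move: ub le_K; case: (diam G) => [D||] //= ub le_K h.
exists D; split=> //; first by apply: lt_le_trans d0 _; rewrite lee_fin in h.
by move=> x y Gx Gy; have [cxy _] := HK x y Gx Gy; split=> //; have := ub x y Gx Gy; rewrite (rdistE cxy) lee_fin.
Qed.

Lemma speed_gt0 (t : R) : 0 < speed c t.
Proof.
case: cG => sm _ _ im _; rewrite /speed sqrtr_gt0; apply: metric_pos.
  exact: chart_cod (chart_atP _).
by apply: im; rewrite oner_eq0.
Qed.

Lemma speed_cont : continuous (speed c).
Proof. by case: cG => sm _ _ _ _ t; exact: (speed_continuous openT sm). Qed.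

Lemma speed_bounds : exists k K : R, 0 < k /\ forall t : R, 0 <= t <= 1 -> k <= speed c t <= K.
Proof.
have I0 : `[0 : R, 1]%classic !=set0 by exists 0; rewrite /= in_itv/= lexx ler01.
have cw : {within `[0, 1], continuous (speed c)} by apply: continuous_subspaceT; exact: speed_cont.
have [a _ Ha] := compact_EVT_min I0 (@segment_compact R 0 1) cw.
have [b _ Hb] := compact_EVT_max I0 (@segment_compact R 0 1) cw.
exists (speed c a), (speed c b); split=> [|t t01]; first exact: speed_gt0.
have tI : t \in `[0, 1]%classic by rewrite inE/= in_itv.
by apply/andP; split; [exact: Ha|exact: Hb].
Qed.

Lemma arc_measurable (A : set M) : closed A -> measurable (`[0, 1] `&` [set t : R | A (c t)] : set R).
Proof.
move=> cA; apply: measurableI; first exact: measurable_itv.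
apply: closed_measurable.
by apply: (@closed_comp _ _ c A) => // t _; exact: param_cont.
Qed.

Lemma closed_arc_closed p q (A : set M) : closed_arc c p q A -> closed A.
Proof.
move=> [a [b [_ -> _]]]; apply: compact_closed; last exact: param_compact.
exact: manifold_hausdorff.
Qed.

Lemma speed_measurable (S : set R) : measurable S -> S `<=` `[0, 1] ->
  measurable_fun S (fun t => (speed c t)%:E).
Proof.
move=> mS _; apply/measurable_EFinP.
apply: measurable_funS (continuous_measurable_fun speed_cont) => //.
Qed.

Lemma arc_setY_measurable (A B : set M) : closed A -> closed B ->
  measurable (`[0, 1] `&` [set t : R | (A `+` B) (c t)] : set R).
Proof.
move=> cA cB.
have -> : `[0, 1] `&` [set t : R | (A `+` B) (c t)] =
    (`[0, 1] `&` [set t : R | A (c t)]) `+` (`[0, 1] `&` [set t : R | B (c t)]).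
  by apply/seteqP; split=> t /=; rewrite /setY /setD /setU /setI /=; tauto.
have mA := arc_measurable cA; have mB := arc_measurable cB.
by apply: measurableU; apply: measurableD.
Qed.

Lemma arc_length_ge (A B : set M) (u v k : R) : closed A -> closed B -> 0 <= u -> u <= v -> v <= 1 ->
  (forall t : R, 0 <= t <= 1 -> k <= speed c t) -> 0 <= k ->
  (forall t : R, u <= t <= v -> (A `+` B) (c t)) ->
  ((k * (v - u))%:E <= arc_length c (A `+` B))%E.
Proof.
move=> cA cB u0 uv v1 Hk k0 H.
have mI : measurable (`[u, v] : set R) by exact: measurable_itv.
have mS := arc_setY_measurable cA cB.
apply: (@le_trans _ _ (\int[lebesgue_measure]_(t in `[u, v]) (speed c t)%:E)%E).
  apply: (@le_trans _ _ (\int[lebesgue_measure]_(t in `[u, v]) (cst k%:E t))%E).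
    have -> : (\int[lebesgue_measure]_(t in `[u, v]) cst k%:E t =
        k%:E * lebesgue_measure (`[u, v]%classic : set R))%E by exact: integral_cst.
    rewrite lebesgue_measure_itv/= lte_fin.
    by case: ltP => [_|vu]; [rewrite -EFinB -EFinM|rewrite mule0 lee_fin mulr_ge0_le0//; lra].
  apply: ge0_le_integral => //.
  - apply: speed_measurable => // t; rewrite /= !in_itv/=; lra.
  - by move=> t; rewrite /= in_itv/= lee_fin => tuv; apply: Hk; lra.
apply: ge0_subset_integral => //.
- by apply: speed_measurable => // t [].
- by move=> t _; rewrite lee_fin speed_ge0.
- move=> t; rewrite /= in_itv/= => tuv; split; first by rewrite /= in_itv/=; lra.
  exact: H.
Qed.

Lemma arc_length_le (A B : set M) (S : set R) (K m : R) : closed A -> closed B ->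
  (forall t : R, 0 <= t <= 1 -> speed c t <= K) -> measurable S -> 0 <= K ->
  (lebesgue_measure S <= m%:E)%E ->
  (forall t : R, 0 <= t <= 1 -> (A `+` B) (c t) -> S t) ->
  (arc_length c (A `+` B) <= (K * m)%:E)%E.
Proof.
move=> cA cB HK mS' K0 Sm H; have mS := arc_setY_measurable cA cB.
apply: (@le_trans _ _ (\int[lebesgue_measure]_(t in `[0%R, 1%R] `&` [set t : R | (A `+` B) (c t)]) (cst K%:E t))%E).
  apply: ge0_le_integral => //.
  - by move=> t _; rewrite lee_fin speed_ge0.
  - by apply: speed_measurable => // t [].
  - by move=> t [/=]; rewrite in_itv/= lee_fin => t01 _; exact: HK.
rewrite integral_cst// EFinM lee_wpmul2l ?lee_fin//.
apply: le_trans Sm; apply: le_measure; rewrite ?inE//.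
by move=> t [/=]; rewrite in_itv/=; exact: H.
Qed.

Lemma int_not01 (j : int) : ~ (0 < (j%:~R : R) < 1).
Proof.
case: j => j; first by rewrite -pmulrn ltr0n ltrn1; lia.
by rewrite NegzE rmorphN/= oppr_gt0 -pmulrn ltrn0.
Qed.

Lemma int_m2_1 (j : int) : -2 < (j%:~R : R) -> (j%:~R : R) <= 1 -> [\/ j = -1, j = 0 | j = 1].
Proof.
case: j => j.
  rewrite -pmulrn lern1 => _; case: j => [|[|//]] _; [by constructor 2|by constructor 3].
rewrite NegzE rmorphN/= ltrN2 -pmulrn ltr_nat; case: j => [|//] _ _; by constructor 1.
Qed.

(** A parameter interval containing no endpoint of the arc cannot pass from inside the arc to
    outside; the parameter shift by [k] puts it in the lift in which the arc is given. *)
Lemma arc_dichotomy p q (A : set M) (v0 r : R) : closed_arc c p q A ->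
  (forall v : R, v0 - r <= v <= v0 + r -> c v <> p /\ c v <> q) ->
  forall v w : R, v0 - r <= v <= v0 + r -> v0 - r <= w <= v0 + r -> A (c v) -> A (c w).
Proof.
move=> [a [b [ab -> pq]]] H v w vI wI [u /= uI]; rewrite in_itv/= in uI.
move=> /esym /param_inj[k vE].
have shift (z : R) : c (z - k%:~R) = c z by rewrite -(param_int (z - k%:~R) k) subrK.
have ends (z : R) : v0 - r <= z + k%:~R <= v0 + r -> z <> a /\ z <> b.
  move=> zI; have [h1 h2] := H _ zI; rewrite !param_int in h1 h2.
  by split=> e; subst z; case: pq => -[e1 e2]; congruence.
exists (w - k%:~R) => //=; rewrite in_itv/=.
apply/andP; split; rewrite leNgt; apply/negP => h.
  have [|na _] := @ends a; first by move: vI wI uI h; rewrite vE; lra.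
  by apply: na.
have [|_ nb] := @ends b; first by move: vI wI uI h; rewrite vE; lra.
by apply: nb.
Qed.

Lemma arc_in_G p q (A : set M) : closed_arc c p q A -> G p /\ G q.
Proof. by move=> [a [b [_ _ [[-> ->]|[-> ->]]]]]; split; exact: param_in. Qed.

Lemma within_near (T : topologicalType) (f : R -> T) (t0 : R) (N : set T) :
  {within `[0, 1], continuous f} -> 0 <= t0 <= 1 -> nbhs (f t0) N ->
  exists2 e : R, 0 < e & forall s : R, 0 <= s <= 1 -> `|s - t0| < e -> N (f s).
Proof.
move=> /subspace_continuousP cf t01 nN.
have tI : `[0, 1]%classic t0 by rewrite /= in_itv.
have [e e0 He] := nbhs_norm_ex (cf t0 tI N nN).
by exists e => // s s01 st; apply: (He s st); rewrite /= in_itv.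
Qed.

(* The point [phi (p t)] never meets an endpoint of the arc [C t] unless it is [q t]; as it lies
   outside the arc for [t = 0] and inside for [t = 1], it must do so by connectedness. *)
Lemma sweepout_antipodal (p q : R -> M) (C : R -> set M) : has_antipodal_map G -> sweepout c p q C ->
  exists2 t : R, 0 <= t <= 1 & rdist (p t) (q t) = diam G.
Proof.
move=> [phi [cphi phiG dphi]] [[e0 e1] [cp cq] arc cC [C0 C1]].
have [D [dD D0 _]] := diamE.
apply: contrapT => no.
have [k [K [k0 kK]]] := speed_bounds.
have pG (t : R) : 0 <= t <= 1 -> G (p t) by move=> /arc/arc_in_G[].
pose y t := phi (p t).
have yG (t : R) : 0 <= t <= 1 -> G (y t) by move=> t01; apply: phiG; exact: pG.
have yp (t : R) : 0 <= t <= 1 -> y t <> p t.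
  move=> t01 e; have := dphi _ (pG t t01); rewrite -/(y t) e dD rdistE; last exact: conn_refl.
  by rewrite dist_refl => -[h]; rewrite h ltxx in D0.
have yq (t : R) : 0 <= t <= 1 -> y t <> q t.
  by move=> t01 e; apply: no; exists t; rewrite // -e; apply: dphi; exact: pG.
have ycont (t0 : R) (N : set M) : 0 <= t0 <= 1 -> nbhs (y t0) N ->
    exists2 e : R, 0 < e & forall s : R, 0 <= s <= 1 -> `|s - t0| < e -> N (y s).
  move=> t01 nN; move/subspace_continuousP : cphi => /(_ (p t0) (pG t0 t01) N nN) h.
  have h' : nbhs (p t0) [set z | G z -> N (phi z)] := h.
  have [e e0' He] := within_near cp t01 h'.
  by exists e => // s s01 st; apply: (He s s01 st); exact: pG.
have closed_pt (x : M) : closed [set x] by apply: compact_closed; [exact: manifold_hausdorff|exact: compact_set1].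
have away (x : M) (v0 : R) : c v0 <> x -> exists2 r : R, 0 < r & forall v : R, `|v - v0| < r -> c v <> x.
  move=> vx; have oS : open [set v : R | (~` [set x]) (c v)].
    by apply: (@open_comp _ _ c) => [v _|]; [exact: param_cont|exact: closed_openC].
  by have [r r0 Hr] := nbhs_norm_ex (open_nbhs_nbhs (conj oS vx)); exists r.
have loc (t0 : R) : 0 <= t0 <= 1 -> exists2 e : R, 0 < e &
    forall s : R, 0 <= s <= 1 -> `|s - t0| < e -> (C s (y s) <-> C t0 (y t0)).
  move=> t01; have [v0 yE v01] := param_lift 0 (yG t0 t01); rewrite add0r in v01.
  have [|r1 r10 Hr1] := @away (p t0) v0; first by rewrite -yE; exact: yp.
  have [|r2 r20 Hr2] := @away (q t0) v0; first by rewrite -yE; exact: yq.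
  pose r := Num.min (Num.min r1 r2 / 2) (1 / 4).
  have [r0 rr1 rr2 r4] : [/\ 0 < r, r < r1, r < r2 & r <= 1 / 4].
    have m0 : 0 < Num.min r1 r2 by rewrite lt_min r10.
    have : Num.min r1 r2 <= r1 /\ Num.min r1 r2 <= r2 by rewrite !ge_min !lexx orbT.
    have : r <= Num.min r1 r2 / 2 by rewrite ge_min lexx.
    have : r <= 1 / 4 by rewrite ge_min lexx orbT.
    have : 0 < r by rewrite lt_min; lra.
    by move=> ? ? ? [? ?]; split=> //; lra.
  have cl (a b : R) : closed (c @` `[a, b]).
    by apply: compact_closed; [exact: manifold_hausdorff|exact: param_compact].
  pose E := c @` `[v0 - r, v0 + r].
  have nE (x : M) (r' : R) : r < r' -> (forall v : R, `|v - v0| < r' -> c v <> x) -> nbhs x (~` E).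
    move=> rr' H; apply: open_nbhs_nbhs; split; first exact/closed_openC/cl.
    by move=> [v /= vI vx]; rewrite in_itv/= in vI; apply: (H v) => //; rewrite ltr_norml; lra.
  have [d1 d10 Hd1] := within_near cp t01 (nE _ _ rr1 Hr1).
  have [d2 d20 Hd2] := within_near cq t01 (nE _ _ rr2 Hr2).
  (* The part of the circle outside the parameter window around [v0] is compact and misses [y t0],
     so nearby points [y s] have a parameter in the window. *)
  have nN : nbhs (y t0) (~` (c @` `[v0 + r, v0 + 1 - r])).
    apply: open_nbhs_nbhs; split; first exact/closed_openC/cl.
    rewrite yE => -[v /= vI /param_inj[j vj]]; rewrite in_itv/= in vI.
    by apply: (@int_not01 j); lra.
  have [d3 d30 Hd3] := ycont t0 _ t01 nN.
  (* [arc_length] integrates over [[0, 1]] only, so the interval used to detect a jump must not run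
     past parameter 1. *)
  pose rho := Num.min r (1 - v0).
  have [rho0 rr rv] : [/\ 0 < rho, rho <= r & rho <= 1 - v0].
    by rewrite /rho; clear -r0 v01; have [|] := leP r (1 - v0); split; lra.
  have arcs : exists2 d4 : R, 0 < d4 & forall s : R, 0 <= s <= 1 -> `|s - t0| < d4 ->
      (arc_length c (C s `+` C t0) < (k * rho)%:E)%E.
    have := cC t0 t01 [set z | (z < (k * rho)%:E)%E]; case.
      by apply: open_ereal_lt'; rewrite lte_fin mulr_gt0.
    move=> e e0' He; exists e => // s s01 st; apply: (He s); last by rewrite /= in_itv.
    by rewrite /= distrC.
  have [d4 d40 Hd4] := arcs.
  exists (Num.min (Num.min d1 d2) (Num.min d3 d4)); first by rewrite !lt_min d10 d20 d30.
  move=> s s01; rewrite !lt_min => /andP[/andP[s1 s2] /andP[s3 s4]].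
  have [w wE wI] := param_lift (v0 - r) (yG s s01).
  have wr : v0 - r <= w <= v0 + r.
    have := Hd3 s s01 s3; rewrite wE => nw; apply/andP; split; first by lra.
    rewrite leNgt; apply/negP => h; apply: nw; exists w => //=; rewrite in_itv/=; lra.
  have vr : v0 - r <= v0 <= v0 + r by clear -r0; lra.
  have Hs (v : R) : v0 - r <= v <= v0 + r -> c v <> p s /\ c v <> q s.
    move=> vI; have := Hd1 s s01 s1; have := Hd2 s s01 s2 => h2 h1.
    by split=> e; [apply: h1|apply: h2]; exists v; rewrite //= in_itv.
  have Ht (v : R) : v0 - r <= v <= v0 + r -> c v <> p t0 /\ c v <> q t0.
    move=> vI; have vI' (r' : R) : r < r' -> `|v - v0| < r' by clear -vI; rewrite ltr_norml; lra.
    by split; [apply: Hr1|apply: Hr2]; exact: vI'.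
  have As := arc_dichotomy (arc s s01) Hs; have At := arc_dichotomy (arc t0 t01) Ht.
  have cls := closed_arc_closed (arc s s01); have clt := closed_arc_closed (arc t0 t01).
  (* If membership changed, the whole interval from [v0] to [v0 + rho] would lie in the symmetric
     difference, whose length would be at least [k * rho]. *)
  have contra : ~ (forall v : R, v0 <= v <= v0 + rho -> (C s `+` C t0) (c v)).
    move=> h; have := Hd4 s s01 s4; rewrite ltNge => /negP; apply.
    have z1 : 0 <= v0 by case/andP: v01.
    have z2 : v0 <= v0 + rho by rewrite lerDl ltW.
    have z3 : v0 + rho <= 1 by rewrite -lerBrDl.
    have z4 (t : R) : 0 <= t <= 1 -> k <= speed c t by move=> /kK/andP[].
    by have := arc_length_ge cls clt z1 z2 z3 z4 (ltW k0) h; rewrite addrAC subrr add0r.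
  have inI (v : R) : v0 <= v <= v0 + rho -> v0 - r <= v <= v0 + r by clear -r0 rr; lra.
  rewrite wE yE; split=> h.
    apply: contrapT => h'; apply: contra => v /inI vI; left; split; first exact: As wr vI h.
    by move=> h2; apply: h'; exact: At vI vr h2.
  apply: contrapT => h'; apply: contra => v /inI vI; right; split; first exact: At vr vI h.
  by move=> h2; apply: h'; exact: As vI wr h2.
have : forall t : R, 0 <= t <= 1 -> ~ C t (y t).
  apply: real_induction => //.
  - by rewrite C0 => /= h; apply: (yp 0) => //; rewrite lexx ler01.
  - move=> t tI H; have t01 : 0 <= t <= 1 by lra.
    have [e e0' He] := loc t t01; exists e => // s st s1.
    have ss : 0 <= s <= 1 by lra.
    have sd : `|s - t| < e by rewrite ltr_norml; lra.
    by have [h _] := He s ss sd; move=> /h; apply: H; rewrite lexx andbT; case/andP: t01.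
  - move=> t tI H; have t01 : 0 <= t <= 1 by lra.
    have [e e0' He] := loc t t01.
    pose s := Num.max 0 (t - e / 2).
    have sI : 0 <= s < t by rewrite le_max lexx gt_max; lra.
    have se : t - e / 2 <= s by rewrite le_max lexx orbT.
    have ss : 0 <= s <= 1 by lra.
    have sd : `|s - t| < e by rewrite ltr_norml; lra.
    by have [_ h] := He s ss sd; move=> /h; apply: (H s).
have I1 : 0 <= (1 : R) <= 1 by rewrite ler01 lexx.
move=> /(_ 1 I1); apply; rewrite C1; have := yG 1 I1.
by case: cG => _ _ _ _ ->.
Qed.

(** Only continuity of the arcs requires work: in parameters, two of them differ by an interval of
    length [|s - t|], and the speed is bounded. *)
Lemma pivot_sweepout (s0 : R) : 0 <= s0 < 1 ->
  sweepout c (fun=> c s0) (fun t => c (s0 + t)) (fun t => c @` `[s0, s0 + t]).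
Proof.
move=> s01; have per : forall t, c (t + 1) = c t by case: cG.
have arc (t : R) : 0 <= t <= 1 -> closed_arc c (c s0) (c (s0 + t)) (c @` `[s0, s0 + t]).
  by move=> t01; exists s0, (s0 + t); split=> //; [lra|left].
split=> //.
- by split; [rewrite addr0|rewrite per].
- split; first by apply: continuous_subspaceT => t; exact: cvg_cst.
  apply: continuous_subspaceT => t; apply: (@cvg_comp _ _ _ (fun t => s0 + t) c); last exact: param_cont.
  by apply: cvgD; [exact: cvg_cst|exact: cvg_id].
- move=> t t01; have [k [K [k0 kK]]] := speed_bounds.
  have K0 : 0 <= K by have := kK 0; rewrite lexx ler01 => /(_ isT) h; lra.
  pose Ct (s : R) : set M := c @` `[s0, s0 + s].
  have bound (s : R) : 0 <= s <= 1 ->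
      (arc_length c (Ct s `+` Ct t) <= (K * (3 * `|s - t|))%:E)%E.
    move=> ss; pose lo := Num.min s t; pose hi := Num.max s t.
    have [l0 lh h1 lE] : [/\ 0 <= lo, lo <= hi, hi <= 1 & hi - lo = `|s - t|].
      rewrite /lo /hi; have [st|ts] := leP s t; first by rewrite distrC ger0_norm ?subr_ge0//; split; lra.
      by rewrite gtr0_norm ?subr_gt0//; split; lra.
    (* [arc_length] uses parameters in [[0, 1]], whereas the arcs have parameters in [[s0, s0 + 1]];
       the two differ by -1, 0 or 1, hence three translates and the factor 3. *)
    pose I (j : R) : set R := `[s0 + lo + j, s0 + hi + j]%classic.
    have mI j : measurable (I j) by exact: measurable_itv.
    have muI j : (lebesgue_measure (I j) <= (`|s - t|)%:E)%E.
      rewrite /I lebesgue_measure_itv/= lte_fin; case: ltP => _; last by rewrite lee_fin.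
      by rewrite -EFinB lee_fin -lE; lra.
    apply: (@arc_length_le _ _ (I (-1) `|` I 0 `|` I 1)) => //.
    + exact: closed_arc_closed (arc s ss).
    + exact: closed_arc_closed (arc t t01).
    + by move=> u /kK; lra.
    + by apply: measurableU => //; apply: measurableU.
    + have mI2 : measurable (I (-1) `|` I 0) by exact: measurableU.
      apply: le_trans (measureU2 (@lebesgue_measure R) mI2 (mI 1)) _.
      have -> : (3 * `|s - t|)%:E = ((`|s - t|)%:E + (`|s - t|)%:E + (`|s - t|)%:E)%E.
        by rewrite -!EFinD; congr EFin; ring.
      have h2 := measureU2 (@lebesgue_measure R) (mI (-1)) (mI 0).
      by apply: leeD; [apply: (le_trans h2); apply: leeD|]; exact: muI.
    + move=> u u01 h; have [v vI [j uE]] : exists2 v : R, s0 + lo <= v <= s0 + hi & exists j : int, u = v + j%:~R.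
        case: h => -[[v /= vI /esym/param_inj[j uE]] nv]; rewrite in_itv/= in vI.
          exists v; last by exists j.
          have : ~ v <= s0 + t by move=> h; apply: nv; exists v; rewrite ?uE ?param_int//= in_itv/=; lra.
          by move=> /negP; rewrite -ltNge /lo /hi; have [st|ts] := leP s t; lra.
        exists v; last by exists j.
        have : ~ v <= s0 + s by move=> h; apply: nv; exists v; rewrite ?uE ?param_int//= in_itv/=; lra.
        by move=> /negP; rewrite -ltNge /lo /hi; have [st|ts] := leP s t; lra.
      have jI : (-2 < (j%:~R : R)) /\ (j%:~R : R) <= 1 by lra.
      have [j1 j2] := jI; case: (int_m2_1 j1 j2) => jE; [left; left|left; right|right]; rewrite /I /= in_itv/= uE jE ?rmorphN/=; lra.
  apply: (@squeeze_cvge _ _ _ _ (fun=> 0%E) _ (fun s => (K * (3 * `|s - t|))%:E)).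
  + near=> s; rewrite integral_ge0 => [|u _]; last by rewrite lee_fin speed_ge0.
    apply: bound; near: s; apply: withinT => // s; rewrite /= in_itv/=.
  + exact: cvg_cst.
  + apply: cvg_EFin; first by near=> s.
    have c0 : (fun s : R => K * (3 * `|s - t|)) @ t --> K * (3 * `|t - t|).
      by apply: cvgM; [exact: cvg_cst|apply: cvgM; [exact: cvg_cst|exact: norm_sub_cont]].
    rewrite subrr normr0 !mulr0 in c0.
    exact: cvg_within_filter c0.
- split; last first.
    case: cG => _ _ _ _ <-; apply/seteqP; split=> [x [u _ <-]|x /(param_lift s0)[v -> vI]]; first exact: param_in.
    by exists v => //=; rewrite in_itv/=; lra.
  rewrite addr0; apply/seteqP; split=> [x [u /=]|x ->]; last by exists s0; rewrite //= in_itv/= lexx.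
  by rewrite in_itv/= => uI <-; congr c; lra.
Unshelve. all: by end_near. Qed.

Lemma width_le_pivot (x : M) (m : \bar R) : G x -> (forall y, G y -> (rdist x y <= m)%E) -> (width G <= m)%E.
Proof.
move=> /(param_lift 0)[s0 -> s01] H; rewrite add0r in s01.
apply: (@le_trans _ _ (ereal_sup [set rdist ((fun=> c s0) t) (c (s0 + t)) | t in `[0, 1]])).
  apply: ereal_inf_lbound; exists c, (fun=> c s0), (fun t => c (s0 + t)), (fun t => c @` `[s0, s0 + t]).
  by split=> //; exact: pivot_sweepout.
by apply: ge_ereal_sup => _ [t _ <-]; apply: H; exact: param_in.
Qed.

Lemma width_diam_partner (x : M) : width G = diam G -> G x -> exists y, G y /\ rdist x y = diam G.
Proof.
move=> wd Gx; have [D [dD D0 HD]] := diamE.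
have G0 : G !=set0 by exists x.
have [y] := compact_EVT_max G0 circle_compact (continuous_subspaceT (@dist_cont _ _ _ x)).
rewrite inE => Gy ymax; exists y; split=> //.
have [xy d] := HD x y Gx Gy; rewrite (rdistE xy) dD; congr EFin.
apply/eqP; rewrite eq_le d/= leNgt; apply/negP => dlt.
have : (width G <= (dist x y)%:E)%E.
  apply: (width_le_pivot Gx) => z Gz; have [xz _] := HD x z Gx Gz.
  by rewrite (rdistE xz) lee_fin; apply: ymax; rewrite inE.
by rewrite wd dD lee_fin leNgt dlt.
Qed.

End Circle.

Lemma antipodal_width (R : realType) (n : nat) (M : riemannianManifold R n) (G : set M) :
  embedded_circle G -> has_antipodal_map G -> width G = diam G.
Proof.
move=> [c cG] am; apply/eqP; rewrite eq_le; apply/andP; split.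
  apply: (width_le_pivot cG (param_in cG 0)) => y Gy.
  by apply: ereal_sup_ubound; exists (c 0), y; split=> //; exact: param_in cG 0.
apply: le_ereal_inf_tmp => _ [c' [p [q [C [c'G sw ->]]]]].
have [t t01 <-] := sweepout_antipodal c'G am sw.
by apply: ereal_sup_ubound; exists t => //=; rewrite in_itv.
Qed.

(** * Diametral pairs on the boundary of the disc *)

Section Plane.
Variable R : realType.
Implicit Types u v x : 'rV[R]_2.

Definition perp u : 'rV[R]_2 := \row_j (if j == 0 then - u 0 1 else u 0 0).

Lemma perp0 u : perp u 0 0 = - u 0 1. Proof. by rewrite mxE. Qed.
Lemma perp1 u : perp u 0 1 = u 0 0. Proof. by rewrite mxE. Qed.

Lemma frameE x u : ip x x = 1 -> u = ip x u *: x + cr x u *: perp x.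
Proof.
move=> x1; apply: rV2P; rewrite !mxE /= -[LHS]mul1r -x1 /ip /cr; ring.
Qed.

Lemma ip_frame x (a b : R) : ip x x = 1 -> ip (a *: x + b *: perp x) (a *: x + b *: perp x) = a ^+ 2 + b ^+ 2.
Proof.
move=> x1; have -> : a ^+ 2 + b ^+ 2 = (a ^+ 2 + b ^+ 2) * ip x x by rewrite x1 mulr1.
by rewrite /ip !mxE /=; ring.
Qed.

(** The inverse of the stereographic projection [stereo x]. *)
Definition istereo x (t : R) : 'rV[R]_2 := ((t ^+ 2 - 1) / (1 + t ^+ 2)) *: x + (2 * t / (1 + t ^+ 2)) *: perp x.

Lemma sqr1_gt0 (t : R) : 0 < 1 + t ^+ 2.
Proof. by rewrite ltr_pwDl// sqr_ge0. Qed.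

Lemma istereo_circle x t : ip x x = 1 -> ip (istereo x t) (istereo x t) = 1.
Proof. by move=> x1; rewrite ip_frame//; field; rewrite gt_eqF// sqr1_gt0. Qed.

Lemma istereoK x t : ip x x = 1 -> istereo x t != x /\ stereo x (istereo x t) = t.
Proof.
move=> x1; have t0 := sqr1_gt0 t.
have e1 : ip x (istereo x t) = (t ^+ 2 - 1) / (1 + t ^+ 2).
  transitivity ((t ^+ 2 - 1) / (1 + t ^+ 2) * ip x x); last by rewrite x1 mulr1.
  by rewrite /ip /istereo !mxE /=; ring.
have e2 : cr x (istereo x t) = 2 * t / (1 + t ^+ 2).
  transitivity (2 * t / (1 + t ^+ 2) * ip x x); last by rewrite x1 mulr1.
  by rewrite /ip /cr /istereo !mxE /=; ring.
have e3 : 1 - ip x (istereo x t) = 2 / (1 + t ^+ 2) by rewrite e1; field; rewrite gt_eqF.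
split; last by rewrite /stereo e3 e2; field; rewrite gt_eqF.
apply/eqP => e; have : 0 < 1 - ip x (istereo x t) by rewrite e3 divr_gt0.
by rewrite e x1 subrr ltxx.
Qed.

Lemma stereoK x u : ip x x = 1 -> ip u u = 1 -> u != x -> istereo x (stereo x u) = u.
Proof.
move=> x1 u1 ux; have cE := stereoE x1 u1 ux; set T := stereo x u in cE *.
have a0 : 0 < 1 - ip x u by rewrite subr_gt0 ip_lt1// u1.
have h : ip x u ^+ 2 + cr x u ^+ 2 = 1.
  have -> : ip x u ^+ 2 + cr x u ^+ 2 = ip x x * ip u u by rewrite /ip /cr; ring.
  by rewrite x1 u1 mulr1.
set a := 1 - ip x u in cE a0; have ipE : ip x u = 1 - a by rewrite /a; ring.
have aE : a * (1 + T ^+ 2) = 2.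
  apply: (mulfI (lt0r_neq0 a0)); apply/eqP; rewrite -subr_eq0; apply/eqP.
  have -> : a * (a * (1 + T ^+ 2)) - a * 2 = (1 - a) ^+ 2 + (a * T) ^+ 2 - 1 by ring.
  by rewrite -ipE -cE h subrr.
have T0 := sqr1_gt0 T.
have aE' : a = 2 / (1 + T ^+ 2) by rewrite -aE mulfK// gt_eqF.
rewrite [RHS](frameE u x1) cE ipE aE' /istereo; congr (_ *: _ + _ *: _); field; by rewrite gt_eqF.
Qed.

Lemma stereo_inj x u v : ip x x = 1 -> ip u u = 1 -> ip v v = 1 -> u != x -> v != x ->
  stereo x u = stereo x v -> u = v.
Proof. by move=> x1 u1 v1 ux vx e; rewrite -(stereoK x1 u1 ux) -(stereoK x1 v1 vx) e. Qed.

(* A rational parametrization of the circle minus [- u], through [u] at [s = 0]. *)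
Definition circle_arc u (s : R) : 'rV[R]_2 := ((1 - s ^+ 2) / (1 + s ^+ 2)) *: u + (2 * s / (1 + s ^+ 2)) *: perp u.

Lemma circle_arcE u s : ip u u = 1 -> ip (circle_arc u s) (circle_arc u s) = 1.
Proof. by move=> x1; rewrite ip_frame//; field; rewrite gt_eqF// sqr1_gt0. Qed.

Lemma circle_arc0 u : circle_arc u 0 = u.
Proof. by rewrite /circle_arc expr0n/= subr0 addr0 mulr0 mul0r scale0r divr1 scale1r addr0. Qed.

Lemma circle_arc_derive u : is_derive (0 : R) (1 : R) (circle_arc u) (2 *: perp u).
Proof.
have n0 : 1 + (0 : R) ^+ 2 != 0 by rewrite expr0n addr0 oner_eq0.
apply/is_derive_coordP => j.
have -> : (fun s => circle_arc u s 0 j) = (fun s : R => (1 - s ^+ 2) * (1 + s ^+ 2)^-1 * u 0 j + 2 * s * (1 + s ^+ 2)^-1 * perp u 0 j).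
  by apply/funext => s; rewrite !mxE.
apply: is_derive_eq; rewrite [in RHS]mxE /GRing.scale /=.
have -> : (1 : R) + 0 ^+ 2 = 1 by rewrite expr0n addr0.
by rewrite expr1n invr1; ring.
Qed.

End Plane.

(** * Interlacing of diametral pairs *)

Section Disc.
Variables (R : realType) (n : nat) (M : riemannianManifold R n).
Hypothesis M_complete : complete_manifold M.
Variables (f : 'rV[R]_2 -> M) (D G : set M).
Hypothesis sf : smooth_on f (@unit_disc R).
Hypothesis finj : forall u v, unit_disc u -> unit_disc v -> f u = f v -> u = v.
Hypothesis DE : D = f @` (@unit_disc R).
Hypothesis GE : G = f @` (@unit_circle R).
Hypothesis convD : totally_convex D.
Variable Dm : R.
Hypothesis Dm0 : 0 < Dm.
Hypothesis diamD : forall x y, G x -> G y -> conn x y /\ dist x y <= Dm.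

Lemma circle_disc (u : 'rV[R]_2) : ip u u = 1 -> unit_disc u.
Proof. by move=> u1; apply/unit_discE; rewrite u1. Qed.

Lemma circle_inj (u v : 'rV[R]_2) : ip u u = 1 -> ip v v = 1 -> f u = f v -> u = v.
Proof. by move=> u1 v1; apply: finj; exact: circle_disc. Qed.

Lemma circle_G u : ip u u = 1 -> G (f u).
Proof. by move=> u1; rewrite GE; exists u => //; apply/unit_circleE. Qed.

Lemma circle_G_inv x : G x -> exists2 u, ip u u = 1 & x = f u.
Proof. by rewrite GE => -[u /unit_circleE u1 <-]; exists u. Qed.

Lemma disc_D u : unit_disc u -> D (f u).
Proof. by move=> u1; rewrite DE; exists u. Qed.

Lemma disc_cont u : unit_disc u -> f x @[x --> u] --> f u.
Proof. by have [U [_ UD [cf _]]] := sf; move=> /UD; exact: cf. Qed.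

Lemma ip_cont (w : 'rV[R]_2) : continuous (ip w).
Proof.
move=> u; have c (j : 'I_2) : (fun v : 'rV[R]_2 => v 0 j) @ u --> u 0 j by exact: coord_continuous.
exact: (cvgD (cvgM (cvg_cst (w 0 0)) (c 0)) (cvgM (cvg_cst (w 0 1)) (c 1))).
Qed.

Lemma ip2_cont : continuous (fun u : 'rV[R]_2 => ip u u).
Proof.
move=> u; have c (j : 'I_2) : (fun v : 'rV[R]_2 => v 0 j) @ u --> u 0 j by exact: coord_continuous.
exact: (cvgD (cvgM (c 0) (c 0)) (cvgM (c 1) (c 1))).
Qed.

Lemma unit_disc_compact : compact (@unit_disc R).
Proof.
apply: (subclosed_compact _ (@compact_ball R 2 0 1)).
  have -> : @unit_disc R = [set u | ip u u <= 1] by apply/seteqP; split=> u /unit_discE.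
  by apply: (@closed_comp _ _ (fun u => ip u u) [set t | t <= 1]) => [u _|]; [exact: ip2_cont|exact: closed_le].
move=> u /unit_discE; rewrite /ip /= subr0 => h; apply: norm_rV_le => // j; rewrite ler_norml.
have [a b] : 0 <= u 0 0 * u 0 0 /\ 0 <= u 0 1 * u 0 1 by rewrite -!expr2 !sqr_ge0.
have key (t : R) : t * t <= 1 -> -1 <= t <= 1 by move=> tt; apply/andP; split; nra.
case: j => -[|[|//]] k; apply: key.
  by rewrite (_ : Ordinal k = 0); [lra|exact: val_inj].
by rewrite (_ : Ordinal k = 1); [lra|exact: val_inj].
Qed.

Lemma image_compact (K : set 'rV[R]_2) : compact K -> K `<=` @unit_disc R -> compact (f @` K).
Proof.
move=> cK KD; apply: continuous_compact => //.
by apply: continuous_in_subspaceT => u; rewrite inE => /KD; exact: disc_cont.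
Qed.

Lemma D_compact : compact D.
Proof. by rewrite DE; apply: image_compact => //; exact: unit_disc_compact. Qed.

Lemma G_compact : compact G.
Proof.
rewrite GE; apply: image_compact; last by move=> u /unit_circleE; exact: circle_disc.
apply: (subclosed_compact _ unit_disc_compact); last by move=> u /unit_circleE; exact: circle_disc.
have -> : @unit_circle R = [set u | ip u u = 1] by apply/seteqP; split=> u /unit_circleE.
by apply: (@closed_comp _ _ (fun u => ip u u) [set t | t = 1]) => [u _|]; [exact: ip2_cont|exact: closed_eq].
Qed.

(** Continuity of the inverse of [f]: the image of the part of the disc far from [u] is compact,
    hence closed, and misses [f u]. *)
Lemma disc_inverse (u : 'rV[R]_2) (e : R) : unit_disc u -> 0 < e ->
  \forall y \near f u, forall v, unit_disc v -> f v = y -> `|v - u| < e.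
Proof.
move=> Du e0; pose K := @unit_disc R `&` [set v | e <= `|v - u|].
have cK : compact K.
  apply: compact_closedI; first exact: unit_disc_compact.
  by apply: (@closed_comp _ _ (fun v : 'rV[R]_2 => `|v - u|) [set t : R | e <= t]) => [v _|]; [exact: norm_sub_cont|exact: closed_ge].
have cfK : closed (f @` K).
  by apply: compact_closed; [exact: manifold_hausdorff|apply: image_compact => // v []].
have : nbhs (f u) (~` (f @` K)).
  apply: open_nbhs_nbhs; split; first exact: closed_openC.
  by move=> [v [Dv /= ve] /(finj Dv Du) vu]; move: ve; rewrite vu subrr normr0 leNgt e0.
apply: filterS => y nK v Dv vy; rewrite ltNge; apply/negP => ve.
by apply: nK; exists v.
Qed.

Lemma disc_conn x y : D x -> D y -> conn x y.
Proof.
rewrite DE => -[u Du <-] [v Dv <-]; have [U [oU UD smU]] := sf.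
pose s (t : R) := u + t *: (v - u).
have sD (t : R) : 0 <= t <= 1 -> unit_disc (s t).
  move=> t01; apply/unit_discE; move: Du Dv => /unit_discE Du /unit_discE Dv.
  have -> : ip (s t) (s t) = (1 - t) * ip u u + t * ip v v - t * (1 - t) * ip (v - u) (v - u).
    by rewrite /ip /s !mxE; ring.
  have : 0 <= ip (v - u) (v - u) by rewrite /ip -!expr2 addr_ge0// sqr_ge0.
  have : 0 <= t * (1 - t) by rewrite mulr_ge0; lra.
  have : (1 - t) * ip u u <= (1 - t) * 1 by rewrite ler_wpM2l//; lra.
  have : t * ip v v <= t * 1 by rewrite ler_wpM2l//; lra.
  move=> h1 h2 h3 h4; have := mulr_ge0 h3 h4; lra.
have cks k : Ck setT k s by apply: Ck_line; exact: openT.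
have sm : smooth_on (f \o s) `[0, 1].
  have cs : continuous s by move=> t; have [c0 _] := cks 0%N; exact: c0.
  have oS : open (s @^-1` U) by apply: open_comp => // t _; exact: cs.
  exists (s @^-1` U); split=> //; first by move=> t; rewrite /= in_itv/= => /sD/UD.
  have cc t : (s @^-1` U) t -> f (s r) @[r --> t] --> f (s t).
    by move=> Ut; have [cf _] := smU; exact: (cvg_comp s f (cs t) (cf _ Ut)).
  split=> // i k; have oW : open (s @^-1` U `&` (f \o s) @^-1` dom i).
    by apply: open_preimage_within => //; exact: dom_open.
  apply: (Ck_compv (smooth_map_open oU smU i) oW (f := chart i \o f) (g := s)) => //.
    exact: smooth_map_Ck.
  by apply: Ck_sub (cks k).
have [L [L0 dL _]] := length_primitive sm.
have := pathl_piece sm dL; rewrite /= /s scale0r addr0 scale1r addrC subrK => p.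
by exists (L 1 - L 0).
Qed.

Lemma mgeo_in_D L g : 0 <= L -> mgeo L g -> D (g 0) -> D (g L) -> forall t : R, 0 <= t <= L -> D (g t).
Proof.
move=> L0 mg D0 DL t tL; have [L00|L00] := eqVneq L 0.
  by rewrite (_ : t = 0)//; lra.
have Lp : 0 < L by rewrite lt_neqAle eq_sym L00.
have [h [gh hg]] := mgeo_geodesic Lp mg.
rewrite -hg//; apply: (convD L0 gh) => //; rewrite hg ?lexx ?L0 ?andbT//.
Qed.

Lemma disc_mgeo x y : D x -> D y ->
  exists g, [/\ mgeo (dist x y) g, g 0 = x, g (dist x y) = y & forall t : R, 0 <= t <= dist x y -> D (g t)].
Proof.
move=> Dx Dy; have [g [mg g0 g1]] := mgeo_ex M_complete (disc_conn Dx Dy).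
exists g; split=> //; apply: mgeo_in_D => //; [exact: dist_ge0|by rewrite g0|by rewrite g1].
Qed.

Lemma disc_choice L g : (forall t : R, 0 <= t <= L -> D (g t)) -> exists k : R -> 'rV[R]_2,
  forall t : R, 0 <= t <= L -> unit_disc (k t) /\ f (k t) = g t.
Proof.
move=> H; have H' (t : R) : exists u : 'rV[R]_2, 0 <= t <= L -> unit_disc u /\ f u = g t.
  have [tL|tL] := pselect (0 <= t <= L); last by exists 0.
  by have := H t tL; rewrite DE => -[u Du fu]; exists u.
by have [k Hk] := choice H'; exists k.
Qed.

(** A minimizing curve stays in [D] by total convexity; it is lifted to the plane disc pointwise,
    and the lift is continuous by [disc_inverse]. Crossing arguments thus take place in the
    plane. *)
Lemma disc_curve x y : D x -> D y -> x <> y -> exists A : R -> 'rV[R]_2,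
  [/\ {within `[0, 1], continuous A}, forall t : R, 0 <= t <= 1 -> unit_disc (A t),
      f (A 0) = x, f (A 1) = y &
      forall t : R, 0 <= t <= 1 -> conn x (f (A t)) /\ dist x (f (A t)) + dist (f (A t)) y = dist x y].
Proof.
move=> Dx Dy xy; set L := dist x y; have [g [mg g0 g1 gD]] := disc_mgeo Dx Dy.
have L0 : 0 < L.
  by rewrite lt_neqAle dist_ge0 andbT eq_sym; apply/eqP => /(dist0_eq (disc_conn Dx Dy)).
have [k Hk] := disc_choice gD.
have tL (t : R) : 0 <= t <= 1 -> 0 <= L * t <= L.
  by move=> /andP[t0 t1]; rewrite mulr_ge0 ?(ltW L0)//= ler_piMr// ltW.
have I0 : 0 <= (0 : R) <= 1 by rewrite lexx ler01.
have I1 : 0 <= (1 : R) <= 1 by rewrite lexx ler01.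
have L00 : 0 <= (0 : R) <= L by rewrite lexx ltW.
have LL : 0 <= L <= L by rewrite lexx ltW.
exists (fun t => k (L * t)); split.
- apply/subspace_continuousP => t; rewrite /= in_itv/= => t01.
  have [Dk fk] := Hk _ (tL t t01).
  apply/cvgrPdist_lt => e e0; have nk := disc_inverse Dk e0; rewrite fk in nk.
  have [d d0 Hd] := mgeo_near mg (tL t t01) nk.
  apply: (@ex_nbhs_norm R R t _ (d / L)); first by rewrite divr_gt0.
  move=> s st; rewrite /= in_itv/= => s01; have [Ds fs] := Hk _ (tL s s01).
  rewrite distrC; apply: Hd (Ds) fs; first exact: tL.
  by rewrite -mulrBr normrM gtr0_norm// mulrC -ltr_pdivlMr.
- by move=> t /tL/Hk[].
- by rewrite mulr0; have [_ ->] := Hk 0 L00.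
- by rewrite mulr1; have [_ ->] := Hk L LL.
- move=> t /tL tt; have [_ ->] := Hk _ tt; have [c1 d1] := mg _ _ L00 tt; have [c2 d2] := mg _ _ tt LL.
  rewrite g0 in c1 d1; rewrite g1 in d2; split=> //; rewrite d1 d2 sub0r normrN distrC.
  by rewrite !ger0_norm; case/andP: tt; lra.
Qed.

Lemma cross_point (x m p q : 'rV[R]_2) : ip x x = 1 -> ip m m = 1 -> ip p p = 1 -> ip q q = 1 ->
  m != x -> p != x -> q != x -> stereo x p < stereo x m < stereo x q ->
  exists z, [/\ conn (f x) z, dist (f x) z + dist z (f m) = dist (f x) (f m) &
    dist (f p) z + dist z (f q) = dist (f p) (f q)].
Proof.
move=> x1 m1 p1 q1 mx px qx pmq.
have Dc u : ip u u = 1 -> D (f u) by move=> u1; apply: disc_D; exact: circle_disc.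
have [|A [cA AD A0 A1 HA]] := disc_curve (Dc x x1) (Dc m m1).
  by move=> /(circle_inj x1 m1) e; rewrite e eqxx in mx.
have [|B [cB BD B0 B1 HB]] := disc_curve (Dc p p1) (Dc q q1).
  by move=> /(circle_inj p1 q1) e; move: pmq; rewrite e => /andP[h1 h2]; have := lt_trans h1 h2; rewrite ltxx.
have I0 : 0 <= (0 : R) <= 1 by rewrite lexx ler01.
have I1 : 0 <= (1 : R) <= 1 by rewrite lexx ler01.
have AB (t : R) : 0 <= t <= 1 -> unit_disc (A t) /\ unit_disc (B t) by move=> t01; split; [exact: AD|exact: BD].
have A0' := finj (AD 0 I0) (circle_disc x1) A0; have A1' := finj (AD 1 I1) (circle_disc m1) A1.
have B0' := finj (BD 0 I0) (circle_disc p1) B0; have B1' := finj (BD 1 I1) (circle_disc q1) B1.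
have [s [t [s01 t01 st]]] := crossing x1 m1 p1 q1 mx px qx pmq cA cB AB A0' A1' B0' B1'.
have [cs ds] := HA s s01; have [ct dt] := HB t t01.
by exists (f (A s)); split=> //; rewrite st.
Qed.

(* If diametral pairs did not interlace, two crossing minimizing geodesics would branch. *)
Lemma cross_contra x m p q z : G x -> G m -> G p -> G q -> m <> p -> q <> x -> conn x z ->
  dist x z + dist z m = dist x m -> dist p z + dist z q = dist p q ->
  dist x p = Dm -> dist m q = Dm -> False.
Proof.
move=> Gx Gm Gp Gq mp qx xz h1 h2 h3 h4.
have [xm dxm] := diamD Gx Gm; have [pq dpq] := diamD Gp Gq.
have [xp _] := diamD Gx Gp; have [mq _] := diamD Gm Gq.
have zm := conn_trans (conn_sym xz) xm; have zp := conn_trans (conn_sym xz) xp.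
have zq := conn_trans zm mq.
have t1 := dist_tri xz zp; have t2 := dist_tri (conn_sym zm) zq.
rewrite h3 in t1; rewrite h4 (dist_sym m) in t2; rewrite (dist_sym p) in h2.
have e1 : dist x m = Dm by lra.
have e2 : dist x z + dist z p = Dm by lra.
have e3 : dist z q = dist x z by lra.
have e4 : dist z m = dist z p by lra.
have [a0|a0] := eqVneq (dist x z) 0.
  apply: qx; rewrite (dist0_eq xz a0); apply/esym/dist0_eq => //.
  by rewrite e3.
have ap : 0 < dist x z by rewrite lt_neqAle dist_ge0 eq_sym a0.
have [g1 [mg1 g10 g11]] := mgeo_ex M_complete xz.
have [g2 [mg2 g20 g21]] := mgeo_ex M_complete zm.
have [g3 [mg3 g30 g31]] := mgeo_ex M_complete zp.
have c2 : mgeo (dist x z + dist z m) (fun t => if t <= dist x z then g1 t else g2 (t - dist x z)).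
  by apply: mgeo_cat => //; [exact: dist_ge0|exact: dist_ge0|rewrite g11 g20|rewrite g10 g21 h1].
have c3 : mgeo (dist x z + dist z p) (fun t => if t <= dist x z then g1 t else g3 (t - dist x z)).
  by apply: mgeo_cat => //; [exact: dist_ge0|exact: dist_ge0|rewrite g11 g30|rewrite g10 g31 h3 e2].
rewrite e4 in c2; set L := dist x z + dist z p in c2 c3 e2 *.
have aL : dist x z <= L by rewrite lerDl dist_ge0.
have L0 : 0 <= L <= L by rewrite lexx e2 ltW.
have agree (t : R) : 0 <= t <= dist x z ->
    (if t <= dist x z then g1 t else g2 (t - dist x z)) = (if t <= dist x z then g1 t else g3 (t - dist x z)).
  by move=> /andP[_ tz]; rewrite tz.
have := mgeo_unique ap aL c2 c3 agree L0.
have [Lz|Lz] := leP L (dist x z).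
  have b0 : dist z p = 0 by have := dist_ge0 z p; rewrite /L in Lz; lra.
  by move=> _; apply: mp; rewrite -(dist0_eq zp b0); apply/esym/dist0_eq; rewrite // e4.
by rewrite /L addrAC subrr add0r -{1}e4 g21 g31; exact: mp.
Qed.

(** If the pairs [x, a] and [b, c] did not interlace, they would be opposite sides of a
    quadrilateral whose diagonals cross. The diagonals are no longer than [Dm], which is the
    situation excluded by [cross_contra]. *)
Lemma stereo_between (x a b c : 'rV[R]_2) : ip x x = 1 -> ip a a = 1 -> ip b b = 1 -> ip c c = 1 ->
  a != x -> b != x -> c != x -> b != a -> c != a ->
  dist (f x) (f a) = Dm -> dist (f b) (f c) = Dm -> stereo x b < stereo x c ->
  stereo x b < stereo x a < stereo x c.
Proof.
move=> x1 a1 b1 c1 ax bx cx ba ca xa bc lt_bc.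
have nf u v : ip u u = 1 -> ip v v = 1 -> u != v -> f u <> f v.
  by move=> u1 v1 uv /(circle_inj u1 v1) e; rewrite e eqxx in uv.
have ns u : ip u u = 1 -> u != x -> u != a -> stereo x u != stereo x a.
  by move=> u1 ux ua; apply: contra ua => /eqP /stereo_inj-> //.
have := ns b b1 bx ba; have := ns c c1 cx ca.
have G_ u : ip u u = 1 -> G (f u) := @circle_G u.
rewrite !neq_lt => /orP[ca'|ac] /orP[ba'|ab]; rewrite ?ba' ?ac//.
- have o : stereo x b < stereo x c < stereo x a by rewrite lt_bc ca'.
  have [z [xz h1 h2]] := cross_point x1 c1 b1 a1 cx bx ax o.
  exfalso; apply: (@cross_contra (f x) (f c) (f a) (f b) z) => //; try exact: G_.
  + exact: nf.
  + exact: nf.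
  + by rewrite addrC (dist_sym z (f b)) (dist_sym (f a) z) h2 dist_sym.
  + by rewrite dist_sym.
- by have := lt_trans ca' (lt_trans ab lt_bc); rewrite ltxx.
- have o : stereo x a < stereo x b < stereo x c by rewrite ab lt_bc.
  have [z [xz h1 h2]] := cross_point x1 b1 a1 c1 bx ax cx o.
  exfalso; apply: (@cross_contra (f x) (f b) (f a) (f c) z) => //; try exact: G_.
  + exact: nf.
  + exact: nf.
Qed.

Hypothesis partner : forall x, G x -> exists y, G y /\ dist x y = Dm.

Lemma partner_neq u v : ip u u = 1 -> dist (f u) (f v) = Dm -> v != u.
Proof. by move=> u1 h; apply/eqP => e; move: Dm0; rewrite -h e dist_refl ltxx. Qed.

Lemma partner_arc (x y1 y2 u : 'rV[R]_2) : ip x x = 1 -> ip y1 y1 = 1 -> ip y2 y2 = 1 -> ip u u = 1 ->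
  dist (f x) (f y1) = Dm -> dist (f x) (f y2) = Dm -> u != x ->
  stereo x y1 < stereo x u < stereo x y2 -> dist (f x) (f u) = Dm.
Proof.
move=> x1 y11 y21 u1 d1 d2 ux /andP[l1 l2].
have y1x := partner_neq x1 d1; have y2x := partner_neq x1 d2.
have [_ [/circle_G_inv[w w1 ->] uw]] := partner (circle_G u1).
have wu := partner_neq u1 uw.
have uy1 : u != y1 by apply/eqP => e; rewrite e ltxx in l1.
have uy2 : u != y2 by apply/eqP => e; rewrite e ltxx in l2.
have [wx|wx] := eqVneq w x; first by rewrite -wx dist_sym.
exfalso.
have nlt a b : ip a a = 1 -> ip b b = 1 -> a != x -> b != x -> a != b -> (stereo x a < stereo x b) || (stereo x b < stereo x a).
  by move=> a1 b1 ax bx ab; rewrite -neq_lt; apply: contra ab => /eqP/stereo_inj->.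
(* The pairs [x, a] and [u, w] interlace, so [a] lies between [u] and [w] as seen from [x]. This
   cannot hold for both [y1] and [y2], which are on opposite sides of [u]. *)
have bt (a : 'rV[R]_2) : ip a a = 1 -> dist (f x) (f a) = Dm -> u != a -> w != a ->
    stereo x u < stereo x a < stereo x w \/ stereo x w < stereo x a < stereo x u.
  move=> a1 da ua wa; have ax := partner_neq x1 da.
  case/orP: (nlt w u w1 u1 wx ux wu) => h; [right|left].
    by apply: stereo_between => //; rewrite dist_sym.
  exact: stereo_between.
have [e|wy1] := eqVneq w y1.
  have wy2 : w != y2 by apply/eqP => e'; have := lt_trans l1 l2; rewrite -e e' ltxx.
  by case: (bt y2 y21 d2 uy2 wy2) => /andP[h1 h2]; rewrite ?e in h1 h2; have := lt_trans l1 l2; lra.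
have [e|wy2] := eqVneq w y2.
  by case: (bt y1 y11 d1 uy1 wy1) => /andP[h1 h2]; rewrite ?e in h1 h2; have := lt_trans l1 l2; lra.
by case: (bt y1 y11 d1 uy1 wy1) => /andP[h1 h2]; case: (bt y2 y21 d2 uy2 wy2) => /andP[h3 h4]; lra.
Qed.

End Disc.

(** * First variation at the boundary *)

Section Velocity.
Variables (R : realType) (n : nat).

Lemma derive_approx (W : normedModType R) (c : R -> W) (x : R) (l : W) (e : R) :
  is_derive x (1 : R) c l -> 0 < e ->
  exists2 d : R, 0 < d & forall s : R, `|s - x| < d -> `|c s - c x - (s - x) *: l| <= e * `|s - x|.
Proof.
move=> [dc <-] e0.
have := dc; rewrite /derivable => /cvg_ex[l' cl].
have lE : 'D_1 c x = l' by rewrite /derive; exact: cvg_lim.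
move/cvgrPdist_le : cl => /(_ e e0) h.
have [d d0 Hd] := nbhs_norm_ex h.
exists d => // s sd; have [->|sx] := eqVneq s x; first by rewrite !subrr scale0r subr0 !normr0 mulr0.
have sx0 : s - x != 0 by rewrite subr_eq0.
have := Hd (s - x); rewrite subr0 => /(_ sd sx0) /=.
rewrite [(s - x) *: 1]mulr1 subrK => h1.
have -> : c s - c x - (s - x) *: 'D_1 c x = - ((s - x) *: (l' - (s - x)^-1 *: (c s - c x))).
  by rewrite lE scalerBr scalerA divff// scale1r opprB.
by rewrite normrN normrZ mulrC ler_wpM2r.
Qed.

Lemma frechet m p (U : set 'rV[R]_m) (F : 'rV[R]_m -> 'rV[R]_p) (u : 'rV[R]_m) : open U -> Ck U 1 F -> U u ->
  exists J : 'M[R]_(m, p), (forall h, 'D_h F u = h *m J) /\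
  forall e : R, 0 < e -> exists2 d : R, 0 < d & forall h : 'rV[R]_m, `|h| < d ->
    `|F (u + h) - F u - h *m J| <= e * `|h|.
Proof.
move=> oU CF Uu; pose J : 'M[R]_(m, p) := \matrix_(k, j) 'D_(delta_mx 0 k) (fun v => F v 0 j) u.
have CFj j : Ck U 1 (fun v => F v 0 j) by move/Ck_coord : CF; exact.
exists J; split=> [h|e e0].
  apply/rowP => j; have [_ /(_ h)[dF _]] := CkS CF.
  rewrite derive_coord; last exact: dF.
  rewrite (derive_lin h oU (CFj j) Uu) mxE; apply: eq_bigr => k _; by rewrite mxE.
have /nbhs_norm_ex[d d0 Hd] : \forall h \near (0 : 'rV[R]_m), forall j : 'I_p,
    `|F (u + h) 0 j - F u 0 j - \sum_k h 0 k * 'D_(delta_mx 0 k) (fun v => F v 0 j) u| <= e * `|h|.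
  near=> h => j; move: j; near: h; apply: filter_forall => j; exact: C1_approx oU (CFj j) Uu e0.
exists d => // h hd; apply: norm_rV_le => [|j]; first by rewrite mulr_ge0// ltW.
have := Hd h; rewrite subr0 => /(_ hd j); rewrite !mxE.
by congr (`|_ - _| <= _); apply: eq_bigr => k _; rewrite mxE.
Unshelve. all: by end_near. Qed.

Lemma mulmx_cont m p (J : 'M[R]_(m, p)) : continuous (fun w : 'rV[R]_m => w *m J).
Proof.
move=> w; apply/cvg_coord => j.
rewrite (_ : (fun v : 'rV[R]_m => (v *m J) 0 j) = (fun v => \sum_k v 0 k * J k j)); last first.
  by apply/funext => v; rewrite mxE.
rewrite mxE.
have cs : continuous (fun v : 'rV[R]_m => \sum_k v 0 k * J k j).
  apply: continuous_big => [|k _ v]; first exact: add_continuous.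
  have c0 : (fun v : 'rV[R]_m => v 0 k) @ v --> v 0 k by exact: coord_continuous.
  exact: (cvgM c0 (cvg_cst (J k j))).
exact: cs.
Qed.

Lemma mulmx_lower p (J : 'M[R]_(2, p)) : (forall w : 'rV[R]_2, w != 0 -> w *m J != 0) ->
  exists2 m : R, 0 < m & forall w : 'rV[R]_2, m * `|w| <= `|w *m J|.
Proof.
move=> Jinj; pose S : set 'rV[R]_2 := [set w | `|w - 0| <= 1] `&` [set w | 1 <= `|w - 0|].
have cS : compact S.
  apply: compact_closedI; first exact: compact_ball.
  by apply: (@closed_comp _ _ (fun w : 'rV[R]_2 => `|w - 0|) [set t : R | 1 <= t]) => [v _|]; [exact: norm_sub_cont|exact: closed_ge].
have S0 : S !=set0.
  exists (const_mx 1); rewrite /S /= subr0.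
  have le1 : `|const_mx 1 : 'rV[R]_2| <= 1 by apply: norm_rV_le => // j; rewrite mxE normr1.
  by split=> //; rewrite /=; have := coord_norm_le (const_mx 1 : 'rV[R]_2) 0; rewrite mxE normr1.
have cJ : continuous (fun w : 'rV[R]_2 => `|w *m J|).
  by move=> w; apply: (@cvg_comp _ _ _ (fun w => w *m J) (fun z => `|z|)); [exact: mulmx_cont|exact: norm_continuous].
have [w] := compact_EVT_min S0 cS (continuous_subspaceT cJ).
rewrite inE /S /= subr0 => -[w1 w2] wmin.
have w0 : w != 0 by apply/eqP => e; rewrite e normr0 in w2; lra.
exists `|w *m J|; first by rewrite normr_gt0; exact: Jinj.
move=> v; have [->|v0] := eqVneq v 0; first by rewrite normr0 mulr0.
have vn : 0 < `|v| by rewrite normr_gt0.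
have nv : `| (`|v|)^-1 *: v| = 1 by rewrite normrZ normfV normr_id mulVf// gt_eqF.
have := wmin ((`|v|)^-1 *: v); rewrite inE /S /= subr0 nv => /(_ (conj (lexx 1) (lexx 1))).
by rewrite -scalemxAl normrZ normfV normr_id mulrC ler_pdivlMr.
Qed.

(* A curve running inside the disc up to its boundary point [u] arrives with outward velocity;
   compactness replaces the differentiability of the inverse of [F]. *)
Lemma outward_velocity (U : set 'rV[R]_2) (F : 'rV[R]_2 -> 'rV[R]_n) (u : 'rV[R]_2) (c : R -> 'rV[R]_n) l :
  open U -> Ck U 1 F -> U u -> (forall w, w != 0 -> 'D_w F u != 0) -> ip u u = 1 ->
  is_derive (1 : R) (1 : R) c l -> c 1 = F u ->
  (forall d : R, 0 < d -> exists2 t0 : R, t0 < 1 & forall t : R, t0 < t < 1 ->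
    exists k, [/\ ip k k <= 1, `|k - u| < d & F k = c t]) ->
  exists2 eta, 'D_eta F u = l & 0 <= ip eta u.
Proof.
move=> oU CF Uu im u1 dc cu H; have [J [JE Jap]] := frechet oU CF Uu.
have [|m m0 mJ] := @mulmx_lower n J; first by move=> w /im; rewrite JE.
(* A bound for the rescaled displacements in the disc: the Jacobian is bounded below by [m], and an
   error of at most [m / 2] can be absorbed. *)
pose C := 2 * (`|l| + 1) / m; have C0 : 0 <= C by rewrite divr_ge0 ?mulr_ge0 ?addr_ge0// ltW.
pose K : set 'rV[R]_2 := [set w | `|w - 0| <= C] `&` [set w | ip u w <= 0].
have cK : compact K.
  apply: compact_closedI; first exact: compact_ball.
  by apply: (@closed_comp _ _ (ip u) [set t : R | t <= 0]) => [v _|]; [exact: ip_cont|exact: closed_le].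
have K0 : K !=set0 by exists 0; rewrite /K /= subrr normr0; split=> //; rewrite /= /ip !mxE !mulr0 addr0.
have cJ : continuous (fun w : 'rV[R]_2 => `|w *m J + l|).
  move=> w; apply: (@cvg_comp _ _ _ (fun w => w *m J + l) (fun z => `|z|)); last exact: norm_continuous.
  exact: (cvgD (@mulmx_cont _ _ J w) (cvg_cst l)).
have [w] := compact_EVT_min K0 cK (continuous_subspaceT cJ).
rewrite inE /K /= subr0 => -[_ wu] wmin.
have small (e : R) : 0 < e -> e <= m / 2 -> e <= 1 -> `|w *m J + l| <= e * C + e.
  move=> e0 em e1; have [d1 d10 Hd1] := Jap e e0.
  have [d2 d20 Hd2] := derive_approx dc e0.
  have [t0 t01 Ht] := H d1 d10.
  pose t := 1 - Num.min (d2 / 2) ((1 - t0) / 2).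
  have [ta tb tc] : [/\ t0 < t, t < 1 & 1 - t < d2].
    rewrite /t; have : 0 < Num.min (d2 / 2) ((1 - t0) / 2) by rewrite lt_min; lra.
    have : Num.min (d2 / 2) ((1 - t0) / 2) <= d2 / 2 by rewrite ge_min lexx.
    have : Num.min (d2 / 2) ((1 - t0) / 2) <= (1 - t0) / 2 by rewrite ge_min lexx orbT.
    by move=> *; split; lra.
  have [|k [k1 ku Fk]] := Ht t; first by rewrite ta.
  set ka := k - u in ku *; have kE : k = u + ka by rewrite /ka addrC subrK.
  have a1 := Hd1 ka ku; rewrite -kE Fk -cu in a1.
  have a2 := Hd2 t; rewrite distrC gtr0_norm ?subr_gt0// in a2; have {}a2 := a2 tc.
  pose tau := 1 - t; have tau0 : 0 < tau by rewrite subr_gt0.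
  rewrite -/tau in a2; have tE : t - 1 = - tau by rewrite /tau opprB.
  rewrite tE scaleNr opprK in a2.
  have cN : `|c t - c 1| <= (`|l| + 1) * tau.
    have -> : c t - c 1 = (c t - c 1 + tau *: l) - tau *: l by rewrite addrK.
    apply: le_trans (ler_normB _ _) _; rewrite normrZ (gtr0_norm tau0).
    have : e * tau <= 1 * tau by rewrite ler_wpM2r// ltW.
    lra.
  have kaC : `|ka| <= C * tau.
    have b1 : `|ka *m J| <= `|c t - c 1| + e * `|ka|.
      have -> : ka *m J = (c t - c 1) - (c t - c 1 - ka *m J) by rewrite subKr.
      by apply: le_trans (ler_normB _ _) _; rewrite lerD2l.
    have b2 := mJ ka; have b3 : e * `|ka| <= m / 2 * `|ka| by rewrite ler_wpM2r.
    have b4 : m * `|ka| <= 2 * ((`|l| + 1) * tau) by lra.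
    by rewrite /C -mulrA [_^-1 * _]mulrC !mulrA ler_pdivlMr// mulrC -!mulrA; lra.
  (* The displacement from [u] divided by the remaining time. It points inwards because the curve is
     in the disc, and its image under the Jacobian nearly equals [- l]; so the minimum of
     [|w J + l|] over the inward vectors in [K] is 0. *)
  pose w' := tau^-1 *: ka.
  have w'K : K w'.
    rewrite /K /= subr0 /w' normrZ normfV (gtr0_norm tau0); split.
      by rewrite mulrC ler_pdivrMr.
    have -> : ip u (tau^-1 *: ka) = tau^-1 * (ip u k - ip u u) by rewrite /ip /ka !mxE; ring.
    rewrite u1 mulr_ge0_le0 ?invr_ge0 ?(ltW tau0)// subr_le0.
    have : 0 <= ip (k - u) (k - u) by rewrite /ip -!expr2 addr_ge0// sqr_ge0.
    have -> : ip (k - u) (k - u) = ip k k - 2 * ip u k + ip u u by rewrite /ip !mxE; ring.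
    by rewrite u1; lra.
  have := wmin w'; rewrite inE => /(_ w'K) h; apply: le_trans h _.
  have -> : w' *m J + l = tau^-1 *: ((c t - c 1 + tau *: l) - (c t - c 1 - ka *m J)).
    rewrite opprB [_ + (ka *m J - _)]addrC addrA subrK.
    by rewrite scalerDr scalerA mulVf ?gt_eqF// scale1r /w' scalemxAl.
  rewrite normrZ normfV (gtr0_norm tau0) mulrC ler_pdivrMr//.
  apply: le_trans (ler_normB _ _) _.
  have : e * `|ka| <= e * (C * tau) by rewrite ler_wpM2l// ltW.
  lra.
have wl : w *m J + l = 0.
  apply/eqP; rewrite -normr_le0; apply/ler_addgt0Pr => e e0; rewrite add0r.
  pose e' := Num.min (Num.min (m / 2) 1) (e / (C + 1)).
  have [p0 p1 p2 p3] : [/\ 0 < e', e' <= m / 2, e' <= 1 & e' <= e / (C + 1)].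
    rewrite !lt_min !ge_min !lexx !orbT; split=> //=.
    by rewrite (divr_gt0 m0)// ltr01/= divr_gt0// ltr_wpDl.
  apply: le_trans (small e' p0 p1 p2) _.
  by move: p3; rewrite ler_pdivlMr ?ltr_wpDl//; lra.
exists (- w); last first.
  have -> : ip (- w) u = - ip u w by rewrite /ip !mxE; ring.
  by rewrite oppr_ge0.
by rewrite JE mulNmx; apply/eqP; rewrite eq_sym -addr_eq0 addrC wl.
Qed.

(** In the plane tangent to the disc, the vectors orthogonal to the boundary form a line, the norm
    leaves two opposite ones, and the sign selects one. A zero normal component is impossible: the
    vector would be tangent and orthogonal to itself. *)
Lemma outward_normal_unique (U : set 'rV[R]_2) (F : 'rV[R]_2 -> 'rV[R]_n) (u : 'rV[R]_2) (g : 'M[R]_n) (eta eta' : 'rV[R]_2) (E : R) :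
  open U -> Ck U 1 F -> U u -> (forall w, w != 0 -> 'D_w F u != 0) -> ip u u = 1 ->
  g^T = g -> (forall v, v != 0 -> 0 < bilin g v v) ->
  0 <= ip eta u -> 0 <= ip eta' u -> 0 < E ->
  bilin g ('D_eta F u) ('D_eta F u) = E -> bilin g ('D_eta' F u) ('D_eta' F u) = E ->
  bilin g ('D_eta F u) ('D_(perp u) F u) = 0 -> bilin g ('D_eta' F u) ('D_(perp u) F u) = 0 ->
  'D_eta F u = 'D_eta' F u.
Proof.
move=> oU CF Uu im u1 gs gp; have [J [JE _]] := frechet oU CF Uu; rewrite !JE.
set a := ip eta u; set a' := ip eta' u; set b := cr u eta; set b' := cr u eta'.
have eE : eta = a *: u + b *: perp u by rewrite /a /b {1}(frameE eta u1); congr (_ *: _ + _); rewrite /ip; ring.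
have eE' : eta' = a' *: u + b' *: perp u by rewrite /a' /b' {1}(frameE eta' u1); congr (_ *: _ + _); rewrite /ip; ring.
move=> a0 a0' E0 n1 n2 p1 p2.
have pu0 : perp u != 0.
  apply/eqP => e; have h0 := congr1 (fun v : 'rV[R]_2 => v 0 0) e; have h1 := congr1 (fun v : 'rV[R]_2 => v 0 1) e.
  move: h0 h1; rewrite perp0 perp1 !mxE => h0 h1; move: u1; rewrite /ip h1.
  have -> : u 0 1 = 0 by lra.
  by rewrite !mulr0 addr0 => h; have := oner_neq0 R; rewrite -h eqxx.
have q0 : 0 < bilin g (perp u *m J) (perp u *m J) by apply: gp; rewrite -JE; exact: im.
have z : a' * b - a * b' = 0.
  have : bilin g ((a' *: eta - a *: eta') *m J) (perp u *m J) = 0.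
    by rewrite mulmxBl -!scalemxAl bilinDl -scaleNr !bilinZl p1 p2 !mulr0 addr0.
  have -> : a' *: eta - a *: eta' = (a' * b - a * b') *: perp u.
    by rewrite eE eE'; apply: rV2P; rewrite !mxE /=; ring.
  rewrite -scalemxAl bilinZl => /eqP; rewrite mulf_eq0 (gt_eqF q0) orbF => /eqP//.
have ee : a' *: eta = a *: eta'.
  apply/eqP; rewrite -subr_eq0; apply/eqP.
  have -> : a' *: eta - a *: eta' = (a' * b - a * b') *: perp u.
    by rewrite eE eE'; apply: rV2P; rewrite !mxE /=; ring.
  by rewrite z scale0r.
have aa : a' ^+ 2 * E = a ^+ 2 * E.
  have : bilin g ((a' *: eta) *m J) ((a' *: eta) *m J) = bilin g ((a *: eta') *m J) ((a *: eta') *m J) by rewrite ee.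
  by rewrite -!scalemxAl !bilinZl !bilinZr n1 n2 !mulrA -!expr2.
have aE : a' = a.
  have : a' ^+ 2 = a ^+ 2 by apply: (mulIf (lt0r_neq0 E0)).
  by move=> h; apply/eqP; rewrite -(@eqrXn2 _ 2)// h.
have [a00|a00] := eqVneq a 0.
  exfalso; have bz : b = 0.
    have : bilin g (eta *m J) (perp u *m J) = 0 by [].
    rewrite eE a00 scale0r add0r -scalemxAl bilinZl => /eqP; rewrite mulf_eq0 (gt_eqF q0) orbF => /eqP//.
  by move: n1; rewrite eE a00 bz !scale0r addr0 mul0mx /bilin !mul0mx mxE => h; rewrite -h ltxx in E0.
congr (_ *m _); apply: (scalerI a00); rewrite -ee aE//.
Qed.

(** The form in which first variation is exploited: [w] is an increment divided by its size
    parameter [s], so the quadratic error carries a factor [s] and disappears in the limit. *)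
Lemma approx_ge0 (g0 : 'M[R]_n) (m0 eta : 'rV[R]_n) (K : R) :
  (forall e : R, 0 < e -> exists (s : R) (g : 'M[R]_n) (m w : 'rV[R]_n),
    [/\ 0 < s < e, forall a b, `|g a b - g0 a b| <= e, `|m - m0| <= e, `|w - eta| <= e &
      0 <= 2 * bilin g m w + K * s * `|w| ^+ 2]) -> 0 <= bilin g0 m0 eta.
Proof.
move=> H.
have H' (k : nat) : exists z : R * 'M[R]_n * 'rV[R]_n * 'rV[R]_n,
    [/\ 0 < z.1.1.1 < k.+1%:R^-1, forall a b, `|z.1.1.2 a b - g0 a b| <= k.+1%:R^-1, `|z.1.2 - m0| <= k.+1%:R^-1,
      `|z.2 - eta| <= k.+1%:R^-1 & 0 <= 2 * bilin z.1.1.2 z.1.2 z.2 + K * z.1.1.1 * `|z.2| ^+ 2].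
  by have [|s [g [m [w h]]]] := H k.+1%:R^-1; [rewrite invr_gt0|exists (s, g, m, w)].
have [z Hz] := choice H'.
have tail (f : nat -> R) (l : R) : (forall k, `|f k - l| <= k.+1%:R^-1) -> f @ \oo --> l.
  move=> h; apply/cvgrPdist_lt => e e0; have [N _ HN] := near_infty_natSinv_lt (PosNum e0).
  by exists N => // k Nk; rewrite distrC; apply: le_lt_trans (h k) _; exact: HN.
have cg a b : (z k).1.1.2 a b @[k --> \oo] --> g0 a b by apply: tail => k; have [_ h _ _ _] := Hz k.
have cm a : (z k).1.2 0 a @[k --> \oo] --> m0 0 a.
  apply: tail => k; have [_ _ h _ _] := Hz k; apply: le_trans h.
  by have := coord_norm_le ((z k).1.2 - m0) a; rewrite !mxE.
have cw a : (z k).2 0 a @[k --> \oo] --> eta 0 a.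
  apply: tail => k; have [_ _ _ h _] := Hz k; apply: le_trans h.
  by have := coord_norm_le ((z k).2 - eta) a; rewrite !mxE.
have cs : (z k).1.1.1 @[k --> \oo] --> 0.
  by apply: tail => k; have [/andP[h1 h2] _ _ _ _] := Hz k; rewrite subr0 gtr0_norm// ltW.
have cb := cvg_bilin cg cm cw.
have cn : `|(z k).2| @[k --> \oo] --> `|eta|.
  apply: tail => k; have [_ _ _ h _] := Hz k; apply: le_trans h.
  exact: ler_dist_dist.
have call : 2 * bilin (z k).1.1.2 (z k).1.2 (z k).2 + K * (z k).1.1.1 * `|(z k).2| ^+ 2 @[k --> \oo]
    --> 2 * bilin g0 m0 eta + K * 0 * `|eta| ^+ 2.
  apply: cvgD; first by apply: cvgM; [exact: cvg_cst|exact: cb].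
  apply: cvgM; first by apply: cvgM; [exact: cvg_cst|exact: cs].
  by rewrite expr2; apply: cvgM.
have : 0 <= 2 * bilin g0 m0 eta + K * 0 * `|eta| ^+ 2.
  apply: (ler_cvg_to (cvg_cst 0) call).
  by apply: nearW => k; have [_ _ _ _ h] := Hz k.
by rewrite mulr0 mul0r addr0 pmulr_rge0.
Qed.

End Velocity.

Section Boundary.
Variables (R : realType) (n : nat) (M : riemannianManifold R n).
Hypothesis M_complete : complete_manifold M.
Variables (f : 'rV[R]_2 -> M) (D G : set M).
Hypothesis sf : smooth_on f (@unit_disc R).
Hypothesis finj : forall u v, unit_disc u -> unit_disc v -> f u = f v -> u = v.
Hypothesis fim : forall u, unit_disc u -> immersion_at f u.
Hypothesis DE : D = f @` (@unit_disc R).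
Hypothesis GE : G = f @` (@unit_circle R).
Hypothesis convD : totally_convex D.
Variable Dm : R.
Hypothesis Dm0 : 0 < Dm.
Hypothesis diamD : forall x y, G x -> G y -> conn x y /\ dist x y <= Dm.
Hypothesis partner : forall x, G x -> exists y, G y /\ dist x y = Dm.

Lemma mgeo_arrival L g (h : R) i u0 (de K V : R) : geo_ball i u0 de K V -> mgeo L g ->
  0 < h -> h <= L -> dom i (g (L - h)) -> dom i (g L) ->
  `|chart i (g (L - h)) - u0| < de -> `|chart i (g L) - u0| < de ->
  exists c c1, [/\ geo_sol i V (chart i (g (L - h))) (chart i (g L)) c c1,
    forall t : R, -1 <= t <= 2 -> cod i (c t),
    bilin (metric i (c 1)) (c1 1) (c1 1) = h ^+ 2,
    forall t : R, 0 <= t <= 1 -> g (L - h + t * h) = chart_inv i (c t) &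
    forall (q' : M) xi, dom i q' -> `|chart i q' - u0| < de -> xi = chart i q' - chart i (g L) ->
        dist (g (L - h)) q' <= h +
          (2 * bilin (metric i (c 1)) (c1 1) xi + K * `|xi| ^+ 2) / (2 * h)].
Proof.
move=> B mg h0 hL d1 d2 n1 n2.
have a0 : 0 <= L - h by rewrite subr_ge0.
have ab : L - h < L by rewrite ltrBlDr ltrDl.
have [c [c1]] := mgeo_sol B mg a0 ab (lexx L) d1 d2 n1 n2.
rewrite subKr => -[S ic nE gE var]; exists c, c1; split=> //.
by apply: nE; lra.
Qed.

Variable e : 'rV[R]_2.
Hypothesis e1 : ip e e = 1.
Let i := chart_at (f e).
Let F := chart i \o f.
Let tangent := 'D_(perp e) F e.

Lemma boundary_chart : exists U, [/\ open U, forall k, Ck U k F, U e & forall w, w != 0 -> 'D_w F e != 0].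
Proof.
have [U [oU UD smU]] := sf; have De := circle_disc e1.
exists (U `&` f @^-1` dom i); split.
- exact: smooth_map_open.
- by move=> k; exact: smooth_map_Ck.
- by split; [exact: UD|exact: chart_atP].
- exact: fim De.
Qed.

(** The sign [sg] allows both directions along the boundary; the factor 2 is the speed of
    [circle_arc] at 0. *)
Lemma arc_increment (sg ep : R) : (sg = 1 \/ sg = -1) -> 0 < ep -> exists2 d : R, 0 < d & forall s : R, 0 < s < d ->
  `|s^-1 *: (F (circle_arc e (sg * s)) - F e) - (2 * sg) *: tangent| <= ep.
Proof.
move=> sg1 ep0; have [U [oU CU Ue _]] := boundary_chart.
have dF : is_derive (0 : R) (1 : R) (fun s => F (circle_arc e s)) (2 *: tangent).
  have da := circle_arc_derive e; have [da' daE] := da.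
  have Ue' : U (circle_arc e 0) by rewrite circle_arc0.
  have := chain_derive_vec oU (CU 1%N) Ue' da'.
  rewrite daE circle_arc0; have [J [JE _]] := frechet oU (CU 1%N) Ue.
  by rewrite JE -scalemxAl -JE.
have [d d0 Hd] := derive_approx dF ep0; exists d => // s /andP[s0 sd].
have ns : `|sg * s| = s by case: sg1 => ->; rewrite ?mul1r ?mulN1r ?normrN gtr0_norm.
have := Hd (sg * s); rewrite subr0 ns circle_arc0 => /(_ sd) h.
have -> : s^-1 *: (F (circle_arc e (sg * s)) - F e) - (2 * sg) *: tangent =
    s^-1 *: (F (circle_arc e (sg * s)) - F e - (sg * s) *: (2 *: tangent)).
  rewrite (_ : (sg * s) *: (2 *: tangent) = s *: ((2 * sg) *: tangent)); last by rewrite !scalerA; congr (_ *: _); ring.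
  by rewrite [RHS]scalerBr [s^-1 *: (s *: _)]scalerA mulVf ?gt_eqF// scale1r.
by rewrite normrZ normfV (gtr0_norm s0) mulrC ler_pdivrMr.
Qed.

Lemma near_arc (N : set M) : nbhs (f e) N -> exists2 d : R, 0 < d & forall s : R, `|s| < d -> N (f (circle_arc e s)).
Proof.
move=> nN; have ca := is_derive_cvg (circle_arc_derive e).
have cf := disc_cont sf (circle_disc e1).
have cfa : (fun s => f (circle_arc e s)) @ (0 : R) --> f e.
  by apply: (@cvg_comp _ _ _ (circle_arc e) f); [exact: ca|rewrite circle_arc0].
have [d d0 Hd] := nbhs_norm_ex (cfa N nN); exists d => // s sd.
by apply: Hd; rewrite subr0.
Qed.

Lemma end_ball : exists de K V r : R, [/\ geo_ball i (chart i (f e)) de K V, 0 < r &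
  forall y, conn (f e) y -> dist (f e) y < r -> dom i y /\ `|chart i y - chart i (f e)| < de].
Proof.
have de : dom i (f e) by exact: chart_atP.
have [d [K [V B]]] := geo_ball_exists (chart_cod de).
have [r r0 Hr] := dist_near (chart_near de (geo_ball_gt0 B)).
by exists d, K, V, r.
Qed.

Section Ball.
Variables (de K V r : R).
Hypothesis B : geo_ball i (chart i (f e)) de K V.
Hypothesis r0 : 0 < r.
Hypothesis Hr : forall y, conn (f e) y -> dist (f e) y < r -> dom i y /\ `|chart i y - chart i (f e)| < de.
Variable h : R.
Hypotheses (h0 : 0 < h) (hr : h < r / 2) (hD : h < Dm).

(** The last stretch of [g], of length [h], rescaled to [[0, 1]]; its final velocity [c1 1]
    therefore has Riemannian norm [h]. *)
Definition arrives g (c c1 : R -> 'rV[R]_n) : Prop :=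
  [/\ mgeo Dm g, g Dm = f e, geo_sol i V (chart i (g (Dm - h))) (chart i (f e)) c c1,
    bilin (metric i (chart i (f e))) (c1 1) (c1 1) = h ^+ 2 &
    forall t : R, 0 <= t <= 1 -> cod i (c t) /\ g (Dm - h + t * h) = chart_inv i (c t)].

Lemma fe_in : dom i (f e) /\ `|chart i (f e) - chart i (f e)| < de.
Proof. by apply: Hr; [exact: conn_refl|rewrite dist_refl]. Qed.

Lemma before_end L g : mgeo L g -> h <= L -> conn (f e) (g L) -> dist (f e) (g L) < r / 2 ->
  dom i (g (L - h)) /\ `|chart i (g (L - h)) - chart i (f e)| < de.
Proof.
move=> mg hL ce d2; have h0' := h0; have hr' := hr.
have I1 : 0 <= L - h <= L by lra.
have I2 : 0 <= L <= L by lra.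
have [cc dd] := mg _ _ I2 I1; rewrite subKr gtr0_norm// in dd.
apply: Hr; first exact: conn_trans ce cc.
by have := dist_tri ce cc; rewrite dd; lra.
Qed.

Lemma arrives_ex g : mgeo Dm g -> g Dm = f e -> exists c c1, arrives g c c1 /\
  forall (q' : M) xi, dom i q' -> `|chart i q' - chart i (f e)| < de -> xi = chart i q' - chart i (f e) ->
    dist (g (Dm - h)) q' <= h + (2 * bilin (metric i (chart i (f e))) (c1 1) xi + K * `|xi| ^+ 2) / (2 * h).
Proof.
move=> mg gD; have [de1 de2] := fe_in.
have [||d1 n1] := before_end mg (ltW hD); rewrite ?gD ?dist_refl ?divr_gt0//; first exact: conn_refl.
have [||c [c1 [S ic nE gE var]]] := mgeo_arrival B mg h0 (ltW hD) d1 _ n1; rewrite ?gD//.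
rewrite gD in S var; have [_ cE _ _] := S; rewrite cE in nE var.
by exists c, c1; split=> //; split=> // t t1; split; [apply: ic; lra|exact: gE].
Qed.

Lemma arrives_outward g c c1 : arrives g c c1 -> (forall t : R, 0 <= t <= Dm -> D (g t)) ->
  exists2 eta, 'D_eta F e = c1 1 & 0 <= ip eta e.
Proof.
move=> [mg gD S nE gE] gin; have [U [oU CU Ue im]] := boundary_chart.
have [c0 cE ode _] := S; have I1 : [set t | -1 <= t <= 2] (1 : R) by rewrite /=; lra.
have [dc _] := ode 1 I1.
apply: (outward_velocity oU (CU 1%N) Ue im e1 dc cE) => d d0.
have De := circle_disc e1.
have nk := disc_inverse sf finj De d0; rewrite -gD in nk.
have h0' := h0; have hD' := hD; have Dm0' := Dm0.
have ID : 0 <= Dm <= Dm by rewrite lexx ltW.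
have [r' r'0 Hr'] := mgeo_near mg ID nk.
exists (Num.max 0 (1 - r' / h)); first by rewrite gt_max ltr01 ltrBlDr ltrDl divr_gt0.
move=> t; rewrite gt_max => /andP[/andP[t0 tr] t1].
have tI : 0 <= t <= 1 by lra.
have [ct gt] := gE t tI.
have th : t * h <= h by rewrite ler_piMl//; lra.
have th0 : 0 <= t * h by rewrite mulr_ge0//; lra.
have sI : 0 <= Dm - h + t * h <= Dm by lra.
have := gin _ sI; rewrite DE => -[k Dk fk].
exists k; split; first exact/unit_discE.
  apply: Hr' Dk fk; first exact: sI.
  have -> : Dm - h + t * h - Dm = - ((1 - t) * h) by ring.
  rewrite normrN gtr0_norm ?mulr_gt0 ?subr_gt0//.
  by rewrite -ltr_pdivlMr//; lra.
by rewrite /F /= fk gt chart_invK.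
Qed.

(** Both final velocities are orthogonal to the boundary, outward and of norm [h], hence equal. Then
    the last stretches coincide by [geo_ivp] at time 1, and the whole curves by non-branching of the
    reversed curves. *)
Lemma arrives_unique g c c1 g' c' c1' : arrives g c c1 -> arrives g' c' c1' ->
  (forall t : R, 0 <= t <= Dm -> D (g t)) -> (forall t : R, 0 <= t <= Dm -> D (g' t)) ->
  bilin (metric i (chart i (f e))) (c1 1) tangent = 0 -> bilin (metric i (chart i (f e))) (c1' 1) tangent = 0 ->
  forall t : R, 0 <= t <= Dm -> g t = g' t.
Proof.
move=> A A' gin gin' p1 p2.
have [eta dE et0] := arrives_outward A gin; have [eta' dE' et0'] := arrives_outward A' gin'.
have [U [oU CU Ue im]] := boundary_chart.
case: A => mg gD S nE gE; case: A' => mg' gD' S' nE' gE'.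
have ice : cod i (chart i (f e)) by apply: chart_cod; have [] := fe_in.
have v : c1 1 = c1' 1.
  rewrite -dE -dE'; apply: (@outward_normal_unique _ _ U F e (metric i (chart i (f e))) eta eta' (h ^+ 2)) => //.
  - exact: Defs.metric_sym.
  - exact: metric_pos.
  - by rewrite exprn_gt0.
  - by rewrite dE.
  - by rewrite dE'.
  - by rewrite dE.
  - by rewrite dE'.
have [_ n1] : dom i (g (Dm - h)) /\ `|chart i (g (Dm - h)) - chart i (f e)| < de.
  by apply: before_end; rewrite ?gD ?dist_refl ?divr_gt0 ?(ltW hD)//; exact: conn_refl.
have [_ n2] : dom i (g' (Dm - h)) /\ `|chart i (g' (Dm - h)) - chart i (f e)| < de.
  by apply: before_end; rewrite ?gD' ?dist_refl ?divr_gt0 ?(ltW hD)//; exact: conn_refl.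
have [_ cE _ _] := S; have [_ cE' _ _] := S'.
have I1 : 0 <= (1 : R) <= 1 by rewrite ler01 lexx.
have cc' : c 1 = c' 1 by rewrite cE cE'.
have all := geo_ball_ivp B n1 n2 S S' I1 cc' v.
have h0' := h0; have hD' := hD.
have agree (s : R) : 0 <= s <= h -> g (Dm - s) = g' (Dm - s).
  move=> sh; have tI : 0 <= (h - s) / h <= 1 by rewrite ler_pdivrMr ?ler_pdivlMr//; lra.
  have -> : Dm - s = Dm - h + ((h - s) / h) * h by rewrite divfK ?gt_eqF//; lra.
  by have [_ ->] := gE _ tI; have [_ ->] := gE' _ tI; rewrite all.
move=> t tD; have tD' : 0 <= Dm - t <= Dm by lra.
have := mgeo_unique h0 (ltW hD) (mgeo_rev mg) (mgeo_rev mg') agree tD'.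
by rewrite subKr.
Qed.

Lemma arc_circle_in s : D (f (circle_arc e s)) /\ G (f (circle_arc e s)).
Proof.
have a1 := circle_arcE s e1; split; last exact: (circle_G GE a1).
exact: (disc_D DE (circle_disc a1)).
Qed.

Lemma f_e_in : D (f e) /\ G (f e).
Proof. by have := arc_circle_in 0; rewrite circle_arc0. Qed.

Lemma perp_from_signs (g : 'M[R]_n) (v : 'rV[R]_n) :
  (forall sg : R, sg = 1 \/ sg = -1 -> 0 <= bilin g v ((2 * sg) *: tangent)) -> bilin g v tangent = 0.
Proof.
move=> H; have := H 1 (or_introl erefl); have := H (-1) (or_intror erefl).
by rewrite !bilinZr; lra.
Qed.

(* First variation of the distance from [g 0], which is constant along the boundary near [f e]. *)
Lemma arrives_perp_flat g c c1 (ep : R) : arrives g c c1 ->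
  (forall (q' : M) xi, dom i q' -> `|chart i q' - chart i (f e)| < de -> xi = chart i q' - chart i (f e) ->
    dist (g (Dm - h)) q' <= h + (2 * bilin (metric i (chart i (f e))) (c1 1) xi + K * `|xi| ^+ 2) / (2 * h)) ->
  0 < ep -> D (g 0) -> (forall s : R, `|s| < ep -> dist (g 0) (f (circle_arc e s)) = Dm) ->
  bilin (metric i (chart i (f e))) (c1 1) tangent = 0.
Proof.
move=> [mg gD S nE gE] var ep0 D0 flat; apply: perp_from_signs => sg sg1.
apply: (@approx_ge0 _ _ _ _ _ K) => d d0.
have [d1 d10 H1] := arc_increment sg1 d0.
have [d2 d20 H2] := near_arc (chart_near (chart_atP (f e)) (geo_ball_gt0 B)).
pose s := Num.min (Num.min d1 d2) (Num.min ep d) / 2.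
have [s0 sd1 sd2 sep sd] : [/\ 0 < s, s < d1, s < d2, s < ep & s < d].
  have m0 : 0 < Num.min (Num.min d1 d2) (Num.min ep d) by rewrite !lt_min d10 d20 ep0.
  have : [/\ Num.min (Num.min d1 d2) (Num.min ep d) <= d1, Num.min (Num.min d1 d2) (Num.min ep d) <= d2,
      Num.min (Num.min d1 d2) (Num.min ep d) <= ep & Num.min (Num.min d1 d2) (Num.min ep d) <= d].
    by rewrite !ge_min !lexx !orbT.
  by move=> [? ? ? ?]; rewrite /s; split; lra.
have ns : `|sg * s| = s by case: sg1 => ->; rewrite ?mul1r ?mulN1r ?normrN gtr0_norm.
pose q := f (circle_arc e (sg * s)); have [Dq Gq] := arc_circle_in (sg * s).
have [dq nq] : dom i q /\ `|chart i q - chart i (f e)| < de by apply: H2; rewrite ns.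
pose xi := chart i q - chart i (f e).
have dqE : dist (g 0) q = Dm by apply: flat; rewrite ns.
have h0' := h0; have hD' := hD; have Dm0' := Dm0.
have I0 : 0 <= (0 : R) <= Dm by lra.
have Ih : 0 <= Dm - h <= Dm by lra.
have [cc dd] := mg _ _ I0 Ih.
have gq : conn (g (Dm - h)) q by apply: conn_trans (conn_sym cc) _; exact: (disc_conn sf DE D0 Dq).
(* The point [q] is as far from [g 0] as [f e] is, so shortening the last stretch is impossible and
   the variation term [P] is nonnegative. *)
have := dist_tri cc gq; rewrite dqE dd sub0r normrN ger0_norm; last by lra.
have := var q xi dq nq erefl; set P := 2 * _ + _ => h1 h2.
have P0 : 0 <= P.
  have : 0 <= P / (2 * h) by lra.
  by rewrite pmulr_lge0// invr_gt0 mulr_gt0.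
exists s, (metric i (chart i (f e))), (c1 1), (s^-1 *: xi); split.
- by rewrite s0.
- by move=> a b; rewrite subrr normr0 ltW.
- by rewrite subrr normr0 ltW.
- by apply: H1; rewrite s0.
- rewrite bilinZr normrZ normfV (gtr0_norm s0) exprMn.
  have -> : 2 * (s^-1 * bilin (metric i (chart i (f e))) (c1 1) xi) + K * s * (s^-1 ^+ 2 * `|xi| ^+ 2) = s^-1 * P.
    by rewrite /P; field; rewrite gt_eqF.
  by rewrite mulr_ge0// invr_ge0 ltW.
Qed.

(* As the minimizing curve from [y] to [f e] is unique, those from [y] to nearby points pass near it. *)
Lemma near_before y z0 (N : set M) : D y -> conn y (f e) -> dist y (f e) = Dm ->
  (forall z, D z -> dist y z = Dm - h -> dist z (f e) = h -> z = z0) -> nbhs z0 N ->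
  exists2 rho : R, 0 < rho & forall x z, D x -> D z -> conn (f e) x -> dist (f e) x < rho ->
    dist z x = h -> dist y z = dist y x - h -> N z.
Proof.
move=> Dy ye yD uniq nN.
(* By uniqueness [Psi] vanishes on [D] only at [z0], so it has a positive lower bound on the part of
   the compact set [D] not interior to [N]. *)
pose Psi z := `|dist z (f e) - h| + `|dist y z - (Dm - h)|.
have cPsi : continuous (Psi : M -> R).
  have -> : Psi = fun z => `|dist (f e) z - h| + `|dist y z - (Dm - h)|.
    by apply/funext => z; rewrite /Psi (dist_sym z).
  move=> z; apply: cvgD; apply: (@cvg_comp _ _ _ _ (fun t : R => `|t - _|)).
  - exact: dist_cont.
  - exact: norm_sub_cont.
  - exact: dist_cont.
  - exact: norm_sub_cont.
pose C := D `&` ~` N^°.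
have cC : compact C.
  apply: compact_closedI; first exact: D_compact sf DE.
  exact/open_closedC/open_interior.
have [mu mu0 Hmu] : exists2 mu : R, 0 < mu & forall z, D z -> Psi z < mu -> N z.
  have [C0|C0] := pselect (C !=set0); last first.
    exists 1 => // z Dz _; apply: contrapT => nz; apply: C0; exists z; split=> // /nbhs_singleton.
    exact: nz.
  have [z] := compact_EVT_min C0 cC (continuous_subspaceT cPsi).
  rewrite inE => -[Dz nz] zmin; exists (Psi z).
    rewrite lt_neqAle addr_ge0// andbT eq_sym; apply/negP.
    rewrite paddr_eq0// !normr_eq0 !subr_eq0 => /andP[/eqP e1' /eqP e2].
    by apply: nz; rewrite (uniq z Dz e2 e1').
  move=> w Dw wz; apply: contrapT => nw.
  have Cw : C w by split=> // /nbhs_singleton.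
  by have := zmin w; rewrite inE => /(_ Cw); rewrite leNgt wz.
exists (mu / 4); first by rewrite divr_gt0.
move=> x z Dx Dz ex dx zx yz; apply: Hmu => //.
have zx' : conn z x by exact: (disc_conn sf DE Dz Dx).
have h1 := dist_lip zx' (conn_sym ex).
have h2 := dist_lip (conn_trans ye ex) (conn_sym ex).
rewrite (dist_sym x) zx in h1; rewrite (dist_sym x) in h2; rewrite yD in h2.
rewrite /Psi distrC yz; have -> : dist y x - h - (Dm - h) = dist y x - Dm by ring.
by move: h1 h2; lra.
Qed.

(** The distance from [g 0] is only maximal at [f e], so comparing [f e] with its neighbours gives
    nothing. Instead the first variation is applied at a neighbour [x] towards [f e]: since [f e] is
    at least as far as [x], the variation term for the curve arriving at [x] is nonnegative. As [x]
    tends to [f e], uniqueness makes these arrival velocities converge to [c1 1]. *)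
Lemma arrives_perp_unique g c c1 : arrives g c c1 -> G (g 0) -> (forall t : R, 0 <= t <= Dm -> D (g t)) ->
  (forall g', mgeo Dm g' -> g' 0 = g 0 -> g' Dm = f e -> forall t : R, 0 <= t <= Dm -> g' t = g t) ->
  bilin (metric i (chart i (f e))) (c1 1) tangent = 0.
Proof.
have excess (a b k d w : R) : a <= b - k + d -> b <= a -> d <= k + w -> 0 <= w by lra.
move=> [mg gD S nE gE] G0 gin uniq.
have h0' := h0; have hD' := hD; have Dm0' := Dm0; have hr' := hr.
have I0 : 0 <= (0 : R) <= Dm by lra.
have ID : 0 <= Dm <= Dm by lra.
have Ih : 0 <= Dm - h <= Dm by lra.
have D0 := gin 0 I0; have [De Ge] := f_e_in.
have [c0e d0e] := mg _ _ I0 ID; rewrite gD sub0r normrN gtr0_norm// in c0e d0e.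
set z0 := g (Dm - h).
(* A point at the right distances from both ends lies on a minimizing curve, obtained by
   concatenation, and that curve is [g] by assumption. *)
have uz z : D z -> dist (g 0) z = Dm - h -> dist z (f e) = h -> z = z0.
  move=> Dz d1 d2; have c1z := disc_conn sf DE D0 Dz; have c2z := disc_conn sf DE Dz De.
  have [g1 [mg1 g10 g11]] := mgeo_ex M_complete c1z; have [g2 [mg2 g20 g21]] := mgeo_ex M_complete c2z.
  have L0 : 0 <= dist (g 0) z by exact: dist_ge0.
  have L1 : 0 <= dist z (f e) by exact: dist_ge0.
  have gz : g1 (dist (g 0) z) = g2 0 by rewrite g11 g20.
  have gs : dist (g1 0) (g2 (dist z (f e))) = dist (g 0) z + dist z (f e).
    by rewrite g10 g21 d0e d1 d2 subrK.
  have := mgeo_cat L0 L1 mg1 mg2 gz gs; set g' := (fun t => if _ then _ else _).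
  have -> : dist (g 0) z + dist z (f e) = Dm by rewrite d1 d2 subrK.
  move=> mg'.
  have q0 : g' 0 = g 0 by rewrite /g' L0.
  have q1 : g' Dm = f e by rewrite /g' d1 leNgt ltrBlDr ltrDl h0/= subKr -d2 g21.
  have q2 : g' (Dm - h) = z by rewrite /g' d1 lexx -d1 g11.
  by rewrite -q2; exact: (uniq g' mg' q0 q1 _ Ih).
have [_ n1] : dom i z0 /\ `|chart i z0 - chart i (f e)| < de.
  by apply: before_end; rewrite ?gD ?dist_refl ?divr_gt0 ?(ltW hD)//; exact: conn_refl.
have [dz0 _] : dom i z0 /\ `|chart i z0 - chart i (f e)| < de.
  by apply: before_end; rewrite ?gD ?dist_refl ?divr_gt0 ?(ltW hD)//; exact: conn_refl.
have ice : cod i (chart i (f e)) by apply: chart_cod; have [] := fe_in.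
suff H (sg : R) : sg = 1 \/ sg = -1 -> 0 <= bilin (metric i (chart i (f e))) (c1 1) ((- (2 * sg)) *: tangent).
  apply: perp_from_signs => sg sg1; have sg1' : - sg = 1 \/ - sg = -1 by case: sg1 => ->; [right|left]; rewrite ?opprK.
  by have := H (- sg) sg1'; rewrite mulrN opprK.
move=> sg1; apply: (@approx_ge0 _ _ _ _ _ K) => ep ep0.
have ep8 : 0 < ep / 8 by rewrite divr_gt0.
have [rho rho0 Hrho] := near_before D0 c0e d0e uz (chart_near dz0 ep8).
have [d1 d10 H1] := arc_increment sg1 ep0.
have nm : nbhs (f e) [set x | forall a b, `|metric i (chart i x) a b - metric i (chart i (f e)) a b| <= ep].
  near=> x => a b; move: a b; near: x; apply: filter_forall => a; apply: filter_forall => b.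
  have cm : (fun x => metric i (chart i x) a b) @ f e --> metric i (chart i (f e)) a b.
    apply: (@cvg_comp _ _ _ (chart i) (fun v => metric i v a b)).
      by apply: chart_continuous; have [] := fe_in.
    exact: metric_cvg.
  by move/cvgrPdist_le : cm => /(_ ep ep0); apply: filterS => x; rewrite distrC.
(* The bound [Dm - h] ensures that a minimizing curve from [g 0] to [x] is longer than [h], so that
   it has a last stretch. *)
pose m := Num.min rho (Num.min (r / 2) (Dm - h)).
have m0 : 0 < m by rewrite !lt_min rho0 divr_gt0//= subr_gt0.
have [d2 d20 H2] := near_arc (filterI (filterI nm (near_dist (f e) m0)) (chart_near (chart_atP (f e)) ep8)).
pose s := Num.min (Num.min d1 d2) ep / 2.
have [s0 sd1 sd2 sd] : [/\ 0 < s, s < d1, s < d2 & s < ep].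
  have m0' : 0 < Num.min (Num.min d1 d2) ep by rewrite !lt_min d10 d20 ep0.
  have [w1 w2 w3] : [/\ Num.min (Num.min d1 d2) ep <= d1, Num.min (Num.min d1 d2) ep <= d2 & Num.min (Num.min d1 d2) ep <= ep].
    by rewrite !ge_min !lexx !orbT.
  by rewrite /s; split; lra.
have ns : `|sg * s| = s by case: sg1 => ->; rewrite ?mul1r ?mulN1r ?normrN gtr0_norm.
pose x := f (circle_arc e (sg * s)); have [Dx Gx] := arc_circle_in (sg * s).
have [[nmx [ex xm]] [dx nx8]] := H2 (sg * s) ltac:(rewrite ns; exact: sd2).
move: xm; rewrite !lt_min => /and3P[x1 x2 x3].
rewrite -/x in Dx Gx nmx ex dx nx8 x1 x2 x3.
have xr : dist (f e) x < r by apply: lt_trans x2 _; rewrite ltr_pdivrMr// ltr_pMr// ltr1n.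
have [_ nx] := Hr ex xr.
have [_ yxD] := diamD G0 Gx.
have yx := conn_trans c0e ex.
have yxh : h < dist (g 0) x.
  by have := dist_tri yx (conn_sym ex); rewrite d0e (dist_sym x); lra.
have [ga [mga ga0 ga1 gain]] := disc_mgeo M_complete sf DE convD D0 Dx.
set L := dist (g 0) x in mga ga1 gain yxD yxh *.
have [J0 JL Jh] : [/\ 0 <= (0 : R) <= L, 0 <= L <= L & 0 <= L - h <= L].
  by rewrite !lexx (ltW (lt_trans h0 yxh)) subr_ge0 (ltW yxh) lerBlDr lerDl (ltW h0).
pose z := ga (L - h); have Dz : D z by exact: gain.
have [czx dzx] := mga _ _ Jh JL; rewrite ga1 addrAC subrr sub0r normrN gtr0_norm// in czx dzx.
have [cyz dyz] := mga _ _ J0 Jh; rewrite ga0 sub0r normrN ger0_norm in cyz dyz; last by case/andP: Jh.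
have [dz nz8] := Hrho x z Dx Dz ex x1 dzx dyz.
have [_ nz] : dom i z /\ `|chart i z - chart i (f e)| < de.
  by apply: before_end => //; rewrite ?ga1// ltW.
have [||c' [c1' [S' ic' nE' gE' var]]] := mgeo_arrival B mga h0 (ltW yxh) dz _ nz; rewrite ?ga1//.
rewrite ga1 in S' var; rewrite -/z in S' var.
have [_ cE' _ _] := S'.
pose xi := chart i (f e) - chart i x.
have [fe1 fe2] := fe_in.
have := var (f e) xi fe1 fe2 erefl; rewrite cE'; set P := 2 * _ + _ => hv.
have P0 : 0 <= P.
  have := dist_tri cyz (conn_trans czx (conn_sym ex)); rewrite d0e dyz => ht.
  have : 0 <= P / (2 * h) by exact: excess ht yxD hv.
  by rewrite pmulr_lge0// invr_gt0 mulr_gt0.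
have dep := geo_ball_dep B nz n1 S' S.
exists s, (metric i (chart i x)), (c1' 1), (s^-1 *: xi); split.
- by rewrite s0.
- exact: nmx.
(* The velocities differ by at most three times the sum of the displacements of the two ends, each
   below [ep / 8]. *)
- apply: le_trans dep _; rewrite -/z -/z0.
  by move: nz8 nx8; move: (`|_|) (`|_|) => u v; lra.
- have -> : s^-1 *: xi - - (2 * sg) *: tangent = - (s^-1 *: (F (circle_arc e (sg * s)) - F e) - (2 * sg) *: tangent).
    have -> : xi = - (F (circle_arc e (sg * s)) - F e) by rewrite opprB.
    by rewrite scalerN scaleNr opprK opprB addrC.
  by rewrite normrN; apply: H1; rewrite s0.
- rewrite bilinZr normrZ normfV (gtr0_norm s0) exprMn.
  have -> : 2 * (s^-1 * bilin (metric i (chart i x)) (c1' 1) xi) + K * s * (s^-1 ^+ 2 * `|xi| ^+ 2) = s^-1 * P.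
    by rewrite /P; field; rewrite gt_eqF.
  by rewrite mulr_ge0// invr_ge0 ltW.
Unshelve. all: by end_near. Qed.

End Ball.
End Boundary.

(** * Uniqueness and continuity of the partner *)

Section AntipodalMap.
Variables (R : realType) (n : nat) (M : riemannianManifold R n).
Hypothesis M_complete : complete_manifold M.
Variables (f : 'rV[R]_2 -> M) (D G : set M).
Hypothesis sf : smooth_on f (@unit_disc R).
Hypothesis finj : forall u v, unit_disc u -> unit_disc v -> f u = f v -> u = v.
Hypothesis fim : forall u, unit_disc u -> immersion_at f u.
Hypothesis DE : D = f @` (@unit_disc R).
Hypothesis GE : G = f @` (@unit_circle R).
Hypothesis convD : totally_convex D.
Variable Dm : R.
Hypothesis Dm0 : 0 < Dm.
Hypothesis diamD : forall x y, G x -> G y -> conn x y /\ dist x y <= Dm.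
Hypothesis partner : forall x, G x -> exists y, G y /\ dist x y = Dm.

Let circle_in_D u : ip u u = 1 -> D (f u).
Proof. by move=> u1; apply: (disc_D DE); exact: circle_disc. Qed.

Let geodesic_in_D g u v : ip u u = 1 -> ip v v = 1 -> mgeo Dm g -> g 0 = f u -> g Dm = f v ->
  forall t : R, 0 <= t <= Dm -> D (g t).
Proof.
move=> u1 v1 mg g0 g1; apply: (mgeo_in_D convD (ltW Dm0) mg).
  by rewrite g0; exact: circle_in_D.
by rewrite g1; exact: circle_in_D.
Qed.

Let radius (r : R) : 0 < r -> exists h : R, [/\ 0 < h, h < r / 2 & h < Dm].
Proof.
have Dm0' := Dm0; move=> r0; exists (Num.min (r / 4) (Dm / 2)).
have m0 : 0 < Num.min (r / 4) (Dm / 2) by rewrite lt_min; lra.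
have [? ?] : Num.min (r / 4) (Dm / 2) <= r / 4 /\ Num.min (r / 4) (Dm / 2) <= Dm / 2.
  by rewrite !ge_min !lexx orbT.
by split; lra.
Qed.

Definition flat_at x e := exists2 ep : R, 0 < ep & forall s : R, `|s| < ep -> dist (f x) (f (circle_arc e s)) = Dm.

Lemma flat_unique x e g g' : ip x x = 1 -> ip e e = 1 -> flat_at x e ->
  mgeo Dm g -> g 0 = f x -> g Dm = f e -> mgeo Dm g' -> g' 0 = f x -> g' Dm = f e ->
  forall t : R, 0 <= t <= Dm -> g t = g' t.
Proof.
move=> x1 e1 [ep ep0 flat] mg g0 g1 mg' g0' g1'.
have [de [K [V [r [B r0 Hr]]]]] := end_ball f e.
have [h [h0 hr hD]] := radius r0.
have gin := geodesic_in_D x1 e1 mg g0 g1; have gin' := geodesic_in_D x1 e1 mg' g0' g1'.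
have [c [c1 [A var]]] := arrives_ex B r0 Hr h0 hr hD mg g1.
have [c' [c1' [A' var']]] := arrives_ex B r0 Hr h0 hr hD mg' g1'.
have flat0 (k : R -> M) : k 0 = f x -> forall s : R, `|s| < ep -> dist (k 0) (f (circle_arc e s)) = Dm.
  by move=> ->; exact: flat.
have Dk (k : R -> M) : k 0 = f x -> D (k 0) by move=> ->; exact: circle_in_D.
have p := arrives_perp_flat sf fim DE GE Dm0 e1 B h0 hD A var ep0 (Dk g g0) (flat0 g g0).
have p' := arrives_perp_flat sf fim DE GE Dm0 e1 B h0 hD A' var' ep0 (Dk g' g0') (flat0 g' g0').
exact: (arrives_unique sf finj fim DE Dm0 e1 B r0 Hr h0 hr hD A A' gin gin' p p').
Qed.

(** Flatness at [e] and [e'] makes the minimizing curves from [x] to each of them unique. Reversed,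
    they satisfy the uniqueness assumption of [arrives_perp_unique] at [x], so they arrive there
    orthogonally and coincide. *)
Lemma flat_at_inj x e e' : ip x x = 1 -> ip e e = 1 -> ip e' e' = 1 ->
  dist (f x) (f e) = Dm -> dist (f x) (f e') = Dm -> flat_at x e -> flat_at x e' -> e = e'.
Proof.
move=> x1 e1 e1' de de' fl fl'.
have [d [K [V [r [B r0 Hr]]]]] := end_ball f x.
have [h [h0 hr hD]] := radius r0.
have key u : ip u u = 1 -> dist (f x) (f u) = Dm -> flat_at x u -> exists g c c1,
    [/\ arrives f Dm x V h g c c1, g 0 = f u, forall t : R, 0 <= t <= Dm -> D (g t) &
    bilin (metric (chart_at (f x)) (chart (chart_at (f x)) (f x))) (c1 1) ('D_(perp x) (chart (chart_at (f x)) \o f) x) = 0].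
  move=> u1 du fu; have [g [mg g0 g1 _]] := disc_mgeo M_complete sf DE convD (circle_in_D x1) (circle_in_D u1).
  rewrite du in mg g1; have mr := mgeo_rev mg.
  have r0' : g (Dm - 0) = f u by rewrite subr0.
  have r1' : g (Dm - Dm) = f x by rewrite subrr.
  have [c [c1 [A _]]] := arrives_ex B r0 Hr h0 hr hD mr r1'.
  have gin := geodesic_in_D u1 x1 mr r0' r1'.
  exists (fun s => g (Dm - s)), c, c1; split=> //.
  apply: (arrives_perp_unique M_complete sf fim DE GE convD Dm0 diamD x1 B r0 Hr h0 hr hD A) => //.
    by rewrite r0'; exact: (circle_G GE u1).
  move=> g' mg' g0' g1' t tD; rewrite r0' in g0'.
  have tD' : 0 <= Dm - t <= Dm by have Dm0' := Dm0; lra.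
  have := flat_unique x1 u1 fu mg g0 g1 (mgeo_rev mg') _ _ tD'; rewrite subrr subr0 subKr => -> //.
have [g [c [c1 [A g0 gin p]]]] := key e e1 de fl.
have [g' [c' [c1' [A' g0' gin' p']]]] := key e' e1' de' fl'.
have I0 : 0 <= (0 : R) <= Dm by rewrite lexx ltW.
have := arrives_unique sf finj fim DE Dm0 x1 B r0 Hr h0 hr hD A A' gin gin' p p' I0.
by rewrite g0 g0'; exact: (circle_inj finj e1 e1').
Qed.

Lemma stereo_cvg (x e : 'rV[R]_2) : ip x x = 1 -> ip e e = 1 -> e != x -> (fun v => stereo x v) @ e --> stereo x e.
Proof.
move=> x1 e1 ex; have c (j : 'I_2) : (fun v : 'rV[R]_2 => v 0 j) @ e --> e 0 j by exact: coord_continuous.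
have cc : (fun v => cr x v) @ e --> cr x e.
  exact: (cvgB (cvgM (cvg_cst (x 0 0)) (c 1)) (cvgM (cvg_cst (x 0 1)) (c 0))).
have ci0 : (fun v => ip x v) @ e --> ip x e.
  exact: (cvgD (cvgM (cvg_cst (x 0 0)) (c 0)) (cvgM (cvg_cst (x 0 1)) (c 1))).
have ci : (fun v => 1 - ip x v) @ e --> 1 - ip x e by exact: (cvgB (cvg_cst (1 : R)) ci0).
have n0 : 1 - ip x e != 0 by rewrite gt_eqF// subr_gt0 ip_lt1// e1.
exact: (cvgM cc (cvgV n0 ci)).
Qed.

Lemma flat_between x y1 y2 e : ip x x = 1 -> ip y1 y1 = 1 -> ip y2 y2 = 1 -> ip e e = 1 ->
  dist (f x) (f y1) = Dm -> dist (f x) (f y2) = Dm -> e != x ->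
  stereo x y1 < stereo x e < stereo x y2 -> flat_at x e.
Proof.
move=> x1 y11 y21 e1 d1 d2 ex /andP[l1 l2].
have ca : circle_arc e @ (0 : R) --> e.
  by have := is_derive_cvg (circle_arc_derive e); rewrite circle_arc0.
have cs : (fun s => stereo x (circle_arc e s)) @ (0 : R) --> stereo x e.
  exact: (cvg_comp _ _ ca (stereo_cvg x1 e1 ex)).
have ci : (fun s => ip x (circle_arc e s)) @ (0 : R) --> ip x e by exact: (cvg_comp _ _ ca (@ip_cont R x e)).
have n1 : \forall s \near (0 : R), stereo x y1 < stereo x (circle_arc e s) by apply: (cvgr_gt _ cs).
have n2 : \forall s \near (0 : R), stereo x (circle_arc e s) < stereo x y2 by apply: (cvgr_lt _ cs).
have n3 : \forall s \near (0 : R), ip x (circle_arc e s) < 1 by apply: (cvgr_lt _ ci); rewrite ip_lt1// e1.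
have [ep ep0 H] := nbhs_norm_ex (filterI (filterI n1 n2) n3).
exists ep => // s sep; have [|[h1 h2] h3] := H s; first by rewrite subr0.
apply: (partner_arc M_complete sf finj DE GE convD Dm0 diamD partner x1 y11 y21 (circle_arcE s e1) d1 d2).
  by apply/eqP => h; rewrite h x1 ltxx in h3.
by rewrite h1 h2.
Qed.

Lemma partner_unique x y1 y2 : ip x x = 1 -> ip y1 y1 = 1 -> ip y2 y2 = 1 ->
  dist (f x) (f y1) = Dm -> dist (f x) (f y2) = Dm -> y1 = y2.
Proof.
move=> x1 y11 y21 d1 d2.
have nlt a b : ip a a = 1 -> ip b b = 1 -> dist (f x) (f a) = Dm -> dist (f x) (f b) = Dm ->
    ~ stereo x a < stereo x b.
  move=> a1 b1 da db lab.
  pose T (k : R) := stereo x a + k * (stereo x b - stereo x a).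
  have pt k : 0 < k < 1 -> ip (istereo x (T k)) (istereo x (T k)) = 1 /\
      [/\ dist (f x) (f (istereo x (T k))) = Dm, flat_at x (istereo x (T k)) & stereo x (istereo x (T k)) = T k].
    move=> /andP[k0 k1]; have e1 := istereo_circle (T k) x1; have [ex eT] := istereoK (T k) x1.
    have bt : stereo x a < stereo x (istereo x (T k)) < stereo x b.
      rewrite eT /T; have : 0 < k * (stereo x b - stereo x a) by rewrite mulr_gt0// subr_gt0.
      have : k * (stereo x b - stereo x a) < 1 * (stereo x b - stereo x a) by rewrite ltr_pM2r// subr_gt0.
      lra.
    split=> //; split=> //; last exact: flat_between bt.
    exact: (partner_arc M_complete sf finj DE GE convD Dm0 diamD partner x1 a1 b1 e1 da db ex bt).
  (* Constancy of the distance is known on both sides only at interior points of the arc, so two of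
     them are compared instead of [a] and [b]. *)
  have [|e1 [q1 f1 t1]] := pt (1 / 3); first lra.
  have [|e2 [q2 f2 t2]] := pt (2 / 3); first lra.
  have := flat_at_inj x1 e1 e2 q1 q2 f1 f2 => /(congr1 (stereo x)).
  rewrite t1 t2 /T => /addrI /eqP; rewrite -subr_eq0 -mulrBl mulf_eq0 => /orP[/eqP h|/eqP h]; lra.
have [h|h|h] := ltgtP (stereo x y1) (stereo x y2).
- by case: (nlt _ _ y11 y21 d1 d2 h).
- by case: (nlt _ _ y21 y11 d2 d1 h).
- exact: (stereo_inj x1 y11 y21 (partner_neq Dm0 x1 d1) (partner_neq Dm0 x1 d2) h).
Qed.

Lemma antipodal_map : exists phi : M -> M, [/\ {within G, continuous phi}, forall x, G x -> G (phi x) &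
  forall x, G x -> dist x (phi x) = Dm].
Proof.
have H (x : M) : exists y : M, G x -> G y /\ dist x y = Dm.
  have [Gx|Gx] := pselect (G x); last by exists x.
  by have [y h] := partner Gx; exists y.
have [phi Hphi] := choice H; exists phi; split=> [|x /Hphi[]//|x /Hphi[]//].
apply/subspace_continuousP => x Gx N nN; have [Gp dp] := Hphi x Gx.
have {}nN : nbhs (phi x) N := nN.
(* Points of [G] not interior to [N] are not partners of [x], by uniqueness; by compactness their
   distances to [x] stay below [Dm - mu] or equal it, whereas the partner of a point close to [x] is
   farther than that. *)
pose C := G `&` ~` N^°.
have cC : compact C.
  apply: compact_closedI; first exact: (G_compact sf GE).
  exact/open_closedC/open_interior.
have notin w : G w -> dist x w = Dm -> ~ C w.
  move=> Gw dw [_ nw]; apply: nw.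
  have [u u1 xE] := circle_G_inv GE Gx; have [v v1 wE] := circle_G_inv GE Gw; have [v' v1' pE] := circle_G_inv GE Gp.
  subst x w; rewrite pE in dp nN; rewrite (partner_unique u1 v1 v1' dw dp).
  exact: nN.
have [mu mu0 Hmu] : exists2 mu : R, 0 < mu & forall w, G w -> Dm - mu < dist x w -> N w.
  have [C0|C0] := pselect (C !=set0); last first.
    exists 1 => // w Gw _; apply: contrapT => nw; apply: C0; exists w; split=> // /nbhs_singleton; exact: nw.
  have [w] := compact_EVT_max C0 cC (continuous_subspaceT (@dist_cont _ _ _ x)).
  rewrite inE => Cw wmax; have [Gw _] := Cw; have [_ dw] := diamD Gx Gw.
  exists (Dm - dist x w).
    by rewrite subr_gt0 lt_neqAle dw andbT; apply/eqP => h; exact: notin Cw.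
  move=> v Gv hv; apply: contrapT => nv.
  have Cv : C v by split=> // /nbhs_singleton.
  by have := wmax v; rewrite inE => /(_ Cv); lra.
have nd := near_dist x mu0.
change (nbhs x (fun y => G y -> N (phi y))).
apply: filterS nd => y [xy dxy] Gy; have [Gpy dpy] := Hphi y Gy.
apply: Hmu => //; have [yp _] := diamD Gy Gpy.
by have := dist_tri (conn_sym xy) (conn_trans xy yp); rewrite dpy (dist_sym y); lra.
Qed.

End AntipodalMap.

Theorem theoremC (R : realType) (n : nat) (M : riemannianManifold R n)
    (M_complete : complete_manifold M) (G : set M)
    (G_circle : embedded_circle G) :
  [/\ has_antipodal_map G -> width G = diam G,
      width G = diam G ->
        forall x : M, G x -> exists y : M, G y /\ rdist x y = diam G
    & forall D : set M, embedded_disc D G -> totally_convex D ->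
        (width G = diam G <-> has_antipodal_map G)].
Proof.
have [c cG] := G_circle; split; first exact: antipodal_width.
  by move=> wd x; exact: (width_diam_partner cG).
move=> D [f [sf finj fim DE GE]] convD; split=> [wd|]; last exact: antipodal_width.
have [Dm [dE Dm0 HD]] := diamE cG.
have partner x : G x -> exists y, G y /\ dist x y = Dm.
  move=> Gx; have [y [Gy xy]] := width_diam_partner cG wd Gx.
  by exists y; split=> //; rewrite /dist xy dE.
have [phi [cphi Gphi dphi]] := antipodal_map M_complete sf finj fim DE GE convD Dm0 HD partner.
exists phi; split=> // x Gx; have [xy _] := HD x (phi x) Gx (Gphi x Gx).
by rewrite (rdistE xy) dphi// dE.
Qed.
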